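(* Let $L$ be an operator of order $2m$ associated to coefficients $A^{j,k}_{\alpha,\beta}$ that satisfy the weak Gårding inequality (WG) with constants $\lambda>0$, $\delta\ge0$, and either the bound (B1) or the bound (B2) with constant $\Lambda$. Let $Q\subset\mathbb R^d$ be an open cube with sides parallel to the coordinate axes, and let $1<\theta\le2$. Let $\vec u\in Y^{m,2}(\theta Q)$ and $T\in Y^{-m,2}(\theta Q)$, and suppose that $L\vec u=T$ in $\theta Q$, that is, $\langle L\vec u,\vec\varphi\rangle_{\theta Q}=\langle T,\vec\varphi\rangle_{\theta Q}$ for all $\vec\varphi\in Y^{m,2}_0(\theta Q)$. Then $$\int_Q|\nabla^m\vec u|^2\le\frac{C}{((\theta-1)|Q|^{1/d})^{2m}}\int_{\theta Q\setminus Q}|\vec u|^2+C\delta\int_{\theta Q}|\vec u|^2+C\|T\|^2,$$ and for all $j$ with $1\le j\le m-1$, $$\frac1{|Q|^{(2m-2j)/d}}\int_Q|\nabla^j\vec u|^2\le\frac{C}{(\theta-1)^{2j}|Q|^{2m/d}}\int_{\theta Q}|\vec u|^2+C\delta\int_{\theta Q}|\vec u|^2+C\|T\|^2,$$ where $C$ depends on $d$, $m$, $\lambda$ and $\Lambda$, and $\|T\|=\|T\|_{Y^{-m,2}(\theta Q)}$ is the operator norm, i.e. the smallest number with $|\langle T,\vec\psi\rangle_{\theta Q}|\le\|\vec\psi\|_{Y^{m,2}(\theta Q)}\|T\|$ for all $\vec\psi\in Y^{m,2}_0(\theta Q)$.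
   Context: $d\ge2$, $m,N\ge1$ are integers; functions take values in $\mathbb C^N$; constants may depend on $N$. $\theta Q$ is the cube concentric with $Q$ with $|\theta Q|=\theta^d|Q|$. Spaces. $\frac1{2_\alpha}=\frac12-\frac{m-|\alpha|}d$ for $m-d/2<|\alpha|\le m$; $\|u\|_{Y^{m,2}(\Omega)}=\sum_{m-d/2<|\alpha|\le m}\|\partial^\alpha u\|_{L^{2_\alpha}(\Omega)}$; elements of $Y^{m,2}(\Omega)$ are defined up to polynomials of degree at most $m-d/2$ ($\vec u$ denotes a representative). $Y^{m,2}_0(\Omega)=\{\vec\varphi\in Y^{m,2}(\mathbb R^d):\vec\varphi=0\text{ outside }\Omega\}$, and $Y^{-m,2}(\Omega)$ is its antidual; for $T\in Y^{-m,2}(\Omega)$, $\langle T,\cdot\rangle_\Omega$ is a bounded linear functional on $Y_0^{m,2}(\Omega)$. Operator. $A^{j,k}_{\alpha,\beta}$ ($1\le j,k\le N$, $|\alpha|,|\beta|\le m$) are measurable complex functions on $\mathbb R^d$ and $\langle L\vec u,\vec\varphi\rangle_\Omega=\sum_{j,k}\sum_{|\alpha|\le m}\sum_{|\beta|\le m}\int_\Omega\partial^\alpha\varphi_j\,\overline{A^{j,k}_{\alpha,\beta}\partial^\beta u_k}$. (WG): for all smooth compactly supported $\vec\varphi$, $\mathrm{Re}\sum_{j,k}\sum_{|\alpha|,|\beta|\le m}\int_{\mathbb R^d}\overline{\partial^\alpha\varphi_j}A^{j,k}_{\alpha,\beta}\partial^\beta\varphi_k\ge\lambda\|\nabla^m\vec\varphi\|^2_{L^2(\mathbb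 R^d)}-\delta\|\vec\varphi\|^2_{L^2(\mathbb R^d)}$. (B1): $\|A^{j,k}_{\alpha,\beta}\|_{L^{2_{\alpha,\beta}}(\mathbb R^d)}\le\Lambda$ with $2_{\alpha,\beta}=\frac d{2m-|\alpha|-|\beta|}$ if $m-\frac d2<|\alpha|\le m$ and $m-\frac d2<|\beta|\le m$, and $A^{j,k}_{\alpha,\beta}=0$ otherwise. (B2): $\|A^{j,k}_{\alpha,\beta}\|_{L^\infty_tL_x^{\widetilde2_{\alpha,\beta}}}\le\Lambda$ with $\widetilde2_{\alpha,\beta}=\frac{d-1}{2m-|\alpha|-|\beta|}$ if $m-\frac{d-1}2<|\alpha|\le m$ and $m-\frac{d-1}2<|\beta|\le m$, and $A^{j,k}_{\alpha,\beta}=0$ otherwise; here $\|f\|_{L_t^\infty L_x^s}=\operatorname{ess\,sup}_{t\in\mathbb R}\|f(\cdot,t)\|_{L^s(\mathbb R^{d-1})}$. (Exponents with zero denominator are $\infty$.) *)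

(* Defs.v *)
From HB Require Import structures.
From mathcomp Require Import all_boot all_order all_algebra.
From mathcomp Require Import all_classical all_reals all_analysis.
From mathcomp Require Import ess_sup_inf.
From mathcomp Require Import complex.
Set Implicit Arguments. Unset Strict Implicit. Unset Printing Implicit Defensive.
Import Order.TTheory GRing.Theory Num.Theory.
Import numFieldNormedType.Exports.
Local Open Scope classical_set_scope.
Local Open Scope complex_scope.
Local Open Scope ring_scope.

(* Product sigma-algebra on row vectors; for [T] a realType it is the Borel
   sigma-algebra of the topology of ['rV[T]_n]. *)
Definition rV_display : measure_display -> measure_display.
Proof. exact. Qed.

Section measurable_rV.
Context {d : measure_display} {T : measurableType d} (n : nat).

Let coord (i : 'I_n) (x : 'rV[T]_n) : T := x ord0 i.

Let rV_set0 : g_sigma_preimage coord set0.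
Proof. exact: sigma_algebra0. Qed.

Let rV_setC A : g_sigma_preimage coord A -> g_sigma_preimage coord (~` A).
Proof. exact: sigma_algebraC. Qed.

Let rV_bigcup (F : _^nat) : (forall i, g_sigma_preimage coord (F i)) ->
  g_sigma_preimage coord (\bigcup_i (F i)).
Proof. exact: sigma_algebra_bigcup. Qed.

HB.instance Definition _ := @isMeasurable.Build (rV_display d)
  'rV[T]_n (g_sigma_preimage coord) rV_set0 rV_setC rV_bigcup.

End measurable_rV.

Lemma measurable_fun_coord d (T : measurableType d) n (i : 'I_n) :
  measurable_fun [set: 'rV[T]_n] (fun x : 'rV[T]_n => x ord0 i).
Proof.
move=> _ Y mY; rewrite setTI; apply: sub_sigma_algebra => /=.
rewrite -bigcup_seq/=; exists i => /=; first by rewrite mem_index_enum.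
by exists Y => //; rewrite setTI.
Qed.

Lemma measurable_fun_rV d d' (T : measurableType d) (T' : measurableType d')
    n (f : T' -> 'rV[T]_n) :
  (forall i, measurable_fun [set: T'] (fun x => f x ord0 i)) ->
  measurable_fun [set: T'] f.
Proof.
move=> mf _ Y mY; rewrite setTI.
suff : g_sigma_preimage (fun i (x : 'rV[T]_n) => x ord0 i) `<=`
    [set A | measurable (f @^-1` A)] by apply.
apply: smallest_sub.
  split; first by rewrite /= preimage_set0.
  - by move=> A mA /=; rewrite setTD preimage_setC; exact: measurableC.
  - by move=> F mF /=; rewrite preimage_bigcup; apply: bigcup_measurable => k _; exact: mF.
rewrite -bigcup_seq => A [i _ [B mB <-]] /=.
by rewrite setTI; have := mf i measurableT B mB; rewrite setTI.
Qed.

(* The point (x, t) of R^d, for x in R^(d-1) and t in R. *)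
Definition snoc {R : Type} {d : nat} (x : 'rV[R]_d.-1) (t : R) : 'rV[R]_d :=
  \row_(i < d) (if insub (i : nat) is Some k then x ord0 k else t).

Lemma measurable_snoc (R : realType) n :
  measurable_fun [set: 'rV[R]_n * measurableTypeR R]
    (fun p => @snoc R n.+1 p.1 p.2).
Proof.
apply: measurable_fun_rV => i.
under eq_fun do rewrite mxE.
case: insub => [k|]; last exact: measurable_snd.
exact: (measurableT_comp (measurable_fun_coord k) measurable_fst).
Qed.

Section lebesgue_rV.
Context {R : realType}.

Section snoc_measure.
Context (n : nat) (mu : {sigma_finite_measure set 'rV[R]_n -> \bar R}).

Definition snoc_measure : set 'rV[R]_n.+1 -> \bar R :=
  pushforward (mu \x @lebesgue_measure R)%E (fun p => @snoc R n.+1 p.1 p.2).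

HB.instance Definition _ := Measure.copy snoc_measure
  (measure_function_pushforward__canonical__measure_function_Measure
    (mu \x @lebesgue_measure R)%E (@measurable_snoc R n)).

Let snoc_sigma_finite : sigma_finite setT snoc_measure.
Proof.
have /sigma_finiteP[F [FT ndF mF]] := sigma_finiteT mu.
have /sigma_finiteP[G [GT ndG mG]] := sigma_finiteT (@lebesgue_measure R).
pose g (y : 'rV[R]_n.+1) : 'rV[R]_n * measurableTypeR R :=
  (\row_i y ord0 (widen_ord (leqnSn n) i), y ord0 ord_max).
have mg : measurable_fun setT g.
  apply: measurable_fun_pair; last exact: measurable_fun_coord.
  apply: measurable_fun_rV => i; under eq_fun do rewrite mxE.
  exact: measurable_fun_coord.
have gK (p : 'rV[R]_n * measurableTypeR R) : g (@snoc R n.+1 p.1 p.2) = p.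
  case: p => x t; congr pair => /=; last by rewrite mxE insubF//= ltnn.
  apply/rowP => i; rewrite !mxE/=; case: insubP => [k _ ki|]; last first.
    by rewrite ltn_ord.
  by congr (x _ _); exact: val_inj.
exists (fun k => g @^-1` (F k `*` G k)).
  apply/seteqP; split => // y _.
  have [k _ Fk] : (\bigcup_k F k) (g y).1 by rewrite -FT.
  have [l _ Gl] : (\bigcup_k G k) (g y).2 by rewrite -GT.
  exists (maxn k l) => //; split.
  - by have /subsetPset := ndF _ _ (leq_maxl k l); apply.
  - by have /subsetPset := ndG _ _ (leq_maxr k l); apply.
move=> k; have [mFk Fkoo] := mF k; have [mGk Gkoo] := mG k; split.
  by rewrite -[X in measurable X]setTI; apply: mg => //; exact: measurableX.
rewrite /snoc_measure /pushforward -comp_preimage.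
rewrite (_ : _ \o _ = id); last by apply/funext => p; exact: gK.
by rewrite preimage_id product_measure1E// lte_mul_pinfty// ge0_fin_numE.
Qed.

HB.instance Definition _ := Measure_isSigmaFinite.Build _ _ _ snoc_measure
  snoc_sigma_finite.

End snoc_measure.

(* Lebesgue measure on R^n, as an iterated product; see [lebesgue_rV_box]. *)
Fixpoint lebesgue_rV (n : nat) : {sigma_finite_measure set 'rV[R]_n -> \bar R} :=
  match n with
  | 0 => [the {sigma_finite_measure set 'rV[R]_0 -> \bar R} of \d_(0 : 'rV[R]_0)]
  | n'.+1 => [the {sigma_finite_measure set 'rV[R]_n'.+1 -> \bar R} of
                snoc_measure (lebesgue_rV n')]
  end.

Lemma measurable_box n (A : 'I_n -> set R) :
  (forall i, measurable (A i)) ->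
  measurable [set x : 'rV[R]_n | forall i, A i (x ord0 i)].
Proof.
move=> mA; rewrite (_ : mkset _ = \big[setI/setT]_(i < n)
    ((fun x : 'rV[R]_n => x ord0 i) @^-1` A i)).
  apply: bigsetI_measurable => i _.
  rewrite -[X in measurable X]setTI; exact: measurable_fun_coord.
rewrite -bigcap_seq; apply/seteqP; split => x /= Ax i; first by move=> _; exact: Ax.
by apply: Ax; rewrite /= mem_index_enum.
Qed.

Lemma lebesgue_rV_box n (A : 'I_n -> set R) :
  (forall i, measurable (A i)) ->
  lebesgue_rV n [set x | forall i, A i (x ord0 i)] =
  (\prod_(i < n) lebesgue_measure (A i))%E.
Proof.
elim: n A => [|n ih] A mA.
  rewrite big_ord0 /= diracE mem_set// => -[].
  by [].
rewrite big_ord_recr/= /snoc_measure /pushforward.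
rewrite (_ : _ @^-1` _ =
    [set x : 'rV[R]_n | forall i, A (widen_ord (leqnSn n) i) (x ord0 i)]
    `*` A ord_max).
  rewrite product_measure1E; [| |exact: mA].
    by congr (_ * _)%E; apply: (ih (fun i => A (widen_ord (leqnSn n) i))) => i.
  by apply: (@measurable_box n (fun i => A (widen_ord (leqnSn n) i))) => i.
apply/seteqP; split => -[x t] /=.
  move=> Axt; split => [i|].
    have := Axt (widen_ord (leqnSn n) i); rewrite mxE/=.
    case: insubP => [k _ ki|]; last by rewrite ltn_ord.
    by have -> : k = i by exact: val_inj.
  by have := Axt ord_max; rewrite mxE insubF//= ltnn.
move=> [Ax At] i; rewrite mxE; case: insubP => [k _ ki|].
  suff -> : i = widen_ord (leqnSn n) k by exact: Ax.
  exact: val_inj.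
rewrite -leqNgt => ni; rewrite (_ : i = ord_max)//; apply/val_inj => /=.
by apply/eqP; rewrite eqn_leq ni -ltnS ltn_ord.
Qed.

End lebesgue_rV.

Section multi_indices.
Context {d : nat}.

(* Multi-indices of order at most [m]; the bound on the components only serves
   to get a finite type. *)
Definition multi_index (m : nat) : Type :=
  {a : {ffun 'I_d -> 'I_m.+1} | (\sum_i a i <= m)%N}.

HB.instance Definition _ m := Finite.on (multi_index m).

Definition multi_index_fun m (a : multi_index m) : 'I_d -> nat :=
  fun i => sval a i.
Coercion multi_index_fun : multi_index >-> Funclass.

Definition mi_order (a : 'I_d -> nat) : nat := \sum_i a i.

End multi_indices.
Arguments multi_index : clear implicits.

Section derivatives.
Context {R : realType} {d : nat}.
Local Notation X := 'rV[R]_d.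
Local Notation leb := (@lebesgue_rV R d).
Local Notation Re := (@complex.Re R).
Local Notation Im := (@complex.Im R).

Definition pderive (s : seq 'I_d) (f : X -> R) : X -> R :=
  foldr (fun i g x => 'D_(delta_mx 0 i : X) g x) f s.

Definition mderive (a : 'I_d -> nat) (f : X -> R) : X -> R :=
  pderive (flatten [seq nseq (a i) i | i <- enum 'I_d]) f.

(* Differentiability of all iterated partial derivatives makes each of them
   exist and be continuous. *)
Definition smooth (f : X -> R) : Prop :=
  forall (s : seq 'I_d) (x : X), differentiable (pderive s f) x.

Definition supp {V : nmodType} (f : X -> V) : set X :=
  closure [set x | f x != 0].

Definition test_fun (Omega : set X) (f : X -> R) : Prop :=
  [/\ smooth f, compact (supp f) & supp f `<=` Omega].

Definition cintegral (D : set X) (f : X -> R[i]) : R[i] :=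
  (\int[leb]_(x in D) Re (f x)) +i* (\int[leb]_(x in D) Im (f x)).

Definition loc_integrable (Omega : set X) (f : X -> R[i]) : Prop :=
  forall K : set X, compact K -> K `<=` Omega ->
    leb.-integrable K (EFin \o Re \o f) /\
    leb.-integrable K (EFin \o Im \o f).

(* Real-valued test functions suffice, by linearity. *)
Definition is_wderive (Omega : set X) (a : 'I_d -> nat) (u v : X -> R[i]) :
    Prop :=
  [/\ loc_integrable Omega u, loc_integrable Omega v &
    forall f, test_fun Omega f ->
      cintegral Omega (fun x => u x * (mderive a f x)%:C) =
      (-1) ^+ mi_order a * cintegral Omega (fun x => v x * (f x)%:C)].

(* A representative of the weak derivative; it is unique up to a null subset
   of [Omega], and junk outside [Omega]. *)
Definition wderive (Omega : set X) (a : 'I_d -> nat) (u : X -> R[i]) :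
    X -> R[i] :=
  xget (fun=> 0) [set v | is_wderive Omega a u v].

End derivatives.

Section vector_valued.
Context {R : realType} {d N : nat}.
Local Notation X := 'rV[R]_d.
Local Notation leb := (@lebesgue_rV R d).
Local Notation Re := (@complex.Re R).
Local Notation Im := (@complex.Im R).
Local Notation V := 'rV[R[i]]_N.

Definition coordf (u : X -> V) (j : 'I_N) : X -> R[i] := fun x => u x ord0 j.

Definition sqnorm (z : V) : R := \sum_j Normc.normc (z ord0 j) ^+ 2.

Definition vwderive (Omega : set X) (a : 'I_d -> nat) (u : X -> V) : X -> V :=
  fun x => \row_j wderive Omega a (coordf u j) x.

Definition sqgrad (Omega : set X) (k : nat) (u : X -> V) (x : X) : R :=
  \sum_(a : multi_index d k | mi_order a == k) sqnorm (vwderive Omega a u x).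

Section spaces.
Variables (Omega : set X) (m : nat).

(* [m - d / 2 < |a|] *)
Definition above_half (a : multi_index d m) : bool :=
  (2 * m < 2 * mi_order a + d)%N.

Definition Yexp (a : multi_index d m) : R :=
  (2^-1 - (m%:R - (mi_order a)%:R) / d%:R)^-1.

Definition Ynorm (u : X -> V) : \bar R :=
  (\sum_(a : multi_index d m | above_half a)
    'N[leb]_((Yexp a)%:E)
      [(fun x => (Num.sqrt (sqnorm (vwderive Omega a u x)))%:E) \_ Omega])%E.

(* A function stands for itself, as a representative of its class modulo
   polynomials of degree at most [m - d / 2], on which [Ynorm] vanishes. Orders
   at most [m - d / 2] carry no integrability condition beyond the local one:
   their weak derivatives exist as soon as those of order [m] are in L^2. *)
Definition Yspace (u : X -> V) : Prop :=
  (forall (j : 'I_N) (a : multi_index d m),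
     exists v, is_wderive Omega a (coordf u j) v) /\
  (Ynorm u < +oo)%E.

End spaces.

(* [setT] in [Yspace setT m]: functions vanishing outside [Omega] have their
   weak derivatives on the whole space. *)
Definition Yspace0 (Omega : set X) (m : nat) (phi : X -> V) : Prop :=
  Yspace setT m phi /\ {ae leb, forall x, ~ Omega x -> phi x = 0}.

Definition Ybounded (Omega : set X) (m : nat) (T : (X -> V) -> R[i]) (K : R) :
    Prop :=
  0 <= K /\ forall psi, Yspace0 Omega m psi ->
    ((Normc.normc (T psi))%:E <= Ynorm Omega m psi * K%:E)%E.

(* [T] stands for [phi |-> <T, phi>_Omega], which is linear in [phi]; only its
   values on [Yspace0 Omega m] matter. Boundedness forces [T] to respect
   almost everywhere equality. *)
Definition Ydual (Omega : set X) (m : nat) (T : (X -> V) -> R[i]) : Prop :=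
  (forall (c : R[i]) phi psi, Yspace0 Omega m phi -> Yspace0 Omega m psi ->
     T (c *: phi + psi) = c * T phi + T psi) /\
  (exists K, Ybounded Omega m T K).

Definition Ydual_norm (Omega : set X) (m : nat) (T : (X -> V) -> R[i]) : R :=
  inf [set K | Ybounded Omega m T K].

End vector_valued.

Definition coefficients (R : realType) (d m N : nat) : Type :=
  'I_N -> 'I_N -> multi_index d m -> multi_index d m -> 'rV[R]_d -> R[i].

Section operator.
Context {R : realType} {d m N : nat}.
Local Notation X := 'rV[R]_d.
Local Notation leb := (@lebesgue_rV R d).
Local Notation Re := (@complex.Re R).
Local Notation Im := (@complex.Im R).
Local Notation V := 'rV[R[i]]_N.
Variable A : coefficients R d m N.

Definition measurable_coefficients : Prop :=
  forall j k a b, measurable_fun setT (Re \o A j k a b) /\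
                  measurable_fun setT (Im \o A j k a b).

Definition Lpairing (Omega : set X) (u phi : X -> V) : R[i] :=
  \sum_j \sum_k \sum_(a : multi_index d m) \sum_(b : multi_index d m)
    cintegral Omega (fun x => wderive Omega a (coordf phi j) x *
      conjc (A j k a b x * wderive Omega b (coordf u k) x)).

Definition cmderive (a : 'I_d -> nat) (f : X -> R[i]) (x : X) : R[i] :=
  mderive a (Re \o f) x +i* mderive a (Im \o f) x.

Definition weak_Garding (lambda delta : R) : Prop :=
  forall phi : X -> V,
    (forall j, smooth (Re \o coordf phi j) /\
               smooth (Im \o coordf phi j)) ->
    compact (supp phi) ->
    lambda * (\int[leb]_x (\sum_(a : multi_index d m | mi_order a == m)
                \sum_j Normc.normc (cmderive a (coordf phi j) x) ^+ 2))
      - delta * (\int[leb]_x sqnorm (phi x)) <=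
    Re (\sum_j \sum_k \sum_(a : multi_index d m)
      \sum_(b : multi_index d m)
        cintegral setT (fun x => conjc (cmderive a (coordf phi j) x) *
          A j k a b x * cmderive b (coordf phi k) x)).

(* n / (2m - |a| - |b|); the truncated subtractions are exact. *)
Definition coef_exp (n : nat) (a b : multi_index d m) : \bar R :=
  let k := (2 * m - mi_order a - mi_order b)%N in
  if k == 0%N then +oo%E else (n%:R / k%:R)%:E.

Definition bound1 (Lambda : R) : Prop :=
  forall j k (a b : multi_index d m),
    (above_half a && above_half b ->
      ('N[leb]_(coef_exp d a b)[(fun x => (Normc.normc (A j k a b x))%:E)]
         <= Lambda%:E)%E) /\
    (~~ (above_half a && above_half b) ->
      {ae leb, forall x, A j k a b x = 0}).

(* [m - (d - 1) / 2 < |a|] *)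
Definition above_half_pred (a : multi_index d m) : bool :=
  (2 * m < 2 * mi_order a + d.-1)%N.

Definition mixed_norm (s : \bar R) (f : X -> R[i]) : \bar R :=
  ess_sup lebesgue_measure (fun t : R =>
    'N[@lebesgue_rV R d.-1]_s[(fun x => (Normc.normc (f (snoc x t)))%:E)])%E.

Definition bound2 (Lambda : R) : Prop :=
  forall j k (a b : multi_index d m),
    (above_half_pred a && above_half_pred b ->
      (mixed_norm (coef_exp d.-1 a b) (A j k a b) <= Lambda%:E)%E) /\
    (~~ (above_half_pred a && above_half_pred b) ->
      {ae leb, forall x, A j k a b x = 0}).

End operator.

(* Open cube of center [c] and side length [l]. *)
Definition cube {R : realType} {d : nat} (c : 'rV[R]_d) (l : R) : set 'rV[R]_d :=
  [set x | forall i, `|x ord0 i - c ord0 i| < l / 2].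

Definition volume {R : realType} {d : nat} (Q : set 'rV[R]_d) : R :=
  fine (lebesgue_rV d Q).

(* Main.v *)
(* It suffices to test the equation with [h * h * u], for cut-offs [h] between nested cubes, and
   to apply (WG) to [h * u]. Everything that differs from the form at [h * u] comes from
   commutators of [h] with the derivatives; these are supported where [h] varies and only see
   derivatives of [u] of order below [m], at the length scale of [h]. By interpolation they are
   absorbed into a small multiple of the order [m] energy of [u] on a slightly larger annulus, and
   iterating over a geometric sequence of annuli sums the remainders to a multiple of
   [(scale)^(-2m) |u|^2]. The hypotheses on the coefficients only enter through the bound
   [\int |a f g| <= M |D^k1 f|_2 |D^k2 g|_2], with [k1 = m - |alpha|] and [k2 = m - |beta|],
   which follows from the Gagliardo-Nirenberg-Sobolev inequality on R^d under (B1), and on each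
   slice R^(d-1) under (B2).

   All of this is done for real-valued families indexed by a finite type, complex functions being
   pairs of real ones, and for smooth functions of bounded support; the solution is reached by
   mollification. A solution in [Yspace] only has its derivatives of order [m] in L^2; that those
   of lower order are locally in L^2 is proved by a Poincare type inequality for the mollified
   functions. *)
Require Import Defs.
From HB Require Import structures.
From mathcomp Require Import all_boot all_order all_algebra.
From mathcomp Require Import all_classical all_reals all_analysis.
From mathcomp Require Import measurable_realfun ess_sup_inf.
From mathcomp Require Import complex.
From mathcomp Require Import ring lra zify.
Set Implicit Arguments. Unset Strict Implicit. Unset Printing Implicit Defensive.
Import Order.TTheory GRing.Theory Num.Theory.
Import numFieldNormedType.Exports.
Local Open Scope classical_set_scope.
Local Open Scope ring_scope.

(** * Iterated partial derivatives *)

(** The interpolation inequality comes from integration by parts, hence holds for functions of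
    bounded support only. A commutator involves derivatives of u itself, so a wider cut-off [ze],
    equal to 1 wherever [h] varies, is inserted before interpolating. The price is that the estimate
    for [h * u] returns the order m energy of [ze * u], on a larger support, so no single cut-off
    closes the argument.

    Along the sequence of annuli the length scale is halved, and the zero-order term grows by 4^m at
    each step. Absorbing the fraction 1/(2 * 4^m) makes the energies divided by 4^(m i) satisfy F_i
    <= F_(i+1)/2 + b, and boundedness of F then suffices.

    All these annuli lie outside Q. Only the cut-off [eta] covers Q, and it varies where the annular
    estimate already holds. Hence the first inequality has the integral over the annulus in its
    first term. The term with delta is carried along unchanged, which keeps C independent of
    delta. *)

Section calculus.
Context {R : realType} {n : nat}.
Local Notation X := 'rV[R]_n.
Local Notation e := (fun i => delta_mx 0 i : X).

Implicit Types f g : X -> R.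

Definition pd (i : 'I_n) (f : X -> R) : X -> R := fun x => 'D_(e i) f x.

Definition diffb (f : X -> R) := forall x, differentiable f x.

Lemma pderive_rcons s i (f : X -> R) : pderive (rcons s i) f = pderive s (pd i f).
Proof. by rewrite /pderive foldr_rcons. Qed.

Lemma pderive_cons s i (f : X -> R) : pderive (i :: s) f = pd i (pderive s f).
Proof. by []. Qed.

Lemma pderive_cat s t (f : X -> R) : pderive (s ++ t) f = pderive s (pderive t f).
Proof. by rewrite /pderive foldr_cat. Qed.

(** [smooth] is the largest class of differentiable functions stable under [pd]. Closure properties
    are therefore proved by exhibiting an invariant class [S], with no formula for higher
    derivatives. *)
Lemma smooth_coind (S : (X -> R) -> Prop) :
  (forall f, S f -> diffb f /\ forall i, S (pd i f)) ->
  forall f, S f -> smooth f.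
Proof.
move=> HS f Sf s; suff : S (pderive s f) by move=> /HS[].
by elim: s => //= i s ih; have [_] := HS _ ih; apply.
Qed.

Lemma smooth_diff f : smooth f -> diffb f.
Proof. by move=> sf; exact: (sf [::]). Qed.

Lemma smooth_pderive s (f : X -> R) : smooth f -> smooth (pderive s f).
Proof. by move=> sf t x; rewrite -pderive_cat; exact: sf. Qed.

Lemma smooth_pd i (f : X -> R) : smooth f -> smooth (pd i f).
Proof. exact: (@smooth_pderive [:: i]). Qed.

Definition smooth1 (h : R -> R) := forall k x, derivable (derive1n k h) x 1.

Lemma smooth1_derive h : smooth1 h -> smooth1 (derive1 h).
Proof. by move=> sh k x; rewrite -derive1Sn; exact: sh. Qed.

Lemma pdD i f g : diffb f -> diffb g -> pd i (f \+ g) = pd i f \+ pd i g.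
Proof.
move=> df dg; apply/funext => x; rewrite /pd /=.
by rewrite -[in LHS]/(f + g) deriveD//; exact: diff_derivable.
Qed.

Lemma pdM i f g : diffb f -> diffb g ->
  pd i (f \* g) = (pd i f \* g) \+ (f \* pd i g).
Proof.
move=> df dg; apply/funext => x; rewrite /pd /=.
rewrite -[in LHS]/(f * g) deriveM; [|exact: diff_derivable..].
by rewrite addrC; congr (_ + _); rewrite /GRing.scale/= mulrC.
Qed.

Lemma pdB i f g : diffb f -> diffb g ->
  pd i (fun x => f x - g x) = (fun x => pd i f x - pd i g x).
Proof.
move=> df dg; apply/funext => x; rewrite /pd /=.
by rewrite -[in LHS]/(f - g) deriveB//; exact: diff_derivable.
Qed.

Lemma pd_cst i (c : R) : pd i (cst c) = cst 0.
Proof. by apply/funext => x; rewrite /pd derive_cst. Qed.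

Lemma pd_comp i (h : R -> R) f : (forall x : R, derivable h x 1) -> diffb f ->
  pd i (h \o f) = ((derive1 h) \o f) \* pd i f.
Proof.
move=> dh df; apply/funext => x; rewrite /pd /=.
have dhx : differentiable h (f x) by exact/derivable1_diffP.
rewrite deriveE; last exact: differentiable_comp.
rewrite diff_comp//= deriv1E//.
by rewrite -deriveE// /GRing.scale/= mulrC.
Qed.

(** The derivative of a product or of a composite mixes sums, products and composites, so no single
    operation gives an invariant class; closing under all of them at once does. *)
Inductive smooth_alg : (X -> R) -> Prop :=
| smooth_alg_base f : smooth f -> smooth_alg f
| smooth_alg_cst (c : R) : smooth_alg (cst c)
| smooth_alg_D f g : smooth_alg f -> smooth_alg g -> smooth_alg (f \+ g)
| smooth_alg_M f g : smooth_alg f -> smooth_alg g -> smooth_alg (f \* g)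
| smooth_alg_comp h f : smooth1 h -> smooth_alg f -> smooth_alg (h \o f).

Lemma smooth_algP f : smooth_alg f -> smooth f.
Proof.
move: f; apply: smooth_coind => f; elim.
- by move=> {}f sf; split=> [|i]; [exact: smooth_diff|apply: smooth_alg_base; exact: smooth_pd].
- by move=> c; split=> [x|i]; [exact: differentiable_cst|rewrite pd_cst; exact: smooth_alg_cst].
- move=> {}f g _ [df sf] _ [dg sg]; split=> [x|i].
    exact: (differentiableD (df x) (dg x)).
  by rewrite pdD//; apply: smooth_alg_D.
- move=> {}f g af [df sf] ag [dg sg]; split=> [x|i].
    exact: (differentiableM (df x) (dg x)).
  by rewrite pdM//; apply: smooth_alg_D; apply: smooth_alg_M.
- move=> h {}f sh af [df sf]; split=> [x|i].
    by apply: differentiable_comp => //; apply/derivable1_diffP; exact: (sh 0%N).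
  rewrite pd_comp//; last by move=> x; exact: (sh 0%N).
  by apply: smooth_alg_M => //; apply: smooth_alg_comp => //; exact: smooth1_derive.
Qed.

Lemma smooth_cst c : smooth (cst c : X -> R).
Proof. by apply: smooth_algP; exact: smooth_alg_cst. Qed.

Lemma smoothD f g : smooth f -> smooth g -> smooth (f \+ g).
Proof. by move=> sf sg; apply: smooth_algP; apply: smooth_alg_D; exact: smooth_alg_base. Qed.

Lemma smoothM f g : smooth f -> smooth g -> smooth (f \* g).
Proof. by move=> sf sg; apply: smooth_algP; apply: smooth_alg_M; exact: smooth_alg_base. Qed.

Lemma smooth_comp h f : smooth1 h -> smooth f -> smooth (h \o f).
Proof. by move=> sh sf; apply: smooth_algP; apply: smooth_alg_comp => //; exact: smooth_alg_base.
  Qed.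

Lemma smoothZ c f : smooth f -> smooth (fun x => c * f x).
Proof. by move=> sf; apply: (@smoothM (cst c) f) => //; exact: smooth_cst. Qed.

Lemma smoothN f : smooth f -> smooth (fun x => - f x).
Proof. by move=> sf; under eq_fun do rewrite -mulN1r; exact: smoothZ. Qed.

Lemma smoothB f g : smooth f -> smooth g -> smooth (fun x => f x - g x).
Proof. by move=> sf sg; apply: (@smoothD f) => //; exact: smoothN. Qed.

Lemma smooth_sum (I : Type) (r : seq I) (P : pred I) (F : I -> X -> R) :
  (forall i, P i -> smooth (F i)) -> smooth (fun x => \sum_(i <- r | P i) F i x).
Proof.
move=> sF; elim: r => [|i r ih].
  by under eq_fun do rewrite big_nil; exact: (smooth_cst 0).
case Pi : (P i); last by under eq_fun do rewrite big_cons Pi.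
by under eq_fun do rewrite big_cons Pi; exact: (smoothD (sF i Pi) ih).
Qed.

Lemma smooth_prod (I : Type) (r : seq I) (P : pred I) (F : I -> X -> R) :
  (forall i, P i -> smooth (F i)) -> smooth (fun x => \prod_(i <- r | P i) F i x).
Proof.
move=> sF; elim: r => [|i r ih].
  by under eq_fun do rewrite big_nil; exact: (smooth_cst 1).
case Pi : (P i); last by under eq_fun do rewrite big_cons Pi.
by under eq_fun do rewrite big_cons Pi; exact: (smoothM (sF i Pi) ih).
Qed.

Lemma pd_coord i j : pd i (fun x : X => x ord0 j) = cst (i == j)%:R.
Proof.
apply/funext => x; rewrite /pd /=.
rewrite deriveE; last exact: differentiable_coord.
have @g : {linear X -> R}.
  by exists (fun N : X => N ord0 j); do 2![eexists]; do ?[constructor];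
     rewrite ?mxE// => ? *; rewrite ?mxE//; move=> ?; rewrite !mxE.
rewrite (_ : (fun _ => _) = g) // diff_lin; last exact: coord_continuous.
by rewrite /= mxE eqxx eq_sym.
Qed.

Lemma smooth_coord j : smooth (fun x : X => x ord0 j).
Proof.
apply: (@smooth_coind (fun f => f = (fun x : X => x ord0 j) \/ exists c, f = cst c)); last by left.
move=> f [->|[c ->]]; split.
- by move=> x; exact: differentiable_coord.
- by move=> i; right; exists (i == j)%:R; rewrite pd_coord.
- by move=> x; exact: differentiable_cst.
- by move=> i; right; exists 0; rewrite pd_cst.
Qed.

Lemma smooth_continuous f : smooth f -> continuous f.
Proof. by move=> /smooth_diff df x; exact: differentiable_continuous. Qed.

Lemma pderiveD s f g : smooth f -> smooth g ->
  pderive s (f \+ g) = pderive s f \+ pderive s g.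
Proof.
move=> sf sg; elim: s => //= i s ->; rewrite -pdD//; exact: smooth_diff (smooth_pderive _ _).
Qed.

Lemma pderive_cst s (c : R) : pderive s (cst c) = cst (if s is [::] then c else 0) :> (X -> R).
Proof. by elim: s => //= i s ->; exact: pd_cst. Qed.

Lemma pderiveZ s (c : R) f : smooth f -> pderive s (fun x => c * f x) = fun x => c * pderive s f x.
Proof.
move=> sf; elim: s => //= i s ->; apply/funext => x.
by rewrite deriveZ//; apply: diff_derivable; exact: sf.
Qed.

Lemma pderiveN s f : smooth f -> pderive s (fun x => - f x) = fun x => - pderive s f x.
Proof.
move=> sf; under eq_fun do rewrite -mulN1r.
by rewrite pderiveZ//; apply/funext => x; rewrite mulN1r.
Qed.

Lemma pderiveB s f g : smooth f -> smooth g ->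
  pderive s (fun x => f x - g x) = fun x => pderive s f x - pderive s g x.
Proof.
move=> sf sg; rewrite -[LHS]/(pderive s (f \+ (fun x => - g x))) pderiveD//; last exact: smoothN.
by rewrite pderiveN.
Qed.

(** Each direction goes to one of two factors. Repetitions are kept, so the Leibniz formula has
    2^(size s) terms and no binomial coefficients. *)
Fixpoint splits (T : Type) (s : seq T) : seq (seq T * seq T) :=
  if s is i :: s' then
    [seq (i :: p.1, p.2) | p <- splits s'] ++ [seq (p.1, i :: p.2) | p <- splits s']
  else [:: ([::], [::])].

Lemma pderiveM s f g x : smooth f -> smooth g ->
  pderive s (f \* g) x = \sum_(p <- splits s) pderive p.1 f x * pderive p.2 g x.
Proof.
move=> sf sg; elim: s x => [x|i s ih x] /=; first by rewrite big_seq1.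
have -> : pderive s (f \* g) = fun x => \sum_(p <- splits s) pderive p.1 f x * pderive p.2 g x.
  exact/funext.
rewrite big_cat !big_map /= -big_split/=.
elim: (splits s) => [|p l ihl].
  by rewrite big_nil; under eq_fun do rewrite big_nil; rewrite derive_cst.
under eq_fun do rewrite big_cons.
rewrite big_cons -ihl.
have d1 := smooth_pderive p.1 sf; have d2 := smooth_pderive p.2 sg.
have /(congr1 (@^~ x)) := pdD i (smooth_diff (smoothM d1 d2))
  (smooth_diff (smooth_sum l (P := predT) (fun p _ => smoothM (smooth_pderive p.1 sf)
    (smooth_pderive p.2 sg)))).
rewrite /pd /= => ->; congr (_ + _).
have /(congr1 (@^~ x)) := pdM i (smooth_diff d1) (smooth_diff d2).
by rewrite /pd /=.
Qed.

Lemma splits_size (T : Type) (s : seq T) :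
  all (fun p => size p.1 + size p.2 == size s)%N (splits s).
Proof.
elim: s => //= i s ih; rewrite all_cat !all_map; apply/andP; split.
  by apply: sub_all ih => p /=; rewrite addSn eqSS.
by apply: sub_all ih => p /=; rewrite addnS eqSS.
Qed.

Lemma size_splits (T : Type) (s : seq T) : size (splits s) = (2 ^ size s)%N.
Proof. by elim: s => //= i s ih; rewrite size_cat !size_map ih expnS mul2n addnn. Qed.

Lemma diff_sum f x (v : X) : differentiable f x -> 'd f x v = \sum_i v ord0 i * pd i f x.
Proof.
move=> df; rewrite {1}[v]row_sum_delta linear_sum.
by apply: eq_bigr => i _; rewrite linearZ /pd deriveE.
Qed.

Lemma is_derive_line f (x v : X) (t : R) : diffb f ->
  is_derive t 1 (fun t => f (x + t *: v)) (\sum_i v ord0 i * pd i f (x + t *: v)).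
Proof.
move=> df.
have dl : is_diff t (fun t : R => x + t *: v) (fun t : R => 0 + t *: v).
  exact: is_diffD.
have dt := @ex_diff _ _ _ _ _ _ _ dl.
apply: DeriveDef.
  by apply/diff_derivable/(differentiable_comp dt); exact: df.
rewrite deriveE; last by apply: (differentiable_comp dt); exact: df.
rewrite (diff_comp dt (df _)) /= (@diff_val _ _ _ _ _ _ _ dl) add0r scale1r.
exact: diff_sum.
Qed.

Lemma line_MVT f (x v : X) : diffb f ->
  exists2 c : R, 0 < c < 1 & f (x + v) - f x = \sum_i v ord0 i * pd i f (x + c *: v).
Proof.
move=> df.
have [|c] := @MVT R (fun t => f (x + t *: v)) (fun t => \sum_i v ord0 i * pd i f (x + t *: v))
  0 1 ltr01 (fun t _ => is_derive_line x v t df).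
  apply: derivable_within_continuous => t _.
  by have [] := is_derive_line x v t df.
rewrite in_itv/= => c01; rewrite scale1r scale0r addr0 subr0 mulr1 => ->.
by exists c.
Qed.

Lemma rV_norm_le (x : X) (r : R) : 0 <= r -> (`|x| <= r) <-> (forall i, `|x ord0 i| <= r).
Proof.
move=> r0; rewrite /Num.norm/= mx_normrE; split=> [/bigmax_leP[_ H] i|H].
  exact: (H (ord0, i)).
by apply/bigmax_leP; split => // -[a b] _; rewrite ord1; exact: H.
Qed.

Lemma rV_norm_coord (x : X) i : `|x ord0 i| <= `|x|.
Proof. by have /rV_norm_le := lexx `|x|; apply. Qed.

Lemma norm_delta i (s : R) : `|s *: e i| <= `|s|.
Proof.
apply/rV_norm_le => // j; rewrite !mxE eqxx/=.
by case: eqP => _; rewrite ?mulr1// mulr0 normr0.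
Qed.

Lemma diffb_shift f (c : X) : diffb f -> diffb (fun y => f (y + c)).
Proof.
move=> df y; apply: (@differentiable_comp _ _ _ _ (fun y : X => y + c) f) => //.
Qed.

Lemma pd_shift i f (c x : X) : pd i (fun y => f (y + c)) x = pd i f (x + c).
Proof.
rewrite /pd /derive.
rewrite (_ : (fun h => h^-1 *: (((fun y => f (y + c)) \o shift x) (h *: e i) - f (x + c))) =
  (fun h => h^-1 *: ((f \o shift (x + c)) (h *: e i) - f (x + c))))//.
by apply/funext => h /=; rewrite addrA.
Qed.

Lemma pdE i f x : pd i f x = 'D_(e i) f x.
Proof. by []. Qed.

Opaque pd.

(** Mean value arguments only equate F and G at two different points near x; continuity turns this
    into equality at x. *)
Lemma eq_of_close (F G : X -> R) x : continuous F -> continuous G ->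
  (forall s, 0 < s -> exists p q, [/\ `|p - x| <= s + s, `|q - x| <= s + s & F p = G q]) ->
  F x = G x.
Proof.
move=> c1 c2 key; apply/eqP; rewrite -subr_eq0 -normr_le0; apply/ler_addgt0Pl => eps eps0; rewrite
  addr0.
have /cvgrPdist_lt/(_ _ (divr_gt0 eps0 (ltr0n R 2)))/nbhs_ballP[d1 /= d10 H1] := c1 x.
have /cvgrPdist_lt/(_ _ (divr_gt0 eps0 (ltr0n R 2)))/nbhs_ballP[d2 /= d20 H2] := c2 x.
have m0 : 0 < Num.min d1 d2 by rewrite lt_min d10.
have s0 : 0 < Num.min d1 d2 / 4 by rewrite divr_gt0.
have [p [q [px qx pq]]] := key _ s0.
have ss : Num.min d1 d2 / 4 + Num.min d1 d2 / 4 < Num.min d1 d2 by lra.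
have {}H1 : `|F x - F p| < eps / 2.
  apply: H1; rewrite -ball_normE /= distrC (le_lt_trans px)// (lt_le_trans ss)//.
  by rewrite ge_min lexx.
have {}H2 : `|G x - G q| < eps / 2.
  apply: H2; rewrite -ball_normE /= distrC (le_lt_trans qx)// (lt_le_trans ss)//.
  by rewrite ge_min lexx orbT.
rewrite -(subrKA (F p)) (le_trans (ler_normD _ _))//.
by rewrite [eps]splitr lerD// ?(ltW H1)// pq distrC ltW.
Qed.

(** Two applications of the mean value theorem write the second difference over a square of side s
    as s^2 times a mixed derivative at a nearby point. The difference is symmetric in the two
    directions, so both mixed derivatives arise. *)
Lemma pdC i j f : smooth f -> pd i (pd j f) = pd j (pd i f).
Proof.
move=> sf; apply/funext => x.
have key (a b : 'I_n) (s : R) : 0 < s -> exists2 p : X, `|p - x| <= s + s &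
    f (x + s *: e a + s *: e b) - f (x + s *: e a) - (f (x + s *: e b) - f x) =
    s ^+ 2 * pd b (pd a f) p.
  move=> s0.
  have sumE k (y : X) g c : \sum_l (s *: e k) ord0 l * pd l g (y + c *: (s *: e k)) =
      s * pd k g (y + (c * s) *: e k).
    rewrite (bigD1 k)//= big1 ?addr0; last first.
      by move=> l lk; rewrite !mxE eqxx (negbTE lk)/= mulr0 mul0r.
    by rewrite !mxE !eqxx mulr1 scalerA.
  pose G (y : X) := f (y + s *: e b) - f y.
  have dG : diffb G.
    move=> y; apply: differentiableB; last exact: smooth_diff.
    exact/diffb_shift/smooth_diff.
  have [c /andP[c0 c1]] := line_MVT x (s *: e a) dG.
  rewrite sumE => GE.
  have -> : f (x + s *: e a + s *: e b) - f (x + s *: e a) - (f (x + s *: e b) - f x)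
    = G (x + s *: e a) - G x by [].
  rewrite GE.
  have -> : pd a G (x + (c * s) *: e a) = pd a f (x + (c * s) *: e a + s *: e b) - pd a f (x + (c *
    s) *: e a).
    have := pdB a (diffb_shift (s *: e b) (smooth_diff sf)) (smooth_diff sf).
    by move=> /(congr1 (@^~ (x + (c * s) *: e a))) /= H; apply: (etrans H); rewrite pd_shift.
  have [c' /andP[c'0 c'1]] := line_MVT (x + (c * s) *: e a) (s *: e b) (smooth_diff (smooth_pd a
    sf)).
  rewrite sumE => ->; exists (x + (c * s) *: e a + (c' * s) *: e b); last by rewrite mulrA expr2.
  rewrite -(addrA x) [x + _]addrC addrK (le_trans (ler_normD _ _))// lerD//.
    rewrite (le_trans (norm_delta _ _))// ger0_norm; last by rewrite mulr_ge0// ltW.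
    by rewrite ler_piMl// ltW.
  rewrite (le_trans (norm_delta _ _))// ger0_norm; last by rewrite mulr_ge0// ltW.
  by rewrite ler_piMl// ltW.
apply: eq_of_close; [exact/smooth_continuous/smooth_pd/smooth_pd|
  exact/smooth_continuous/smooth_pd/smooth_pd|].
move=> s s0; have [p px pE] := key j i s s0.
have [q qx qE] := key i j s s0.
exists p, q; split; [exact: px|exact: qx|].
have s2 : s ^+ 2 != 0 by rewrite expf_eq0/= (gt_eqF s0).
have xE : x + s *: e j + s *: e i = x + s *: e i + s *: e j by exact: addrAC.
have E4 (a b c d : R) : a - b - (c - d) = a - c - (b - d) by ring.
by apply: (mulfI s2); apply: (etrans (esym pE)); apply: (etrans _ qE); rewrite xE; exact: E4.
Qed.

(** By [pdC] any direction can be moved to the front, and the rest follows by induction on the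
    sequence. *)
Lemma pderive_perm s t f : smooth f -> perm_eq s t -> pderive s f = pderive t f.
Proof.
move=> sf.
have cons_rem u i : i \in u -> pderive u f = pderive (i :: rem i u) f.
  elim: u => // j u ih; rewrite inE [rem _ _]/=; case: eqVneq => [->|ji] // iu.
  by rewrite pderive_cons (ih iu) !pderive_cons pdC//; exact: smooth_pderive.
elim: s t => [|i s ih] t st; first by have /perm_nilP -> : perm_eq t [::] by rewrite perm_sym.
have it : i \in t by rewrite -(perm_mem st) mem_head.
rewrite (cons_rem t i it)/= (ih (rem i t))//.
by rewrite -(perm_cons i); apply: (perm_trans st); exact: perm_to_rem.
Qed.

End calculus.

(** * Lebesgue measure on row vectors *)

Section rV_measure.
Context {R : realType}.
Local Notation leb n := (@lebesgue_rV R n).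

Definition box n (A : 'I_n -> set R) : set 'rV[R]_n :=
  [set x | forall i, A i (x ord0 i)].

Definition ocbox n : set (set 'rV[R]_n) :=
  [set B | exists a b : 'I_n -> R, B = box (fun i => `]a i, b i]%classic)].

Arguments ocbox : clear implicits.

Lemma setI_box n (A B : 'I_n -> set R) :
  box A `&` box B = box (fun i => A i `&` B i).
Proof.
apply/seteqP; split=> x /=; first by move=> [Ax Bx] i; split; [exact: Ax|exact: Bx].
by move=> ABx; split=> i; case: (ABx i).
Qed.

Lemma setI_closed_ocbox n : setI_closed (ocbox n).
Proof.
move=> _ _ [a [b ->]] [a' [b' ->]]; rewrite setI_box.
exists (fun i => Num.max (a i) (a' i)), (fun i => Num.min (b i) (b' i)).
congr box; apply/funext => i; apply/funext => x; apply/propext.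
rewrite /= !in_itv/= gt_max le_min.
by split=> [[/andP[-> ->] /andP[-> ->]]|/andP[/andP[-> ->] /andP[-> ->]]].
Qed.

Lemma measurable_ocbox n : ocbox n `<=` measurable.
Proof. by move=> _ [a [b ->]]; apply: measurable_box => i; exact: measurable_itv. Qed.

Definition cbox n (k : nat) : set 'rV[R]_n := box (fun=> `]-k%:R, k%:R]%classic).

Arguments cbox : clear implicits.

Lemma cbox_cover n : \bigcup_k cbox n k = setT.
Proof.
apply/seteqP; split=> // x _; exists (Num.bound `|x|).+1 => // i /=.
have : `|x ord0 i| < (Num.bound `|x|).+1%:R.
  rewrite (le_lt_trans (rV_norm_coord x i))// (lt_trans (archi_boundP (normr_ge0 x)))//.
  by rewrite ltr_nat.
by rewrite ltr_norml in_itv/= => /andP[-> /ltW ->].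
Qed.

(** Half-open boxes form a pi-system, as uniqueness of measures and Dynkin induction require. The
    preimage of an interval under a coordinate is unbounded in the other coordinates, hence only a
    countable union of boxes. *)
Lemma measurable_rV_ocbox n : measurable = <<s ocbox n >>.
Proof.
apply/seteqP; split; last first.
  apply: smallest_sub; first exact: sigma_algebra_measurable.
  exact: measurable_ocbox.
apply: smallest_sub; first exact: smallest_sigma_algebra.
rewrite -bigcup_seq => A [i _ [B mB <-]] /=; rewrite setTI.
have : <<s @ocitv R >> B by exact: mB.
suff : <<s @ocitv R >> `<=` [set B | <<s ocbox n >> ((fun x : 'rV[R]_n => x ord0 i) @^-1` B)].
  by apply.
apply: smallest_sub.
  have [sa0 saC saU] := smallest_sigma_algebra setT (ocbox n).
  split.
  - by rewrite /= preimage_set0; exact: sa0.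
  - by move=> C /= mC; rewrite setTD preimage_setC -setTD; exact: saC.
  - by move=> F mF /=; rewrite preimage_bigcup; exact: saU.
move=> _ [[a b] _ <-] /=.
have -> : (fun x : 'rV[R]_n => x ord0 i) @^-1` `]a, b] =
   \bigcup_k box (fun j => if j == i then `]a, b]%classic else `]-k%:R, k%:R]%classic).
  apply/seteqP; split=> x /=.
    move=> xi; have : (\bigcup_k cbox n k) x by rewrite cbox_cover.
    move=> [k _ kx]; exists k => // j; case: eqP => [->//|_]; exact: kx.
  by move=> [k _ /(_ i)]; rewrite eqxx.
have [_ _ saU] := smallest_sigma_algebra setT (ocbox n).
apply: saU => k; apply: sub_sigma_algebra.
exists (fun j => if j == i then a else -k%:R), (fun j => if j == i then b else k%:R).
by congr box; apply/funext => j; case: ifP.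
Qed.

Lemma lebesgue_ocbox n (a b : 'I_n -> R) : (forall i, a i <= b i) ->
  leb n (box (fun i => `]a i, b i]%classic)) = (\prod_i (b i - a i))%:E.
Proof.
move=> ab; rewrite lebesgue_rV_box; last by move=> i; exact: measurable_itv.
rewrite (eq_bigr (fun i => (b i - a i)%:E)) ?prodEFin// => i _.
rewrite lebesgue_measure_itv/= lte_fin lt_neqAle ab andbT.
by case: eqVneq => [->|]//=; rewrite subrr.
Qed.

Lemma lebesgue_cbox_lty n k : (leb n (cbox n k) < +oo)%E.
Proof. by rewrite /cbox lebesgue_ocbox ?ltry// => i; rewrite (@le_trans _ _ 0)// oppr_le0. Qed.

(** [lebesgue_rV] is an iterated product, so translation invariance cannot be read off its
    definition; it follows from the values on boxes. *)
Lemma lebesgue_rV_unique n (m : {measure set 'rV[R]_n -> \bar R}) :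
  (forall a b : 'I_n -> R, (forall i, a i <= b i) ->
    m (box (fun i => `]a i, b i]%classic)) = (\prod_i (b i - a i))%:E) ->
  forall A, measurable A -> m A = leb n A.
Proof.
move=> mE; have eqbox A : ocbox n A -> m A = leb n A.
  move=> [a [b ->]]; have [ab|] := pselect (forall i, a i <= b i).
    by rewrite mE// lebesgue_ocbox.
  move=> /existsNP[i /negP]; rewrite -ltNge => ba.
  rewrite (_ : box _ = set0) ?measure0//; apply/seteqP; split=> // x /(_ i).
  by rewrite /= in_itv/= => /andP[/lt_le_trans h /h]; rewrite ltNge (ltW ba).
apply: (@measure_unique _ _ _ (ocbox n) (cbox n)).
- exact: measurable_rV_ocbox.
- exact: setI_closed_ocbox.
- by move=> k; exists (fun=> -k%:R), (fun=> k%:R).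
- exact: cbox_cover.
- exact: eqbox.
- by move=> k; rewrite eqbox ?lebesgue_cbox_lty//; exists (fun=> -k%:R), (fun=> k%:R).
Qed.

Lemma measurable_shift n (c : 'rV[R]_n) : measurable_fun setT (fun x : 'rV[R]_n => x + c).
Proof.
apply: measurable_fun_rV => i; under eq_fun do rewrite mxE.
by apply: measurable_funD => //; exact: measurable_fun_coord.
Qed.

Lemma lebesgue_rV_shift n (c : 'rV[R]_n) A : measurable A ->
  pushforward (leb n) (fun x => x + c) A = leb n A.
Proof.
pose m : {measure set 'rV[R]_n -> \bar R} :=
  measure_function_pushforward__canonical__measure_function_Measure (leb n) (measurable_shift c).
apply: (lebesgue_rV_unique (m := m)) => a b ab.
rewrite /m /= /pushforward (_ : _ @^-1` _ =
  box (fun i => `]a i - c ord0 i, b i - c ord0 i]%classic)).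
  rewrite lebesgue_ocbox; last by move=> i; rewrite lerD2r.
  by congr EFin; apply: eq_bigr => i _; lra.
by apply/seteqP; split=> x /= H i; have := H i; rewrite /= !in_itv/= mxE ltrBlDr lerBrDr.
Qed.

Lemma ge0_integral_shift n (c : 'rV[R]_n) (f : 'rV[R]_n -> \bar R) :
  measurable_fun [set: 'rV[R]_n] f -> (forall x, 0 <= f x)%E ->
  (\int[leb n]_x f ((x : 'rV[R]_n) + c)%R = \int[leb n]_x f x)%E.
Proof.
move=> mf f0.
rewrite [RHS](eq_measure_integral
  (measure_function_pushforward__canonical__measure_function_Measure (leb n) (measurable_shift c)))
    /=; last first.
  by move=> A mA _; rewrite /= lebesgue_rV_shift.
by rewrite ge0_integral_pushforward//; exact: measurable_shift.
Qed.

Lemma abs_close (x y q e : R) : x - e < q -> q < x + e -> q - e < y -> y < q + e ->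
  `|x - y| <= e + e.
Proof. by move=> *; rewrite ler_norml; apply/andP; split; lra. Qed.

(** The sigma-algebra is the product one while the topology is that of the norm. The link is a
    countable cover of U by the cubes with rational centre and radius 1/(k+1) that it contains. *)
Lemma open_measurable_rV n (U : set 'rV[R]_n) : open U -> measurable U.
Proof.
move=> oU.
pose B (q : 'rV[rat]_n * nat) : set 'rV[R]_n :=
  box (fun i => `](ratr (q.1 ord0 i) - q.2.+1%:R^-1), (ratr (q.1 ord0 i) + q.2.+1%:R^-1)[%classic).
have -> : U = \bigcup_(q in [set q | B q `<=` U]) B q.
  apply/seteqP; split=> x; last by move=> [q]; apply.
  move=> Ux.
  have /nbhs_ballP[r /= r0 rU] := open_nbhs_nbhs (conj oU Ux).
  pose k := Num.bound (2 / r).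
  have kr : k.+1%:R^-1 < r / 2.
    rewrite -[r / 2]invrK invf_plt ?posrE ?invr_gt0// ?divr_gt0// invrK invfM invrK mulrC.
    rewrite (lt_trans (archi_boundP _)) ?ltr_nat// divr_ge0//.
    exact: ltW.
  have /choice[q qx] : forall i, exists q : rat, x ord0 i - k.+1%:R^-1 < ratr q < x ord0 i +
    k.+1%:R^-1.
    move=> i; have [] := @rat_in_itvoo R (x ord0 i - k.+1%:R^-1) (x ord0 i + k.+1%:R^-1).
      by rewrite ltrBlDr -addrA ltrDl -mulr2n pmulrn_lgt0.
    by move=> q; rewrite in_itv/= => ?; exists q.
  exists (\row_i q i, k) => /=.
    move=> y yB; apply: rU; rewrite -ball_normE /=.
    rewrite (@le_lt_trans _ _ (k.+1%:R^-1 + k.+1%:R^-1))//; last by rewrite [r]splitr ltrD.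
    apply/rV_norm_le => [|i]; first by rewrite addr_ge0.
    have := yB i; have := qx i; rewrite /B /box /= in_itv/= !mxE => /andP[h1 h2] /andP[h3 h4].
    exact: (abs_close h1 h2 h3 h4).
  move=> i; have := qx i; rewrite /= in_itv/= !mxE => /andP[h1 h2].
  by rewrite ltrBlDr h2/= -ltrBlDr h1.
have cB (q : 'rV[rat]_n * nat) : measurable (B q).
  by apply: measurable_box => i; exact: measurable_itv.
rewrite (_ : \bigcup_(q in _) _ = \bigcup_k (if unpickle k is Some q then
    if `[< B q `<=` U >] then B q else set0 else set0)).
  by apply: bigcupT_measurable => k; case: unpickle => // q; case: ifP.
apply/seteqP; split=> x.
  by move=> [q /= qU Bqx]; exists (pickle q) => //; rewrite pickleK asboolT.
by move=> [k _]; case: unpickle => // q; case: asboolP => // qU Bq; exists q.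
Qed.

Lemma continuous_measurable_rV n (f : 'rV[R]_n -> R) :
  continuous f -> measurable_fun setT f.
Proof.
move=> /continuousP cf; apply: (measurability _ (RGenOpens.measurableE R)) => _ [_ [a [b ->] <-]].
by rewrite setTI; apply: open_measurable_rV; exact/cf/interval_open.
Qed.

(** * Continuous functions and test functions of bounded support *)

Definition ccube n (r : R) : set 'rV[R]_n := box (fun=> `[-r, r]%classic).

Lemma ccubeP n (r : R) (x : 'rV[R]_n) : 0 <= r -> ccube r x <-> `|x| <= r.
Proof.
move=> r0; rewrite rV_norm_le//; split=> H i; have := H i; rewrite /= in_itv/= ler_norml//.
Qed.

Lemma measurable_ccube n r : measurable (@ccube n r).
Proof. by apply: measurable_box => i; exact: measurable_itv. Qed.

Lemma lebesgue_ccube_lty n r : (leb n (@ccube n r) < +oo)%E.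
Proof.
rewrite lebesgue_rV_box; last by move=> i; exact: measurable_itv.
rewrite (eq_bigr (fun=> (fine (lebesgue_measure `[-r, r]%classic))%:E)); last first.
  by move=> i _; rewrite fineK// lebesgue_measure_itv/=; case: ifP.
by rewrite prodEFin ltry.
Qed.

(** On this class the integral is linear and monotone with no integrability side conditions. No sign
    is asked of [r], and [cb_bounded] replaces it by its absolute value. *)
Definition cb n (f : 'rV[R]_n -> R) :=
  continuous f /\ exists r : R, forall x, r < `|x| -> f x = 0.

Lemma cb_bounded n (f : 'rV[R]_n -> R) : cb f ->
  exists2 M, 0 <= M & exists2 r, 0 <= r & forall x, `|f x| <= M * \1_(ccube r) x.
Proof.
move=> [cf [r fr]].
have r0 : 0 <= `|r| by [].
have [|M [Mr MP]] := @compact_bounded _ _ (f @` (@ccube n `|r|)).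
  apply: continuous_compact; first by apply: continuous_subspaceT.
  apply: bounded_closed_compact.
    by exists `|r|; split => // M rM x /(ccubeP _ r0) xr; exact: le_trans xr (ltW rM).
  rewrite (_ : ccube _ = [set x | `|x| <= `|r|]).
    apply: (@closed_comp _ _ (fun x : 'rV[R]_n => `|x|) [set y | y <= `|r|]).
      by move=> x _; exact: norm_continuous.
    exact: closed_le.
  by apply/seteqP; split=> x /= /(ccubeP _ r0).
exists (`|M| + 1); first exact: addr_ge0.
exists `|r| => // x; have [xr|xr] := leP `|x| `|r|.
  rewrite indicE mem_set ?mulr1; last exact/(ccubeP _ r0).
  apply: (MP (`|M| + 1)); first by rewrite (le_lt_trans (ler_norm M))// ltrDl.
  by exists x => //; exact/(ccubeP _ r0).
rewrite fr ?normr0 ?mulr_ge0 ?addr_ge0//.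
by rewrite (le_lt_trans (ler_norm _) xr).
Qed.

Lemma cb_integrable n (f : 'rV[R]_n -> R) : cb f -> (leb n).-integrable setT (EFin \o f).
Proof.
move=> cbf; have [M M0 [r r0 fM]] := cb_bounded cbf.
apply: (@le_integrable _ _ _ _ _ measurableT _ (fun x => (M * \1_(@ccube n r) x)%:E)).
- by apply/measurable_EFinP; apply: continuous_measurable_rV; case: cbf.
- by move=> x _; rewrite /= lee_fin (le_trans (fM x))// ler_norm.
under eq_fun do rewrite EFinM.
apply: integrableZl => //.
apply/integrableP; split.
  by apply/measurable_EFinP; apply: measurable_indic; exact: measurable_ccube.
under eq_integral do rewrite gee0_abs ?lee_fin//.
by rewrite integral_indic// ?setIT; [exact: lebesgue_ccube_lty|exact: measurable_ccube].
Qed.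

Lemma cb0 n : cb (fun _ : 'rV[R]_n => 0 : R).
Proof. by split; [exact: cst_continuous|exists 0]. Qed.

Lemma cbD n (f g : 'rV[R]_n -> R) : cb f -> cb g -> cb (fun x => f x + g x).
Proof.
move=> [cf [r fr]] [cg [s gs]]; split; first by move=> x; exact: continuousD (cf x) (cg x).
exists (Num.max r s) => x; rewrite gt_max => /andP[rx sx].
by rewrite fr// gs// addr0.
Qed.

Lemma cbMl n (f g : 'rV[R]_n -> R) : continuous g -> cb f -> cb (fun x => g x * f x).
Proof.
move=> cg [cf [r fr]]; split; first by move=> x; exact: continuousM (cg x) (cf x).
by exists r => x rx; rewrite fr// mulr0.
Qed.

Lemma cbZ n (c : R) (f : 'rV[R]_n -> R) : cb f -> cb (fun x => c * f x).
Proof. by apply: cbMl; exact: cst_continuous. Qed.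

Lemma cbM n (f g : 'rV[R]_n -> R) : cb f -> cb g -> cb (fun x => f x * g x).
Proof. by move=> [cf _]; exact: cbMl. Qed.

Lemma cb_comp n (h : R -> R) (f : 'rV[R]_n -> R) : continuous h -> h 0 = 0 ->
  cb f -> cb (fun x => h (f x)).
Proof.
move=> ch h0 [cf [r fr]]; split.
  by move=> x; apply: continuous_comp; [exact: cf|exact: ch].
by exists r => x rx; rewrite fr.
Qed.

Lemma cb_sqr n (f : 'rV[R]_n -> R) : cb f -> cb (fun x => f x ^+ 2).
Proof. by move=> cf; under eq_fun do rewrite expr2; exact: cbM. Qed.

Lemma cb_norm n (f : 'rV[R]_n -> R) : cb f -> cb (fun x => `|f x|).
Proof. by apply: cb_comp; [exact: norm_continuous|exact: normr0]. Qed.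

Lemma cbN n (f : 'rV[R]_n -> R) : cb f -> cb (fun x => - f x).
Proof. by apply: cb_comp; [exact: opp_continuous|exact: oppr0]. Qed.

Lemma cb_sum n (I : Type) (s : seq I) (P : pred I) (F : I -> 'rV[R]_n -> R) :
  (forall i, P i -> cb (F i)) -> cb (fun x => \sum_(i <- s | P i) F i x).
Proof.
move=> cF; elim: s => [|i s ih]; first by under eq_fun do rewrite big_nil; exact: cb0.
case Pi : (P i); last by under eq_fun do rewrite big_cons Pi.
by under eq_fun do rewrite big_cons Pi; apply: cbD => //; exact: cF.
Qed.

Lemma near_pderive n (f g : 'rV[R]_n -> R) s (x : 'rV[R]_n) : (\forall y \near x, f y = g y) ->
  \forall y \near x, pderive s f y = pderive s g y.
Proof.
elim: s => // i s ih /ih H.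
by apply: filterS (nbhs_interior H) => y Hy; apply: near_eq_derive; exact: Hy.
Qed.

Lemma near_pderiveE n (f g : 'rV[R]_n -> R) s (x : 'rV[R]_n) : (\forall y \near x, f y = g y) ->
  pderive s f x = pderive s g x.
Proof. by move=> /(near_pderive s)/nbhs_singleton. Qed.

Lemma near_norm_gt n (x : 'rV[R]_n) r : r < `|x| -> \forall y \near x, r < `|y|.
Proof.
by move=> rx; have /cvgr_gt := @norm_continuous _ _ x; apply.
Qed.

Lemma pderive_cst0 n s : pderive s (fun _ : 'rV[R]_n => 0 : R) = fun=> 0.
Proof. by rewrite (pderive_cst s 0); case: s. Qed.

(** Test functions on the whole space. Bounded support is stated by a radius, in place of the
    compact support of [test_fun], because a radius passes directly to derivatives, sums and
    slices. *)
Definition tf n (f : 'rV[R]_n -> R) :=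
  smooth f /\ exists r : R, forall x, r < `|x| -> f x = 0.

Lemma tf_pderive n s (f : 'rV[R]_n -> R) : tf f -> tf (pderive s f).
Proof.
move=> [sf [r fr]]; split; first exact: smooth_pderive.
exists r => x rx; rewrite (@near_pderiveE _ _ (fun=> 0)) ?pderive_cst0//.
by apply: filterS (near_norm_gt rx) => y /fr.
Qed.

Lemma tf_cb n (f : 'rV[R]_n -> R) : tf f -> cb f.
Proof. by move=> [sf fr]; split => //; exact: smooth_continuous. Qed.

Lemma tfM n (f g : 'rV[R]_n -> R) : smooth f -> tf g -> tf (f \* g).
Proof.
move=> sf [sg [r gr]]; split; first exact: smoothM.
by exists r => x /gr /= ->; rewrite mulr0.
Qed.

Lemma tfD n (f g : 'rV[R]_n -> R) : tf f -> tf g -> tf (f \+ g).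
Proof.
move=> tf1 tf2; have [_ [r H]] := cbD (tf_cb tf1) (tf_cb tf2).
by split; [apply: smoothD; [case: tf1|case: tf2]|exists r].
Qed.

Lemma tfZ n c (f : 'rV[R]_n -> R) : tf f -> tf (fun x => c * f x).
Proof. by apply: (tfM (f := cst c)); exact: smooth_cst. Qed.

Lemma tfN n (f : 'rV[R]_n -> R) : tf f -> tf (fun x => - f x).
Proof. by move=> tff; under eq_fun do rewrite -mulN1r; exact: tfZ. Qed.

Lemma tfB n (f g : 'rV[R]_n -> R) : tf f -> tf g -> tf (fun x => f x - g x).
Proof. by move=> tf1 tf2; exact: tfD tf1 (tfN tf2). Qed.

Lemma measurable_cb n (f : 'rV[R]_n -> R) : cb f -> measurable_fun setT f.
Proof. by case=> cf _; exact: continuous_measurable_rV. Qed.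

(** * Slices in the last variable, and integrals of derivatives *)

Lemma snocE n (x : 'rV[R]_n) (t : R) (i : 'I_n) :
  @snoc R n.+1 x t ord0 (widen_ord (leqnSn n) i) = x ord0 i.
Proof.
rewrite mxE; case: insubP => [k _ /= ki|]; last by rewrite /= ltn_ord.
by congr (x _ _); exact: val_inj.
Qed.

Lemma snoc_max n (x : 'rV[R]_n) (t : R) : @snoc R n.+1 x t ord0 ord_max = t.
Proof. by rewrite mxE insubF//= ltnn. Qed.

Lemma snocP n (P : 'I_n.+1 -> Prop) : (forall i, P (widen_ord (leqnSn n) i)) ->
  P ord_max -> forall i, P i.
Proof.
move=> Pw Pm i; have [ni|ni] := ltnP i n.
  by have -> : i = widen_ord (leqnSn n) (Ordinal ni) by exact: val_inj.
suff -> : i = ord_max by [].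
by apply: val_inj => /=; apply/eqP; rewrite eqn_leq ni -ltnS ltn_ord.
Qed.

Lemma integrable_snoc n (f : 'rV[R]_n.+1 -> \bar R) :
  (leb n.+1).-integrable setT f ->
  (leb n \x @lebesgue_measure R)%E.-integrable setT (fun p => f (@snoc R n.+1 p.1 p.2)).
Proof.
move=> /integrableP[mf foo]; apply/integrableP; split.
  apply: measurableT_comp => //; exact: measurable_snoc.
move: foo; rewrite ge0_integral_pushforward//; first exact: measurable_snoc.
exact: measurableT_comp.
Qed.

Lemma ge0_integral_snoc n (f : 'rV[R]_n.+1 -> \bar R) :
  measurable_fun [set: 'rV[R]_n.+1] f -> (forall x, 0 <= f x)%E ->
  (\int[leb n.+1]_x f x = \int[leb n]_x \int[@lebesgue_measure R]_t f (@snoc R n.+1 x t))%E.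
Proof.
move=> mf f0.
rewrite ge0_integral_pushforward//; last exact: measurable_snoc.
rewrite preimage_setT fubini_tonelli1//.
  by apply: measurableT_comp => //; exact: measurable_snoc.
by move=> p; exact: f0.
Qed.

Lemma ge0_integral_snoc2 n (f : 'rV[R]_n.+1 -> \bar R) :
  measurable_fun [set: 'rV[R]_n.+1] f -> (forall x, 0 <= f x)%E ->
  (\int[leb n.+1]_x f x = \int[@lebesgue_measure R]_t \int[leb n]_x f (@snoc R n.+1 x t))%E.
Proof.
move=> mf f0.
rewrite ge0_integral_pushforward//; last exact: measurable_snoc.
rewrite preimage_setT fubini_tonelli2//.
  by apply: measurableT_comp => //; exact: measurable_snoc.
by move=> p; exact: f0.
Qed.

Lemma integral_snoc n (f : 'rV[R]_n.+1 -> \bar R) :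
  (leb n.+1).-integrable setT f ->
  (\int[leb n.+1]_x f x = \int[leb n]_x \int[@lebesgue_measure R]_t f (@snoc R n.+1 x t))%E.
Proof.
move=> fi; have fi2 := integrable_snoc fi.
rewrite (@integral_pushforward _ _ _ _ _ _ (@measurable_snoc R n)) //.
  by rewrite preimage_setT -integral12_prod_meas1.
by move/integrableP : fi => [].
Qed.

Lemma integral_snoc2 n (f : 'rV[R]_n.+1 -> \bar R) :
  (leb n.+1).-integrable setT f ->
  (\int[leb n.+1]_x f x = \int[@lebesgue_measure R]_t \int[leb n]_x f (@snoc R n.+1 x t))%E.
Proof.
move=> fi; have fi2 := integrable_snoc fi.
rewrite (@integral_pushforward _ _ _ _ _ _ (@measurable_snoc R n)) //.
  by rewrite preimage_setT -integral21_prod_meas1.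
by move/integrableP : fi => [].
Qed.

Lemma snoc_line n (x : 'rV[R]_n) (t : R) :
  @snoc R n.+1 x t = @snoc R n.+1 x 0 + t *: delta_mx 0 ord_max.
Proof.
apply/rowP; apply: snocP => [i|].
  rewrite snocE mxE snocE !mxE eqxx/= (_ : _ == _ = false) ?mulr0 ?addr0//.
  by apply/eqP => /(congr1 val)/= ni; have := ltn_ord i; rewrite ni ltnn.
by rewrite snoc_max mxE snoc_max !mxE !eqxx/= mulr1 add0r.
Qed.

Lemma snoc_shift n (x h : 'rV[R]_n) (t : R) :
  @snoc R n.+1 (h + x) t = @snoc R n.+1 h 0 + @snoc R n.+1 x t.
Proof.
apply/rowP; apply: snocP => [j|].
  by rewrite snocE [LHS]mxE [RHS]mxE !snocE.
by rewrite [RHS]mxE !snoc_max add0r.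
Qed.

Lemma differentiable_snoc n (t : R) (x : 'rV[R]_n) :
  differentiable (fun x : 'rV[R]_n => @snoc R n.+1 x t) x.
Proof.
rewrite (_ : (fun x : 'rV[R]_n => _) = fun x : 'rV[R]_n =>
   (\sum_(j < n) x ord0 j *: delta_mx 0 (widen_ord (leqnSn n) j)) + t *: delta_mx 0 ord_max).
  apply: differentiableD; last exact: differentiable_cst.
  rewrite (_ : (fun x : 'rV[R]_n => _) = \sum_(j < n) (fun x : 'rV[R]_n =>
    x ord0 j *: delta_mx 0 (widen_ord (leqnSn n) j))); last first.
    by apply/funext => y; rewrite fct_sumE.
  by apply: differentiable_sum => j; apply: differentiableZl; exact: differentiable_coord.
apply/funext => y; apply/rowP; apply: snocP => [j|].
  rewrite snocE mxE summxE (bigD1 j)//= big1 ?addr0; last first.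
    move=> k kj; rewrite !mxE eqxx/= (_ : _ == _ = false) ?mulr0//.
    by apply: contra_neqF kj => /eqP/(congr1 val)/= jk; exact: val_inj.
  rewrite !mxE !eqxx mulr1/= (_ : _ == _ = false) ?mulr0 ?addr0//.
  by apply/eqP => /(congr1 val)/= ni; have := ltn_ord j; rewrite ni ltnn.
rewrite snoc_max mxE summxE big1 ?add0r ?mxE ?eqxx ?mulr1// => k _.
rewrite !mxE eqxx/= (_ : _ == _ = false) ?mulr0//.
by apply/eqP => /(congr1 val)/= ni; have := ltn_ord k; rewrite -ni ltnn.
Qed.

Lemma smooth_slice_diff n (f : 'rV[R]_n.+1 -> R) t : diffb f ->
  diffb (fun x : 'rV[R]_n => f (@snoc R n.+1 x t)).
Proof.
move=> df x; apply: (@differentiable_comp _ _ _ _ (fun x : 'rV[R]_n => @snoc R n.+1 x t) f) => //.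
exact: differentiable_snoc.
Qed.

Lemma snoc_delta n (h : R) (i : 'I_n) :
  @snoc R n.+1 (h *: delta_mx 0 i) 0 = h *: delta_mx 0 (widen_ord (leqnSn n) i).
Proof.
apply/rowP; apply: snocP => [j|]; first by rewrite snocE !mxE eqxx.
rewrite snoc_max !mxE eqxx/= (_ : _ == _ = false) ?mulr0//.
by apply/eqP => /(congr1 val)/= ni; have := ltn_ord i; rewrite -ni ltnn.
Qed.

Lemma pd_slice n (f : 'rV[R]_n.+1 -> R) t i :
  pd i (fun x : 'rV[R]_n => f (@snoc R n.+1 x t)) =
  (fun x => pd (widen_ord (leqnSn n) i) f (@snoc R n.+1 x t)).
Proof.
apply/funext => x; rewrite !pdE /derive.
rewrite (_ : (fun h => _) = (fun h => h^-1 *: ((f \o shift (@snoc R n.+1 x t)) (h *: delta_mx 0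
  (widen_ord (leqnSn n) i)) -
   f (@snoc R n.+1 x t))))//.
by apply/funext => h /=; rewrite snoc_shift snoc_delta.
Qed.

Lemma pderive_slice n (f : 'rV[R]_n.+1 -> R) t s :
  pderive s (fun x : 'rV[R]_n => f (@snoc R n.+1 x t)) =
  (fun x => pderive [seq widen_ord (leqnSn n) i | i <- s] f (@snoc R n.+1 x t)).
Proof. by elim: s => // i s ih; rewrite map_cons !pderive_cons ih pd_slice. Qed.

Lemma norm_snoc_l n (x : 'rV[R]_n) t : `|x| <= `|@snoc R n.+1 x t|.
Proof. by apply/rV_norm_le => // i; rewrite -(snocE x t) rV_norm_coord. Qed.

Lemma norm_snoc_r n (x : 'rV[R]_n) t : `|t| <= `|@snoc R n.+1 x t|.
Proof. by rewrite -[t in leLHS](snoc_max x) rV_norm_coord. Qed.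

Lemma tf_slice n (f : 'rV[R]_n.+1 -> R) t : tf f ->
  tf (fun x : 'rV[R]_n => f (@snoc R n.+1 x t)).
Proof.
move=> [sf [r fr]]; split.
  by move=> s; rewrite pderive_slice; apply: smooth_slice_diff; exact: sf.
by exists r => x rx; apply: fr; rewrite (lt_le_trans rx)// norm_snoc_l.
Qed.

Lemma is_derive_snoc n (f : 'rV[R]_n.+1 -> R) (x : 'rV[R]_n) (t : R) : diffb f ->
  is_derive t 1 (fun t => f (@snoc R n.+1 x t)) (pd ord_max f (@snoc R n.+1 x t)).
Proof.
move=> df; have := is_derive_line (@snoc R n.+1 x 0) (delta_mx 0 ord_max) t df.
rewrite -snoc_line (bigD1 ord_max)//= big1 ?addr0; last first.
  by move=> i im; rewrite mxE eqxx/= (negbTE im) mul0r.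
by rewrite mxE !eqxx mul1r; under eq_fun do rewrite -snoc_line.
Qed.

Lemma ftc_R (h h' : R -> R) (a b : R) : a < b -> (forall t : R, is_derive t 1 h (h' t)) ->
  continuous h' -> (\int[@lebesgue_measure R]_(t in `[a, b]) (h' t)%:E = (h b - h a)%:E)%E.
Proof.
move=> ab dh ch; have ch0 : continuous h.
  move=> t; apply: differentiable_continuous; apply/derivable1_diffP.
  by have [] := dh t.
rewrite (@continuous_FTC2 _ h' h)//.
- by apply: continuous_subspaceT => t; exact: ch.
- split=> [t _||]; first by have [] := dh t.
  + by apply: cvg_at_right_filter; exact: ch0.
  + by apply: cvg_at_left_filter; exact: ch0.
- by move=> t _; rewrite derive1E; apply: derive_val.
Qed.

Lemma integral_R_supp (h : R -> R) (r : R) : (forall t, r < `|t| -> h t = 0) ->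
  (\int[@lebesgue_measure R]_t (h t)%:E = \int[@lebesgue_measure R]_(t in `[(-r)%R, r]) (h t)%:E)%E.
Proof.
move=> hr; rewrite [RHS]integral_mkcond; apply: eq_integral => t _.
rewrite /patch; case: ifPn => //; rewrite notin_setE/= in_itv/= -ler_norml.
by move=> /negP; rewrite -ltNge => /hr ->.
Qed.

Lemma integral_deriv0 (h h' : R -> R) (r : R) : (forall t : R, is_derive t 1 h (h' t)) ->
  continuous h' -> (forall t, r < `|t| -> h t = 0) ->
  (\int[@lebesgue_measure R]_t (h' t)%:E = 0)%E.
Proof.
(* [h] is known to vanish only strictly beyond r, and r may be negative; both endpoints have to lie
   in that region. *)
move=> dh ch hr; pose r1 := `|r| + 1.
have rr1 : r < r1 by rewrite (le_lt_trans (ler_norm r))// ltrDl.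
have r10 : 0 < r1 by rewrite ltr_wpDl.
rewrite (integral_R_supp (r := r1)).
  rewrite (ftc_R _ dh ch) ?gtrN// !hr ?subrr//; first by rewrite normrN gtr0_norm.
  by rewrite gtr0_norm.
move=> t rt; have [_ <-] := dh t.
rewrite (@near_eq_derive _ _ _ _ (cst 0)) ?derive_cst//.
have := @norm_continuous _ _ t; move=> /cvgr_gt/(_ _ (lt_trans rr1 rt)).
by apply: filterS => y /hr.
Qed.

(** For one of the first coordinates the integral vanishes on every slice by induction on the
    dimension; for the last coordinate the fundamental theorem of calculus applies on every line. *)
Lemma Rint_pd0 n i (f : 'rV[R]_n -> R) : tf f -> (\int[leb n]_x (pd i f x)%:E = 0)%E.
Proof.
elim: n i f => [[]//|n ih i f tff].
have ic : (leb n.+1).-integrable setT (EFin \o pd i f).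
  by apply: cb_integrable; apply: tf_cb; exact: (tf_pderive [:: i]).
move: i ic; apply: snocP => [i|] ic.
  rewrite integral_snoc2//; under eq_integral => t _.
    under eq_integral => x _ do rewrite -[(pd _ f _)](congr1 (@^~ x) (pd_slice f t i)).
    rewrite ih; last exact: tf_slice.
    over.
  by rewrite integral0.
have [sf [r fr]] := tff.
have E (x : 'rV[R]_n) : (\int[@lebesgue_measure R]_t (pd ord_max f (@snoc R n.+1 x t))%:E = 0)%E.
  apply: (@integral_deriv0 (fun t => f (@snoc R n.+1 x t)) _ r).
  - by move=> t; apply: is_derive_snoc; exact: smooth_diff.
  - move=> t; apply: differentiable_continuous; apply/derivable1_diffP.
    by have [] := is_derive_snoc x t (smooth_diff (smooth_pd ord_max sf)).
  - by move=> t rt; apply: fr; rewrite (lt_le_trans rt)// norm_snoc_r.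
rewrite integral_snoc//=; under eq_integral do rewrite E.
by rewrite integral0.
Qed.

End rV_measure.

(** * Energies and interpolation *)

Section energy.
Context {R : realType} {n : nat}.
Local Notation X := 'rV[R]_n.
Local Notation leb := (@lebesgue_rV R n).
Implicit Types f g w : X -> R.

Definition itg f : R := \int[leb]_x f x.

Lemma itgD f g : cb f -> cb g -> itg (fun x => f x + g x) = itg f + itg g.
Proof. by move=> cf cg; rewrite /itg RintegralD//; exact: cb_integrable. Qed.

Lemma itgZ c f : cb f -> itg (fun x => c * f x) = c * itg f.
Proof. by move=> cf; rewrite /itg RintegralZl//; exact: cb_integrable. Qed.

Lemma itg0 : itg (fun=> 0) = 0.
Proof. by rewrite /itg Rintegral_cst//= mul0r. Qed.

Lemma itgN f : cb f -> itg (fun x => - f x) = - itg f.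
Proof. by move=> cf; under [in LHS]eq_fun do rewrite -mulN1r; rewrite itgZ// mulN1r. Qed.

Lemma itg_sum (I : Type) (s : seq I) (P : pred I) (F : I -> X -> R) :
  (forall i, P i -> cb (F i)) ->
  itg (fun x => \sum_(i <- s | P i) F i x) = \sum_(i <- s | P i) itg (F i).
Proof.
move=> cF; elim: s => [|i s ih].
  by under eq_fun do rewrite big_nil; rewrite itg0 big_nil.
rewrite big_cons; case Pi : (P i); last by under eq_fun do rewrite big_cons Pi.
under eq_fun do rewrite big_cons Pi.
by rewrite itgD ?ih//; [exact: cF|exact: cb_sum].
Qed.

Lemma itg_ge0 f : (forall x, 0 <= f x) -> 0 <= itg f.
Proof. by move=> f0; apply: Rintegral_ge0. Qed.

Lemma itg_le f g : cb f -> cb g -> (forall x, f x <= g x) -> itg f <= itg g.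
Proof. by move=> cf cg fg; apply: le_Rintegral => //; exact: cb_integrable. Qed.

Lemma itg_EFin f : cb f -> (\int[leb]_x (f x)%:E)%E = (itg f)%:E.
Proof.
move=> cf; rewrite /itg /Rintegral fineK//; apply: integrable_fin_num => //.
exact: cb_integrable.
Qed.

Lemma itg_pd i f : tf f -> itg (pd i f) = 0.
Proof. by move=> tff; rewrite /itg /Rintegral Rint_pd0. Qed.

Lemma cb_tfM f g : continuous f -> tf g -> cb (fun x => f x * g x).
Proof. by move=> cf tg; apply: cbMl => //; exact: tf_cb. Qed.

Lemma tf_pd i f : tf f -> tf (pd i f).
Proof. exact: (tf_pderive [:: i]). Qed.

Lemma itg_by_parts i f g : smooth f -> tf g ->
  itg (fun x => pd i f x * g x) = - itg (fun x => f x * pd i g x).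
Proof.
move=> sf tg; apply/eqP; rewrite -addr_eq0 -itgD; last 2 first.
- exact/cb_tfM/tg/smooth_continuous/smooth_pd.
- apply: cb_tfM; [exact: smooth_continuous|exact: tf_pd].
apply/eqP; rewrite -[RHS](itg_pd i (tfM sf tg)) pdM//; first exact: smooth_diff.
by apply: smooth_diff; case: tg.
Qed.

Lemma itg_pderive s f g : smooth f -> tf g ->
  itg (fun x => pderive s f x * g x) =
  (-1) ^+ size s * itg (fun x => f x * pderive (rev s) g x).
Proof.
elim: s f g => [|i s ih] f g sf tg; first by rewrite mul1r.
rewrite pderive_cons itg_by_parts//; last exact: smooth_pderive.
rewrite ih//; last exact: tf_pd.
rewrite rev_cons pderive_rcons exprS mulN1r mulNr//.
Qed.

(* The squared L^2 norm of the gradient of order [k], summed over sequences of directions, so that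
   each multi-index is counted with its multinomial multiplicity. *)
Fixpoint en (k : nat) (f : X -> R) : R :=
  if k is k'.+1 then \sum_i en k' (pd i f) else itg (fun x => f x ^+ 2).

Lemma en_ge0 k f : 0 <= en k f.
Proof.
elim: k f => [|k ih] f /=; first by apply: itg_ge0 => x; exact: sqr_ge0.
by apply: sumr_ge0 => i _; exact: ih.
Qed.
Hint Resolve en_ge0 : core.

Lemma cb_sqr_tf f : tf f -> cb (fun x => f x ^+ 2).
Proof. by move=> tff; exact/cb_sqr/tf_cb. Qed.

Lemma enZ k c f : tf f -> en k (fun x => c * f x) = c ^+ 2 * en k f.
Proof.
elim: k f => [|k ih] f tff /=.
  rewrite -itgZ; last exact: cb_sqr_tf.
  by congr itg; apply/funext => x; rewrite exprMn.
rewrite mulr_sumr; apply: eq_bigr => i _; rewrite -ih; last exact: tf_pd.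
by congr en; have := pderiveZ [:: i] c (proj1 tff).
Qed.

Lemma enD k f g : tf f -> tf g -> en k (f \+ g) <= 2 * (en k f + en k g).
Proof.
elim: k f g => [|k ih] f g tff tg /=.
  rewrite -itgD; [|exact: cb_sqr_tf..].
  rewrite -itgZ; last by apply: cbD; exact: cb_sqr_tf.
  apply: itg_le.
  - exact/cb_sqr_tf/tfD.
  - by apply: cbZ; apply: cbD; exact: cb_sqr_tf.
  by move=> x /=; have := sqr_ge0 (f x - g x); rewrite sqrrB sqrrD mulr2n; lra.
rewrite -big_split/= mulr_sumr; apply: ler_sum => i _.
have sd h : tf h -> diffb h by case=> /smooth_diff.
by rewrite pdD; [apply: ih; exact: tf_pd|exact: sd..].
Qed.

Lemma tf0 : tf (fun _ : X => 0 : R).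
Proof. by split; [exact: (smooth_cst 0)|exists 0]. Qed.

Lemma tf_sum (I : Type) (s : seq I) (P : pred I) (F : I -> X -> R) :
  (forall i, P i -> tf (F i)) -> tf (fun x => \sum_(i <- s | P i) F i x).
Proof.
move=> cF; elim: s => [|i s ih]; first by under eq_fun do rewrite big_nil; exact: tf0.
case Pi : (P i); last by under eq_fun do rewrite big_cons Pi.
by under eq_fun do rewrite big_cons Pi; apply: (tfD (cF i Pi) ih).
Qed.

Lemma en0 k : en k (fun _ : X => 0 : R) = 0.
Proof.
have -> : (fun _ : X => 0 : R) = (fun x => 0 * 0) by apply/funext => x; rewrite mul0r.
by rewrite (enZ k 0 tf0) expr0n/= mul0r.
Qed.

Lemma en_sum k (I : Type) (s : seq I) (F : I -> X -> R) :
  (forall i, tf (F i)) ->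
  en k (fun x => \sum_(i <- s) F i x) <= 2 ^+ size s * \sum_(i <- s) en k (F i).
Proof.
move=> cF; elim: s => [|i s ih].
  by under eq_fun do rewrite big_nil; rewrite big_nil mulr0 en0.
under eq_fun do rewrite big_cons; rewrite big_cons.
apply: (le_trans (enD k (cF i) (tf_sum _ _))) => //=.
rewrite exprS -mulrA ler_pM2l// mulrDr lerD//.
by rewrite ler_peMl// exprn_ege1// ler1n.
Qed.

Lemma en_pderive_le k s f : smooth f -> en k (pderive s f) <= en (k + size s) f.
Proof.
elim/last_ind: s f => [|s i ih] f sf; first by rewrite addn0.
rewrite size_rcons addnS pderive_rcons /= (le_trans (ih _ (smooth_pd i sf)))//.
by rewrite (bigD1 i)//= lerDl sumr_ge0.
Qed.

(** For k = 0, integration by parts turns the square of [pd i f] into - f times its second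
    derivative, and Young's inequality splits the product. The energy of f then appears once for
    each of the n directions. Larger k follow by applying this to derivatives. *)
Lemma en_step k (d : R) f : 0 < d -> tf f ->
  en k.+1 f <= d * en k.+2 f + n%:R * d^-1 * en k f.
Proof.
move=> d0; elim: k f => [|k ih] f tff; last first.
  rewrite [en k.+2 f]/= [en k.+3 f]/= [en k.+1 f]/= !mulr_sumr -big_split/=.
  by apply: ler_sum => i _; apply: ih; exact: tf_pd.
have H i : itg (fun x => pd i f x ^+ 2) <=
    d * itg (fun x => pd i (pd i f) x ^+ 2) + d^-1 * itg (fun x => f x ^+ 2).
  have t1 := tf_pd i tff; have t2 := tf_pd i t1.
  have -> : itg (fun x => pd i f x ^+ 2) = itg (fun x => - (f x * pd i (pd i f) x)).
    rewrite itgN; last exact: cbM (tf_cb tff) (tf_cb t2).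
    by rewrite -itg_by_parts//; case: tff.
  rewrite -!itgZ; [|exact: cb_sqr_tf..].
  rewrite -itgD; [|by apply: cbZ; exact: cb_sqr_tf..].
  apply: itg_le.
  - by apply: cbN; exact: cbM (tf_cb tff) (tf_cb t2).
  - by apply: cbD; apply: cbZ; exact: cb_sqr_tf.
  move=> x; set a := f x; set b := pd i (pd i f) x.
  have e : d^-1 * d = 1 by rewrite mulVf// gt_eqF.
  have : 0 <= d^-1 * (a + d * b) ^+ 2 by rewrite mulr_ge0 ?sqr_ge0 ?invr_ge0// ltW.
  have -> : d^-1 * (a + d * b) ^+ 2 = d^-1 * a ^+ 2 + (d^-1 * d) * (a * b) *+ 2 + (d^-1 * d) * d *
    b ^+ 2.
    by ring.
  have : 0 <= d^-1 * a ^+ 2 by rewrite mulr_ge0 ?sqr_ge0 ?invr_ge0// ltW.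
  have : 0 <= d * b ^+ 2 by rewrite mulr_ge0 ?sqr_ge0// ltW.
  rewrite e; lra.
rewrite /=; apply: (le_trans (ler_sum _ (fun i _ => H i))).
rewrite big_split/= -mulr_sumr lerD//.
  rewrite ler_pM2l//; apply: ler_sum => i _.
  by rewrite (bigD1 i)//= lerDl sumr_ge0// => j _; exact: (en_ge0 0).
by rewrite sumr_const card_ord -mulrA mulr_natl.
Qed.

End energy.

Lemma eqle (R : realType) (x y : R) : x = y -> x <= y.
Proof. by move=> ->. Qed.

(** Interpolation deduced from three consecutive terms alone. The constant is fixed before the
    sequence [b], so the energies may be rescaled freely before it is applied. *)
Lemma interp_seq (R : realType) (n m : nat) (eps : R) : 0 < eps ->
  exists2 C : R, 0 <= C & forall b : nat -> R, (forall k, 0 <= b k) ->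
    (forall k d, 0 < d -> b k.+1 <= d * b k.+2 + n%:R * d^-1 * b k) ->
    forall k, (k < m)%N -> b k <= eps * b m + C * b 0%N.
Proof.
elim: m eps => [|m ih] eps e0; first by exists 0.
have [->|m0] := eqVneq m 0%N.
  exists 1 => // b b0 H [|//] _; rewrite mul1r lerDr; apply: mulr_ge0 => //; exact: ltW.
pose d := Num.min eps 1 / 2.
have d0 : 0 < d by rewrite divr_gt0// lt_min e0 ltr01.
(* With this fraction in the induction hypothesis, n/d times [b m.-1] contains at most half of
   [b m], which is absorbed on the left. *)
have dn : 0 < d / (2 * n.+1%:R) by rewrite divr_gt0// mulr_gt0.
have [C1 C10 H1] := ih _ dn.
have [C2 C20 H2] := ih 1 ltr01.
pose C3 := 2 * n%:R * d^-1 * C1.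
have C30 : 0 <= C3 by rewrite !mulr_ge0// invr_ge0 ltW.
exists (C2 + C3); first exact: addr_ge0.
move=> b b0 H k; rewrite ltnS => km.
have bm : b m <= 2 * d * b m.+1 + C3 * b 0%N.
  have := H m.-1 d d0; rewrite prednK ?lt0n// => h.
  have := H1 b b0 H m.-1; rewrite ltn_predL lt0n m0 => /(_ isT) h1.
  have e1 : n%:R * d^-1 * (d / (2 * n.+1%:R)) <= 2^-1 :> R.
    rewrite mulrA mulfVK ?gt_eqF// invfM mulrCA ler_piMr ?invr_ge0//.
    by rewrite ler_pdivrMr ?ltr0n// mul1r ler_nat.
  have e2 : n%:R * d^-1 * b m.-1 <= 2^-1 * b m + n%:R * d^-1 * C1 * b 0%N.
    have nd : 0 <= n%:R * d^-1 by rewrite mulr_ge0// invr_ge0 ltW.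
    apply: (le_trans (ler_wpM2l nd h1)); rewrite mulrDr lerD//.
      by rewrite mulrA ler_wpM2r.
    by rewrite mulrA.
  have -> : C3 * b 0%N = 2 * (n%:R * d^-1 * C1 * b 0%N) by rewrite /C3 !mulrA.
  move: e2 h; set Y := _ * C1 * b 0%N; set Z := _ * b m.-1; lra.
have dd : 2 * d <= eps /\ 2 * d <= 1.
  by rewrite /d mulrCA divff// mulr1; split; rewrite ge_min lexx ?orbT.
have bm' : b m <= eps * b m.+1 + C3 * b 0%N.
  by apply: (le_trans bm); rewrite lerD2r ler_wpM2r//; case: dd.
move: km; rewrite leq_eqVlt => /orP[/eqP ->|km].
  by rewrite (le_trans bm')// lerD2l ler_wpM2r// lerDr.
have := H2 b b0 H k km; rewrite mul1r mulrDl => h.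
by move: h bm'; lra.
Qed.

(** * Scale-weighted energies of products with cut-offs *)

Section weighted.
Context {R : realType} {n : nat}.
Local Notation X := 'rV[R]_n.
Implicit Types f g w : X -> R.
Hint Resolve en_ge0 : core.

(* Energies are weighted so as to be homogeneous when [r] is the inverse of a length. *)
Definition wen (r : R) (k : nat) w := \sum_(j < k.+1) r ^+ (2 * (k - j)) * en j w.

Lemma wen_ge0 r k w : 0 <= r -> 0 <= wen r k w.
Proof. by move=> r0; apply: sumr_ge0 => j _; rewrite mulr_ge0 ?exprn_ge0 ?en_ge0. Qed.

Lemma wenS r k w : wen r k.+1 w = r ^+ 2 * wen r k w + en k.+1 w.
Proof.
rewrite /wen big_ord_recr/= subnn expr0 mul1r mulr_sumr; congr (_ + _).
apply: eq_bigr => j _; rewrite mulrA -exprD; congr (_ ^+ _ * _).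
by rewrite subSn ?mulnS// -ltnS.
Qed.

Lemma wen_pd r k w : 0 <= r -> \sum_i wen r k (pd i w) <= wen r k.+1 w.
Proof.
move=> r0; rewrite /wen exchange_big/= [leRHS]big_ord_recl/= ler_wpDl//.
  by rewrite mulr_ge0 ?exprn_ge0//; exact: (en_ge0 0).
by apply: ler_sum => j _; rewrite /= /bump/= add1n subSS mulr_sumr.
Qed.

Lemma wen_pd1 r k i w : 0 <= r -> wen r k (pd i w) <= wen r k.+1 w.
Proof.
move=> r0; apply: le_trans (wen_pd k w r0); rewrite (bigD1 i)//= lerDl.
by apply: sumr_ge0 => j _; exact: wen_ge0.
Qed.

Lemma wen_pderive r k s w : 0 <= r -> wen r k (pderive s w) <= wen r (k + size s) w.
Proof.
move=> r0; elim/last_ind: s w => [|s i ih] w; first by rewrite addn0.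
by rewrite size_rcons addnS pderive_rcons (le_trans (ih _))// wen_pd1.
Qed.

Lemma wen_scale r k j w : 0 <= r -> r ^+ (2 * j) * wen r k w <= wen r (k + j) w.
Proof.
move=> r0; elim: j => [|j ih]; first by rewrite addn0 muln0 mul1r.
rewrite addnS wenS mulnS exprD -mulrA ler_wpDr//; first exact: en_ge0.
by rewrite ler_wpM2l ?exprn_ge0.
Qed.

(* [r] is the inverse of the length scale on which [h] varies. *)
Definition dbound (K : nat) (M r : R) (h : X -> R) :=
  smooth h /\ forall s x, (size s <= K)%N -> `|pderive s h x| <= M * r ^+ size s.

Lemma dbound_pderive K M r h s : dbound (size s + K) M r h ->
  dbound K (M * r ^+ size s) r (pderive s h).
Proof.
move=> [sh H]; split; first exact: smooth_pderive.
move=> t x tK; rewrite -pderive_cat (le_trans (H _ _ _))//.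
  by rewrite size_cat addnC leq_add2l.
by rewrite size_cat addnC exprD mulrA.
Qed.

Lemma dboundM K M1 M2 r h1 h2 : 0 <= M1 -> 0 <= M2 -> 0 <= r ->
  dbound K M1 r h1 -> dbound K M2 r h2 ->
  dbound K (2 ^+ K * (M1 * M2)) r (h1 \* h2).
Proof.
move=> M10 M20 r0 [s1 H1] [s2 H2]; split; first exact: smoothM.
move=> s x sK; rewrite pderiveM// (le_trans (ler_norm_sum _ _ _))//.
have := splits_size s; have := size_splits s.
move: (splits s) => l sl Hl.
apply: (@le_trans _ _ (\sum_(p <- l) M1 * M2 * r ^+ size s)).
  elim: l {sl} Hl => [|p l ih] /=; first by rewrite !big_nil.
  move=> /andP[/eqP ps pl]; rewrite !big_cons lerD//; last exact: ih.
  rewrite normrM -ps exprD mulrACA ler_pM//; [apply: H1|apply: H2];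
    by rewrite (leq_trans _ sK)// -ps ?leq_addr ?leq_addl.
rewrite big_const_seq count_predT iter_addr addr0 sl -[leLHS]mulr_natl natrX -[leRHS]mulrA.
apply: ler_wpM2r; first by rewrite !mulr_ge0 ?exprn_ge0.
by rewrite -!natrX ler_nat leq_exp2l.
Qed.

(** A derivative that falls on [h] costs a factor r, and this is the weight that [wen] attaches to
    one derivative less on [w]; the constant is therefore independent of r. *)
Lemma en_mul k M r h w : 0 <= M -> 0 <= r -> dbound k M r h -> tf w ->
  en k (h \* w) <= (2 * n.+1%:R) ^+ k * M ^+ 2 * wen r k w.
Proof.
elim: k M h w => [|k ih] M h w M0 r0 [sh H] tw.
  rewrite /wen big_ord1 subnn muln0 !expr0 !mul1r /= -itgZ; last exact: cb_sqr_tf.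
  apply: itg_le.
  - exact/cb_sqr_tf/tfM.
  - exact/cbZ/cb_sqr_tf.
  move=> x; rewrite /= exprMn ler_wpM2r ?sqr_ge0//.
  have := H [::] x isT; rewrite /= expr0 mulr1 => hM.
  by rewrite -real_normK ?num_real// ler_pXn2r.
have t0 : 0 <= (2 * n.+1%:R) ^+ k * M ^+ 2 :> R by rewrite mulr_ge0 ?exprn_ge0 ?en_ge0.
rewrite /=; apply: (@le_trans _ _ (\sum_(i < n) 2 * ((2 * n.+1%:R) ^+ k * M ^+ 2 *
   (r ^+ 2 * wen r k w) + (2 * n.+1%:R) ^+ k * M ^+ 2 * wen r k (pd i w)))).
  apply: ler_sum => i _; rewrite pdM; [|exact: smooth_diff|by apply: smooth_diff; case: tw].
  have ti := tf_pd i tw.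
  apply: (le_trans (enD k (tfM (smooth_pd i sh) tw) (tfM sh ti))).
  rewrite ler_pM2l// lerD//; last first.
    by apply: ih => //; split => // s x sk; apply: H; rewrite ltnW.
  have db : dbound k (M * r) r (pd i h).
    by have := @dbound_pderive k M r h [:: i]; rewrite /= expr1; apply; split.
  apply: (le_trans (ih _ _ _ _ r0 db tw)); first exact: mulr_ge0.
  by apply: eqle; ring.
rewrite -mulr_sumr big_split/= sumr_const card_ord -!mulr_sumr.
set c := (_ ^+ k * _); set A := r ^+ 2 * wen r k w.
have A0 : 0 <= A by rewrite mulr_ge0 ?exprn_ge0 ?wen_ge0.
have e0 : 0 <= en k.+1 w := en_ge0 _ _.
have w0 : A <= wen r k.+1 w by rewrite wenS lerDl.
have s0 := wen_pd k w r0.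
have -> : (2 * n.+1%:R) ^+ k.+1 * M ^+ 2 = 2 * n.+1%:R * c by rewrite exprS /c mulrA.
rewrite -[_ *+ n]mulr_natl -[n.+1%:R]natr1.
have h2 := ler_wpM2l t0 s0; have h1 := ler_wpM2l t0 w0.
have h3 := ler_wpM2l (ler0n R n) h1.
by move: h2 h3; rewrite -/c; lra.
Qed.

(* The part of [wen r m w] of order less than [m]. *)
Definition lowen r m w := r ^+ 2 * wen r m.-1 w.

(** At least one derivative falls on [h], so a factor r^2 can be taken out and [w] carries at most m
    - 1 derivatives. *)
Lemma en_lower m k M r h w s t : 0 <= M -> 0 <= r -> s != [::] ->
  (k + size s + size t = m)%N ->
  dbound m M r h -> tf w ->
  en k (pderive s h \* pderive t w) <= (2 * n.+1%:R) ^+ k * M ^+ 2 * lowen r m w.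
Proof.
move=> M0 r0 s0 km hb tw.
have db : dbound k (M * r ^+ size s) r (pderive s h).
  apply: dbound_pderive; case: hb => sh H; split => // u x uk; apply: H.
  by rewrite (leq_trans uk)// -km addnC leq_addr.
apply: (le_trans (en_mul _ r0 db (tf_pderive t tw))).
  by rewrite mulr_ge0 ?exprn_ge0 ?en_ge0.
have -> : (2 * n.+1%:R) ^+ k * (M * r ^+ size s) ^+ 2 * wen r k (pderive t w) =
  (2 * n.+1%:R) ^+ k * M ^+ 2 * ((r ^+ size s) ^+ 2 * wen r k (pderive t w)) by ring.
apply: ler_wpM2l; first by rewrite mulr_ge0 ?exprn_ge0.
rewrite /lowen; case: s s0 km {db} => // i s _ km /=.
have -> : (r ^+ (size s).+1) ^+ 2 = r ^+ 2 * r ^+ (2 * size s).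
  by rewrite -exprM -exprD; congr (_ ^+ _); lia.
rewrite -mulrA ler_wpM2l ?exprn_ge0//.
apply: (le_trans (ler_wpM2l _ (wen_pderive k t w r0))); first by rewrite exprn_ge0.
apply: (le_trans (wen_scale _ _ _ r0)).
by rewrite -km /= addnS -addnA (addnC (size t)) addnA.
Qed.

Lemma lowen_interp m (eps : R) : (0 < m)%N -> 0 < eps -> exists2 C : R, 0 <= C &
  forall r w, 0 < r -> tf w -> lowen r m w <= eps * en m w + C * r ^+ (2 * m) * en 0 w.
Proof.
move=> m0 e0; have em0 : 0 < eps / m%:R by rewrite divr_gt0 ?ltr0n.
have [C C0 H] := interp_seq n m em0.
exists (m%:R * C); first by rewrite mulr_ge0.
move=> r w r0 tw.
have r20 j : 0 < r ^+ j by rewrite exprn_gt0.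
(* Dividing the energy of order k by r^(2k) frees the three-term inequality of r; [en_step] is then
   used with d / r^2 in place of d. *)
have {}H := H (fun k => (r ^+ (2 * k))^-1 * en k w).
have {}H k : (k < m)%N -> r ^+ (2 * (m - k)) * en k w <= eps / m%:R * en m w + C * r ^+ (2 * m) *
  en 0 w.
  move=> km; have := H _ _ k km.
  rewrite muln0 expr0 invr1 mul1r => /(_ _ _)/(ler_wpM2l (ltW (r20 (2 * m)%N))) h.
  apply: le_trans (le_trans (h _ _) _).
  - by rewrite mulrA ler_wpM2r ?en_ge0// mulnBr expfB// ltn_pmul2l.
  - by move=> j; rewrite mulr_ge0 ?en_ge0// invr_ge0 exprn_ge0 ?(ltW r0).
  - move=> j d d0; have d'0 : 0 < d / r ^+ 2 by rewrite divr_gt0.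
    have := en_step j d'0 tw => /(ler_wpM2l _) h'.
    apply: le_trans (h' _ _) _; first by rewrite invr_ge0 ltW.
    rewrite mulrDr lerD//; apply: eqle.
      rewrite !mulnS !exprD; have := r20 (2 * j)%N; move: (r ^+ (2 * j)) => Xj Xj0; field.
      by rewrite !gt_eqF.
    rewrite !mulnS !exprD; have := r20 (2 * j)%N; move: (r ^+ (2 * j)) => Xj Xj0; field.
    by rewrite !gt_eqF.
  rewrite mulrDr lerD//; apply: eqle; first by field; rewrite !gt_eqF// ltr0n.
  by ring.
rewrite /lowen /wen prednK// mulr_sumr.
apply: (@le_trans _ _ (\sum_(j < m) (eps / m%:R * en m w + C * r ^+ (2 * m) * en 0 w))).
  apply: ler_sum => j _; rewrite mulrA -exprD.
  have -> : (2 + 2 * (m.-1 - j) = 2 * (m - j))%N by have := ltn_ord j; lia.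
  exact: H.
rewrite sumr_const card_ord -mulr_natl; apply: eqle.
by field; rewrite gt_eqF// ltr0n.
Qed.
End weighted.

(** * The Gagliardo-Nirenberg-Sobolev inequality *)

Section abspow.
Context {R : realType}.
Implicit Types (p g y : R).

Lemma continuous_abspow p : 0 < p -> continuous (fun y : R => `|y| `^ p).
Proof.
move=> p0 /= y; have [->|y0] := eqVneq y 0.
  rewrite /continuous_at normr0 powR0 ?gt_eqF//; apply/cvgrPdist_lt => e e0.
  apply/nbhs_ballP; exists (e `^ p^-1); first exact: powR_gt0.
  move=> z /=; rewrite !sub0r !normrN => zd.
  rewrite ger0_norm ?powR_ge0//.
  have -> : e = (e `^ p^-1) `^ p by rewrite -powRrM mulVf ?gt_eqF// powRr1// ltW.
  by apply: gt0_ltr_powR => //; rewrite nnegrE// powR_ge0.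
apply: (@continuous_comp R R R (fun y : R => `|y|) (fun z : R => z `^ p)); first exact:
  norm_continuous.
apply: differentiable_continuous; apply/derivable1_diffP/derivable_powR.
by rewrite in_itv/= andbT normr_gt0.
Qed.

Lemma contM (T : topologicalType) (f g : T -> R) : continuous f -> continuous g ->
  continuous (fun x => f x * g x).
Proof. by move=> cf cg x; exact: continuousM (cf x) (cg x). Qed.

Lemma sqr_abspow g y : 2 < g -> `|y| `^ g = y ^+ 2 * `|y| `^ (g - 2).
Proof.
move=> g2; have [->|y0] := eqVneq y 0.
  by rewrite expr0n/= mul0r normr0 powR0 ?gt_eqF//; lra.
rewrite -(real_normK (num_real y)) -powR_mulrn// -powRD; first by congr powR; lra.
by rewrite normr_eq0 y0 implybT.
Qed.

(** For g > 2 the difference quotient at 0 is h |h|^(g-2), which tends to 0, so the formula holds at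
    the origin too. In the Sobolev argument p >= 2 makes the exponent exceed 2. *)
Lemma is_derive_abspow g (y : R) : 2 < g ->
  is_derive y 1 (fun z : R => `|z| `^ g) (g * (y * `|y| `^ (g - 2))).
Proof.
move=> g2; have g0 : 0 < g by lra.
have pos (x : R) : 0 < x -> is_derive x 1 (fun z : R => z `^ g) (g * (x * x `^ (g - 2))).
  move=> x0; have xI : x \in `]0, +oo[ by rewrite in_itv/= x0.
  apply: DeriveDef; first exact: derivable_powR.
  rewrite -derive1E powR_derive1//; congr (_ * _).
  rewrite -(@mulr_powRB1 _ x (g - 1)) ?ltW//; last by lra.
  by congr (_ * powR _ _); lra.
have [y0|y0|->] := ltgtP y 0.
- have ny : 0 < - y by rewrite oppr_gt0.
  have h : is_derive y 1 ((fun z : R => z `^ g) \o -%R) (g * (- y * (- y) `^ (g - 2)) * -1).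
    apply: is_derive1_comp; exact: pos.
  have e : \forall z \near y, (- z) `^ g = `|z| `^ g.
    near=> z; rewrite /= ltr0_norm//.
    by near: z; exact: lt_nbhsl.
  rewrite ltr0_norm//.
  have -> : g * (y * (- y) `^ (g - 2)) = g * (- y * (- y) `^ (g - 2)) * -1 by ring.
  exact: (near_eq_is_derive e h).
- have e : \forall z \near y, z `^ g = `|z| `^ g.
    near=> z; rewrite /= gtr0_norm//.
    by near: z; exact: lt_nbhsr.
  rewrite gtr0_norm//.
  exact: (near_eq_is_derive e (pos y y0)).
- rewrite mul0r mulr0.
  have H : (fun h : R => h^-1 *: (`|h * 1 + 0| `^ g - `|0 : R| `^ g)) @ (0:R)^' --> (0 : R).
    have c : h * `|h| `^ (g - 2) @[h --> (0:R)^'] --> (0 : R).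
      have cc : continuous (fun h : R => h * `|h| `^ (g - 2)).
        by apply: contM => [h|]; [exact: cvg_id|apply: continuous_abspow; lra].
      by have /continuous_withinNx := cc 0; rewrite /= mul0r.
    apply: cvg_trans c; apply: near_eq_cvg; near=> h.
    have -> : `|h * 1 + 0| `^ g - `|0 : R| `^ g = h ^+ 2 * `|h| `^ (g - 2).
      rewrite addr0 mulr1 normr0 powR0; last by rewrite gt_eqF.
      by rewrite subr0; exact: sqr_abspow.
    rewrite -[RHS]/(h^-1 * _) expr2 !mulrA mulVf ?mul1r//.
    by near: h; exact: nbhs_dnbhs_neq.
  apply: DeriveDef; first by apply/cvg_ex; exists 0.
  exact: cvg_lim.
Unshelve. all: by end_near. Qed.

(* Gagliardo's one-dimensional step. *)
Lemma abspow_le_integral g (h h' : R -> R) r t : 2 < g ->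
  (forall t : R, is_derive t 1 h (h' t)) -> continuous h' ->
  (forall t, r < `|t| -> h t = 0) ->
  ((`|h t| `^ g)%:E <=
   \int[@lebesgue_measure R]_s (g * (`|h s| `^ (g - 1) * `|h' s|))%:E)%E.
Proof.
move=> g2 dh ch hr.
have ch0 : continuous h.
  move=> s; apply: differentiable_continuous; apply/derivable1_diffP.
  by have [] := dh s.
pose F s := `|h s| `^ g.
pose F' s := (g * (h s * `|h s| `^ (g - 2))) * h' s.
have dF (s : R) : is_derive s 1 F (F' s).
  by apply: (is_derive1_comp (f := fun z : R => `|z| `^ g)) => //; exact: is_derive_abspow.
have cF' : continuous F'.
  apply: contM => //; apply: contM; first by move=> s; exact: cvg_cst.
  apply: contM => // s.
  apply: (@continuous_comp _ _ _ h (fun z : R => `|z| `^ (g - 2))); first exact: ch0.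
  by apply: continuous_abspow; lra.
pose a := - (`|r| + `|t| + 1).
have ra : r < `|a|.
  rewrite /a normrN ger0_norm ?addr_ge0//.
  by have := ler_norm r; have := normr_ge0 t; lra.
have at_ : a < t by rewrite /a; have := ler_norm (- t); have := normr_ge0 r; rewrite normrN; lra.
have e := ftc_R at_ dF cF'.
have Fa : F a = 0 by rewrite /F hr// normr0 powR0// gt_eqF//; lra.
have HF' s : `|F' s| <= g * (`|h s| `^ (g - 1) * `|h' s|).
  rewrite /F' !normrM gtr0_norm; last by lra.
  rewrite -!mulrA ler_wpM2l//; first by lra.
  rewrite mulrA ler_wpM2r// [`|_ `^ _|]ger0_norm ?powR_ge0//.
  rewrite -(@mulr_powRB1 _ `|h s| (g - 1))//; last by lra.
  by rewrite ler_wpM2l// (_ : g - 1 - 1 = g - 2)//; lra.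
have mF' : measurable_fun setT F' by exact: continuous_measurable_fun.
have mG : measurable_fun setT (fun s => (g * (`|h s| `^ (g - 1) * `|h' s|))).
  apply: continuous_measurable_fun; apply: contM; first by move=> s; exact: cvg_cst.
  apply: contM => s; last first.
    by apply: (@continuous_comp _ _ _ h' (fun z : R => `|z|)); [exact: ch|exact: norm_continuous].
  apply: (@continuous_comp _ _ _ h (fun z : R => `|z| `^ (g - 1))); first exact: ch0.
  by apply: continuous_abspow; lra.
rewrite -[X in (X%:E <= _)%E]/(F t) -[F t]subr0 -Fa -e.
have le1 : (\int[@lebesgue_measure R]_(s in `[a, t]) (F' s)%:E <=
   \int[@lebesgue_measure R]_(s in `[a, t]) `|(F' s)%:E|)%E.
  apply: (le_trans (lee_abs _)); apply: le_abse_integral => //.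
  by apply/measurable_EFinP; exact: measurable_funTS.
apply: (le_trans le1).
apply: (@le_trans _ _ (\int[@lebesgue_measure R]_(s in `[a, t]) (g * (`|h s| `^ (g - 1) * `|h'
  s|))%:E)%E).
  apply: ge0_le_integral => //.
  - apply: measurableT_comp => //; apply/measurable_EFinP; exact: measurable_funTS.
  - by apply/measurable_EFinP; exact: measurable_funTS.
  - by move=> s _; rewrite lee_fin.
apply: ge0_subset_integral => //.
- exact/measurable_EFinP.
- by move=> s _; rewrite lee_fin (le_trans _ (HF' s)).
Qed.

Lemma hoelder_cvx d (T : measurableType d) (mu : {measure set T -> \bar R}) (f g : T -> R) (a : R) :
  measurable_fun setT f -> measurable_fun setT g ->
  (forall x, 0 <= f x) -> (forall x, 0 <= g x) -> 0 < a < 1 ->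
  (\int[mu]_x (f x `^ a * g x `^ (1 - a))%:E <=
   (\int[mu]_x (f x)%:E) `^ a * (\int[mu]_x (g x)%:E) `^ (1 - a))%E.
Proof.
move=> mf mg f0 g0 /andP[a0 a1].
have a1' : 0 < 1 - a by rewrite subr_gt0.
pose F x := f x `^ a; pose G x := g x `^ (1 - a).
have mF : measurable_fun setT F by exact: (measurableT_comp (measurable_powR _)).
have mG : measurable_fun setT G by exact: (measurableT_comp (measurable_powR _)).
have e1 (u : T -> R) (b : R) : 0 < b -> (forall x, 0 <= u x) ->
   ('N[mu]_(b^-1%:E)[EFin \o (fun x => u x `^ b)%R] = (\int[mu]_x (u x)%:E) `^ b)%E.
  move=> b0 u0; rewrite unlock invrK; congr (_ `^ _)%E; apply: eq_integral => x _.
  by rewrite -[(EFin \o _) x]/((u x `^ b)%:E) gee0_abs ?lee_fin ?powR_ge0// poweR_EFin -powRrM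
    divff ?gt_eqF// powRr1.
have e2 : (\int[mu]_x (F x * G x)%:E = 'N[mu]_1[EFin \o (F \* G)%R])%E.
  rewrite Lnorm1; apply: eq_integral => x _.
  by rewrite /= ger0_norm// mulr_ge0// powR_ge0.
have i0 : 0 < a^-1 by rewrite invr_gt0.
have i1 : 0 < (1 - a)^-1 by rewrite invr_gt0.
have i2 : a^-1^-1 + (1 - a)^-1^-1 = 1 by rewrite !invrK subrKC.
have := hoelder mu mF mG i0 i1 i2.
by rewrite -e2 (e1 f a a0 f0) (e1 g _ a1' g0).
Qed.
End abspow.

(** * Gagliardo's inequality, by induction on the dimension *)

Section gagliardo.
Context {R : realType}.
Local Notation leb n := (@lebesgue_rV R n).
Local Notation mu := (@lebesgue_measure R).

Definition upd n (x : 'rV[R]_n) (i : 'I_n) (s : R) : 'rV[R]_n :=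
  \row_j (if j == i then s else x ord0 j).

Lemma upd_line n (x : 'rV[R]_n) i s : upd x i s = upd x i 0 + s *: delta_mx 0 i.
Proof.
apply/rowP => j; rewrite !mxE eqxx/=; case: eqVneq => _; first by rewrite mulr1 add0r.
by rewrite mulr0 addr0.
Qed.

Lemma upd_id n (x : 'rV[R]_n) i : upd x i (x ord0 i) = x.
Proof. by apply/rowP => j; rewrite mxE; case: eqVneq => [->|]. Qed.

Lemma upd_snoc n (x : 'rV[R]_n) t i s :
  upd (@snoc R n.+1 x t) (widen_ord (leqnSn n) i) s = @snoc R n.+1 (upd x i s) t.
Proof.
apply/rowP; apply: snocP => [j|].
  rewrite mxE !snocE mxE; congr (if _ then _ else _).
rewrite mxE !snoc_max; case: eqP => // /(congr1 val)/= ni.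
by have := ltn_ord i; rewrite -ni ltnn.
Qed.

Lemma upd_snoc_max n (x : 'rV[R]_n) t s :
  upd (@snoc R n.+1 x t) ord_max s = @snoc R n.+1 x s.
Proof.
apply/rowP; apply: snocP => [j|].
  rewrite mxE !snocE; case: eqP => // /(congr1 val)/= ni.
  by have := ltn_ord j; rewrite ni ltnn.
by rewrite mxE eqxx snoc_max.
Qed.

Lemma continuous_snoc_l n (t : R) : continuous (fun x : 'rV[R]_n => @snoc R n.+1 x t).
Proof.
by move=> x; apply: differentiable_continuous; exact: differentiable_snoc.
Qed.

Lemma continuous_snoc_r n (x : 'rV[R]_n) : continuous (fun t : R => @snoc R n.+1 x t).
Proof.
move=> t; under eq_fun do rewrite snoc_line.
apply: cvgD; first exact: cvg_cst.
by apply: cvgZr_tmp; exact: cvg_id.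
Qed.

Lemma cb_slice n (f : 'rV[R]_n.+1 -> R) t : cb f -> cb (fun x : 'rV[R]_n => f (@snoc R n.+1 x t)).
Proof.
move=> [cf [r fr]]; split.
  by move=> x; apply: continuous_comp; [exact: continuous_snoc_l|exact: cf].
by exists r => x rx; apply: fr; rewrite (lt_le_trans rx)// norm_snoc_l.
Qed.

(** The only property of |f|^gam and of its gradient that Gagliardo's argument uses; it is inherited
    by slices. *)
Definition below n (g h : 'rV[R]_n -> R) := forall i x,
  ((g x)%:E <= \int[mu]_s (h (upd x i s))%:E)%E.

(* Gagliardo's inequality; the weight [p] makes the induction on the dimension work. *)
Definition gn_stmt k := forall g h p : 'rV[R]_k.+1 -> R, cb g -> cb h ->
  (forall x, 0 <= g x) -> (forall x, 0 <= h x) -> below g h ->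
  measurable_fun setT p -> (forall x, 0 <= p x) ->
  (leb k.+1).-integrable setT (EFin \o p) ->
  (\int[leb k.+1]_x (g x * p x `^ k.+1%:R^-1)%:E <=
   (itg h)%:E * (\int[leb k.+1]_x (p x)%:E) `^ (k.+1%:R^-1))%E.

Lemma integral_rV0 (F : 'rV[R]_0 -> \bar R) : (\int[leb 0]_x F x = F 0%R)%E.
Proof.
have -> : F = cst (F 0) by apply/funext => x /=; congr F; apply/rowP => -[].
by rewrite integral_cst// /cst /= diracE mem_set// mule1.
Qed.

Lemma cb_line n (f : 'rV[R]_n.+1 -> R) (x : 'rV[R]_n) : cb f ->
  mu.-integrable setT (fun t => (f (@snoc R n.+1 x t))%:E).
Proof.
move=> cf; have [M M0 [r r0 fM]] := cb_bounded cf.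
have cl : continuous (fun t : R => f (@snoc R n.+1 x t)).
  move=> t; apply: (@continuous_comp _ _ _ (fun t : R => @snoc R n.+1 x t) f).
    exact: continuous_snoc_r.
  by case: cf => cf _; exact: cf.
apply: (@le_integrable _ (measurableTypeR R) R mu setT measurableT
  (fun t => (f (@snoc R n.+1 x t))%:E) (fun t => (M * \1_(`[-r, r]%classic : set R) t)%:E)).
- by apply/measurable_EFinP; exact: continuous_measurable_fun.
- move=> t _; rewrite /= lee_fin (le_trans (fM _))// ger0_norm; last by rewrite mulr_ge0.
  rewrite ler_wpM2l// !indicE ler_nat; case: (boolP (_ \in ccube r)) => //.
  rewrite inE => /(ccubeP _ r0) xr; rewrite mem_set//= in_itv/= -ler_norml.
  exact: le_trans (norm_snoc_r x t) xr.
under eq_fun do rewrite EFinM.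
apply: integrableZl => //.
apply/integrableP; split.
  by apply/measurable_EFinP; apply: measurable_indic; exact: measurable_itv.
under eq_integral do rewrite gee0_abs ?lee_fin//.
have l : (mu (`[(-r)%R, r]%classic : set R) < +oo)%E.
  by rewrite lebesgue_measure_itv/=; case: ifP => //; rewrite ltry.
by rewrite integral_indic// setIT; exact: l.
Qed.

(** The factor g^(1/(k+1)) is bounded by the same power of P, the integral of h in the last
    direction. P does not depend on the last variable, so it can serve as the weight on every slice,
    and its total integral is that of h. *)
Lemma gn_step k (g h : 'rV[R]_k.+2 -> R) : gn_stmt k -> cb g -> cb h ->
  (forall x, 0 <= g x) -> (forall x, 0 <= h x) -> below g h ->
  (\int[leb k.+2]_x (g x `^ (1 + k.+1%:R^-1))%:E <= (itg h)%:E `^ (1 + k.+1%:R^-1))%E.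
Proof.
move=> IH cg ch g0 h0 gh.
pose P (x : 'rV[R]_k.+1) := (\int[mu]_s (h (@snoc R k.+2 x s))%:E)%E.
have Pfin x : P x \is a fin_num by apply: integrable_fin_num => //; exact: cb_line.
have P0 x : (0 <= P x)%E by apply: integral_ge0 => s _; rewrite lee_fin.
pose p x := fine (P x).
have pE x : (p x)%:E = P x by rewrite fineK.
have mh := measurable_cb ch; have mg := measurable_cb cg.
have h0' x : (0 <= (h x)%:E)%E by rewrite lee_fin.
have mh' : measurable_fun setT (EFin \o h) by exact/measurable_EFinP.
have iP : (\int[leb k.+1]_x P x)%E = (itg h)%:E.
  by rewrite -itg_EFin// [RHS]ge0_integral_snoc//.
have mP : measurable_fun setT P.
  have := @measurable_fun_fubini_tonelli_F _ _ _ _ R mu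
    (fun z : 'rV[R]_k.+1 * measurableTypeR R => (h (@snoc R k.+2 z.1 z.2))%:E).
  apply; last by move=> z; rewrite lee_fin.
  by apply/measurable_EFinP; apply: measurableT_comp => //; exact: measurable_snoc.
have mp : measurable_fun setT p.
  by apply: measurableT_comp => //; exact: measurable_fine.
have p0 x : 0 <= p x by rewrite fine_ge0.
have ip : (leb k.+1).-integrable setT (EFin \o p).
  apply/integrableP; split; first exact/measurable_EFinP.
  under eq_integral do rewrite /= ger0_norm// pE.
  by rewrite iP ltry.
have nn : 0 < k.+1%:R^-1 :> R by rewrite invr_gt0.
have mgp : measurable_fun setT (fun x => (g x `^ (1 + k.+1%:R^-1))%:E).
  by apply/measurable_EFinP; exact: (measurableT_comp (measurable_powR _)).
rewrite ge0_integral_snoc2//; last by move=> x; rewrite lee_fin powR_ge0.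
apply: (@le_trans _ _ (\int[mu]_t ((itg h `^ k.+1%:R^-1)%:E * (itg (fun x : 'rV[R]_k.+1 => h (@snoc
  R k.+2 x t)))%:E))%E).
  apply: ge0_le_integral => //.
  - by move=> t _; apply: integral_ge0 => x _; rewrite lee_fin powR_ge0.
  - have := @measurable_fun_fubini_tonelli_G _ _ _ _ R (leb k.+1)
      (fun z : 'rV[R]_k.+1 * measurableTypeR R => (g (@snoc R k.+2 z.1 z.2) `^ (1 +
        k.+1%:R^-1))%:E).
    apply; last by move=> z; rewrite lee_fin powR_ge0.
    by apply: (measurableT_comp mgp); exact: measurable_snoc.
  - apply: measurable_funeM.
    have := @measurable_fun_fubini_tonelli_G _ _ _ _ R (leb k.+1)
      (fun z : 'rV[R]_k.+1 * measurableTypeR R => (h (@snoc R k.+2 z.1 z.2))%:E).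
    have -> : (fun t => (itg (fun x : 'rV[R]_k.+1 => h (@snoc R k.+2 x t)))%:E) =
        (fun t => \int[leb k.+1]_x (h (@snoc R k.+2 x t))%:E)%E.
      by apply/funext => t; rewrite itg_EFin//; exact: cb_slice.
    apply; last by move=> z; rewrite lee_fin.
    by apply/measurable_EFinP; apply: measurableT_comp => //; exact: measurable_snoc.
  move=> t _.
  have := IH (fun x => g (@snoc R k.+2 x t)) (fun x => h (@snoc R k.+2 x t)) p (cb_slice t cg)
    (cb_slice t ch)
     (fun x => g0 _) (fun x => h0 _).
  have blw : below (fun x : 'rV[R]_k.+1 => g (@snoc R k.+2 x t)) (fun x => h (@snoc R k.+2 x t)).
    move=> i x; have := gh (widen_ord (leqnSn _) i) (@snoc R k.+2 x t).
    by under eq_integral do rewrite upd_snoc.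
  move=> /(_ blw mp p0 ip).
  under [X in (_ <= _ * X `^ _)%E -> _]eq_integral do rewrite pE.
  rewrite iP poweR_EFin => /(le_trans _) H; rewrite muleC; apply: H.
  apply: ge0_le_integral => //.
  - by move=> x _; rewrite lee_fin powR_ge0.
  - by apply/measurable_EFinP; apply: (measurableT_comp (measurable_powR _)); apply: measurable_cb;
    exact: cb_slice.
  - apply/measurable_EFinP; apply: measurable_funM; first by apply: measurable_cb; exact: cb_slice.
    exact: (measurableT_comp (measurable_powR _)).
  move=> x _; rewrite lee_fin powRD; last by rewrite gt_eqF// addr_gt0.
  rewrite powRr1// ler_wpM2l//; apply: ge0_ler_powR; [exact: ltW|by rewrite nnegrE|by rewrite
    nnegrE|].
  rewrite -lee_fin pE; have := gh ord_max (@snoc R k.+2 x t).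
  by under eq_integral do rewrite upd_snoc_max.
have itE t : (itg (fun x : 'rV[R]_k.+1 => h (@snoc R k.+2 x t)))%:E =
    (\int[leb k.+1]_x (h (@snoc R k.+2 x t))%:E)%E.
  by rewrite itg_EFin//; exact: cb_slice.
have iH : (\int[mu]_t \int[leb k.+1]_x (h (@snoc R k.+2 x t))%:E = (itg h)%:E)%E.
  rewrite -itg_EFin//; apply: esym; exact: (@ge0_integral_snoc2 R _ (EFin \o h) mh' h0').
under eq_integral do rewrite itE.
rewrite ge0_integralZl//.
- apply: (@le_trans _ _ ((itg h `^ k.+1%:R^-1)%:E * (itg h)%:E)%E).
    by rewrite le_eqVlt; apply/orP; left; apply/eqP; congr (_ * _)%E; exact: iH.
  rewrite poweR_EFin -EFinM lee_fin powRD; last by rewrite gt_eqF// addr_gt0.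
  by rewrite mulrC powRr1// itg_ge0.
- have := @measurable_fun_fubini_tonelli_G _ _ _ _ R (leb k.+1)
    (fun z : 'rV[R]_k.+1 * measurableTypeR R => (h (@snoc R k.+2 z.1 z.2))%:E).
  apply; last by move=> z; rewrite lee_fin.
  by apply/measurable_EFinP; apply: measurableT_comp => //; exact: measurable_snoc.
- by move=> t _; apply: integral_ge0 => x _; rewrite lee_fin.
- by rewrite lee_fin powR_ge0.
Qed.

(** In the inductive step Hölder splits off the weight, with powers a = 1 - 1/(k+2) and 1/(k+2);
    since (1 + 1/(k+1)) a = 1, the other factor is the one that [gn_step] estimates. In dimension
    one, [below] bounds g by the whole integral of h. *)
Lemma gn_ind k : gn_stmt k.
Proof.
elim: k => [|k ih] g h p cg ch g0 h0 gh mp p0 ip.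
  rewrite invr1 poweRe1; last by apply: integral_ge0 => x _; rewrite lee_fin.
  rewrite -ge0_integralZl//; [|exact/measurable_EFinP|by move=> x _; rewrite lee_fin|
    by rewrite lee_fin itg_ge0].
  apply: ge0_le_integral => //.
  - by move=> x _; rewrite lee_fin mulr_ge0// powR_ge0.
  - apply/measurable_EFinP; apply: measurable_funM; first exact: measurable_cb.
    exact: (measurableT_comp (measurable_powR _)).
  - by apply/measurable_EFinP; exact: measurable_funM.
  move=> x _; rewrite powRr1// -EFinM lee_fin ler_wpM2r// -lee_fin.
  apply: (le_trans (gh ord0 x)).
  rewrite -itg_EFin// ge0_integral_snoc//; last first.
    by apply/measurable_EFinP; exact: measurable_cb.
  rewrite integral_rV0 le_eqVlt; apply/orP; left; apply/eqP; apply: eq_integral => s _.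
  congr (h _)%:E; apply/rowP => j; rewrite (_ : j = ord_max).
    by rewrite snoc_max mxE (ord1 ord_max) eqxx.
  by rewrite [LHS]ord1 [RHS]ord1.
have T := gn_step ih cg ch g0 h0 gh.
have n0 : 0 < k.+1%:R :> R by [].
pose b : R := k.+2%:R^-1; pose a : R := 1 - b.
have b0 : 0 < b by rewrite invr_gt0.
have b1 : b < 1 by rewrite invf_lt1// ltr1n.
have ab : (1 + k.+1%:R^-1) * a = 1.
  rewrite /a /b -natr1; field.
  by rewrite natr1 !gt_eqF.
have a01 : 0 < a < 1 by rewrite /a; lra.
have := @hoelder_cvx _ _ _ (leb k.+2) (fun x => g x `^ (1 + k.+1%:R^-1)) p a.
have -> : 1 - a = b by rewrite /a; ring.
have e1 x : (g x `^ (1 + k.+1%:R^-1)) `^ a = g x by rewrite -powRrM ab powRr1.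
under eq_integral do rewrite e1.
move=> H; apply: (le_trans (H _ _ _ _ a01)) => //.
- exact: (measurableT_comp (measurable_powR _) (measurable_cb cg)).
- by move=> x; exact: powR_ge0.
apply: lee_wpmul2r; first exact: poweR_ge0.
have a0 : 0 <= a by case/andP: a01 => /ltW.
apply: (le_trans (gt0_ler_poweR a0 _ _ T)).
- by rewrite in_itv/= leey andbT integral_ge0// => x _; rewrite lee_fin powR_ge0.
- by rewrite in_itv/= leey andbT; exact: (poweR_ge0 (itg h)%:E).
by rewrite !poweR_EFin -powRrM ab powRr1// itg_ge0.
Qed.

Lemma gagliardo_nirenberg k (g h : 'rV[R]_k.+2 -> R) : cb g -> cb h ->
  (forall x, 0 <= g x) -> (forall x, 0 <= h x) -> below g h ->
  itg (fun x => g x `^ (1 + k.+1%:R^-1)) <= itg h `^ (1 + k.+1%:R^-1).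
Proof.
move=> cg ch g0 h0 gh; have := gn_step (gn_ind (k := k)) cg ch g0 h0 gh.
rewrite poweR_EFin itg_EFin ?lee_fin//.
have := cb_comp (continuous_abspow _) _ cg.
have p0 : 0 < 1 + k.+1%:R^-1 :> R by rewrite addr_gt0// invr_gt0.
move=> /(_ _ p0); rewrite normr0 powR0 ?gt_eqF// => /(_ erefl).
by under eq_fun do rewrite ger0_norm//.
Qed.

Lemma below_abspow n (f : 'rV[R]_n -> R) gam : 2 < gam -> tf f ->
  below (fun x => `|f x| `^ gam)
        (fun x => gam * (`|f x| `^ (gam - 1) * \sum_i `|pd i f x|)).
Proof.
move=> g2 [sf [r fr]] i x.
pose h s := f (upd x i s); pose h' s := pd i f (upd x i s).
have dh (s : R) : is_derive s 1 h (h' s).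
  have := is_derive_line (upd x i 0) (delta_mx 0 i) s (smooth_diff sf).
  rewrite -upd_line (bigD1 i)//= big1 ?addr0; last first.
    by move=> j ji; rewrite mxE eqxx/= (negbTE ji) mul0r.
  by rewrite mxE !eqxx mul1r; under eq_fun do rewrite -upd_line.
have ch' : continuous h'.
  move=> s; apply: differentiable_continuous; apply/derivable1_diffP.
  have := is_derive_line (upd x i 0) (delta_mx 0 i) s (smooth_diff (smooth_pd i sf)).
  by under eq_fun do rewrite -upd_line; case.
have hr s : r < `|s| -> h s = 0.
  move=> rs; apply: fr; apply: (lt_le_trans rs).
  by have := rV_norm_coord (upd x i s) i; rewrite mxE eqxx.
have := abspow_le_integral (x ord0 i) g2 dh ch' hr.
rewrite {1}/h upd_id => /le_trans; apply.
have mh : measurable_fun setT h.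
  apply: continuous_measurable_fun => s; apply: differentiable_continuous.
  by apply/derivable1_diffP; case: (dh s).
apply: ge0_le_integral => //.
- by move=> s _; rewrite lee_fin !mulr_ge0// ?powR_ge0//; lra.
- apply/measurable_EFinP; apply: measurable_funM => //; apply: measurable_funM.
    by apply: (measurableT_comp (measurable_powR _)); exact: measurableT_comp.
  by apply: measurableT_comp => //; exact: continuous_measurable_fun.
- apply/measurable_EFinP; apply: measurable_funM => //; apply: measurable_funM.
    by apply: (measurableT_comp (measurable_powR _)); exact: measurableT_comp.
  apply: measurable_sum => j; apply: measurableT_comp => //.
  apply: continuous_measurable_fun => s; apply: differentiable_continuous; apply/derivable1_diffP.
  have := is_derive_line (upd x i 0) (delta_mx 0 i) s (smooth_diff (smooth_pd j sf)).
  by under eq_fun do rewrite -upd_line; case.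
move=> s _; rewrite lee_fin ler_wpM2l//; first by lra.
rewrite ler_wpM2l ?powR_ge0// (bigD1 i)//= lerDl sumr_ge0//.
Qed.
End gagliardo.

Section lp_norm.
Context {R : realType}.
Variable n : nat.
Local Notation X := 'rV[R]_n.

Definition lpn (p : R) (f : X -> R) : R := itg (fun x => `|f x| `^ p) `^ p^-1.

Lemma cb_abspow p f : 0 < p -> cb f -> cb (fun x : X => `|f x| `^ p).
Proof.
move=> p0 cf; apply: (@cb_comp _ _ (fun z : R => `|z| `^ p)) => //.
  exact: continuous_abspow.
by rewrite normr0 powR0 ?gt_eqF.
Qed.

Lemma lpn_ge0 p f : 0 <= lpn p f. Proof. exact: powR_ge0. Qed.

Lemma lpn_pow p f : 0 < p -> lpn p f `^ p = itg (fun x => `|f x| `^ p).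
Proof.
move=> p0; rewrite /lpn -powRrM mulVf ?gt_eqF// powRr1//.
by apply: itg_ge0 => x; exact: powR_ge0.
Qed.

Lemma itg_hoelder p q f g : 0 < p -> 0 < q -> p^-1 + q^-1 = 1 -> cb f -> cb g ->
  itg (fun x => `|f x| * `|g x|) <= lpn p f * lpn q g.
Proof.
move=> p0 q0 pq cf cg.
have a01 : 0 < p^-1 < 1 by rewrite invr_gt0 p0/= -pq ltrDl invr_gt0.
have := @hoelder_cvx _ _ _ (@lebesgue_rV R n) (fun x => `|f x| `^ p) (fun x => `|g x| `^ q) p^-1.
have -> : 1 - p^-1 = q^-1 by rewrite -pq addrC addKr.
have e1 (z r : R) : 0 < r -> (`|z| `^ r) `^ r^-1 = `|z|.
  by move=> r0; rewrite -powRrM divff ?gt_eqF// powRr1.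
under eq_integral do rewrite (e1 _ p p0) (e1 _ q q0).
have cp := cb_abspow p0 cf; have cq := cb_abspow q0 cg.
rewrite (itg_EFin cp) (itg_EFin cq) itg_EFin; last by apply: cbM; exact: cb_norm.
rewrite !poweR_EFin -EFinM lee_fin; apply => //.
- exact: measurable_cb.
- exact: measurable_cb.
Qed.

End lp_norm.

Section sobolev.
Context {R : realType}.
Variable k : nat.
Local Notation n := k.+3.
Local Notation X := 'rV[R]_n.

(* Gagliardo-Nirenberg-Sobolev, with [1 / q = 1 / p - 1 / n]. *)
Lemma sobolev1 p (f : X -> R) : 2 <= p -> p < n%:R -> tf f ->
  lpn (n%:R * p / (n%:R - p)) f <=
  p * (n%:R - 1) / (n%:R - p) * \sum_i lpn p (pd i f).
Proof.
move=> p2 pn tff; set gam := (X in _ <= X * _); set q := _ / _.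
have np0 : 0 < n%:R - p :> R by rewrite subr_gt0.
have n2 : 2 < n%:R :> R by rewrite ltr_nat.
have p0 : 0 < p by lra.
have q0 : 0 < q by rewrite divr_gt0 ?mulr_gt0//; lra.
have g2 : 2 < gam by rewrite /gam ltr_pdivlMr//; nra.
have g0 : 0 < gam by lra.
have e : gam * (1 + k.+2%:R^-1) = q.
  rewrite /gam /q; have := np0; rewrite -(natr1 k.+2).
  have : 0 < k.+2%:R :> R by [].
  move: (k.+2%:R : R) => y y0 yp; field.
  by rewrite !gt_eqF.
pose p' := p / (p - 1).
have p'0 : 0 < p' by rewrite divr_gt0//; lra.
have pp : p'^-1 + p^-1 = 1.
  rewrite /p'; field; apply/andP; split; rewrite gt_eqF//; lra.
have e2 : (gam - 1) * p' = q.
  rewrite /gam /p' /q; field.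
  by apply/andP; split; rewrite gt_eqF//; lra.
clearbody gam q p'.
pose h x := gam * (`|f x| `^ (gam - 1) * \sum_i `|pd i f x|).
have cf := tf_cb tff.
have cg : cb (fun x => `|f x| `^ gam) by exact: cb_abspow.
have cg1 : cb (fun x => `|f x| `^ (gam - 1)) by apply: cb_abspow => //; lra.
have cd i : cb (fun x => `|pd i f x|) by exact/cb_norm/tf_cb/tf_pd.
have ch : cb h by apply: cbZ; apply: cbM => //; exact: cb_sum.
have h0 x : 0 <= h x.
  by apply: mulr_ge0; [exact: ltW|apply: mulr_ge0; [exact: powR_ge0|exact: sumr_ge0]].
have := gagliardo_nirenberg cg ch (fun x => powR_ge0 _ _) h0 (below_abspow g2 tff).
have -> : (fun x => (`|f x| `^ gam) `^ (1 + k.+2%:R^-1)) = (fun x => `|f x| `^ q).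
  by apply/funext => x; rewrite -powRrM e.
rewrite -(lpn_pow _ q0).
have [->|Lq0] := eqVneq (lpn q f) 0.
  by move=> _; rewrite mulr_ge0 ?sumr_ge0 ?ltW// => i _; exact: lpn_ge0.
have L0 : 0 < lpn q f by rewrite lt_neqAle eq_sym Lq0 lpn_ge0.
move=> H.
have {}H : lpn q f `^ gam <= itg h.
  have e0 : 0 < 1 + k.+2%:R^-1 :> R by rewrite addr_gt0// invr_gt0.
  have E : lpn q f `^ q = (lpn q f `^ gam) `^ (1 + k.+2%:R^-1) by rewrite -powRrM e.
  rewrite E in H.
  rewrite leNgt; apply/negP => /(gt0_ltr_powR e0); rewrite !nnegrE powR_ge0 (itg_ge0 h0).
  by move=> /(_ isT isT) H'; move: (lt_le_trans H' H); rewrite ltxx.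
have e3 : lpn p' (fun x => `|f x| `^ (gam - 1)) = lpn q f `^ (gam - 1).
  rewrite /lpn -powRrM; have -> : q^-1 * (gam - 1) = p'^-1.
    rewrite -e2 invfM mulrAC mulVf ?mul1r// gt_eqF//; lra.
  rewrite (_ : (fun x => _) = fun x => `|f x| `^ q)//; apply/funext => x.
  by rewrite (ger0_norm (powR_ge0 _ _)) -powRrM e2.
have hle : itg h <= gam * \sum_i (lpn q f `^ (gam - 1) * lpn p (pd i f)).
  rewrite /h itgZ; last by apply: cbM => //; exact: cb_sum.
  rewrite ler_pM2l//; under eq_fun do rewrite mulr_sumr.
  rewrite itg_sum; last by move=> i _; exact: cbM.
  apply: ler_sum => i _; rewrite -e3.
  have := itg_hoelder p'0 p0 pp cg1 (tf_cb (tf_pd i tff)).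
  by under [X in itg X <= _]eq_fun do rewrite (ger0_norm (powR_ge0 _ _)).
have Lg : 0 < lpn q f `^ (gam - 1) by rewrite powR_gt0.
rewrite -(ler_pM2l Lg) [leLHS]mulrC [leLHS](mulr_powRB1 (ltW L0) g0).
by apply: (le_trans (le_trans H hle)); rewrite -mulr_sumr mulrCA.
Qed.

(* [1 / p_j = 1 / 2 - j / n] *)
Definition sexp (j : nat) : R := 2 * n%:R / (n%:R - 2 * j%:R).

(** [sobolev1] is iterated. Its hypothesis p >= 2 holds because every [sexp j] is at least 2, and
    [sexp j] < n is equivalent to 2 (j + 1) < n. *)
Lemma sobolev j : (2 * j < n)%N -> exists2 C : R, 0 <= C &
  forall f : X -> R, tf f -> lpn (sexp j) f <= C * Num.sqrt (en j f).
Proof.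
elim: j => [_|j ih jn].
  exists 1 => // f tff; rewrite mul1r /sexp mulr0 subr0 mulfK//.
  rewrite /lpn powR12_sqrt; last by apply: itg_ge0 => x; exact: powR_ge0.
  rewrite le_eqVlt; apply/orP; left; apply/eqP; congr (Num.sqrt (itg _)).
  by apply/funext => x; rewrite powR_mulrn// real_normK// num_real.
have [|C C0 H] := ih; first by lia.
have nj : 0 < n%:R - 2 * j%:R :> R.
  by rewrite subr_gt0 -natrM ltr_nat; lia.
have nj1 : 0 < n%:R - 2 * j.+1%:R :> R.
  by rewrite subr_gt0 -natrM ltr_nat.
have n0 : 0 < k.+3%:R :> R by [].
have p2 : 2 <= sexp j.
  by rewrite /sexp ler_pdivlMr// ler_pM2l// lerBlDr lerDl mulr_ge0.
have pn : sexp j < n%:R.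
  rewrite /sexp ltr_pdivrMr// mulrC ltr_pM2l ?ltr0n//.
  by move: nj1; rewrite -natr1; lra.
have qE : n%:R * sexp j / (n%:R - sexp j) = sexp j.+1.
  rewrite /sexp; move: nj nj1 n0; rewrite -(natr1 j); move: (k.+3%:R : R) => x.
  move=> nj nj1 x0; field.
  apply/and3P; split; rewrite gt_eqF//.
  have -> : x * (x - 2 * j%:R) - 2 * x = x * (x - 2 * (j%:R + 1)) by ring.
  exact: mulr_gt0.
pose gam := sexp j * (n%:R - 1) / (n%:R - sexp j).
have gam0 : 0 <= gam.
  apply: divr_ge0; last by rewrite subr_ge0; exact: ltW.
  apply: mulr_ge0; first exact: le_trans p2.
  by rewrite subr_ge0 ler1n.
exists (gam * (n%:R * C)); first by apply: mulr_ge0 => //; exact: mulr_ge0.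
move=> f tff; have := sobolev1 p2 pn tff; rewrite qE => /le_trans; apply.
rewrite -/gam -!(mulrA gam) ler_wpM2l//.
apply: (@le_trans _ _ (\sum_(i < n) C * Num.sqrt (en j.+1 f))).
  apply: ler_sum => i _; apply: (le_trans (H _ (tf_pd i tff))).
  rewrite ler_wpM2l// ler_sqrt ?en_ge0// /= (bigD1 i)//= lerDl.
  by apply: sumr_ge0 => l _; exact: en_ge0.
by rewrite sumr_const card_ord -[leLHS]mulr_natl mulrA.
Qed.
End sobolev.

(** * Bounds for the coefficients *)

Section coef.
Context {R : realType}.
Local Notation leb n := (@lebesgue_rV R n).
Local Notation mu := (@lebesgue_measure R).

Lemma integral_CS d (T : measurableType d) (m : {measure set T -> \bar R}) (f g : T -> R) (A B : R)
  :
  measurable_fun setT f -> measurable_fun setT g ->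
  (forall x, 0 <= f x) -> (forall x, 0 <= g x) -> 0 <= A -> 0 <= B ->
  (\int[m]_x (f x)%:E <= A%:E)%E -> (\int[m]_x (g x)%:E <= B%:E)%E ->
  (\int[m]_x (Num.sqrt (f x) * Num.sqrt (g x))%:E <= (Num.sqrt A * Num.sqrt B)%:E)%E.
Proof.
move=> mf mg f0 g0 A0 B0 fA gB.
have h01 : 0 < (2^-1 : R) < 1 by apply/andP; split; lra.
have := hoelder_cvx m mf mg f0 g0 h01.
have -> : 1 - 2^-1 = 2^-1 :> R by lra.
under eq_integral do rewrite !powR12_sqrt//.
move=> /le_trans; apply; rewrite EFinM -!powR12_sqrt// -!poweR_EFin.
have i0 (h : T -> R) : (forall x, 0 <= h x) -> (0 <= \int[m]_x (h x)%:E)%E.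
  by move=> h0; apply: integral_ge0 => x _; rewrite lee_fin.
have h0 : 0 <= 2^-1 :> R by lra.
apply: lee_pmul; rewrite ?poweR_ge0//; apply: gt0_ler_poweR => //;
  by rewrite in_itv/= leey andbT ?lee_fin// i0.
Qed.

(* Besides (WG), the only property of the coefficients that is used; it follows from (B1) and from
   (B2). *)
Definition cbd n (k1 k2 : nat) (a : 'rV[R]_n -> R) (M : R) := forall f g, tf f -> tf g ->
  (\int[leb n]_x (a x * (`|f x| * `|g x|))%:E <=
   (M * (Num.sqrt (en k1 f) * Num.sqrt (en k2 g)))%:E)%E.

Lemma cbd_le n k1 k2 a M M' : M <= M' -> @cbd n k1 k2 a M -> cbd k1 k2 a M'.
Proof.
move=> MM H f g tff tg; apply: (le_trans (H f g tff tg)); by rewrite lee_fin ler_wpM2r.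
Qed.

Lemma cbd_ae n (a : 'rV[R]_n -> R) M : measurable_fun setT a -> (forall x, 0 <= a x) ->
  0 <= M -> {ae leb n, forall x, a x <= M} -> cbd 0 0 a M.
Proof.
move=> ma a0 M0 aM f g tff tg.
have mf := measurable_cb (tf_cb tff); have mg := measurable_cb (tf_cb tg).
apply: (@le_trans _ _ (\int[leb n]_x (M * (Num.sqrt (f x ^+ 2) * Num.sqrt (g x ^+ 2)))%:E)%E).
  apply: ae_ge0_le_integral => //.
  - by move=> x _; rewrite lee_fin !mulr_ge0.
  - apply/measurable_EFinP; apply: measurable_funM => //.
    by apply: measurable_funM; exact: measurableT_comp.
  - by move=> x _; rewrite lee_fin !mulr_ge0// sqrtr_ge0.
  - under eq_fun do rewrite !sqrtr_sqr.
    apply/measurable_EFinP; apply: measurable_funM => //.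
    by apply: measurable_funM; exact: measurableT_comp.
  apply: filterS aM => x ax _; rewrite lee_fin !sqrtr_sqr ler_wpM2r//.
under eq_integral do rewrite EFinM.
rewrite ge0_integralZl//; last 1 first.
- under eq_fun do rewrite !sqrtr_sqr.
  by apply/measurable_EFinP; apply: measurable_funM; exact: measurableT_comp.
rewrite [leRHS]EFinM; apply: lee_wpmul2l; first by rewrite lee_fin.
apply: integral_CS; rewrite ?en_ge0//.
- exact: measurable_funX.
- exact: measurable_funX.
- by move=> x; exact: sqr_ge0.
- by move=> x; exact: sqr_ge0.
- by rewrite itg_EFin//; exact: cb_sqr_tf.
- by rewrite itg_EFin//; exact: cb_sqr_tf.
Qed.

Lemma lebesgue_rV_gt0 n : (0 < leb n setT)%E.
Proof.
apply: (@lt_le_trans _ _ 1%E); first exact: lte01.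
have := @lebesgue_ocbox R n (fun=> 0) (fun=> 1) (fun=> ler01).
under eq_bigr do rewrite subr0; rewrite big1// => <-.
by apply: le_measure; rewrite ?inE//; apply: measurable_ocbox; exists (fun=> 0), (fun=> 1).
Qed.

Lemma cbd_Loo n (a : 'rV[R]_n -> R) M : measurable_fun setT a -> (forall x, 0 <= a x) ->
  0 <= M -> ('N[leb n]_(+oo)[EFin \o a] <= M%:E)%E -> cbd 0 0 a M.
Proof.
move=> ma a0 M0; rewrite unlock lebesgue_rV_gt0 => /ess_supP H.
apply: cbd_ae => //; apply: filterS H => x /=.
by rewrite lee_fin ger0_norm.
Qed.

Lemma sexp_gt0 k j : (2 * j < k.+3)%N -> 0 < sexp (R := R) k j.
Proof.
move=> jn; rewrite /sexp divr_gt0 ?mulr_gt0//.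
by rewrite subr_gt0 -natrM ltr_nat.
Qed.

(** Hölder twice: first the coefficient against |f g|^s with s = 1/(1 - b), then |f|^p against |g|^q
    with the powers s/p and s/q, which add up to 1. *)
Lemma lpn_hoelder3 n (a f g : 'rV[R]_n -> R) (p q b : R) M :
  0 < p -> 0 < q -> 0 < b < 1 -> p^-1 + q^-1 = 1 - b ->
  measurable_fun setT a -> (forall x, 0 <= a x) -> 0 <= M -> cb f -> cb g ->
  ('N[leb n]_((b^-1)%:E)[EFin \o a] <= M%:E)%E ->
  (\int[leb n]_x (a x * (`|f x| * `|g x|))%:E <= (M * (lpn p f * lpn q g))%:E)%E.
Proof.
move=> p0 q0 /andP[b0 b1] pq ma a0 M0 cf cg.
have b1' : 0 < 1 - b by rewrite subr_gt0.
pose s := (1 - b)^-1.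
have s0 : 0 < s by rewrite invr_gt0.
have mf := measurable_cb cf; have mg := measurable_cb cg.
have mfg : measurable_fun setT (fun x => `|f x| * `|g x|).
  by apply: measurable_funM; exact: measurableT_comp.
have mpow (h : 'rV[R]_n -> R) r : measurable_fun setT h -> measurable_fun setT (fun x => h x `^ r).
  by move=> mh; exact: (measurableT_comp (measurable_powR _)).
have e1 (z r : R) : 0 < r -> 0 <= z -> (z `^ r) `^ r^-1 = z.
  by move=> r0 z0; rewrite -powRrM divff ?gt_eqF// powRr1.
have e2 (z : R) : 0 <= z -> (z `^ b^-1) `^ b = z.
  by move=> z0; rewrite -powRrM mulVf ?gt_eqF// powRr1.
have H1 := @hoelder_cvx _ _ _ (leb n) (fun x => a x `^ b^-1) (fun x => (`|f x| * `|g x|) `^ s) b.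
have {}H1 := H1 (mpow _ _ ma) (mpow _ _ mfg) (fun x => powR_ge0 _ _) (fun x => powR_ge0 _ _).
have bb : 0 < b < 1 by rewrite b0.
move: H1 => /(_ bb); have s1 : 1 - b = s^-1 by rewrite invrK.
under eq_integral do rewrite e2// s1 e1 ?mulr_ge0//.
rewrite unlock invrK.
have -> : (\int[leb n]_x `|(EFin \o a) x| `^ b^-1)%E = (\int[leb n]_x (a x `^ b^-1)%:E)%E.
  by apply: eq_integral => x _; rewrite /= ger0_norm.
move=> H1 aM; apply: (le_trans H1); rewrite EFinM.
apply: lee_pmul => //; rewrite ?poweR_ge0//.
have c0 : 0 < s / p by rewrite divr_gt0.
have cE : 1 - s / p = s / q.
  apply/eqP; rewrite subr_eq -mulrDr addrC pq mulVf// gt_eqF//.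
have c1 : 0 < s / p < 1 by rewrite c0 -subr_gt0 cE divr_gt0.
have := @hoelder_cvx _ _ _ (leb n) (fun x => `|f x| `^ p) (fun x => `|g x| `^ q) (s / p).
have mf' : measurable_fun setT (fun x => `|f x| `^ p).
  by apply: (mpow (fun x => `|f x|)); exact: measurableT_comp.
have mg' : measurable_fun setT (fun x => `|g x| `^ q).
  by apply: (mpow (fun x => `|g x|)); exact: measurableT_comp.
move=> /(_ mf' mg' (fun x => powR_ge0 _ _) (fun x => powR_ge0 _ _) c1).
have e3 (z r : R) : 0 < r -> (z `^ r) `^ (s / r) = z `^ s.
  by move=> r0; rewrite -powRrM mulrCA divff ?gt_eqF// mulr1.
rewrite cE; under eq_integral do rewrite !e3// -powRM//.
rewrite (itg_EFin (cb_abspow p0 cf)) (itg_EFin (cb_abspow q0 cg)).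
rewrite -(lpn_pow f p0) -(lpn_pow g q0).
have e4 (y z : R) : 0 <= y -> 0 <= z ->
    ((y `^ p)%:E `^ (s / p) * (z `^ q)%:E `^ (s / q))%E = ((y * z) `^ s)%:E.
  by move=> y0 z0; rewrite !poweR_EFin !e3// -EFinM -powRM.
rewrite (e4 _ _ (lpn_ge0 p f) (lpn_ge0 q g)).
clear e3 e4 cE c1; clearbody s.
move: (lpn p f) (lpn q g) (lpn_ge0 p f) (lpn_ge0 q g) => y z y0 z0 H2.
apply: (@le_trans _ _ (((y * z) `^ s)%:E `^ s^-1)%E).
  rewrite s1; apply: gt0_ler_poweR => //; first by rewrite invr_ge0 ltW.
  - rewrite in_itv/= leey andbT integral_ge0// => x _; rewrite lee_fin; exact: powR_ge0.
  - rewrite in_itv/= leey andbT lee_fin; exact: powR_ge0.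
by rewrite poweR_EFin e1// mulr_ge0.
Qed.

Lemma cbd_Lp k k1 k2 : (2 * k1 < k.+3)%N -> (2 * k2 < k.+3)%N -> (0 < k1 + k2)%N ->
  exists2 C : R, 0 <= C & forall (a : 'rV[R]_k.+3 -> R) M, measurable_fun setT a -> (forall x, 0 <=
    a x) -> 0 <= M ->
  ('N[leb k.+3]_((k.+3%:R / (k1 + k2)%:R)%:E)[EFin \o a] <= M%:E)%E ->
  cbd k1 k2 a (C * M).
Proof.
move=> h1 h2 h0; have [C1 C10 H1] := @sobolev R k k1 h1.
have [C2 C20 H2] := @sobolev R k k2 h2.
exists (C1 * C2); first exact: mulr_ge0.
move=> a M ma a0 M0 aM f g tff tg.
have n0 : 0 < k.+3%:R :> R by [].
have k0 : 0 < (k1 + k2)%:R :> R by rewrite ltr0n.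
have kn : (k1 + k2)%:R < k.+3%:R :> R by rewrite ltr_nat; lia.
pose b : R := (k1 + k2)%:R / k.+3%:R.
have b01 : 0 < b < 1 by rewrite /b divr_gt0//= ltr_pdivrMr// mul1r.
have bE : (b^-1 = k.+3%:R / (k1 + k2)%:R) by rewrite /b invfM invrK mulrC.
(* The exponent n / (k1 + k2) of the coefficient is exactly dual to the two Sobolev exponents. *)
have e : (sexp k k1)^-1 + (sexp k k2)^-1 = 1 - b.
  rewrite /sexp /b !invfM !invrK natrD; move: (k.+3%:R : R) n0 => y y0.
  by field; rewrite gt_eqF.
rewrite -bE in aM.
have := @lpn_hoelder3 _ a f g _ _ _ M (sexp_gt0 h1) (sexp_gt0 h2) b01 e ma a0 M0 (tf_cb tff) (tf_cb
  tg) aM.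
move=> /le_trans; apply; rewrite lee_fin.
apply: (@le_trans _ _ (M * (C1 * Num.sqrt (en k1 f) * (C2 * Num.sqrt (en k2 g))))).
  apply: ler_wpM2l => //; apply: ler_pM; rewrite ?lpn_ge0//; [exact: H1|exact: H2].
by apply: eqle; ring.
Qed.

Lemma cbd_lebesgue n k1 k2 : (2 * k1 < n)%N -> (2 * k2 < n)%N ->
  exists2 C : R, 0 <= C & forall (a : 'rV[R]_n -> R) M, measurable_fun setT a -> (forall x, 0 <= a
    x) -> 0 <= M ->
  ('N[leb n]_(if (k1 + k2 == 0)%N then +oo else (n%:R / (k1 + k2)%:R)%:E)[EFin \o a] <= M%:E)%E ->
  cbd k1 k2 a (C * M).
Proof.
move=> h1 h2; have [/eqP|k0] := eqVneq (k1 + k2)%N 0%N.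
  rewrite addn_eq0 => /andP[/eqP -> /eqP ->]; exists 1 => // a M ma a0 M0 H.
  by rewrite mul1r; exact: cbd_Loo.
(* In dimension at most 2 the hypotheses leave only k1 = k2 = 0, treated above. *)
case: n h1 h2 => [|[|[|n]]] h1 h2; [lia|lia|lia|].
by apply: cbd_Lp => //; rewrite lt0n.
Qed.

(** A slice only sees derivatives along the first n coordinates, so the energies of the slices
    integrate to a part of the full energy. *)
Lemma slice_en n k (f : 'rV[R]_n.+1 -> R) : tf f ->
  measurable_fun setT (fun t : R => en k (fun x : 'rV[R]_n => f (@snoc R n.+1 x t))) /\
  (\int[mu]_t (en k (fun x : 'rV[R]_n => f (@snoc R n.+1 x t)))%:E <= (en k f)%:E)%E.
Proof.
elim: k f => [|k ih] f tff.
  have c2 := cb_sqr_tf tff.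
  have e t : (en 0 (fun x : 'rV[R]_n => f (@snoc R n.+1 x t)))%:E =
      (\int[leb n]_x (f (@snoc R n.+1 x t) ^+ 2)%:E)%E.
    by rewrite itg_EFin//; exact: cb_sqr_tf (tf_slice t tff).
  have m2 : measurable_fun setT (EFin \o (fun x : 'rV[R]_n.+1 => f x ^+ 2)).
    by apply/measurable_EFinP; exact: measurable_cb.
  split.
    apply/measurable_EFinP; rewrite (_ : _ \o _ =
      (fun t => \int[leb n]_x (f (@snoc R n.+1 x t) ^+ 2)%:E)%E); last exact/funext.
    have := @measurable_fun_fubini_tonelli_G _ _ _ _ R (leb n)
      (fun z : 'rV[R]_n * measurableTypeR R => (f (@snoc R n.+1 z.1 z.2) ^+ 2)%:E).
    apply; last by move=> z; rewrite lee_fin sqr_ge0.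
    exact: (measurableT_comp m2 (@measurable_snoc R n)).
  under eq_integral do rewrite e.
  rewrite [en 0 f]/= -itg_EFin// le_eqVlt; apply/orP; left; apply/eqP/esym.
  by apply: (@ge0_integral_snoc2 R n _ m2) => x; rewrite /= lee_fin sqr_ge0.
have e (t : R) : en k.+1 (fun x : 'rV[R]_n => f (@snoc R n.+1 x t)) =
    \sum_i en k (fun x : 'rV[R]_n => pd (widen_ord (leqnSn n) i) f (@snoc R n.+1 x t)).
  by apply: eq_bigr => i _; rewrite pd_slice.
have IH i := ih (pd (widen_ord (leqnSn n) i) f) (tf_pd _ tff).
split.
  by under eq_fun do rewrite e; apply: measurable_sum => i; case: (IH i).
under eq_integral do rewrite e -sumEFin.
rewrite ge0_integral_sum//; last 2 first.
- by move=> i; apply/measurable_EFinP; case: (IH i).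
- by move=> i t _; rewrite lee_fin en_ge0.
apply: (@le_trans _ _ (\sum_(i < n) (en k (pd (widen_ord (leqnSn n) i) f))%:E)%E).
  by apply: lee_sum => i _; case: (IH i).
by rewrite sumEFin lee_fin /= big_ord_recr/= lerDl en_ge0.
Qed.

(** The bound on a slice is a product of two square roots of energies; Cauchy-Schwarz in t
    recombines them through [slice_en]. *)
Lemma cbd_slice n k1 k2 (a : 'rV[R]_n.+1 -> R) M : 0 <= M -> (forall x, 0 <= a x) ->
  measurable_fun setT a ->
  {ae mu, forall t, cbd k1 k2 (fun x : 'rV[R]_n => a (@snoc R n.+1 x t)) M} ->
  cbd k1 k2 a M.
Proof.
move=> M0 a0 ma H f g tff tg.
have mf := measurable_cb (tf_cb tff); have mg := measurable_cb (tf_cb tg).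
have mF : measurable_fun setT (fun x => (a x * (`|f x| * `|g x|))%:E).
  apply/measurable_EFinP; apply: measurable_funM => //.
  by apply: measurable_funM; exact: measurableT_comp.
have F0 x : (0 <= (a x * (`|f x| * `|g x|))%:E)%E by rewrite lee_fin !mulr_ge0.
rewrite (ge0_integral_snoc2 mF F0).
have [m1 i1] := slice_en k1 tff; have [m2 i2] := slice_en k2 tg.
set e1 := (fun t : R => en k1 _) in m1 i1; set e2 := (fun t : R => en k2 _) in m2 i2.
have ms : measurable_fun setT (fun t : R => Num.sqrt (e1 t) * Num.sqrt (e2 t)).
  apply: measurable_funM.
    under eq_fun do rewrite -powR12_sqrt ?en_ge0//; exact: (measurableT_comp (measurable_powR _)).
  under eq_fun do rewrite -powR12_sqrt ?en_ge0//; exact: (measurableT_comp (measurable_powR _)).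
apply: (@le_trans _ _ (\int[mu]_t (M * (Num.sqrt (e1 t) * Num.sqrt (e2 t)))%:E)%E).
  apply: ae_ge0_le_integral => //.
  - by move=> t _; apply: integral_ge0 => x _; exact: F0.
  - have := @measurable_fun_fubini_tonelli_G _ _ _ _ R (leb n)
      (fun z : 'rV[R]_n * measurableTypeR R => (a (@snoc R n.+1 z.1 z.2) *
        (`|f (@snoc R n.+1 z.1 z.2)| * `|g (@snoc R n.+1 z.1 z.2)|))%:E).
    apply; last by move=> z; exact: F0.
    exact: (measurableT_comp mF (@measurable_snoc R n)).
  - by move=> t _; rewrite lee_fin !mulr_ge0// sqrtr_ge0.
  - by apply/measurable_EFinP; exact: measurable_funM.
  case: H => B [mB B0 HB]; exists B; split => // t /= nt; apply: HB => Ht.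
  by apply: nt => _; exact: Ht (tf_slice t tff) (tf_slice t tg).
under eq_integral do rewrite EFinM.
rewrite ge0_integralZl//; last exact/measurable_EFinP.
rewrite [leRHS]EFinM; apply: lee_wpmul2l; first by rewrite lee_fin.
by apply: integral_CS => //; rewrite ?en_ge0// => t; exact: en_ge0.
Qed.
End coef.

(** * Cut-off functions *)

Section smooth_inv.
Context {R : realType} {n : nat}.
Local Notation X := 'rV[R]_n.
Implicit Types f g : X -> R.

(** For v = 1/g one has pd v = - v^2 pd g, so polynomials in v with smooth coefficients are stable
    under differentiation. *)
Inductive inv_alg (v : X -> R) : (X -> R) -> Prop :=
| inv_alg_base f : smooth f -> inv_alg v f
| inv_alg_inv : inv_alg v v
| inv_alg_D f g : inv_alg v f -> inv_alg v g -> inv_alg v (f \+ g)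
| inv_alg_M f g : inv_alg v f -> inv_alg v g -> inv_alg v (f \* g).

Lemma smooth_inv g : smooth g -> (forall x, g x != 0) -> smooth (fun x => (g x)^-1).
Proof.
move=> sg g0; set v := fun x => _.
have dv : diffb v by move=> x; apply: differentiableV => //; exact: smooth_diff.
have pv i : pd i v = v \* (v \* (fun x => - pd i g x)).
  have gv : g \* v = cst 1 by apply/funext => x; rewrite /= /v divff.
  have := pdM i (smooth_diff sg) dv; rewrite gv pd_cst => e.
  apply/funext => x; have := congr1 (fun h => h x) e; rewrite /= {2 4 5}/v => {}e.
  by apply: (mulfI (g0 x)); rewrite mulVKf//; move: e => /esym/eqP; rewrite addrC addr_eq0 => /eqP
    ->; rewrite mulrN mulrC.
apply: (smooth_coind (S := inv_alg v)); last exact: inv_alg_inv.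
move=> f; elim=> {f}.
- by move=> f sf; split; [exact: smooth_diff|move=> i; apply: inv_alg_base; exact: smooth_pd].
- split=> // i; rewrite pv; apply: inv_alg_M; first exact: inv_alg_inv.
  by apply: inv_alg_M; [exact: inv_alg_inv|apply: inv_alg_base; apply: smoothN; exact: smooth_pd].
- move=> f1 f2 _ [d1 s1] _ [d2 s2]; split; first by move=> x; exact: differentiableD.
  by move=> i; rewrite pdD//; apply: inv_alg_D.
- move=> f1 f2 h1 [d1 s1] h2 [d2 s2]; split; first by move=> x; exact: differentiableM.
  by move=> i; rewrite pdM//; apply: inv_alg_D; apply: inv_alg_M.
Qed.
End smooth_inv.

Section step_function.
Context {R : realType}.

Lemma smooth1_coind (S : (R -> R) -> Prop) :
  (forall h, S h -> (forall x : R, derivable h x 1) /\ S (derive1 h)) ->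
  forall h, S h -> smooth1 h.
Proof.
move=> H h Sh k; elim: k h Sh => [|k ih] h Sh x; first by case: (H h Sh).
by rewrite derive1Sn; apply: ih; case: (H h Sh).
Qed.

(** Makes the calculus of smooth functions on row vectors, [smooth_inv] in particular, available for
    functions of one variable. *)
Lemma smooth1_rV (h : R -> R) : smooth (fun x : 'rV[R]_1 => h (x ord0 ord0)) -> smooth1 h.
Proof.
move: h; apply: smooth1_coind => h sh.
pose H (x : 'rV[R]_1) := h (x ord0 ord0).
have d (t : R) : is_derive t 1 h (pd ord0 H (t *: delta_mx 0 ord0)).
  have := is_derive_line 0 (delta_mx 0 ord0) t (smooth_diff sh).
  rewrite big_ord1 mxE eqxx mul1r add0r /H; congr is_derive.
  by apply/funext => s; rewrite !mxE eqxx add0r mulr1.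
split; first by move=> t; case: (d t).
have -> : (fun x : 'rV[R]_1 => derive1 h (x ord0 ord0)) = pd ord0 H; last exact: smooth_pd.
apply/funext => x; rewrite derive1E; have [_ ->] := d (x ord0 ord0).
by congr (pd _ _ _); apply/rowP => j; rewrite !mxE !ord1 eqxx mulr1.
Qed.

(** The power of 1/x makes the family closed under differentiation up to linear combinations: the
    derivative of member k involves members k + 1 and k + 2. *)
Definition flat (k : nat) (x : R) : R := if 0 < x then x^-1 ^+ k * expR (- x^-1) else 0.

Lemma flat_ge0 k x : 0 <= flat k x.
Proof.
rewrite /flat; case: ifP => // x0.
by rewrite mulr_ge0 ?expR_ge0// exprn_ge0// invr_ge0 ltW.
Qed.

(** From exp y >= y^(k+1) / (k+1)! at y = 1/x. A linear bound for all k is enough for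
    differentiability at 0, since the difference quotient of [flat k] there is [flat k.+1]. *)
Lemma flat_le k x : flat k x <= k.+1`!%:R * `|x|.
Proof.
rewrite /flat; case: ifP => [x0|_]; last exact: mulr_ge0.
have y0 : 0 < x^-1 by rewrite invr_gt0.
rewrite gtr0_norm// expRN ler_pdivrMr ?expR_gt0//.
have := expR_ge1Dxn k (ltW y0); set e := expR _ => H.
have F0 : 0 < k.+1`!%:R :> R by rewrite ltr0n fact_gt0.
have {}H : x^-1 ^+ k.+1 <= k.+1`!%:R * e.
  by rewrite -ler_pdivrMl// mulrC; apply: le_trans H; rewrite lerDr.
rewrite mulrAC -ler_pdivrMr//.
by rewrite -exprSr.
Qed.

Lemma is_derive_flat k (x : R) : is_derive x 1 (flat k) (- k%:R * flat k.+1 x + flat k.+2 x).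
Proof.
have [x0|x0|->] := ltgtP x 0.
- have e : \forall z \near x, 0 = flat k z.
    near=> z; rewrite /flat ifF//; apply/negbTE; rewrite -leNgt ltW//.
    by near: z; exact: lt_nbhsl.
  rewrite /flat !ifF; [|by apply/negbTE; rewrite -leNgt ltW..].
  rewrite mulr0 addr0; apply: (near_eq_is_derive e); exact: is_derive_cst.
- have e : \forall z \near x, z^-1 ^+ k * expR (- z^-1) = flat k z.
    near=> z; rewrite /flat ifT//.
    by near: z; exact: lt_nbhsr.
  apply: (near_eq_is_derive e); rewrite /flat !x0.
  have d1 : is_derive x 1 (fun z : R => z^-1) (- x^-1 ^+ 2).
    have := @is_deriveV R id x 1 1 (lt0r_neq0 x0) (is_derive_id x 1).
    by rewrite /GRing.scale/= mulr1 exprVn.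
  have d2 : is_derive x 1 (fun z : R => expR (- z^-1)) (x^-1 ^+ 2 * expR (- x^-1)).
    have := @is_derive1_comp R expR (fun z : R => - z^-1) x _ _ (is_derive_expR _) (is_deriveN d1).
    by rewrite opprK mulrC.
  have d3 : is_derive x 1 (fun z : R => z^-1 ^+ k) (- k%:R * x^-1 ^+ k.+1).
    have := @is_deriveX R R _ k x 1 _ d1.
    have -> : (k%:R * x^-1 ^+ k.-1) *: (- x^-1 ^+ 2) = - k%:R * x^-1 ^+ k.+1.
      case: k {e} => [|k]; first by rewrite !mul0r scale0r oppr0 mul0r.
      by rewrite /GRing.scale/= mulrN -mulrA -exprD addn2 mulNr.
    by rewrite exprfctE.
  have := is_deriveM d3 d2; rewrite /GRing.scale/=; congr is_derive.
  by rewrite !exprS; ring.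
- rewrite {2 3}/flat ltxx mulr0 addr0.
  have f0 : flat k 0 = 0 by rewrite /flat ltxx.
  have H : (fun h : R => h^-1 *: (flat k (h * 1 + 0) - flat k 0)) @ (0:R)^' --> (0 : R).
    apply/cvgrPdist_le => e e0; near=> h.
    rewrite mulr1 addr0 f0 subr0 sub0r normrN /GRing.scale/=.
    have -> : h^-1 * flat k h = flat k.+1 h.
      by rewrite /flat; case: ifP => _; rewrite ?mulr0// exprS mulrA.
    rewrite ger0_norm ?flat_ge0//; apply: (le_trans (flat_le _ _)).
    have F0 : 0 < k.+2`!%:R :> R by rewrite ltr0n fact_gt0.
    rewrite mulrC -ler_pdivlMr//; near: h; apply: dnbhs0_le; exact: divr_gt0.
  apply: DeriveDef; first by apply/cvg_ex; exists 0.
  exact: cvg_lim.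
Unshelve. all: by end_near. Qed.

Inductive flat_alg : (R -> R) -> Prop :=
| flat_alg_base k : flat_alg (flat k)
| flat_alg_D f g : flat_alg f -> flat_alg g -> flat_alg (f \+ g)
| flat_alg_Z c f : flat_alg f -> flat_alg (fun x => c * f x).

Lemma smooth1_flat k : smooth1 (flat k).
Proof.
apply: (smooth1_coind (S := flat_alg)); last exact: flat_alg_base.
move=> f; elim=> {f k} [k|f g _ [df ff] _ [dg fg]|c f _ [df ff]].
- split; first by move=> x; have [] := is_derive_flat k x.
  have -> : derive1 (flat k) = (fun x => - k%:R * flat k.+1 x) \+ flat k.+2.
    by apply/funext => x; rewrite derive1E; have [_ ->] := is_derive_flat k x.
  by apply: flat_alg_D; [apply: flat_alg_Z|]; exact: flat_alg_base.
- split; first by move=> x; exact: derivableD.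
  have -> : derive1 (f \+ g) = derive1 f \+ derive1 g.
    by apply/funext => x; rewrite /= !derive1E -deriveD.
  exact: flat_alg_D.
- split; first by move=> x; exact: derivableZ.
  have -> : derive1 (fun x => c * f x) = fun x => c * derive1 f x.
    by apply/funext => x; rewrite /= !derive1E -[RHS]/(c *: _) -deriveZ.
  exact: flat_alg_Z.
Qed.

Lemma smooth_step : exists h : R -> R, [/\ smooth1 h, forall t, 0 <= h t <= 1,
  forall t, t <= 0 -> h t = 0 & forall t, 1 <= t -> h t = 1].
Proof.
pose e := flat 0; have se : smooth1 e by exact: smooth1_flat.
have e0 t : 0 <= e t by exact: flat_ge0.
have en0 t : t <= 0 -> e t = 0 by move=> t0; rewrite /e /flat ltNge t0.
have ep t : 0 < t -> 0 < e t.
  by move=> t0; rewrite /e /flat t0 mulr_gt0 ?expR_gt0.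
have den t : 0 < e t + e (1 - t).
  have [t0|t0] := ltP 0 t; first by rewrite ltr_pwDl// ep.
  by rewrite ltr_wpDl// ep//; lra.
(* The denominator is positive because t and 1 - t are never both nonpositive. *)
exists (fun t => e t / (e t + e (1 - t))); split.
- apply: smooth1_rV.
  pose E (x : 'rV[R]_1) := e (x ord0 ord0); pose E' (x : 'rV[R]_1) := e (1 - x ord0 ord0).
  have sE : smooth E by apply: (smooth_comp se); exact: smooth_coord.
  have sE' : smooth E'.
    by apply: (smooth_comp se); apply: smoothB; [exact: (smooth_cst 1)|exact: smooth_coord].
  apply: (@smoothM _ _ E (fun x => (E x + E' x)^-1)) => //.
  apply: smooth_inv; first exact: smoothD.
  by move=> x; rewrite gt_eqF// den.
- move=> t; rewrite divr_ge0 ?(ltW (den t))//= ler_pdivrMr ?den// mul1r lerDl//.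
- by move=> t t0; rewrite (en0 t)// mul0r.
- by move=> t t1; rewrite (en0 (1 - t)) ?subr_le0// addr0 divff// gt_eqF// ep//; lra.
Qed.

(** Every derivative is constant on each side of [0, 1] and continuous on it, hence bounded; a sum
    over the orders up to K gives one constant. *)
Lemma step_bounds (h : R -> R) (K : nat) : smooth1 h ->
  (forall t, t <= 0 -> h t = 0) -> (forall t, 1 <= t -> h t = 1) ->
  exists2 C, 0 <= C & forall k t, (k <= K)%N -> `|derive1n k h t| <= C.
Proof.
move=> sh h0 h1.
have dcst (g : R -> R) (c t : R) : (\forall z \near t, g z = c) -> derive1 g t = 0.
  by move=> H; rewrite derive1E (near_eq_derive (g := cst c) _ H) ?derive_cst// oner_neq0.
have out k : (forall t, t < 0 -> derive1n k h t = 0) /\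
   exists c, forall t, 1 < t -> derive1n k h t = c.
  elim: k => [|k [ih0 [c ih1]]].
    by split=> [t t0|]; [exact/h0/ltW|exists 1 => t t1; exact/h1/ltW].
  split=> [t t0|]; last (exists 0 => t t1).
    by rewrite derive1nS; apply: (dcst _ 0); near=> z; apply: ih0; near: z; exact: lt_nbhsl.
  by rewrite derive1nS; apply: (dcst _ c); near=> z; apply: ih1; near: z; exact: lt_nbhsr.
have one k : exists2 C, 0 <= C & forall t, `|derive1n k h t| <= C.
  have [oL [c oR]] := out k.
  have ck : continuous (fun t => `|derive1n k h t|).
    move=> t; apply: (@continuous_comp _ _ _ (derive1n k h) (fun z : R => `|z|)); last exact:
      norm_continuous.
    by apply: differentiable_continuous; apply/derivable1_diffP; exact: sh.
  have [|s _ Hs] := @EVT_max R (fun t => `|derive1n k h t|) 0 1 ler01.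
    exact: continuous_subspaceT.
  exists (`|derive1n k h s| + `|c|); first exact: addr_ge0.
  move=> t; have [t0|t0] := ltP t 0; first by rewrite oL// normr0 addr_ge0.
  have [t1|t1] := ltP 1 t; first by rewrite oR// lerDr.
  by apply: ler_wpDr => //; apply: Hs; rewrite in_itv/= t0.
elim: K => [|K [C C0 H]].
  by have [C C0 H] := one 0%N; exists C => // k t; rewrite leqn0 => /eqP ->.
have [C' C'0 H'] := one K.+1; exists (C + C'); first exact: addr_ge0.
move=> k t; rewrite leq_eqVlt => /predU1P[->|kK]; first exact: ler_wpDl.
by apply: ler_wpDr => //; exact: H.
Unshelve. all: by end_near. Qed.
End step_function.

Section cutoff.
Context {R : realType}.

Lemma pdZ n j c (f : 'rV[R]_n -> R) : smooth f -> pd j (fun x => c * f x) = fun x => c * pd j f x.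
Proof. exact: (pderiveZ [:: j] c). Qed.

Lemma dbound_affine n K C (h : R -> R) (al be : R) (i : 'I_n) : smooth1 h ->
  (forall k t, (k <= K)%N -> `|derive1n k h t| <= C) ->
  dbound K C `|al| (fun x : 'rV[R]_n => h (al * x ord0 i + be)).
Proof.
move=> sh hC.
pose aff (x : 'rV[R]_n) := al * x ord0 i + be.
have saff : smooth aff.
  by apply: smoothD; [apply: smoothZ; exact: smooth_coord|exact: (smooth_cst be)].
have paff j : pd j aff = cst (al * (j == i)%:R).
  rewrite /aff (@pdD _ _ j (fun x : 'rV[R]_n => al * x ord0 i) (cst be)); last 2 first.
  - by apply: smooth_diff; apply: smoothZ; exact: smooth_coord.
  - exact: smooth_diff (smooth_cst _).
  apply/funext => x; rewrite /= pd_cst/= addr0.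
  by rewrite (pdZ j al (smooth_coord i)) pd_coord eq_sym.
have shk k : smooth1 (derive1n k h).
  elim: k => [|k ih]; first exact: sh.
  by rewrite derive1nS; exact: smooth1_derive ih.
have E s : exists c, `|c| <= `|al| ^+ size s /\
   pderive s (fun x : 'rV[R]_n => h (aff x)) = fun x => c * derive1n (size s) h (aff x).
  elim: s => [|j s [c [cl Es]]].
    by exists 1; split; [rewrite normr1|apply/funext => x; rewrite mul1r].
  exists (c * (al * (j == i)%:R)); split.
    rewrite [size _]/= exprSr !normrM ler_pM//.
    by case: (j == i); rewrite ?normr1 ?mulr1// normr0 mulr0.
  rewrite pderive_cons Es; apply/funext => x.
  have sk : smooth (fun x => derive1n (size s) h (aff x)) by exact: smooth_comp (shk _) saff.
  rewrite (pdZ j c sk).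
  have -> : pd j (fun x => derive1n (size s) h (aff x)) =
      (derive1 (derive1n (size s) h) \o aff) \* pd j aff.
    by apply: pd_comp; [move=> t; exact: sh|exact: smooth_diff].
  by rewrite paff /= -derive1nS -mulrA; congr (_ * _); rewrite mulrC.
split; first exact: (smooth_comp sh saff).
move=> s x sK; have [c [cl ->]] := E s.
rewrite normrM mulrC ler_pM//; exact: hC.
Qed.

Lemma dbound_cst n K r (c : R) : 0 <= r -> dbound K `|c| r (fun _ : 'rV[R]_n => c).
Proof.
move=> r0; split; first exact: (smooth_cst c).
move=> [|i s] x _; rewrite (pderive_cst _ c) ?mulr1//=.
by rewrite normr0 mulr_ge0// exprn_ge0.
Qed.

Lemma dbound_prod n K M r (I : Type) (s : seq I) (F : I -> 'rV[R]_n -> R) : 0 <= M -> 0 <= r ->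
  (forall i, dbound K M r (F i)) ->
  dbound K ((2 ^+ K * M) ^+ size s) r (fun x => \prod_(i <- s) F i x).
Proof.
move=> M0 r0 HF; elim: s => [|i s ih].
  under eq_fun do rewrite big_nil; rewrite expr0.
  by have := @dbound_cst n K r 1 r0; rewrite normr1.
under eq_fun do rewrite big_cons.
rewrite [size _]/= exprS -mulrA; apply: dboundM => //.
by rewrite exprn_ge0// mulr_ge0// exprn_ge0.
Qed.

Lemma rV_norm_lt n (x : 'rV[R]_n) (r : R) : 0 < r -> (forall i, `|x ord0 i| < r) -> `|x| < r.
Proof.
move=> r0 H; rewrite /Num.norm/= mx_normrE; apply/bigmax_ltP; split=> // -[i j] _ /=.
by rewrite (ord1 i).
Qed.

(** A product over the coordinates of two steps each, since balls of the maximum norm are cubes. M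
    is fixed before c, a and b because the steps are affine reparametrisations of one function,
    whose k-th derivative only gains (b - a)^(-k). *)
Lemma cutoff n K : exists2 M : R, 0 <= M & forall (c : 'rV[R]_n) (a b : R), 0 <= a < b ->
  exists h : 'rV[R]_n -> R, [/\ dbound K M (b - a)^-1 h, forall x, 0 <= h x <= 1,
    forall x, `|x - c| <= a -> h x = 1 & forall x, b <= `|x - c| -> h x = 0].
Proof.
have [h [sh h01 h0 h1]] := @smooth_step R.
have [C C0 hC] := step_bounds K sh h0 h1.
pose M1 := 2 ^+ K * (C * C).
have M10 : 0 <= M1 by rewrite mulr_ge0 ?exprn_ge0// mulr_ge0.
exists ((2 ^+ K * M1) ^+ n); first by rewrite exprn_ge0// mulr_ge0// exprn_ge0.
move=> c a b /andP[a0 ab]; pose r := (b - a)^-1.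
have ba : 0 < b - a by rewrite subr_gt0.
have r0 : 0 < r by rewrite invr_gt0.
pose F (i : 'I_n) (x : 'rV[R]_n) := h (- r * x ord0 i + r * (b + c ord0 i)) *
  h (r * x ord0 i + r * (b - c ord0 i)).
have F01 i x : 0 <= F i x <= 1.
  rewrite /F; have /andP[p0 p1] := h01 (- r * x ord0 i + r * (b + c ord0 i)).
  have /andP[q0 q1] := h01 (r * x ord0 i + r * (b - c ord0 i)).
  by rewrite mulr_ge0//= mulr_ile1.
exists (fun x => \prod_(i < n) F i x); split.
- have := @dbound_prod n K M1 r _ (index_enum 'I_n) F M10 (ltW r0).
  rewrite /index_enum -enumT size_enum_ord; apply => i.
  apply: dboundM => //; first exact: ltW.
  - have := @dbound_affine n K C h (- r) (r * (b + c ord0 i)) i sh hC.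
    by rewrite normrN gtr0_norm.
  - have := @dbound_affine n K C h r (r * (b - c ord0 i)) i sh hC.
    by rewrite gtr0_norm.
- move=> x; rewrite prodr_ge0/=; last by move=> i _; case/andP: (F01 i x).
  by rewrite Num.Theory.prodr_ile1// => i _; exact: F01.
- move=> x xa; rewrite big1// => i _.
  have := le_trans (rV_norm_coord (x - c) i) xa; rewrite !mxE ler_norml => /andP[l1 l2].
  rewrite /F !h1 ?mulr1//.
    have -> : r * x ord0 i + r * (b - c ord0 i) = (b + (x ord0 i - c ord0 i)) / (b - a) by rewrite
      /r; ring.
    by rewrite ler_pdivlMr//; lra.
  have -> : - r * x ord0 i + r * (b + c ord0 i) = (b - (x ord0 i - c ord0 i)) / (b - a) by rewrite
    /r; ring.
  by rewrite ler_pdivlMr//; lra.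
- move=> x bx; have [i bi] : exists i, b <= `|(x - c) ord0 i|.
    apply: contrapT => H; move: bx; rewrite leNgt => /negP; apply.
    apply: rV_norm_lt; first by apply: le_lt_trans ab.
    by move=> i; rewrite ltNge; apply/negP => bi; apply: H; exists i.
  rewrite (bigD1 i)//=; rewrite [F i x](_ : _ = 0) ?mul0r//.
  move: bi; rewrite !mxE ler_normr => /orP[bi|bi]; rewrite /F.
    rewrite h0 ?mul0r//.
    have -> : - r * x ord0 i + r * (b + c ord0 i) = (b - (x ord0 i - c ord0 i)) * r by ring.
    by rewrite pmulr_lle0//; lra.
  rewrite [X in _ * X]h0 ?mulr0//.
  have -> : r * x ord0 i + r * (b - c ord0 i) = (b + (x ord0 i - c ord0 i)) * r by ring.
  by rewrite pmulr_lle0//; lra.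
Qed.

Lemma lebesgue_ccube n (r : R) : 0 <= r -> lebesgue_rV n (@ccube R n r) = ((r + r) ^+ n)%:E.
Proof.
move=> r0; rewrite lebesgue_rV_box; last by move=> i; exact: measurable_itv.
under eq_bigr do rewrite lebesgue_measure_itv/= lte_fin.
rewrite (eq_bigr (fun=> (r + r)%:E)); last first.
  move=> i _; case: ifPn => [_|]; first by rewrite opprK.
  rewrite -leNgt => rr; suff -> : r = 0 by rewrite addr0.
  by lra.
by rewrite prodEFin prodr_const card_ord.
Qed.

Lemma mollifier n (rho : R) : 0 < rho -> exists phi : 'rV[R]_n -> R,
  [/\ smooth phi, forall x, 0 <= phi x, forall x, rho <= `|x| -> phi x = 0 & itg phi = 1].
Proof.
move=> r0; have [M M0 H] := cutoff n 0.
have h2 : 0 <= rho / 2 < rho by apply/andP; split; lra.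
have [h [[sh _] h01 h1 h0]] := H 0 _ _ h2.
have ch : cb h.
  split; first exact: smooth_continuous.
  by exists rho => x rx; apply: h0; rewrite subr0 ltW.
have hge0 x : 0 <= h x by case/andP: (h01 x).
have I0 : 0 < itg h.
  rewrite -lte_fin -itg_EFin//.
  have r2 : 0 <= rho / 2 by lra.
  apply: (@lt_le_trans _ _ (lebesgue_rV n (@ccube R n (rho / 2)))).
    by rewrite lebesgue_ccube// lte_fin exprn_gt0//; lra.
  rewrite -[X in lebesgue_rV n X]setIT -integral_indic//; last exact: measurable_ccube.
  apply: ge0_le_integral => //.
  - by apply/measurable_EFinP; apply: measurable_indic; exact: measurable_ccube.
  - by apply/measurable_EFinP; exact: measurable_cb.
  - move=> x _; rewrite lee_fin indicE; case: (boolP (_ \in _)) => //.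
    by rewrite inE => /(ccubeP _ r2) xr; rewrite h1// subr0.
exists (fun x => (itg h)^-1 * h x); split.
- exact: smoothZ.
- by move=> x; rewrite mulr_ge0// invr_ge0 ltW.
- by move=> x rx; rewrite h0 ?mulr0// subr0.
- by rewrite itgZ// mulVf// gt_eqF.
Qed.
End cutoff.

(** * Mollification *)

Section approximation.
Context {R : realType} {n : nat} (p : nat) (p0 : (0 < p)%N).
Local Notation X := 'rV[R]_n.
Local Notation leb := (@lebesgue_rV R n).
Implicit Types (v w f : X -> R).

(** Approximability by test functions as a predicate: density in L^p is obtained by closing it under
    the operations that lead from boxes to measurable functions. *)
Definition apx v := measurable_fun setT v /\ forall e : R, 0 < e ->
  exists2 f, tf f & (\int[leb]_x (`|v x - f x| ^+ p)%:E <= e%:E)%E.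

Lemma expr_normD (x y : R) : `|x + y| ^+ p <= 2 ^+ p * (`|x| ^+ p + `|y| ^+ p).
Proof.
apply: (@le_trans _ _ ((2 * Num.max `|x| `|y|) ^+ p)).
  rewrite lerXn2r ?nnegrE ?mulr_ge0 ?le_max ?normr_ge0//.
  apply: (le_trans (ler_normD _ _)); rewrite mulr_natl mulr2n.
  by apply: lerD; rewrite le_max lexx ?orbT.
rewrite exprMn ler_wpM2l ?exprn_ge0//.
by case: (leP `|x| `|y|) => _; rewrite ?lerDl ?lerDr exprn_ge0.
Qed.

Lemma measurable_normX v : measurable_fun setT v -> measurable_fun setT (fun x => `|v x| ^+ p).
Proof. by move=> mv; apply: measurable_funX; exact: measurableT_comp. Qed.

Lemma measurable_normXB v w : measurable_fun setT v -> measurable_fun setT w ->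
  measurable_fun setT (fun x => (`|v x - w x| ^+ p)%:E).
Proof.
move=> mv mw; apply/measurable_EFinP.
by apply: (@measurable_normX (fun x => v x - w x)); exact: measurable_funB.
Qed.

Lemma ge0_integralD_le (A B : R) v w w' : measurable_fun setT v -> measurable_fun setT w ->
  measurable_fun setT w' ->
  (\int[leb]_x (`|v x - w x| ^+ p)%:E <= A%:E)%E ->
  (\int[leb]_x (`|w x - w' x| ^+ p)%:E <= B%:E)%E ->
  (\int[leb]_x (`|v x - w' x| ^+ p)%:E <= (2 ^+ p * (A + B))%:E)%E.
Proof.
move=> mv mw mw' HA HB.
apply: (@le_trans _ _ (\int[leb]_x ((2 ^+ p)%:E * ((`|v x - w x| ^+ p)%:E + (`|w x - w' x| ^+
  p)%:E)))%E).
  apply: ge0_le_integral => //.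
  - exact: measurable_normXB.
  - by apply: measurable_funeM; apply: emeasurable_funD; exact: measurable_normXB.
  move=> x _; rewrite -EFinD -EFinM lee_fin.
  have -> : v x - w' x = (v x - w x) + (w x - w' x) by ring.
  exact: expr_normD.
rewrite ge0_integralZl//; last 2 first.
- by apply: emeasurable_funD; exact: measurable_normXB.
- by move=> x _; rewrite adde_ge0// lee_fin exprn_ge0.
rewrite ge0_integralD//; [|exact: measurable_normXB..].
rewrite [leRHS]EFinM; apply: lee_wpmul2l; first by rewrite lee_fin exprn_ge0.
by rewrite EFinD leeD.
Qed.

Lemma apx_lim v : measurable_fun setT v ->
  (forall e : R, 0 < e -> exists2 w, apx w & (\int[leb]_x (`|v x - w x| ^+ p)%:E <= e%:E)%E) ->
  apx v.
Proof.
move=> mv H; split=> // e e0.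
pose e' := e / (2 ^+ p * 2).
have c0 : 0 < 2 ^+ p * 2 :> R by rewrite mulr_gt0// exprn_gt0.
have e'0 : 0 < e' by rewrite divr_gt0.
have [w [mw /(_ _ e'0)[f tff wf]] vw] := H _ e'0.
exists f => //; have := ge0_integralD_le mv mw (measurable_cb (tf_cb tff)) vw wf.
by have -> : 2 ^+ p * (e' + e') = e by rewrite /e'; field; rewrite !gt_eqF// exprn_gt0.
Qed.

Lemma apx_tf f : tf f -> apx f.
Proof.
move=> tff; split=> [|e e0]; first exact: measurable_cb (tf_cb tff).
exists f => //; under eq_integral do rewrite subrr normr0 expr0n (gtn_eqF p0).
by rewrite integral0 lee_fin ltW.
Qed.

Lemma apxD v w : apx v -> apx w -> apx (fun x => v x + w x).
Proof.
move=> [mv Hv] [mw Hw]; split=> [|e e0]; first exact: measurable_funD.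
pose e' := e / (2 ^+ p * 2).
have c0 : 0 < 2 ^+ p * 2 :> R by rewrite mulr_gt0// exprn_gt0.
have e'0 : 0 < e' by rewrite divr_gt0.
have [f tff vf] := Hv _ e'0; have [g tg wg] := Hw _ e'0.
have mf := measurable_cb (tf_cb tff); have mg := measurable_cb (tf_cb tg).
exists (f \+ g); first exact: tfD.
have := @ge0_integralD_le e' e' (fun x => v x + w x) (fun x => f x + w x) (f \+ g).
have -> : 2 ^+ p * (e' + e') = e by rewrite /e'; field; rewrite !gt_eqF// exprn_gt0.
apply; [exact: measurable_funD..| |].
- apply: le_trans vf; rewrite le_eqVlt; apply/orP; left; apply/eqP; apply: eq_integral => x _.
  by congr (`|_| ^+ _)%:E; ring.
- apply: le_trans wg; rewrite le_eqVlt; apply/orP; left; apply/eqP; apply: eq_integral => x _.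
  by congr (`|_| ^+ _)%:E; rewrite /=; ring.
Qed.

Lemma apxZ c v : apx v -> apx (fun x => c * v x).
Proof.
move=> [mv Hv]; split=> [|e e0]; first exact: measurable_funM.
have c0 : 0 < `|c| ^+ p + 1 by rewrite ltr_wpDl// exprn_ge0.
have e'0 : 0 < e / (`|c| ^+ p + 1) by rewrite divr_gt0.
have [f tff vf] := Hv _ e'0; have mf := measurable_cb (tf_cb tff).
exists (fun x => c * f x); first exact: tfZ.
under eq_integral do rewrite -mulrBr normrM exprMn EFinM.
rewrite ge0_integralZl//; last exact: measurable_normXB.
apply: (le_trans (lee_wpmul2l _ vf)); first by rewrite lee_fin exprn_ge0.
rewrite -EFinM lee_fin mulrA ler_pdivrMr// [leRHS]mulrC ler_wpM2r ?(ltW e0)//.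
by rewrite lerDl.
Qed.

Lemma apx_sum (I : Type) (s : seq I) (F : I -> X -> R) :
  (forall i, apx (F i)) -> apx (fun x => \sum_(i <- s) F i x).
Proof.
move=> H; elim: s => [|i s ih]; first by under eq_fun do rewrite big_nil; exact/apx_tf/tf0.
by under eq_fun do rewrite big_cons; exact: apxD.
Qed.

Lemma apx_dominated v (w : nat -> X -> R) (g : X -> R) : measurable_fun setT v ->
  (forall k, apx (w k)) -> (forall x, w k x @[k --> \oo] --> v x) ->
  (forall k x, `|v x - w k x| <= g x) ->
  leb.-integrable setT (fun x => (g x ^+ p)%:E) -> apx v.
Proof.
move=> mv aw wv vg ig; apply: apx_lim => // e e0.
have mw k : measurable_fun setT (w k) by case: (aw k).
have H : ((\int[leb]_x (`|v x - w k x| ^+ p)%:E)%E @[k --> \oo] --> (\int[leb]_x (cst 0%E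
  x))%E)%classic.
  apply: (dominated_cvg _ _ _ _ ig) => //.
  - by move=> k; exact: measurable_normXB.
  - move=> x _; have -> : cst 0%E x = (`|v x - v x| ^+ p)%:E :> \bar R.
      by rewrite subrr normr0 expr0n (gtn_eqF p0).
    apply: cvg_EFin; first exact: nearW.
    apply: (cvg_comp (fun k => `|v x - w k x|) (fun z : R => z ^+ p)); last exact: exprn_continuous.
    by apply: cvg_norm; apply: cvgB; [exact: cvg_cst|exact: wv].
  - move=> k x _; rewrite gee0_abs lee_fin ?exprn_ge0//.
    by rewrite lerXn2r ?nnegrE// (le_trans _ (vg k x)).
rewrite integral0 in H.
move/fine_cvgP: H => [fin Hf].
have /cvgrPdist_le /(_ e e0) Hf' := Hf.
near \oo => k; exists (w k) => //.
have fk : (\int[leb]_x (`|v x - w k x| ^+ p)%:E)%E \is a fin_num by near: k.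
rewrite -(fineK fk) lee_fin.
have : `|0 - fine (\int[leb]_x (`|v x - w k x| ^+ p)%:E)%E| <= e by near: k.
by rewrite sub0r normrN; apply: le_trans; exact: ler_norm.
Unshelve. all: by end_near. Qed.

(** As k grows, h (k (x - a)) tends to the indicator of x > a and h (1 - k (x - b)) to that of x <=
    b, at every point and with the endpoints of a half-open interval. *)
Lemma apx_box (a b : 'I_n -> R) : apx (\1_(box (fun i => `]a i, b i]%classic)) : X -> R).
Proof.
set B := box _; have [h [sh h01 h0 h1]] := @smooth_step R.
pose F (k : nat) (i : 'I_n) (x : X) :=
  h (k%:R * x ord0 i + - (k%:R * a i)) * h (- k%:R * x ord0 i + (k%:R * b i + 1)).
have F01 k i x : 0 <= F k i x <= 1.
  rewrite /F; have /andP[q0 q1] := h01 (k%:R * x ord0 i + - (k%:R * a i)).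
  have /andP[r0 r1] := h01 (- k%:R * x ord0 i + (k%:R * b i + 1)).
  by rewrite mulr_ge0//= mulr_ile1.
have sF k : smooth (fun x : X => \prod_(i < n) F k i x).
  apply: smooth_prod => i _.
  by apply: smoothM; apply: (smooth_comp sh); apply: (@smoothD _ _ (fun x : X => _ * x ord0 i) (cst
    _));
    solve [exact: smooth_cst|apply: smoothZ; exact: smooth_coord].
pose r := \sum_i (`|a i| + `|b i| + 1).
have r0 : 0 <= r by apply: sumr_ge0 => i _; rewrite !addr_ge0.
have Fr k (x : X) : r < `|x| -> \prod_(i < n) F k.+1 i x = 0.
  move=> rx; have [i ri] : exists i, `|a i| + `|b i| + 1 < `|x ord0 i|.
    apply: contrapT => H; move: rx; rewrite ltNge => /negP; apply.
    apply/rV_norm_le => // i; apply: (@le_trans _ _ (`|a i| + `|b i| + 1)).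
      by rewrite leNgt; apply/negP => ?; apply: H; exists i.
    by rewrite /r (bigD1 i)//= lerDl sumr_ge0// => j _; rewrite !addr_ge0.
  rewrite (bigD1 i)//= /F.
  have k0 : 1 <= k.+1%:R :> R by rewrite ler1n.
  have [xa|xa] := leP (x ord0 i) (a i).
    rewrite h0 ?mul0r//; nra.
  rewrite [X in _ * X * _]h0 ?mulr0 ?mul0r//.
  have := normr_ge0 (a i); have := ler_norm (- a i); have := ler_norm (b i); rewrite normrN.
  have : x ord0 i > b i + 1.
    move: ri; rewrite ltr_normr => /orP[]; have := normr_ge0 (b i);
    have := normr_ge0 (a i); have := ler_norm (- a i); have := ler_norm (b i); rewrite normrN; lra.
  nra.
apply: (@apx_dominated _ (fun k x => \prod_(i < n) F k.+1 i x) (\1_(ccube r) : X -> R)).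
- by apply: measurable_indic; apply: measurable_ocbox; exists a, b.
- by move=> k; apply: apx_tf; split => //; exists r => x; exact: Fr.
- move=> x; rewrite /indic.
  have [xB|xB] := boolP (x \in B).
    rewrite inE in xB.
    apply: cvg_near_cst.
    have Hi (i : 'I_n) : \forall k \near \oo, F k.+1 i x = 1.
      have := xB i; rewrite /= in_itv/= => /andP[ai bi].
      near=> k; rewrite /F !h1 ?mulr1//.
        have : 0 <= k.+1%:R :> R by []. nra.
      have : (x ord0 i - a i)^-1 <= k.+1%:R.
        apply: (@le_trans _ _ k%:R); last by rewrite ler_nat.
        by near: k; exact: nbhs_infty_ger.
      by rewrite -mulrBr -ler_pdivrMr ?subr_gt0// div1r.
    have : \forall k \near \oo, forall i, F k.+1 i x = 1 by apply: filter_forall.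
    by apply: filterS => k H; rewrite big1.
  rewrite notin_setE in xB.
  have [i Hi] : exists i, ~ (a i < x ord0 i <= b i).
    by apply: contrapT => H; apply: xB => i; rewrite /= in_itv/=; apply: contrapT => ?; apply: H;
      exists i.
  apply: cvg_near_cst; near=> k; rewrite (bigD1 i)//= /F.
  have k0 : 0 <= k.+1%:R :> R by [].
  have [xa|xa] := leP (x ord0 i) (a i).
    rewrite h0 ?mul0r//; nra.
  rewrite [X in _ * X * _]h0 ?mulr0 ?mul0r//.
  have bi : b i < x ord0 i by rewrite ltNge; apply/negP => ?; apply: Hi; rewrite xa.
  have : (x ord0 i - b i)^-1 <= k.+1%:R.
    apply: (@le_trans _ _ k%:R); last by rewrite ler_nat.
    by near: k; exact: nbhs_infty_ger.
  rewrite -div1r ler_pdivrMr ?subr_gt0// => K1.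
  rewrite (_ : _ + _ = 1 - k.+1%:R * (x ord0 i - b i)) ?subr_le0//; ring.
- move=> k x; have [xr|xr] := leP `|x| r.
    have -> : (\1_(ccube r) x : R) = 1 by rewrite indicE mem_set//; exact/ccubeP.
    have : 0 <= \prod_(i < n) F k.+1 i x <= 1.
      rewrite prodr_ge0/=; last by move=> i _; case/andP: (F01 k.+1 i x).
      by rewrite Num.Theory.prodr_ile1// => i _; exact: F01.
    have : 0 <= (\1_B x : R) <= 1 by rewrite indicE; case: (_ \in _); rewrite ?lexx ler01.
    by move=> /andP[? ?] /andP[? ?]; rewrite ler_norml; apply/andP; split; lra.
  rewrite Fr// subr0 indicE memNset ?normr0 ?indicE//.
  move=> xB; move: xr; rewrite ltNge => /negP; apply; apply/rV_norm_le => // i.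
  have := xB i; rewrite /= in_itv/= => /andP[ax xb].
  apply: (@le_trans _ _ (`|a i| + `|b i| + 1)).
    rewrite ler_norml; have := normr_ge0 (a i); have := ler_norm (- a i); have := ler_norm (b i);
      rewrite normrN.
    by have := normr_ge0 (b i); move=> *; apply/andP; split; lra.
  by rewrite /r (bigD1 i)//= lerDl sumr_ge0// => j _; rewrite !addr_ge0.
- under eq_fun do rewrite indicE -natrX -[X in (X ^ p)%N]/(nat_of_bool _).
  rewrite (_ : (fun x => _) = EFin \o (\1_(@ccube R n r) : X -> R)); last first.
    by apply/funext => x /=; rewrite indicE; case: (_ \in _); rewrite ?exp1n ?exp0n.
  apply/integrableP; split; first by apply/measurable_EFinP; apply: measurable_indic; exact:
    measurable_ccube.
  under eq_integral do rewrite /= ger0_norm//.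
  by rewrite integral_indic ?setIT ?lebesgue_ccube_lty//; exact: measurable_ccube.
Unshelve. all: by end_near. Qed.
End approximation.
Import HBNNSimple.
Section approximation2.
Context {R : realType} {n : nat} (p : nat) (p0 : (0 < p)%N).
Local Notation X := 'rV[R]_n.
Local Notation leb := (@lebesgue_rV R n).
Implicit Types (v w f : X -> R).

Lemma indicE_expr (A : set X) : (fun x => (((\1_A : X -> R) x) ^+ p)%:E) = EFin \o \1_A.
Proof.
by apply/funext => x /=; rewrite indicE; case: (_ \in _); rewrite ?expr1n ?expr0n ?gtn_eqF.
Qed.

Lemma integrable_indic_cbox (N : nat) : leb.-integrable setT (EFin \o (\1_(@cbox R n N) : X -> R)).
Proof.
have mc : measurable (@cbox R n N : set X) by apply: measurable_ocbox; exists (fun=> - N%:R),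
  (fun=> N%:R).
apply/integrableP; split; first by apply/measurable_EFinP; apply: measurable_indic.
under eq_integral do rewrite /= ger0_norm//.
by rewrite integral_indic ?setIT ?lebesgue_cbox_lty.
Qed.

(** Dynkin induction on A. The intersection with a fixed box keeps complements and countable unions
    dominated by an integrable function. *)
Lemma apx_indic (A : set X) (N : nat) : measurable A -> apx p (\1_(A `&` @cbox R n N) : X -> R).
Proof.
have mc : measurable (@cbox R n N : set X) by apply: measurable_ocbox; exists (fun=> - N%:R),
  (fun=> N%:R).
move=> mA; pose P (A : set X) := apx p (\1_(A `&` @cbox R n N) : X -> R).
have : <<s @ocbox R n >> A by rewrite -measurable_rV_ocbox.
have D := @dynkin_induction _ X (@ocbox R n) P (@measurable_rV_ocbox R n) (@setI_closed_ocbox R n).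
move=> sA; refine (D _ _ _ _ A sA).
- by rewrite /P setTI; exact: apx_box.
- move=> B oB; rewrite /P; have [a [b ->]] : ocbox (B `&` @cbox R n N); last exact: apx_box.
  by apply: setI_closed_ocbox => //; exists (fun=> - N%:R), (fun=> N%:R).
- move=> S mS PS; rewrite /P.
  have -> : (\1_(~` S `&` @cbox R n N) : X -> R) =
      fun x => \1_(@cbox R n N) x + (-1) * \1_(S `&` @cbox R n N) x.
    apply/funext => x; rewrite mulN1r !indicE !in_setI in_setC.
    by case: (x \in S); case: (x \in @cbox R n N); rewrite /= ?subrr ?subr0.
  by apply: apxD => //; [exact: apx_box|exact: apxZ].
- move=> F mF tF PF; rewrite /P.
  apply: (@apx_dominated _ _ _ p0 _ (fun k x => \sum_(j < k) (\1_(F j `&` @cbox R n N) : X -> R) x)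
    (\1_(@cbox R n N))).
  + apply: measurable_indic; apply: measurableI => //; exact: bigcup_measurable.
  + move=> k; apply: (@apx_sum _ _ _ p0 _ _ (fun (j : 'I_k) => \1_(F j `&` @cbox R n N))).
    by move=> j; exact: PF.
  + move=> x; have [[i Fi]|nF] := pselect (exists i, (F i `&` @cbox R n N) x).
      apply: cvg_near_cst; exists i.+1 => // k /= ik.
      rewrite [RHS]indicE mem_set; last by case: Fi => ? ?; split => //; exists i.
      rewrite (bigD1 (Ordinal ik))//= indicE mem_set// big1 ?addr0// => j ji.
      rewrite indicE memNset// => -[Fj _]; case: Fi => Fi _.
      have /trivIsetP /(_ j i I I) := tF; rewrite (_ : (j : nat) != i)//.
      by move=> /(_ isT)/seteqP[+ _] => /(_ x); apply.
    apply: cvg_near_cst; near=> k.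
    rewrite [RHS]indicE memNset; last by move=> -[[i _ Fi] cx]; apply: nF; exists i.
    by rewrite big1// => j _; rewrite indicE memNset// => Fj; apply: nF; exists j.
  + move=> k x.
    have s01 : 0 <= \sum_(j < k) (\1_(F j `&` @cbox R n N) : X -> R) x <= (\1_(\bigcup_k F k `&`
      @cbox R n N) : X -> R) x.
      rewrite sumr_ge0//=.
      have [[i Fi]|nF] := pselect (exists i : 'I_k, (F i `&` @cbox R n N) x).
        rewrite [leRHS]indicE mem_set; last by case: Fi => ? ?; split => //; exists i.
        rewrite (bigD1 i)//= indicE mem_set// big1 ?addr0// => j ji.
        rewrite indicE memNset// => -[Fj _]; case: Fi => Fi _.
        have /trivIsetP /(_ j i I I) := tF; rewrite (_ : (j : nat) != i)//.
        by move=> /(_ isT)/seteqP[+ _] => /(_ x); apply.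
      by rewrite big1// => j _; rewrite indicE memNset// => Fj; apply: nF; exists j.
    have : (\1_(\bigcup_k F k `&` @cbox R n N) : X -> R) x <= \1_(@cbox R n N) x.
      rewrite !indicE in_setI; case: (_ \in @cbox R n N); rewrite ?andbF//= andbT; by case: (_ \in
        _).
    by case/andP: s01 => s0 s1 s2; rewrite ger0_norm ?subr_ge0//; lra.
  + by rewrite indicE_expr; exact: integrable_indic_cbox.
Unshelve. all: by end_near. Qed.

Lemma apx_ge0 v (N : nat) : measurable_fun setT v -> (forall x, 0 <= v x) ->
  (forall x, ~ @cbox R n N x -> v x = 0) ->
  leb.-integrable setT (fun x => (v x ^+ p)%:E) -> apx p v.
Proof.
move=> mv v0 vN iv.
have mv' : measurable_fun setT (EFin \o v) by exact/measurable_EFinP.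
pose s := nnsfun_approx measurableT mv'.
have scvg (x : X) : s k x @[k --> \oo] --> v x.
  have := @cvg_nnsfun_approx _ _ R setT measurableT (EFin \o v) mv' _ x I.
  have v0' (y : X) : setT y -> (0%R <= (EFin \o v) y)%E by rewrite /= lee_fin.
  by move=> /(_ v0') /fine_cvgP[_].
have sle k (x : X) : 0 <= s k x <= v x.
  rewrite fun_ge0/=.
  have nd : {homo (fun k => s k x) : i j / (i <= j)%N >-> i <= j}.
    by move=> i j ij; have /lefP := nd_nnsfun_approx measurableT mv' ij; apply.
  have := nondecreasing_cvgn_le nd _ k; rewrite (cvg_lim _ (scvg x))//; apply.
  exact: scvg.
apply: (@apx_dominated _ _ _ p0 _ (fun k => s k) v) => //.
- move=> k.
  have -> : (s k : X -> R) = fun x => \sum_(y \in range (s k)) (y * \1_(s k @^-1` [set y]) x).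
    by apply/funext => x; exact: fimfunE.
  have fs : finite_set (range (s k)) by exact: fimfunP.
  under eq_fun do rewrite fsbig_finite//=.
  apply: (@apx_sum _ _ _ p0 _ _ (fun y x => y * \1_(s k @^-1` [set y]) x)) => y.
  (* The level set of the value 0 may be unbounded, but its term vanishes; the other level sets lie
     in the box. *)
  have [->|y0] := eqVneq y 0; first by under eq_fun do rewrite mul0r; exact: apx_tf tf0.
  apply: apxZ => //.
  rewrite (_ : s k @^-1` [set y] = s k @^-1` [set y] `&` @cbox R n N); first exact: apx_indic.
  apply/esym/setIidPl => x /= sy; apply: contrapT => /vN vx.
  by have := sle k x; rewrite vx sy -eq_le => /eqP yy; move: y0; rewrite yy eqxx.
- by move=> k x; have /andP[? ?] := sle k x; rewrite ger0_norm; lra.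
Qed.

Lemma apx_cbox v (N : nat) : measurable_fun setT v -> (forall x, ~ @cbox R n N x -> v x = 0) ->
  leb.-integrable setT (fun x => (`|v x| ^+ p)%:E) -> apx p v.
Proof.
move=> mv vN iv.
have -> : v = fun x => Num.max (v x) 0 + (-1) * Num.max (- v x) 0.
  by apply/funext => x; case: (leP (v x) 0); case: (leP (- v x) 0) => *; lra.
have i1 w : measurable_fun setT w -> (forall x, `|w x| <= `|v x|) ->
    leb.-integrable setT (fun x => (w x ^+ p)%:E).
  move=> mw wv; apply: (le_integrable measurableT _ _ iv).
    by apply/measurable_EFinP; exact: measurable_funX.
  move=> x _; rewrite /= lee_fin normrX [leRHS]ger0_norm ?exprn_ge0//.
  by rewrite lerXn2r ?nnegrE.
have m1 : measurable_fun setT (fun x => Num.max (v x) 0) by exact: measurable_maxr.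
have m2 : measurable_fun setT (fun x => Num.max (- v x) 0).
  by apply: measurable_maxr => //; exact: measurableT_comp.
have b1 x : `|Num.max (v x) 0| <= `|v x|.
  by case: (leP (v x) 0) => _ //; rewrite normr0.
have b2 x : `|Num.max (- v x) 0| <= `|v x|.
  by case: (leP (- v x) 0) => _; rewrite ?normr0 ?normrN.
apply: apxD => //; last apply: apxZ => //.
- apply: (@apx_ge0 _ N) => //; [|by move=> x /vN ->; rewrite maxxx|exact: i1].
  by move=> x; rewrite le_max lexx orbT.
- apply: (@apx_ge0 _ N) => //; [|by move=> x /vN ->; rewrite oppr0 maxxx|exact: i1].
  by move=> x; rewrite le_max lexx orbT.
Qed.
End approximation2.

Lemma itgE (R : realType) n (f : 'rV[R]_n -> R) : itg f = \int[@lebesgue_rV R n]_x f x.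
Proof. by []. Qed.
Opaque itg.

Section mollification.
Context {R : realType} {n : nat}.
Local Notation X := 'rV[R]_n.
Local Notation leb := (@lebesgue_rV R n).
Implicit Types (f psi phi v w : X -> R).

Lemma tf_bounded f : tf f -> exists2 B, 0 <= B & forall x, `|f x| <= B.
Proof.
move=> /tf_cb/cb_bounded[M M0 [r r0 H]]; exists M => // x.
apply: (le_trans (H x)); rewrite ler_piMr// indicE; by case: (_ \in _).
Qed.

Lemma tf_lip f : tf f -> exists2 B, 0 <= B & forall p v : X, `|f (p + v) - f p| <= B * `|v|.
Proof.
move=> tff.
have H i := tf_bounded (tf_pd i tff).
exists (\sum_i s2val (cid2 (H i))).
  by apply: sumr_ge0 => i _; case: cid2.
move=> p v; have [c _ ->] := line_MVT p v (smooth_diff (proj1 tff)).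
apply: (le_trans (ler_norm_sum _ _ _)); rewrite mulr_suml; apply: ler_sum => i _.
rewrite normrM mulrC; apply: ler_pM => //; last exact: rV_norm_coord.
by case: cid2 => B B0 HB /=.
Qed.

Lemma tf_taylor f : tf f -> exists2 B, 0 <= B & forall p v : X,
  `|f (p + v) - f p - \sum_i v ord0 i * pd i f p| <= B * `|v| ^+ 2.
Proof.
move=> tff; have H i := tf_lip (tf_pd i tff).
exists (\sum_i s2val (cid2 (H i))); first by apply: sumr_ge0 => i _; case: cid2.
move=> p v; have [c /andP[c0 c1] ->] := line_MVT p v (smooth_diff (proj1 tff)).
rewrite -sumrB; apply: (le_trans (ler_norm_sum _ _ _)); rewrite mulr_suml; apply: ler_sum => i _.
rewrite -mulrBr normrM expr2 mulrA [leRHS]mulrC ler_pM//; first exact: rV_norm_coord.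
case: cid2 => B B0 HB /=; apply: (le_trans (HB _ _)); rewrite ler_wpM2l//.
by rewrite normrZ gtr0_norm// ler_piMl// ltW.
Qed.

(** A quadratic bound on the remainder yields differentiability and the partial derivatives
    together. For [Jk] it comes from Taylor's formula for the kernel, integrated, with no limit to
    exchange with the integral. *)
Lemma differentiable_quad (f : X -> R) (x : X) (c : 'I_n -> R) (B : R) : 0 <= B ->
  (forall v : X, `|f (x + v) - f x - \sum_i v ord0 i * c i| <= B * `|v| ^+ 2) ->
  differentiable f x /\ forall i, pd i f x = c i.
Proof.
move=> B0 H; pose l (v : X) := \sum_i c i * v ord0 i.
have sl : smooth l by apply: smooth_sum => i _; apply: smoothZ; exact: smooth_coord.
have dl := smooth_diff sl 0.
have lE (v : X) : 'd l 0 v = \sum_i v ord0 i * c i.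
  rewrite (diff_sum v dl); apply: eq_bigr => i _; congr (_ * _).
  rewrite pdE /l; have := @diff_sum.
  have E : 'D_(delta_mx 0 i) l 0 = \sum_j (delta_mx 0 i : X) ord0 j * pd j l 0.
    by rewrite deriveE// diff_sum.
  have pl j : pd i (fun v : X => c j * v ord0 j) = cst (c j * (i == j)%:R).
    by rewrite pdZ ?pd_coord//; exact: smooth_coord.
  have ps (s : seq 'I_n) : pd i (fun v : X => \sum_(j <- s) c j * v ord0 j) = cst (\sum_(j <- s) c
    j * (i == j)%:R).
    elim: s => [|j s ih].
      by under eq_fun do rewrite big_nil; rewrite big_nil (pd_cst i 0).
    under eq_fun do rewrite big_cons; rewrite big_cons.
    rewrite (@pdD _ _ i (fun v : X => c j * v ord0 j) (fun v : X => \sum_(j <- s) c j * v ord0 j)).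
    - by rewrite ih pl.
    - by apply: smooth_diff; apply: smoothZ; exact: smooth_coord.
    - by apply: smooth_diff; apply: smooth_sum => k _; apply: smoothZ; exact: smooth_coord.
  move=> _; rewrite -pdE ps /= (bigD1 i)//= eqxx mulr1 big1 ?addr0// => j ji.
  by rewrite eq_sym (negbTE ji) mulr0.
have cl : continuous ('d l 0) by apply: diff_continuous; exact: dl.
have e : f \o shift x = cst (f x) + 'd l 0 +o_ (0 : X) id.
  have B1 : 0 < B + 1 by rewrite ltr_wpDl.
  apply/eqaddoP => e e0.
  have hn : \forall v \near nbhs (0 : X), `|v| <= (B + 1)^-1 * e.
    apply/nbhs_ballP; exists ((B + 1)^-1 * e); first by rewrite /= mulr_gt0// invr_gt0.
    by move=> v; rewrite -ball_normE /= sub0r normrN => /ltW.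
  apply: filterS hn => v hv; rewrite /= -[(_ - _) v]/(f (v + x) - (f x + 'd l 0 v)).
  rewrite lE opprD addrA [v + x]addrC.
  apply: (le_trans (H v)); rewrite expr2 mulrA ler_wpM2r//.
  apply: (@le_trans _ _ ((B + 1) * `|v|)); first by rewrite ler_wpM2r// lerDl.
  by rewrite -ler_pdivlMl.
have dE : 'd f x = 'd l 0 :> (X -> R) by exact: diff_unique.
have df : differentiable f x.
  apply/diff_locallyP; rewrite dE; split; [exact: cl|exact: e].
split; first exact: df.
move=> i; have := congr1 (fun g : X -> R => g (delta_mx 0 i)) dE.
rewrite -[X in X = _ -> _](deriveE _ df) -pdE => ->.
rewrite (lE (delta_mx 0 i)); clear; rewrite (bigD1 i)//= mxE !eqxx mul1r big1 ?addr0// => j ji.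
by rewrite mxE (negbTE ji) andbF mul0r.
Qed.

(* The convolution of [w] with the reflection of [psi]. *)
Definition Jk psi w (x : X) : R := itg (fun y => psi (y - x) * w y).

Lemma continuous_shiftB psi (x : X) : continuous psi -> continuous (fun y : X => psi (y - x)).
Proof.
move=> cp y; apply: (@continuous_comp _ _ _ (fun y : X => y - x) psi); last exact: cp.
by apply: differentiable_continuous.
Qed.

Lemma integrable_bddM psi w (B : R) : measurable_fun setT psi -> (forall x, `|psi x| <= B) ->
  leb.-integrable setT (EFin \o w) -> leb.-integrable setT (fun x => (psi x * w x)%:E).
Proof.
move=> mp pB iw; have mw := measurable_int _ iw.
have B0 : 0 <= B by apply: le_trans (pB 0).
apply: (le_integrable measurableT _ _ (integrableZl measurableT B iw)).
- by apply/measurable_EFinP; apply: measurable_funM => //; exact/measurable_EFinP.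
- move=> x _; rewrite /= lee_fin !normrM ler_wpM2r//.
  by rewrite (ger0_norm B0).
Qed.

Lemma integrable_Jk psi w x : cb psi -> leb.-integrable setT (EFin \o w) ->
  leb.-integrable setT (fun y => (psi (y - x) * w y)%:E).
Proof.
move=> cp iw; have [M M0 [r r0 H]] := cb_bounded cp.
apply: (@integrable_bddM _ _ M) => //.
  by apply: continuous_measurable_rV; apply: continuous_shiftB; case: cp.
move=> y; apply: (le_trans (H _)); rewrite ler_piMr// indicE; by case: (_ \in _).
Qed.

Lemma Jk_diff psi w x : tf psi -> leb.-integrable setT (EFin \o w) ->
  differentiable (Jk psi w) x /\ forall i, pd i (Jk psi w) x = - Jk (pd i psi) w x.
Proof.
move=> tp iw; have [B B0 H] := tf_taylor tp.
pose W := itg (fun y => `|w y|).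
have iaw : leb.-integrable setT (fun y => (`|w y|)%:E) by exact: (integrable_abse iw).
apply: (@differentiable_quad _ _ _ (B * W)).
  by rewrite mulr_ge0// itg_ge0.
move=> v.
have i1 := integrable_Jk (x + v) (tf_cb tp) iw.
have i2 := integrable_Jk x (tf_cb tp) iw.
have i3 i := integrable_Jk x (tf_cb (tf_pd i tp)) iw.
have i4 i : leb.-integrable setT (fun y => (v ord0 i * (pd i psi (y - x) * w y))%:E).
  by under eq_fun do rewrite EFinM; exact: integrableZl.
have i5 (s : seq 'I_n) : leb.-integrable setT (fun y => (\sum_(i <- s) v ord0 i * (pd i psi (y - x)
  * w y))%:E).
  by under eq_fun do rewrite -sumEFin; apply: integrable_sum => // i _; exact: i4.
have sE (s : seq 'I_n) : itg (fun y => \sum_(i <- s) v ord0 i * (pd i psi (y - x) * w y)) =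
    \sum_(i <- s) v ord0 i * Jk (pd i psi) w x.
  elim: s => [|i s ih].
    by under eq_fun do rewrite big_nil; rewrite big_nil itg0.
  under eq_fun do rewrite big_cons; rewrite big_cons -ih !itgE.
  rewrite (RintegralD measurableT (i4 i) (i5 s)); congr (_ + _).
  by rewrite /Jk itgE RintegralZl//; exact: i3.
have i6 : leb.-integrable setT (fun y => (psi (y - (x + v)) * w y - psi (y - x) * w y)%:E).
  by under eq_fun do rewrite EFinB; exact: (integrableB measurableT i1 i2).
have -> : Jk psi w (x + v) - Jk psi w x - \sum_i v ord0 i * - Jk (pd i psi) w x =
   itg (fun y => psi (y - (x + v)) * w y - psi (y - x) * w y +
      \sum_i v ord0 i * (pd i psi (y - x) * w y)).
  under [X in _ - X]eq_bigr do rewrite mulrN.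
  rewrite sumrN opprK -sE /Jk !itgE (RintegralD measurableT i6 (i5 _)).
  by rewrite (RintegralB measurableT i1 i2).
have ii : leb.-integrable setT (fun y => (psi (y - (x + v)) * w y - psi (y - x) * w y +
      \sum_i v ord0 i * (pd i psi (y - x) * w y))%:E).
  by under eq_fun do rewrite EFinD; exact: (integrableD measurableT i6 (i5 _)).
rewrite itgE; apply: (le_trans (le_normr_Rintegral _ ii)) => //.
have -> : B * W * `|v| ^+ 2 = itg (fun y => B * `|v| ^+ 2 * `|w y|).
  by rewrite !itgE RintegralZl// -itgE -/W; ring.
rewrite itgE; apply: le_Rintegral => //.
- exact: (integrable_abse ii).
- exact: (integrableZl measurableT (B * `|v| ^+ 2) iaw).
move=> y _; have := H (y - x) (- v).
have -> : y - x + - v = y - (x + v) by rewrite opprD addrA.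
rewrite normrN => Hy.
have -> : psi (y - (x + v)) * w y - psi (y - x) * w y + \sum_i v ord0 i * (pd i psi (y - x) * w y) =
   (psi (y - (x + v)) - psi (y - x) - \sum_i (- v) ord0 i * pd i psi (y - x)) * w y.
  rewrite !mulrBl mulr_suml -sumrN; congr (_ + _); apply: eq_bigr => i _.
  by rewrite !mxE; ring.
by rewrite normrM ler_wpM2r.
Qed.

Lemma pd_Jk psi w i : tf psi -> leb.-integrable setT (EFin \o w) ->
  pd i (Jk psi w) = fun x => - Jk (pd i psi) w x.
Proof. by move=> tp iw; apply/funext => x; have [_ ->] := Jk_diff x tp iw. Qed.

(** Differentiating [Jk psi w] differentiates the kernel and changes the sign, so the scalar
    multiples of such functions, over all kernels, form an invariant class. *)
Lemma smooth_Jk psi w : tf psi -> leb.-integrable setT (EFin \o w) -> smooth (Jk psi w).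
Proof.
move=> tp iw; pose S (f : X -> R) := exists c psi, tf psi /\ f = fun x => c * Jk psi w x.
apply: (smooth_coind (S := S)); last by exists 1, psi; split=> //; apply/funext => x; rewrite mul1r.
move=> f [c [q [tq ->]]].
have dq : diffb (Jk q w) by move=> x; have [] := Jk_diff x tq iw.
split=> [x|i]; first exact: differentiableM.
exists (- c), (pd i q); split; first exact: tf_pd.
apply/funext => x; rewrite (@pdM _ _ i (cst c) (Jk q w))//= pd_cst /= mul0r add0r.
by rewrite pd_Jk// mulrN mulNr.
Qed.

Lemma pderive_Jk s psi w : tf psi -> leb.-integrable setT (EFin \o w) ->
  pderive s (Jk psi w) = fun x => (-1) ^+ size s * Jk (pderive s psi) w x.
Proof.
move=> tp iw; elim: s => [|i s ih]; first by apply/funext => x; rewrite mul1r.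
have ts := tf_pderive s tp.
rewrite pderive_cons ih pdZ; last exact: smooth_Jk.
by rewrite pd_Jk//; apply/funext => x; rewrite /= exprS; ring.
Qed.
End mollification.

(** The geometric rate makes the sum of the [f k] integrable, hence finite almost everywhere, and
    its terms tend to 0. Almost everywhere convergence is thus obtained without extracting
    subsequences. *)
Lemma ae_cvg0_summable (R : realType) d (T : measurableType d) (mu : {measure set T -> \bar R})
  (f : nat -> T -> R) : (forall k, measurable_fun setT (f k)) -> (forall k x, 0 <= f k x) ->
  (forall k, \int[mu]_x (f k x)%:E <= (1 / (2 ^ k.+1)%:R)%:E)%E ->
  {ae mu, forall x, f k x @[k --> \oo] --> 0}.
Proof.
move=> mf f0 If.
have mfE k : measurable_fun setT (fun x => (f k x)%:E) by exact/measurable_EFinP.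
have f0E k x : (0 <= (f k x)%:E)%E by rewrite lee_fin.
have S : (\int[mu]_x (\sum_(0 <= k <oo) (f k x)%:E) < +oo)%E.
  rewrite integral_nneseries//; apply: (@le_lt_trans _ _ 1%:E); last exact: ltry.
  apply: le_trans (epsilon_trick0 xpredT ler01).
  by apply: lee_nneseries => k _; [move=> _; apply: integral_ge0|exact: If].
have : mu.-integrable setT (fun x => \sum_(0 <= k <oo) (f k x)%:E)%E.
  apply/integrableP; split; first exact: ge0_emeasurable_sum.
  by under eq_integral do rewrite gee0_abs ?nneseries_ge0//.
move=> /(integrable_ae measurableT); apply: filterS => x /(_ I) fin.
apply: cvg_series_cvg_0; apply: nnseries_is_cvg => //.
by rewrite ltey_eq fin.
Qed.

(** * Convergence of mollification in L^1 and L^2 *)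

Section mollifier_convergence.
Context {R : realType} {n : nat}.
Local Notation X := 'rV[R]_n.
Local Notation leb := (@lebesgue_rV R n).
Implicit Types (f phi v w : X -> R).

Definition mollk (rho : R) phi := [/\ smooth phi, forall x, 0 <= phi x,
  forall x, rho <= `|x| -> phi x = 0 & itg phi = 1].

Lemma mollk_tf rho phi : mollk rho phi -> tf phi.
Proof. by case=> sp _ p0 _; split=> //; exists rho => x rx; exact/p0/ltW. Qed.

Lemma Jk_abs rho phi w x : mollk rho phi -> leb.-integrable setT (EFin \o w) ->
  (`|Jk phi w x|%:E <= \int[leb]_z (phi z * `|w (z + x)|)%:E)%E.
Proof.
move=> mp iw; have tp := mollk_tf mp; have [_ p0 _ _] := mp.
have ii := integrable_Jk x (tf_cb tp) iw.
have mw : measurable_fun setT w by apply/measurable_EFinP; exact: measurable_int iw.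
have -> : (`|Jk phi w x|%:E = `|\int[leb]_y (phi (y - x) * w y)%:E|)%E.
  by rewrite /Jk itgE /Rintegral -abse_EFin fineK//; exact: integrable_fin_num.
apply: (le_trans (le_abse_integral _ measurableT (measurable_int _ ii))).
have mpw : measurable_fun setT (fun y : X => (phi (y - x) * `|w y|)%:E).
  apply/measurable_EFinP; apply: measurable_funM; last exact: measurableT_comp.
  by apply: continuous_measurable_rV; apply: continuous_shiftB; case: (tf_cb tp).
have pw0 (y : X) : (0 <= (phi (y - x) * `|w y|)%:E)%E by rewrite lee_fin mulr_ge0.
rewrite le_eqVlt; apply/orP; left; apply/eqP.
transitivity (\int[leb]_z (phi (z - x) * `|w z|)%:E)%E.
  by apply: eq_integral => y _; rewrite /= normrM ger0_norm.
rewrite -(ge0_integral_shift x mpw pw0).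
by apply: eq_integral => y _; rewrite addrK.
Qed.

Lemma measurable_shift_pair w : measurable_fun setT w ->
  measurable_fun setT (fun z : X * X => w (z.1 + z.2)).
Proof.
move=> mw; apply: (measurableT_comp mw); apply: measurable_fun_rV => i.
under eq_fun do rewrite mxE.
apply: measurable_funD; apply: (measurableT_comp (measurable_fun_coord i)).
  exact: measurable_fst.
exact: measurable_snd.
Qed.

(** Exponent 1 serves for the du Bois-Reymond lemma and for derivatives known only to be locally
    integrable, exponent 2 for energies. *)
Definition p12 (p : nat) := (p == 1%N) || (p == 2%N).

(** Jensen's inequality for the probability density phi; for p = 2 it is Cauchy-Schwarz with phi |w|
    split as sqrt(phi) times sqrt(phi) |w|. *)
Lemma Jk_pow p rho phi w x : p12 p -> mollk rho phi -> leb.-integrable setT (EFin \o w) ->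
  ((`|Jk phi w x| ^+ p)%:E <= \int[leb]_z (phi z * `|w (z + x)| ^+ p)%:E)%E.
Proof.
move=> hp mp iw; have tp := mollk_tf mp; have [_ p0 _ p1] := mp.
have mphi := measurable_cb (tf_cb tp).
have mw : measurable_fun setT w by apply/measurable_EFinP; exact: measurable_int iw.
have mwx : measurable_fun setT (fun z : X => w (z + x)).
  exact: (measurableT_comp mw (@measurable_shift R n x)).
have H := Jk_abs x mp iw.
case/orP: hp => /eqP ->; first by under eq_integral do rewrite expr1.
set B := (X in (_ <= X)%E).
have B0 : (0 <= B)%E by apply: integral_ge0 => z _; rewrite lee_fin mulr_ge0// exprn_ge0.
case: (ltP B +oo%E) => [Boo|]; last by rewrite leye_eq => /eqP ->; rewrite leey.
have Bfin : B \is a fin_num by rewrite ge0_fin_numE.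
have CS : (\int[leb]_z (Num.sqrt (phi z) * Num.sqrt (phi z * `|w (z + x)| ^+ 2))%:E <=
    (Num.sqrt 1 * Num.sqrt (fine B))%:E)%E.
  apply: integral_CS => //.
  - by apply: measurable_funM => //; apply: measurable_funX; exact: measurableT_comp.
  - by move=> z; rewrite mulr_ge0// exprn_ge0.
  - exact: fine_ge0.
  - by rewrite itg_EFin ?p1//; exact: tf_cb.
  - by rewrite fineK.
have : (`|Jk phi w x|%:E <= (Num.sqrt (fine B))%:E)%E.
  apply: (le_trans H); move: CS; rewrite sqrtr1 mul1r; apply: le_trans.
  rewrite le_eqVlt; apply/orP; left; apply/eqP; apply: eq_integral => z _.
  by rewrite sqrtrM// sqrtr_sqr normr_id mulrA -expr2 sqr_sqrtr.
rewrite lee_fin => H2; rewrite -(fineK Bfin) lee_fin.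
by rewrite -(sqr_sqrtr (fine_ge0 B0)) lerXn2r ?nnegrE ?sqrtr_ge0.
Qed.

Lemma Jk_contraction p rho phi w : p12 p -> mollk rho phi -> leb.-integrable setT (EFin \o w) ->
  (\int[leb]_x (`|Jk phi w x| ^+ p)%:E <= \int[leb]_x (`|w x| ^+ p)%:E)%E.
Proof.
move=> hp mp iw; have tp := mollk_tf mp; have [_ p0 _ p1] := mp.
have mphi := measurable_cb (tf_cb tp).
have mw : measurable_fun setT w by apply/measurable_EFinP; exact: measurable_int iw.
have mF : measurable_fun setT (fun z : X * X => (phi z.2 * `|w (z.2 + z.1)| ^+ p)%:E).
  apply/measurable_EFinP; apply: measurable_funM.
    exact: (measurableT_comp mphi measurable_snd).
  apply: measurable_funX; apply: measurableT_comp => //.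
  under eq_fun do rewrite addrC; exact: measurable_shift_pair.
have F0 (z : X * X) : (0 <= (phi z.2 * `|w (z.2 + z.1)| ^+ p)%:E)%E.
  by rewrite lee_fin mulr_ge0// exprn_ge0.
have sJ : smooth (Jk phi w) by exact: smooth_Jk.
apply: (@le_trans _ _ (\int[leb]_x \int[leb]_z (phi z * `|w (z + x)| ^+ p)%:E)%E).
  apply: ge0_le_integral => //.
  - apply/measurable_EFinP; apply: measurable_normX.
    exact: continuous_measurable_rV (smooth_continuous sJ).
  - exact: (measurable_fun_fubini_tonelli_F (m2 := leb) _ mF F0).
  - by move=> x _; exact: Jk_pow hp mp iw.
have := fubini_tonelli (m1 := leb) (m2 := leb) _ mF F0 => /= ->.
set W := (X in (_ <= X)%E).
have W0 : (0 <= W)%E by apply: integral_ge0 => x _; rewrite lee_fin exprn_ge0.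
have mwp : measurable_fun setT (fun x : X => (`|w x| ^+ p)%:E).
  by apply/measurable_EFinP; exact: measurable_normX.
have wp0 x : (0 <= (`|w x| ^+ p)%:E)%E by rewrite lee_fin exprn_ge0.
have E z : (\int[leb]_x (phi z * `|w (z + x)| ^+ p)%:E = (phi z)%:E * W)%E.
  under eq_integral do rewrite EFinM addrC.
  rewrite ge0_integralZl//.
  - by rewrite (ge0_integral_shift z mwp wp0).
  - apply/measurable_EFinP; apply: measurable_normX.
    exact: (measurableT_comp mw (@measurable_shift R n z)).
  - by rewrite lee_fin.
under eq_integral do rewrite E.
rewrite ge0_integralZr//; last 2 first.
- exact/measurable_EFinP.
- by move=> z _; rewrite lee_fin.
by rewrite itg_EFin ?p1 ?mul1e//; exact: tf_cb.
Qed.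

Lemma Jk_tf_close f : tf f -> exists2 B, 0 <= B &
  forall (rho : R) phi, 0 < rho -> mollk rho phi -> forall x, `|Jk phi f x - f x| <= B * rho.
Proof.
move=> tff; have [B B0 HB] := tf_lip tff; exists B => // rho phi r0 mp x.
have tp := mollk_tf mp; have [_ p0 pr p1] := mp; have cp := tf_cb tp.
have if_ : leb.-integrable setT (EFin \o f) by exact: cb_integrable (tf_cb tff).
have cs : cb (fun y => phi (y - x)).
  split; first by apply: continuous_shiftB; case: cp.
  exists (rho + `|x|) => y yr; apply: pr; have := ler_normD (y - x) x.
  by rewrite subrK; lra.
have c1 : cb (fun y => phi (y - x) * f y) by apply: cbM => //; exact: tf_cb.
have e1 : itg (fun y => phi (y - x)) = 1.
  apply: EFin_inj; rewrite -itg_EFin// -p1 -itg_EFin//.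
  have m1 : measurable_fun setT (fun y : X => (phi y)%:E) by apply/measurable_EFinP; exact:
    measurable_cb.
  have h0 (y : X) : (0 <= (phi y)%:E)%E by rewrite lee_fin.
  exact: (ge0_integral_shift (- x) m1 h0).
have -> : Jk phi f x - f x = itg (fun y => phi (y - x) * f y + (- f x) * phi (y - x)).
  by rewrite itgD//; [rewrite itgZ// e1 mulr1|exact: cbZ].
have cc : cb (fun y => phi (y - x) * f y + (- f x) * phi (y - x)).
  by apply: cbD => //; exact: cbZ.
have -> : B * rho = itg (fun y => B * rho * phi (y - x)) by rewrite itgZ// e1 mulr1.
have key y : `|phi (y - x) * f y + (- f x) * phi (y - x)| <= B * rho * phi (y - x).
  rewrite (_ : _ + _ = phi (y - x) * (f y - f x)); last by ring.
  rewrite normrM ger0_norm// mulrC.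
  have [yr|yr] := leP rho `|y - x|; first by rewrite pr// !mulr0.
  rewrite ler_wpM2r//; have := HB x (y - x); rewrite subrKC => /le_trans; apply.
  by rewrite ler_wpM2l// ltW.
rewrite ler_norml -itgN ?cbZ//; last exact: cbZ.
apply/andP; split; apply: itg_le => //; try exact: cbZ; try (apply: cbN; exact: cbZ).
- by move=> y; have := key y; rewrite ler_norml => /andP[].
- by move=> y; have := key y; rewrite ler_norml => /andP[].
Qed.

(** v is replaced by a nearby test function f, at a cost controlled by contraction. On f the error
    is at most a multiple of rho at each point, and it is supported in a fixed cube because rho <=
    1. *)
Lemma Jk_cvg p v (e : R) : p12 p -> leb.-integrable setT (EFin \o v) -> apx p v -> 0 < e ->
  exists2 r0, 0 < r0 & forall rho phi, 0 < rho <= r0 -> mollk rho phi ->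
  (\int[leb]_x (`|Jk phi v x - v x| ^+ p)%:E <= e%:E)%E.
Proof.
move=> hp iv [mv av] e0.
have p0 : (0 < p)%N by case/orP: hp => /eqP ->.
have K0 : 0 < 2 ^+ p :> R by rewrite exprn_gt0.
pose e' := e / (2 ^+ p * (1 + 2 ^+ p * 2)).
have e'0 : 0 < e' by rewrite divr_gt0// mulr_gt0// addr_gt0// mulr_gt0.
have eE : 2 ^+ p * (e' + 2 ^+ p * (e' + e')) = e.
  rewrite /e'; move: (2 ^+ p : R) K0 => K K0; field.
  by rewrite !gt_eqF//; lra.
have [f tff vf] := av _ e'0.
have [B B0 HB] := Jk_tf_close tff.
have if_ : leb.-integrable setT (EFin \o f) by exact: cb_integrable (tf_cb tff).
have [sf [r fr]] := tff.
pose V := (2 * (`|r| + 1)) ^+ n : R.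
have V0 : 0 <= V by rewrite exprn_ge0// mulr_ge0// addr_ge0.
pose r0 := Num.min 1 (Num.min 1 (e' / (V + 1)) / (B + 1)).
have B1 : 0 < B + 1 by rewrite ltr_wpDl.
have V1 : 0 < V + 1 by rewrite ltr_wpDl.
have r00 : 0 < r0.
  by rewrite lt_min ltr01/= divr_gt0// lt_min ltr01/= divr_gt0.
exists r0 => // rho phi /andP[rho0 rr] mp.
have tp := mollk_tf mp; have [_ pp0 pr p1] := mp.
have mJ w : leb.-integrable setT (EFin \o w) -> measurable_fun setT (Jk phi w).
  by move=> iw; apply: continuous_measurable_rV; exact/smooth_continuous/smooth_Jk.
have mf := measurable_cb (tf_cb tff).
rewrite -eE; apply: (ge0_integralD_le _ (w := Jk phi f)) => //; [exact: mJ|exact: mJ| |].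
  have -> : (fun x : X => (`|Jk phi v x - Jk phi f x| ^+ p)%:E) =
      (fun x => (`|Jk phi (fun y => v y - f y) x| ^+ p)%:E).
    apply/funext => x; congr (`|_| ^+ _)%:E.
    have i1 := integrable_Jk x (tf_cb tp) iv; have i2 := integrable_Jk x (tf_cb tp) if_.
    rewrite /Jk !itgE -(RintegralB measurableT i1 i2); apply: eq_Rintegral => y _.
    by rewrite mulrBr.
  apply: le_trans vf; apply: (Jk_contraction hp mp).
  exact: (integrableB measurableT iv if_).
apply: (ge0_integralD_le _ (w := f)) => //; first exact: mJ; last first.
  apply: le_trans vf; rewrite le_eqVlt; apply/orP; left; apply/eqP.
  by apply: eq_integral => x _; rewrite distrC.
have rho1 : rho <= 1 by apply: (le_trans rr); rewrite /r0 ge_min lexx.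
have Brho : B * rho <= Num.min 1 (e' / (V + 1)).
  apply: (@le_trans _ _ ((B + 1) * r0)); first by rewrite ler_pM// ?lerDl ?(ltW rho0).
  rewrite mulrC -ler_pdivlMr// /r0 ge_min; apply/orP; right; exact: lexx.
have c0 : 0 <= `|r| + 1 by rewrite addr_ge0.
apply: (@le_trans _ _ (\int[leb]_x ((e' / (V + 1)) * \1_(ccube (`|r| + 1)) x)%:E)%E).
  apply: ge0_le_integral => //.
  - by apply: measurable_normXB => //; exact: mJ.
  - apply/measurable_EFinP; apply: measurable_funM => //.
    by apply: measurable_indic; exact: measurable_ccube.
  move=> x _; rewrite lee_fin indicE.
  have [xr|xr] := leP `|x| (`|r| + 1).
    rewrite mem_set; last exact/ccubeP.
    rewrite mulr1; apply: (@le_trans _ _ ((B * rho) ^+ p)).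
      by rewrite lerXn2r ?nnegrE ?mulr_ge0 ?(ltW rho0)//; exact: HB.
    have b1 : B * rho <= 1 by apply: (le_trans Brho); rewrite ge_min lexx.
    have b2 : B * rho <= e' / (V + 1) by apply: (le_trans Brho); rewrite ge_min lexx orbT.
    apply: le_trans b2; rewrite -[leRHS]expr1; apply: ler_wiXn2l => //.
    by rewrite mulr_ge0// ltW.
  rewrite memNset; last by move=> /(ccubeP _ c0); rewrite leNgt xr.
  rewrite mulr0 fr; last by apply: le_lt_trans xr; rewrite (le_trans (ler_norm _))// lerDl.
  rewrite subr0 (_ : Jk phi f x = 0) ?normr0 ?expr0n ?gtn_eqF//.
  rewrite /Jk (_ : (fun y => _) = fun=> 0) ?itg0//; apply/funext => y.
  have [yr|yr] := leP rho `|y - x|; first by rewrite pr// mul0r.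
  rewrite fr ?mulr0//; have := ler_normD (x - y) y; rewrite subrK [`|x - y|]distrC.
  by have := ler_norm r; lra.
under eq_integral do rewrite EFinM.
rewrite ge0_integralZl//; last 2 first.
- by apply/measurable_EFinP; apply: measurable_indic; exact: measurable_ccube.
- by rewrite lee_fin divr_ge0// ltW.
rewrite integral_indic ?setIT//; last exact: measurable_ccube.
rewrite [X in (_ * X)%E](_ : _ = V%:E); last first.
  by apply: (etrans (lebesgue_ccube n c0)); congr (_ ^+ _)%:E; ring.
rewrite -EFinM lee_fin.
by rewrite mulrAC ler_pdivrMr// ler_wpM2l ?(ltW e'0)// lerDl.
Qed.
End mollifier_convergence.

(** * Weak derivatives *)

Section weak_derivatives.
Context {R : realType} {n : nat}.
Local Notation X := 'rV[R]_n.
Local Notation leb := (@lebesgue_rV R n).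
Implicit Types (f phi u v w : X -> R) (Omega : set X) (c : X).

Definition cl c (s : R) : set X := [set x | `|x - c| <= s].

Lemma near_cl_out c s (x : X) : s < `|x - c| -> \forall y \near x, s < `|y - c|.
Proof.
move=> sx; have cc : continuous (fun y : X => `|y - c|).
  by apply: (@continuous_shiftB R n (fun z => `|z|)); exact: norm_continuous.
by have /cvgr_gt := cc x; apply.
Qed.

Lemma near_cl_in c s (x : X) : `|x - c| < s -> \forall y \near x, `|y - c| < s.
Proof.
move=> sx; have cc : continuous (fun y : X => `|y - c|).
  by apply: (@continuous_shiftB R n (fun z => `|z|)); exact: norm_continuous.
by have /cvgr_lt := cc x; apply.
Qed.

Lemma closed_cl c s : closed (cl c s).
Proof.
rewrite -openC openE => x /=; rewrite /cl /= => /negP; rewrite -ltNge => sx.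
by apply: filterS (near_cl_out sx) => y yc; apply/negP; rewrite -ltNge.
Qed.

Lemma bounded_cl c s (x : X) : cl c s x -> `|x| <= s + `|c|.
Proof.
move=> xs; have := ler_normD (x - c) c; rewrite subrK => /le_trans; apply.
by rewrite lerD2r.
Qed.

Lemma compact_cl c s : compact (cl c s).
Proof.
apply: bounded_closed_compact; last exact: closed_cl.
exists (s + `|c|); split; first exact: num_real.
by move=> M sM x xs; apply: (le_trans (bounded_cl xs)); exact: ltW.
Qed.

Lemma measurable_cl c s : measurable (cl c s).
Proof.
rewrite -[cl c s]setCK; apply: measurableC; apply: open_measurable_rV.
by rewrite openC; exact: closed_cl.
Qed.

(** Local integrability gives no control up to the boundary of Omega, so functions are truncated to
    a closed cube inside Omega before being mollified. *)
Definition res c s v : X -> R := fun x => v x * \1_(cl c s) x.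

Lemma res_in c s v x : cl c s x -> res c s v x = v x.
Proof. by move=> xs; rewrite /res indicE mem_set// mulr1. Qed.

Lemma res_out c s v x : ~ cl c s x -> res c s v x = 0.
Proof. by move=> xs; rewrite /res indicE memNset// mulr0. Qed.

Definition linted Omega v := forall K : set X, compact K -> K `<=` Omega ->
  leb.-integrable K (EFin \o v).

Lemma resE c s v : EFin \o res c s v = (EFin \o v) \_ (cl c s).
Proof.
apply/funext => x /=; rewrite patchE; case: ifPn => xs.
  by rewrite res_in//; exact/set_mem.
by rewrite res_out// => /mem_set; exact/negP.
Qed.

Lemma integrable_res c s v Omega : linted Omega v -> cl c s `<=` Omega ->
  leb.-integrable setT (EFin \o res c s v).
Proof.
move=> lv cO; rewrite resE; apply/(integrable_mkcond (EFin \o v) (measurable_cl c s)).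
by apply: lv => //; exact: compact_cl.
Qed.

(* Weak derivatives along a sequence of directions, as opposed to a multi-index. *)
Definition wds Omega s u v := [/\ linted Omega u, linted Omega v &
  forall f, test_fun Omega f -> \int[leb]_(x in Omega) (u x * pderive s f x) =
    (-1) ^+ size s * \int[leb]_(x in Omega) (v x * f x)].

Lemma pderive_out c s f : (forall x, s < `|x - c| -> f x = 0) ->
  forall t x, s < `|x - c| -> pderive t f x = 0.
Proof.
move=> f0 t x sx; rewrite (@near_pderiveE _ _ _ (fun=> 0)) ?pderive_cst0//.
by apply: filterS (near_cl_out sx) => y /f0.
Qed.

Lemma test_fun_cl Omega c s f : cl c s `<=` Omega -> smooth f ->
  (forall x, s < `|x - c| -> f x = 0) -> test_fun Omega f.
Proof.
move=> cO sf f0.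
have sub : supp f `<=` cl c s.
  have /closure_id -> := @closed_cl c s; apply: closureS => x /= fx.
  by rewrite /cl /= leNgt; apply/negP => /f0 e; rewrite e eqxx in fx.
split=> //; last exact: subset_trans cO.
apply: (@subclosed_compact _ _ (cl c s)) => //; first exact: closed_closure.
exact: compact_cl.
Qed.

Lemma Rintegral_res Omega c s v f : cl c s `<=` Omega ->
  (forall x, s < `|x - c| -> f x = 0) ->
  \int[leb]_(x in Omega) (v x * f x) = itg (fun x => f x * res c s v x).
Proof.
move=> cO f0; rewrite Rintegral_mkcond itgE; apply: eq_Rintegral => x _.
rewrite patchE; have [xs|xs] := leP `|x - c| s.
  by rewrite mem_set; [rewrite res_in// mulrC|exact: cO].
by rewrite f0// mul0r mulr0; case: ifP.
Qed.

Lemma wds_res Omega s u v c r f : wds Omega s u v -> cl c r `<=` Omega -> smooth f ->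
  (forall x, r < `|x - c| -> f x = 0) ->
  itg (fun x => pderive s f x * res c r u x) =
  (-1) ^+ size s * itg (fun x => f x * res c r v x).
Proof.
move=> [_ _ H] cO sf f0; rewrite -(Rintegral_res v cO f0).
by rewrite -(Rintegral_res u cO (pderive_out f0 s)) H//; exact: test_fun_cl cO sf f0.
Qed.

Lemma mollk_exists (rho : R) : 0 < rho -> exists phi : X -> R, mollk rho phi.
Proof. by move=> r0; have [phi H] := mollifier n r0; exists phi. Qed.

Lemma smooth_shiftB phi (x : X) : smooth phi -> smooth (fun y : X => phi (y - x)).
Proof.
move=> sp; pose S (f : X -> R) := exists2 g, smooth g & f = fun y : X => g (y - x).
apply: (smooth_coind (S := S)); last by exists phi.
move=> f [g sg ->]; split; first exact: diffb_shift (smooth_diff sg).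
by move=> i; exists (pd i g); [exact: smooth_pd|apply/funext => y; exact: pd_shift].
Qed.

Lemma pderive_shiftB phi (x : X) s : pderive s (fun y : X => phi (y - x)) = fun y => pderive s phi
  (y - x).
Proof.
elim: s => // i s ih; rewrite !pderive_cons ih; apply/funext => y; exact: pd_shift.
Qed.

Lemma mollk_out (rho : R) phi c r x : mollk rho phi -> `|x - c| <= r - rho ->
  forall y, r < `|y - c| -> phi (y - x) = 0.
Proof.
case=> _ _ p0 _ xr y ry; apply: p0; have := ler_normD (y - x) (x - c).
by rewrite addrA subrK; lra.
Qed.

(** At distance rho inside the cube the translated kernel is an admissible test function, and the
    sign of the weak derivative cancels that of [pderive_Jk]. *)
Lemma Jk_wds Omega s u v c r rho phi x : wds Omega s u v -> cl c r `<=` Omega ->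
  mollk rho phi -> `|x - c| <= r - rho ->
  pderive s (Jk phi (res c r u)) x = Jk phi (res c r v) x.
Proof.
move=> wd cO mp xr; have [lu lv _] := wd; have tp := mollk_tf mp.
rewrite pderive_Jk//; last exact: integrable_res cO.
have := @wds_res _ _ _ _ c r (fun y => phi (y - x)) wd cO (smooth_shiftB x (proj1 tp)) (mollk_out
  mp xr).
rewrite pderive_shiftB /Jk => ->.
by rewrite mulrA -exprMn mulrNN mulr1 expr1n mul1r.
Qed.

Lemma apx_res p Omega c r v : (0 < p)%N -> leb.-integrable setT (EFin \o res c r v) ->
  leb.-integrable setT (fun x => (`|res c r v x| ^+ p)%:E) -> apx p (res c r v).
Proof.
move=> p0 iv ip; pose N := (Num.bound `|r + `|c| |).+1.
apply: (@apx_cbox _ _ p p0 _ N) => //.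
  by apply/measurable_EFinP; exact: measurable_int iv.
move=> x xN; apply: res_out => xr; apply: xN => i /=; rewrite in_itv/=.
have : `|x ord0 i| < N%:R.
  apply: (le_lt_trans (rV_norm_coord x i)); apply: (le_lt_trans (bounded_cl xr)).
  apply: (@lt_le_trans _ _ (Num.bound `|r + `|c| |)%:R); last by rewrite ler_nat.
  by apply: (le_lt_trans (ler_norm _)); exact: archi_boundP.
by rewrite ltr_norml => /andP[-> /ltW].
Qed.

(* du Bois-Reymond *)
Lemma ae0_of_test Omega v c r r' : linted Omega v -> cl c r `<=` Omega -> r' < r ->
  (forall f, smooth f -> (forall x, r < `|x - c| -> f x = 0) ->
     itg (fun x => f x * res c r v x) = 0) ->
  {ae leb, forall x, cl c r' x -> v x = 0}.
Proof.
move=> lv cO rr H; have iw := integrable_res lv cO.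
set w := res c r v in iw.
have iw1 : leb.-integrable setT (fun x => (`|w x| ^+ 1)%:E) by exact: integrable_abse iw.
have aw : apx 1 w by exact: apx_res.
have mw : measurable_fun setT w by apply/measurable_EFinP; exact: measurable_int iw.
have m' : measurable_fun setT (fun x => res c r' w x).
  by apply: measurable_funM => //; apply: measurable_indic; exact: measurable_cl.
have I0 : (\int[leb]_x `|(res c r' w x)%:E| = 0)%E.
  apply/eqP; rewrite eq_le; apply/andP; split; last exact: integral_ge0.
  apply/lee_addgt0Pr => e e0; rewrite add0e.
  have [r0 r00 HJ] := Jk_cvg (p := 1) isT iw aw e0.
  pose rho := Num.min r0 (r - r').
  have rho0 : 0 < rho by rewrite lt_min r00 subr_gt0.
  have [phi mp] := mollk_exists rho0.
  have := HJ rho phi; rewrite rho0 ge_min lexx => /(_ isT mp); apply: le_trans.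
  apply: ge0_le_integral => //.
  - by apply/measurable_EFinP; exact: measurableT_comp.
  - apply: measurable_normXB => //; apply: continuous_measurable_rV; apply: smooth_continuous.
    exact: smooth_Jk (mollk_tf mp) iw.
  move=> x _; rewrite /= lee_fin expr1.
  have [xr|xr] := leP `|x - c| r'; last first.
    by rewrite res_out ?normr0//; apply/negP; rewrite -ltNge.
  rewrite res_in// /Jk H ?sub0r ?normrN//.
    exact: smooth_shiftB (proj1 (mollk_tf mp)).
  have : rho <= r - r' by rewrite ge_min lexx orbT.
  by move=> rho1; apply: mollk_out mp _; lra.
have /ae_eq_integral_abs := I0.
move=> /(_ measurableT) [|B [mB B0 HB]]; first exact/measurable_EFinP.
exists B; split => // x /= nx; apply: HB => /= H0; apply: nx => xr'.
have := H0 I; rewrite res_in// => -[]; rewrite /w res_in//.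
by rewrite /cl /= (le_trans xr')// ltW.
Qed.

Lemma compact_measurable_rV (K : set X) : compact K -> measurable K.
Proof.
move=> /(compact_closed (@norm_hausdorff _ X)) cK.
rewrite -[K]setCK; apply: measurableC; apply: open_measurable_rV.
by rewrite openC.
Qed.

(** Countability turns almost everywhere statements on the cubes into one on Omega; strict growth
    leaves room for mollifying inside the next cube. *)
Definition exh Omega c (q : nat -> R) := [/\ forall k, q k < q k.+1,
  forall k, cl c (q k) `<=` Omega & forall x, Omega x -> exists k, cl c (q k) x].

Lemma ae_nat_forall (P : nat -> X -> Prop) : (forall k, {ae leb, forall x, P k x}) ->
  {ae leb, forall x, forall k, P k x}.
Proof. by move=> H; apply/ae_foralln. Qed.

Lemma wds_unique Omega c q s u v v' : exh Omega c q -> wds Omega s u v -> wds Omega s u v' ->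
  {ae leb, forall x, Omega x -> v x = v' x}.
Proof.
move=> [qS qO Oq] w1 w2; have [lu lv _] := w1; have [_ lv' _] := w2.
pose z x := v x - v' x.
have lz : linted Omega z.
  move=> K cK KO; have := integrableB _ (lv K cK KO) (lv' K cK KO); apply.
  exact: compact_measurable_rV.
suff : {ae leb, forall x, forall k, cl c (q k) x -> z x = 0}.
  apply: filterS => x H /Oq[k xk]; apply/eqP; rewrite -subr_eq0; apply/eqP; exact: H xk.
apply: ae_nat_forall => k; apply: (ae0_of_test lz (qO k.+1) (qS k)) => f sf f0.
have if1 y : linted Omega y -> leb.-integrable setT (fun x => (f x * res c (q k.+1) y x)%:E).
  move=> ly; have tff : tf f.
    split=> //; exists (q k.+1 + `|c|) => x xr; apply: f0; rewrite ltNge; apply/negP.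
    by move=> /bounded_cl; rewrite leNgt xr.
  have [B B0 HB] := tf_bounded tff.
  by apply: (integrable_bddM _ HB (integrable_res ly (qO k.+1))); exact: measurable_cb (tf_cb tff).
have -> : (fun x => f x * res c (q k.+1) z x) =
   (fun x => f x * res c (q k.+1) v x - f x * res c (q k.+1) v' x).
  by apply/funext => x; rewrite /res /z; ring.
rewrite itgE (RintegralB measurableT (if1 _ lv) (if1 _ lv')) -!itgE.
have e1 := wds_res w1 (qO k.+1) sf f0; have e2 := wds_res w2 (qO k.+1) sf f0.
have : (-1) ^+ size s * itg (fun x => f x * res c (q k.+1) v x) =
       (-1) ^+ size s * itg (fun x => f x * res c (q k.+1) v' x) by rewrite -e1 -e2.
by move=> /(mulfI (negbT (signr_eq0 R (size s)))) ->; rewrite subrr.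
Qed.
End weak_derivatives.

Lemma fatou_ae (R : realType) d (T : measurableType d) (mu : {measure set T -> \bar R})
  (f : nat -> T -> R) (g : T -> R) (M : \bar R) :
  (forall k, measurable_fun setT (f k)) -> measurable_fun setT g ->
  (forall k x, 0 <= f k x) -> (forall x, 0 <= g x) ->
  {ae mu, forall x, f k x @[k --> \oo] --> g x} ->
  (forall k, \int[mu]_x (f k x)%:E <= M)%E -> (\int[mu]_x (g x)%:E <= M)%E.
Proof.
move=> mf mg f0 g0 fg fM.
have mfE k : measurable_fun setT (fun x => (f k x)%:E) by exact/measurable_EFinP.
apply: (@le_trans _ _ (\int[mu]_x limn_einf (fun k => (f k x)%:E))%E).
  apply: ae_ge0_le_integral => //.
  - by move=> x _; rewrite lee_fin.
  - exact/measurable_EFinP.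
  - move=> x _; rewrite limn_einf_lim; apply: lime_ge; first exact: is_cvg_einfs.
    by apply: nearW => k; apply: le_ereal_inf_tmp => _ [j _ <-]; rewrite lee_fin.
  - under eq_fun do rewrite limn_einf_lim.
    apply: (emeasurable_fun_cvg (fun k => fun x => einfs (fun k => (f k x)%:E) k)).
      by move=> k; exact: measurable_fun_einfs.
    by move=> x _; exact: is_cvg_einfs.
  apply: filterS fg => x fgx _.
  have -> // : limn_einf (fun k => (f k x)%:E) = (g x)%:E.
  suff /cvg_limn_einf_sup[] : (f k x)%:E @[k --> \oo] --> (g x)%:E by [].
  by apply: cvg_EFin; first exact: nearW.
apply: (le_trans (fatou mu measurableT _ _)) => //.
  by move=> k x _; rewrite lee_fin.
rewrite limn_einf_lim; apply: lime_le; first exact: is_cvg_einfs.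
by apply: nearW => k; apply: le_trans (fM k); apply: ereal_inf_lbound; exists k => /=.
Qed.

Lemma sqr_sum_le (R : realType) (I : finType) (F : I -> R) :
  (\sum_i F i) ^+ 2 <= #|I|%:R * \sum_i F i ^+ 2.
Proof.
rewrite expr2 big_distrlr /=.
apply: (@le_trans _ _ (\sum_i \sum_j (F i ^+ 2 + F j ^+ 2) / 2)).
  apply: ler_sum => i _; apply: ler_sum => j _.
  by have := sqr_ge0 (F i - F j); rewrite sqrrB; lra.
rewrite (eq_bigr (fun i => F i ^+ 2 / 2 *+ #|I| + (\sum_j F j ^+ 2) / 2)); last first.
  by move=> i _; rewrite -mulr_suml big_split/= mulrDl sumr_const mulrnAl.
by rewrite big_split/= sumr_const sumrMnl -mulr_suml -mulrnDl -splitr mulr_natl.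
Qed.

(** * Local integrability of lower order derivatives *)

Section translation.
Context {R : realType} {n : nat}.
Local Notation X := 'rV[R]_n.
Local Notation leb := (@lebesgue_rV R n).
Local Notation mu := (@lebesgue_measure R).
Implicit Types (f F u v w : X -> R) (c : X).

Definition grad2 F (x : X) := \sum_i pd i F x ^+ 2.

Lemma grad2_ge0 F x : 0 <= grad2 F x.
Proof. by apply: sumr_ge0 => i _; exact: sqr_ge0. Qed.

Lemma smooth_grad2 F : smooth F -> smooth (grad2 F).
Proof.
move=> sF; apply: smooth_sum => i _; under eq_fun do rewrite expr2.
by apply: smoothM; exact: smooth_pd.
Qed.

Lemma smooth_measurable F : smooth F -> measurable_fun setT F.
Proof. by move=> sF; exact: continuous_measurable_rV (smooth_continuous sF). Qed.

Definition i01 (t : R) : R := \1_(`[0, 1]%classic : set R) t.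

Lemma measurable_i01 : measurable_fun setT i01.
Proof. by apply: measurable_indic; exact: measurable_itv. Qed.

Lemma i01_ge0 t : 0 <= i01 t. Proof. by rewrite /i01 indicE. Qed.

Lemma integral_i01 : (\int[mu]_t (i01 t)%:E = 1)%E.
Proof.
have l : (mu (`[0%R, 1%R]%classic : set R) = 1)%E.
  by rewrite lebesgue_measure_itv/= lte_fin ltr01 oppr0 adde0.
by rewrite integral_indic// setIT; exact: l.
Qed.

(** The fundamental theorem along the segment from x to x + z, then Cauchy-Schwarz in t. The
    indicator [i01] is kept as a factor so that t ranges over the whole line when Fubini is
    applied. *)
Lemma increment_sq F (x z : X) (sg : R) : smooth F -> `|z| <= sg ->
  (((F (x + z) - F x) ^+ 2)%:E <=
   \int[mu]_t (n%:R * sg ^+ 2 * (i01 t * grad2 F (x + t *: z)))%:E)%E.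
Proof.
move=> sF zs; have sg0 : 0 <= sg by apply: le_trans zs.
pose h' (t : R) := \sum_i z ord0 i * pd i F (x + t *: z).
have dh (t : R) := is_derive_line x z t (smooth_diff sF).
have ch' : continuous h'.
  have -> : h' = fun t => (fun y : X => \sum_i z ord0 i * pd i F y) (x + t *: z) by [].
  move=> t; apply: differentiable_continuous; apply/derivable1_diffP.
  have sG : smooth (fun y : X => \sum_i z ord0 i * pd i F y).
    by apply: smooth_sum => i _; apply: smoothZ; exact: smooth_pd.
  by have [] := is_derive_line x z t (smooth_diff sG).
have mh' : measurable_fun setT h' by exact: continuous_measurable_fun.
have FE : (\int[mu]_t (i01 t * h' t)%:E = (F (x + z) - F x)%:E)%E.
  have := ftc_R ltr01 dh ch'; rewrite scale1r scale0r addr0 => <-.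
  rewrite [RHS]integral_mkcond; apply: eq_integral => t _; rewrite patchE /i01 indicE.
  by case: (_ \in _); rewrite ?mul1r ?mul0r.
have hH t : h' t ^+ 2 <= n%:R * sg ^+ 2 * grad2 F (x + t *: z).
  have cs : (\sum_i z ord0 i * pd i F (x + t *: z)) ^+ 2 <=
     n%:R * \sum_i (z ord0 i * pd i F (x + t *: z)) ^+ 2.
    by have := @sqr_sum_le R _ (fun i => z ord0 i * pd i F (x + t *: z)); rewrite card_ord.
  apply: (le_trans cs); rewrite -mulrA ler_wpM2l// mulr_sumr; apply: ler_sum => i _.
  rewrite exprMn ler_wpM2r ?sqr_ge0// -real_normK ?num_real// lerXn2r ?nnegrE//.
  exact: le_trans (rV_norm_coord z i) zs.
have mH : measurable_fun setT (fun t : R => grad2 F (x + t *: z)).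
  apply: continuous_measurable_fun => t; apply: differentiable_continuous; apply/derivable1_diffP.
  by have [] := is_derive_line x z t (smooth_diff (smooth_grad2 sF)).
set B := (X in (_ <= X)%E).
have B0 : (0 <= B)%E.
  apply: integral_ge0 => t _; rewrite lee_fin mulr_ge0// ?mulr_ge0 ?sqr_ge0 ?i01_ge0//.
  exact: grad2_ge0.
case: (ltP B +oo%E) => [Boo|]; last by rewrite leye_eq => /eqP ->; rewrite leey.
have Bfin : B \is a fin_num by rewrite ge0_fin_numE.
have mi := measurable_i01.
have CS : (\int[mu]_t (Num.sqrt (i01 t) * Num.sqrt (i01 t * h' t ^+ 2))%:E <=
    (Num.sqrt 1 * Num.sqrt (fine B))%:E)%E.
  apply: integral_CS => //.
  - by apply: measurable_funM => //; exact: measurable_funX.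
  - by move=> t; rewrite mulr_ge0 ?i01_ge0// sqr_ge0.
  - exact: fine_ge0.
  - by rewrite integral_i01.
  rewrite fineK//; apply: ge0_le_integral => //.
  - by move=> t _; rewrite lee_fin mulr_ge0 ?i01_ge0// sqr_ge0.
  - by apply/measurable_EFinP; apply: measurable_funM => //; exact: measurable_funX.
  - by apply/measurable_EFinP; apply: measurable_funM => //; exact: measurable_funM.
  by move=> t _; rewrite lee_fin [leRHS]mulrCA ler_wpM2l ?i01_ge0.
have : (`|F (x + z) - F x|%:E <= (Num.sqrt (fine B))%:E)%E.
  move: CS; rewrite sqrtr1 mul1r; apply: le_trans; rewrite -abse_EFin -FE.
  apply: (le_trans (le_abse_integral _ measurableT _)).
    by apply/measurable_EFinP; exact: measurable_funM.
  rewrite le_eqVlt; apply/orP; left; apply/eqP; apply: eq_integral => t _.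
  rewrite /= sqrtrM ?i01_ge0// sqrtr_sqr mulrA -expr2 sqr_sqrtr ?i01_ge0//.
  by rewrite normrM ger0_norm ?i01_ge0.
rewrite lee_fin => H2; rewrite -(fineK Bfin) lee_fin -real_normK ?num_real//.
by rewrite -(sqr_sqrtr (fine_ge0 B0)) lerXn2r ?nnegrE ?sqrtr_ge0.
Qed.

Lemma indic_cl_shift c (r r1 sg : R) (x y : X) : r + sg <= r1 -> `|y| <= sg ->
  (\1_(cl c r) x : R) <= \1_(cl c r1) (x + y).
Proof.
move=> rs ys; rewrite !indicE; case: (boolP (x \in cl c r)) => // /set_mem xr.
rewrite mem_set// /cl /= addrAC; apply: (le_trans (ler_normD _ _)).
by apply: le_trans rs; rewrite lerD.
Qed.

(** After Fubini, each t in [0, 1] contributes the gradient on the cube shifted by t z, which stays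
    inside the larger cube. *)
Lemma translation_L2 F c (r r1 sg : R) (z : X) : smooth F -> r + sg <= r1 -> `|z| <= sg ->
  (\int[leb]_x (\1_(cl c r) x * (F (x + z) - F x) ^+ 2)%:E <=
   (n%:R * sg ^+ 2)%:E * \int[leb]_x (\1_(cl c r1) x * grad2 F x)%:E)%E.
Proof.
move=> sF rs zs; have sg0 : 0 <= sg by apply: le_trans zs.
have mF := smooth_measurable sF; have sG := smooth_grad2 sF; have mG := smooth_measurable sG.
have K0 : 0 <= n%:R * sg ^+ 2 by rewrite mulr_ge0// sqr_ge0.
have m1 q : measurable_fun setT (\1_(cl c q) : X -> R).
  by apply: measurable_indic; exact: measurable_cl.
have i0 (A : set X) x : 0 <= (\1_A x : R) by rewrite indicE.
pose H (p : X * measurableTypeR R) := \1_(cl c r) p.1 * (n%:R * sg ^+ 2 * (i01 p.2 * grad2 F (p.1 +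
  p.2 *: z))).
have H0 p : (0 <= (H p)%:E)%E.
  by rewrite lee_fin !mulr_ge0 ?i01_ge0 ?grad2_ge0 ?sqr_ge0.
have mS : measurable_fun setT (fun p : X * measurableTypeR R => p.1 + p.2 *: z).
  apply: measurable_fun_rV => i; under eq_fun do rewrite !mxE.
  apply: measurable_funD; first exact: (measurableT_comp (measurable_fun_coord i) measurable_fst).
  by apply: measurable_funM => //; exact: measurable_snd.
have mH : measurable_fun setT (EFin \o H).
  apply/measurable_EFinP; apply: measurable_funM; first exact: (measurableT_comp (m1 r)
    measurable_fst).
  apply: measurable_funM => //; apply: measurable_funM.
    exact: (measurableT_comp measurable_i01 measurable_snd).
  exact: (measurableT_comp mG mS).
apply: (@le_trans _ _ (\int[leb]_x \int[mu]_t (H (x, t))%:E)%E).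
  apply: ge0_le_integral => //.
  - by move=> x _; rewrite lee_fin mulr_ge0// sqr_ge0.
  - apply/measurable_EFinP; apply: measurable_funM => //; apply: measurable_funX.
    apply: measurable_funB => //; exact: (measurableT_comp mF (@measurable_shift R n z)).
  - exact: (measurable_fun_fubini_tonelli_F (m2 := mu) _ mH H0).
  move=> x _; rewrite /H /=; under eq_integral do rewrite EFinM.
  rewrite ge0_integralZl//; last 2 first.
  - apply/measurable_EFinP; apply: measurable_funM => //; apply: measurable_funM; first exact:
    measurable_i01.
    apply: continuous_measurable_fun => t; apply: differentiable_continuous; apply/derivable1_diffP.
    by have [] := is_derive_line x z t (smooth_diff sG).
  - by move=> t _; rewrite lee_fin !mulr_ge0 ?i01_ge0 ?grad2_ge0 ?sqr_ge0.
  by rewrite EFinM; apply: lee_wpmul2l; [rewrite lee_fin|exact: increment_sq].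
rewrite (fubini_tonelli (m1 := leb) (m2 := mu) _ mH H0).
set E := (\int[leb]_x (\1_(cl c r1) x * grad2 F x)%:E)%E.
have E0 : (0 <= E)%E by apply: integral_ge0 => x _; rewrite lee_fin mulr_ge0 ?grad2_ge0.
have mE : measurable_fun setT (fun x : X => (\1_(cl c r1) x * grad2 F x)%:E).
  by apply/measurable_EFinP; exact: measurable_funM.
have mEs (y : X) : measurable_fun setT (fun x : X => (\1_(cl c r1) (x + y) * grad2 F (x + y))%:E).
  exact: (measurableT_comp mE (@measurable_shift R n y)).
apply: (@le_trans _ _ (\int[mu]_t ((i01 t)%:E * ((n%:R * sg ^+ 2)%:E * E)))%E); last first.
  rewrite ge0_integralZr//; last 3 first.
  - by apply/measurable_EFinP; exact: measurable_i01.
  - by move=> t _; rewrite lee_fin i01_ge0.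
  - by rewrite mule_ge0.
  by rewrite integral_i01 mul1e.
apply: ge0_le_integral => //.
- by move=> t _; apply: integral_ge0 => x _; exact: H0.
- exact: (measurable_fun_fubini_tonelli_G (m1 := leb) _ mH H0).
- under eq_fun do rewrite muleC.
  by apply: measurable_funeM; apply/measurable_EFinP; exact: measurable_i01.
move=> t _; rewrite -[E](ge0_integral_shift (t *: z) mE); last first.
  by move=> x; rewrite lee_fin mulr_ge0 ?grad2_ge0.
rewrite muleA -EFinM -ge0_integralZl//; last 2 first.
- by move=> x _; rewrite lee_fin mulr_ge0 ?grad2_ge0.
- by rewrite lee_fin mulr_ge0 ?i01_ge0.
apply: ge0_le_integral => //.
- by move=> x _; exact: H0.
- apply/measurable_EFinP; apply: measurable_funM => //; apply: measurable_funM => //.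
  apply: measurable_funM; first exact: (measurable_cst (i01 t)).
  exact: (measurableT_comp mG (@measurable_shift R n (t *: z))).
- by apply: measurable_funeM; exact: mEs.
move=> x _; rewrite /H /= -EFinM lee_fin.
rewrite [leLHS](_ : _ = n%:R * sg ^+ 2 * (i01 t * (\1_(cl c r) x * grad2 F (x + t *: z)))); last by
  ring.
rewrite [X in _ <= X * _]mulrC -[leRHS]mulrA ler_wpM2l//.
rewrite /i01 indicE; case: (boolP (t \in `[0, 1]%classic)) => t01; last by rewrite !mul0r.
rewrite !mul1r ler_wpM2r ?grad2_ge0//; apply: (indic_cl_shift c _ rs).
move: t01; rewrite inE /= in_itv/= => /andP[t0 t1].
by rewrite normrZ ger0_norm// (le_trans _ zs)// ler_piMl.
Qed.

Lemma lebesgue_cl c (r : R) : 0 <= r -> leb (cl c r) = ((r + r) ^+ n)%:E.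
Proof.
move=> r0; have := lebesgue_rV_shift (- c) (@measurable_ccube R n r).
rewrite lebesgue_ccube// => <-; rewrite /pushforward; congr (leb _).
by apply/seteqP; split=> x /=; rewrite /cl => /(ccubeP _ r0).
Qed.

Lemma integral_indic_cl c (r : R) : 0 <= r ->
  (\int[leb]_x ((\1_(cl c r) x : R)%:E) = ((r + r) ^+ n)%:E)%E.
Proof.
move=> r0; rewrite integral_indic//; last exact: measurable_cl.
by rewrite setIT; exact: lebesgue_cl.
Qed.

(** A Poincaré inequality with translates in place of the mean. Integrated over |z| <= sg, the
    inequality |F x| <= |F (x+z) - F x| + |F (x+z)| bounds V |F x|. The increments are controlled by
    the gradient through [translation_L2], the translates by the L^1 norm, so an L^1 bound is
    upgraded to L^2 on a smaller cube. *)
Lemma local_L2 (r r1 : R) : 0 <= r -> r < r1 -> exists2 C, 0 <= C & forall c F E L,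
  smooth F -> 0 <= E -> 0 <= L ->
  (\int[leb]_x (\1_(cl c r1) x * grad2 F x)%:E <= E%:E)%E ->
  (\int[leb]_x (\1_(cl c r1) x * `|F x|)%:E <= L%:E)%E ->
  (\int[leb]_x (\1_(cl c r) x * F x ^+ 2)%:E <= (C * (E + L ^+ 2))%:E)%E.
Proof.
move=> r0 rr1; pose sg := r1 - r; have sg0 : 0 < sg by rewrite subr_gt0.
pose V := (sg + sg) ^+ n; have V0 : 0 < V by rewrite exprn_gt0// addr_gt0.
pose W := (r + r) ^+ n; have W0 : 0 <= W by rewrite exprn_ge0// addr_ge0.
pose C1 := 2 * (n%:R * sg ^+ 2); pose C2 := 2 / V ^+ 2 * W.
have C10 : 0 <= C1 by apply: mulr_ge0 => //; apply: mulr_ge0 => //; exact: sqr_ge0.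
have C20 : 0 <= C2 by rewrite mulr_ge0// divr_ge0// sqr_ge0.
exists (C1 + C2); first exact: addr_ge0.
move=> c F E L sF E0 L0 hE hL.
have mF := smooth_measurable sF.
have rs : r + sg <= r1 by rewrite /sg; lra.
pose K : X -> R := \1_(cl 0 sg).
have i0 (A : set X) x : 0 <= (\1_A x : R) by rewrite indicE.
have m1 q y : measurable_fun setT (\1_(cl y q) : X -> R).
  by apply: measurable_indic; exact: measurable_cl.
have IK : (\int[leb]_z (K z)%:E = V%:E)%E by rewrite integral_indic_cl// ltW.
have Kz z : K z != 0 -> `|z| <= sg.
  rewrite /K indicE; case: (boolP (_ \in _)); rewrite ?eqxx// inE /cl /=.
  by rewrite subr0.
pose D x : \bar R := (\int[leb]_z (K z * (F (x + z) - F x) ^+ 2)%:E)%E.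
have mFs (x : X) : measurable_fun setT (fun z : X => F (x + z)).
  by under eq_fun do rewrite addrC; exact: (measurableT_comp mF (@measurable_shift R n x)).
have D0 x : (0 <= D x)%E by apply: integral_ge0 => z _; rewrite lee_fin mulr_ge0// sqr_ge0.
have pw x : cl c r x -> ((F x ^+ 2)%:E <= (2 / V)%:E * D x + (2 / V ^+ 2 * L ^+ 2)%:E)%E.
  move=> xr; have V20 : (0 < (2 / V)%:E :> \bar R)%E by rewrite lte_fin divr_gt0.
  case: (ltP (D x) +oo%E) => [Doo|]; last first.
    by rewrite leye_eq => /eqP ->; rewrite gt0_muley// addye// leey.
  have Dfin : D x \is a fin_num by rewrite ge0_fin_numE.
  have CS : (\int[leb]_z (Num.sqrt (K z) * Num.sqrt (K z * (F (x + z) - F x) ^+ 2))%:E <=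
      (Num.sqrt V * Num.sqrt (fine (D x)))%:E)%E.
    apply: integral_CS => //.
    - exact: m1.
    - apply: measurable_funM; first exact: m1.
      by apply: measurable_funX; exact: measurable_funB.
    - by move=> z; rewrite mulr_ge0// ?sqr_ge0//; exact: i0.
    - exact: ltW.
    - exact: fine_ge0.
    - by rewrite IK.
    - by rewrite fineK.
  have b1 : (\int[leb]_z (K z * `|F (x + z) - F x|)%:E <= (Num.sqrt V * Num.sqrt (fine (D
    x)))%:E)%E.
    apply: le_trans CS; rewrite le_eqVlt; apply/orP; left; apply/eqP; apply: eq_integral => z _.
    by rewrite sqrtrM ?i0// sqrtr_sqr mulrA -expr2 sqr_sqrtr// i0.
  have mL : measurable_fun setT (fun y : X => (\1_(cl c r1) y * `|F y|)%:E).
    by apply/measurable_EFinP; apply: measurable_funM => //; exact: measurableT_comp.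
  have b2 : (\int[leb]_z (K z * `|F (x + z)|)%:E <= L%:E)%E.
    apply: le_trans hL; rewrite -(ge0_integral_shift x mL); last by move=> y; rewrite lee_fin
      mulr_ge0.
    apply: ge0_le_integral => //.
    - by move=> z _; rewrite lee_fin mulr_ge0//; exact: i0.
    - apply/measurable_EFinP; apply: measurable_funM; first exact: m1.
      by apply: measurableT_comp.
    - exact: (measurableT_comp mL (@measurable_shift R n x)).
    move=> z _; rewrite lee_fin [z + x]addrC ler_wpM2r//.
    have [->|/Kz zs] := eqVneq (K z) 0; first exact: i0.
    have := indic_cl_shift c x rs zs; rewrite [leLHS]indicE mem_set//; apply: le_trans.
    by rewrite /K indicE; case: (_ \in _).
  have b3 : ((V * `|F x|)%:E <= (Num.sqrt V * Num.sqrt (fine (D x)) + L)%:E)%E.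
    rewrite EFinD; apply: le_trans (leeD b1 b2).
    rewrite -ge0_integralD//; last 4 first.
    - by move=> z _; rewrite lee_fin mulr_ge0//; exact: i0.
    - apply/measurable_EFinP; apply: measurable_funM; first exact: m1.
      by apply: measurableT_comp => //; exact: measurable_funB.
    - by move=> z _; rewrite lee_fin mulr_ge0//; exact: i0.
    - apply/measurable_EFinP; apply: measurable_funM; first exact: m1.
      by apply: measurableT_comp.
    rewrite EFinM -IK -ge0_integralZr//; last 2 first.
    - by apply/measurable_EFinP; exact: m1.
    - by move=> z _; rewrite lee_fin; exact: i0.
    apply: ge0_le_integral => //.
    - by move=> z _; rewrite -EFinM lee_fin mulr_ge0//; exact: i0.
    - under eq_fun do rewrite -EFinM.
      by apply/measurable_EFinP; apply: measurable_funM => //; exact: m1.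
    - under eq_fun do rewrite -EFinD; apply/measurable_EFinP; apply: measurable_funD.
        apply: measurable_funM; first exact: m1.
        by apply: measurableT_comp => //; exact: measurable_funB.
      by apply: measurable_funM; [exact: m1|exact: measurableT_comp].
    move=> z _; rewrite -EFinM -EFinD lee_fin -mulrDr ler_wpM2l//.
    by have := ler_normB (F (x + z)) (F (x + z) - F x); rewrite subKr addrC.
  rewrite -(fineK Dfin) -EFinM -EFinD lee_fin; move: b3; rewrite lee_fin => b3.
  have d0 := fine_ge0 (D0 x); have s0 := sqrtr_ge0 V; have s1 := sqrtr_ge0 (fine (D x)).
  have e1 := sqr_sqrtr (ltW V0); have e2 := sqr_sqrtr d0.
  have b4 : (V * `|F x|) ^+ 2 <= 2 * (V * fine (D x) + L ^+ 2).
    apply: (@le_trans _ _ ((Num.sqrt V * Num.sqrt (fine (D x)) + L) ^+ 2)).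
      rewrite lerXn2r ?nnegrE ?addr_ge0 ?mulr_ge0//; exact: ltW.
    have -> : V * fine (D x) = (Num.sqrt V * Num.sqrt (fine (D x))) ^+ 2 by rewrite exprMn e1 e2.
    by move: (Num.sqrt V * _) => a; have := sqr_ge0 (a - L); rewrite sqrrB sqrrD; lra.
  rewrite exprMn real_normK ?num_real// in b4.
  have V2 : 0 < V ^+ 2 by rewrite exprn_gt0.
  rewrite -(ler_pM2l V2); apply: (le_trans b4); apply: eqle.
  by field; rewrite gt_eqF.
pose H (p : X * X) := \1_(cl c r) p.1 * (K p.2 * (F (p.1 + p.2) - F p.1) ^+ 2).
have H0 p : (0 <= (H p)%:E)%E by rewrite lee_fin mulr_ge0// mulr_ge0 ?sqr_ge0//; exact: i0.
have mH : measurable_fun setT (EFin \o H).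
  apply/measurable_EFinP; apply: measurable_funM; first exact: (measurableT_comp (m1 r c)
    measurable_fst).
  apply: measurable_funM; first exact: (measurableT_comp (m1 sg 0) measurable_snd).
  apply: measurable_funX; apply: measurable_funB; first exact: measurable_shift_pair.
  exact: (measurableT_comp mF measurable_fst).
have mI : measurable_fun setT (fun x => \int[leb]_z (H (x, z))%:E)%E.
  exact: (measurable_fun_fubini_tonelli_F (m2 := leb) _ mH H0).
have I0 x : (0 <= \int[leb]_z (H (x, z))%:E)%E by apply: integral_ge0 => z _; exact: H0.
have c1 : 0 <= 2 / V by rewrite divr_ge0// ltW.
have c2 : 0 <= 2 / V ^+ 2 * L ^+ 2 by rewrite mulr_ge0 ?sqr_ge0// divr_ge0// sqr_ge0.
apply: (@le_trans _ _ (\int[leb]_x ((2 / V)%:E * (\int[leb]_z (H (x, z))%:E) +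
    (2 / V ^+ 2 * L ^+ 2)%:E * (\1_(cl c r) x)%:E))%E).
  apply: ge0_le_integral => //.
  - by move=> x _; rewrite lee_fin mulr_ge0// sqr_ge0.
  - by apply/measurable_EFinP; apply: measurable_funM => //; exact: measurable_funX.
  - apply: emeasurable_funD; first exact: measurable_funeM.
    by apply: measurable_funeM; apply/measurable_EFinP; exact: m1.
  move=> x _; rewrite indicE; case: (boolP (x \in cl c r)) => xr; last first.
    by rewrite mul0r mule0 adde0 mule_ge0// lee_fin.
  rewrite mul1r mule1; have /pw := set_mem xr.
  suff -> : D x = (\int[leb]_z (H (x, z))%:E)%E by [].
  by apply: eq_integral => z _; rewrite /H /= indicE xr mul1r.
rewrite ge0_integralD//.
all: try solve [by apply: measurable_funeM; apply/measurable_EFinP; exact: m1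
  | exact: measurable_funeM | by move=> x _; rewrite mule_ge0// lee_fin].
rewrite ge0_integralZl// [X in (_ + X <= _)%E]ge0_integralZl//.
all: try solve [by apply/measurable_EFinP; exact: m1].
rewrite integral_indic_cl//.
rewrite (fubini_tonelli (m1 := leb) (m2 := leb) _ mH H0).
have key : (\int[leb]_z \int[leb]_x (EFin \o H) (x, z) <= (V * (n%:R * sg ^+ 2 * E))%:E)%E.
  rewrite EFinM -IK -ge0_integralZr//; last 3 first.
  - by apply/measurable_EFinP; exact: m1.
  - by move=> z _; rewrite lee_fin; exact: i0.
  - by rewrite lee_fin mulr_ge0// mulr_ge0// sqr_ge0.
  apply: ge0_le_integral => //.
  - by move=> z _; apply: integral_ge0 => x _; exact: H0.
  - exact: (measurable_fun_fubini_tonelli_G (m1 := leb) _ mH H0).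
  - under eq_fun do rewrite muleC.
    by apply: measurable_funeM; apply/measurable_EFinP; exact: m1.
  move=> z _; rewrite /H /=.
  have -> : (fun x => (\1_(cl c r) x * (K z * (F (x + z) - F x) ^+ 2))%:E) =
    (fun x => (K z)%:E * (\1_(cl c r) x * (F (x + z) - F x) ^+ 2)%:E)%E.
    by apply/funext => x; rewrite -EFinM mulrCA.
  have [->|/Kz zs] := eqVneq (K z) 0.
    by under eq_integral do rewrite mul0e; rewrite integral0 mul0e.
  rewrite ge0_integralZl//; last 3 first.
  - apply/measurable_EFinP; apply: measurable_funM => //; apply: measurable_funX.
    by apply: measurable_funB => //; exact: (measurableT_comp mF (@measurable_shift R n z)).
  - by move=> x _; rewrite lee_fin mulr_ge0// sqr_ge0.
  - by rewrite lee_fin; exact: i0.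
  apply: lee_wpmul2l; first by rewrite lee_fin; exact: i0.
  apply: (le_trans (translation_L2 c sF rs zs)); rewrite [leRHS]EFinM.
  by apply: lee_wpmul2l => //; rewrite lee_fin mulr_ge0// sqr_ge0.
apply: (@le_trans _ _ ((2 / V)%:E * (V * (n%:R * sg ^+ 2 * E))%:E + (2 / V ^+ 2 * L ^+ 2 *
  W)%:E)%E).
  apply: leeD; last by rewrite -EFinM.
  by apply: lee_wpmul2l; [rewrite lee_fin|exact: key].
rewrite -EFinM -EFinD lee_fin.
have -> : 2 / V * (V * (n%:R * sg ^+ 2 * E)) + 2 / V ^+ 2 * L ^+ 2 * W = C1 * E + C2 * L ^+ 2.
  by rewrite /C1 /C2; field; rewrite gt_eqF.
by rewrite mulrDr !mulrDl; apply: lerD; rewrite ?lerDl ?lerDr mulr_ge0// sqr_ge0.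
Qed.
End translation.

(** * Square integrability of lower order derivatives, and approximation by test functions *)

Section bootstrap.
Context {R : realType} {n : nat}.
Local Notation X := 'rV[R]_n.
Local Notation leb := (@lebesgue_rV R n).
Implicit Types (f F u v w : X -> R) (c : X).

Lemma indic_ge0 (A : set X) (x : X) : 0 <= (\1_A x : R).
Proof. by rewrite indicE. Qed.

Lemma indic_le1 (A : set X) (x : X) : (\1_A x : R) <= 1.
Proof. by rewrite indicE; case: (_ \in _). Qed.

Lemma measurable_indic_cl c (r : R) : measurable_fun setT (\1_(cl c r) : X -> R).
Proof. by apply: measurable_indic; exact: measurable_cl. Qed.

Lemma cvg_dist0 (a : nat -> R) (b : R) : `|a k - b| @[k --> \oo] --> 0 -> a k @[k --> \oo] --> b.
Proof.
move=> /cvgrPdist_lt h; apply/cvgrPdist_lt => e /h; apply: filterS => k.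
by rewrite sub0r normrN normr_id distrC.
Qed.

Lemma res_sqr c r v x : `|res c r v x| ^+ 2 = \1_(cl c r) x * v x ^+ 2.
Proof.
rewrite real_normK ?num_real// /res exprMn mulrC; congr (_ * _).
by rewrite indicE; case: (_ \in _); rewrite ?expr1n ?expr0n.
Qed.

Lemma cl_sub c (r r' : R) : r <= r' -> cl c r `<=` cl c r'.
Proof. by move=> rr x /= /le_trans; apply. Qed.

Lemma mollify p (I : finType) (w : I -> X -> R) (rho0 e : R) : p12 p -> 0 < rho0 -> 0 < e ->
  (forall i, leb.-integrable setT (EFin \o w i)) -> (forall i, apx p (w i)) ->
  exists rho phi, [/\ 0 < rho <= rho0, mollk rho phi &
    forall i, (\int[leb]_x (`|Jk phi (w i) x - w i x| ^+ p)%:E <= e%:E)%E].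
Proof.
move=> p12p rho00 e0 iw aw.
have h i : exists r0, 0 < r0 /\ forall rho phi, 0 < rho <= r0 -> mollk rho phi ->
    (\int[leb]_x (`|Jk phi (w i) x - w i x| ^+ p)%:E <= e%:E)%E.
  by have [r0 r00 hr0] := Jk_cvg p12p (iw i) (aw i) e0; exists r0.
have {}[r0 hr0] := choice h.
have ri0 i : 0 < r0 i by have [] := hr0 i.
have s0 : 0 <= \sum_i (r0 i)^-1 by apply: sumr_ge0 => i _; rewrite invr_ge0 ltW.
(* The reciprocal of a sum of reciprocals lies below each of the finitely many thresholds. *)
pose rho := (rho0^-1 + \sum_i (r0 i)^-1)^-1.
have d0 : 0 < rho0^-1 + \sum_i (r0 i)^-1 by rewrite ltr_pwDl// invr_gt0.
have rhop : 0 < rho by rewrite invr_gt0.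
have [phi mphi] := mollk_exists (n := n) rhop.
exists rho, phi; split => //.
  by rewrite rhop /= -[leRHS]invrK lef_pV2 ?posrE ?invr_gt0// lerDl.
move=> i; apply: ((hr0 i).2 rho phi _ mphi); rewrite rhop /= -[leRHS]invrK lef_pV2 ?posrE
  ?invr_gt0//.
rewrite (bigD1 i)//= addrCA lerDl addr_ge0 ?invr_ge0 ?(ltW rho00)//.
by apply: sumr_ge0 => j _; rewrite invr_ge0 ltW.
Qed.

Lemma mollify_seq p (I : finType) (w : I -> X -> R) (rho0 : R) : p12 p -> 0 < rho0 ->
  (forall i, leb.-integrable setT (EFin \o w i)) -> (forall i, apx p (w i)) ->
  exists (rho : nat -> R) (phi : nat -> X -> R), forall k,
    [/\ 0 < rho k <= rho0, mollk (rho k) (phi k) &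
    forall i, (\int[leb]_x (`|Jk (phi k) (w i) x - w i x| ^+ p)%:E <= (1 / (2 ^ k.+1)%:R)%:E)%E].
Proof.
move=> p12p rho00 iw aw.
have h k : exists z : R * (X -> R), [/\ 0 < z.1 <= rho0, mollk z.1 z.2 &
    forall i, (\int[leb]_x (`|Jk z.2 (w i) x - w i x| ^+ p)%:E <= (1 / (2 ^ k.+1)%:R)%:E)%E].
  have e0 : 0 < 1 / (2 ^ k.+1)%:R :> R by rewrite divr_gt0// ltr0n expn_gt0.
  by have [rho [phi h]] := mollify p12p rho00 e0 iw aw; exists (rho, phi).
have {h}[z hz] := choice h.
by exists (fun k => (z k).1), (fun k => (z k).2).
Qed.

(** On a slightly smaller cube the derivative s of the mollified u is the mollified v, and its
    gradient is the mollified g. [local_L2] bounds it in L^2 uniformly, from the L^1 norm of v and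
    the L^2 norms of g, and Fatou passes to v. *)
Lemma bootstrap_step Omega c s u v (g : 'I_n -> X -> R) (r r2 : R) :
  0 <= r -> r < r2 -> cl c r2 `<=` Omega -> wds Omega s u v ->
  (forall i, wds Omega (i :: s) u (g i)) ->
  (forall i, (\int[leb]_x (\1_(cl c r2) x * g i x ^+ 2)%:E < +oo)%E) ->
  (\int[leb]_x (\1_(cl c r) x * v x ^+ 2)%:E < +oo)%E.
Proof.
move=> r0 rr2 Om wv wg g2; pose r1 := (r + r2) / 2.
have rr1 : r < r1 by rewrite /r1; lra.
have r12 : r1 < r2 by rewrite /r1; lra.
have [lu lv _] := wv; have iu := integrable_res lu Om; have iv := integrable_res lv Om.
have ig i : leb.-integrable setT (EFin \o res c r2 (g i)).
  by have [_ lg _] := wg i; exact: integrable_res lg Om.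
have mv : measurable_fun setT (res c r2 v) by apply/measurable_EFinP; have /integrableP[] := iv.
have av : apx 1 (res c r2 v).
  by apply: (@apx_res _ _ 1 Omega) => //; exact: (integrable_abse iv).
have [rho [phi hphi]] := @mollify_seq 1 'I_1 (fun=> res c r2 v) (r2 - r1) isT
  ltac:(by rewrite subr_gt0) (fun=> iv) (fun=> av).
have mphi k : mollk (rho k) (phi k) by have [] := hphi k.
have rhol k : rho k <= r2 - r1 by have [/andP[]] := hphi k.
have tphi k := mollk_tf (mphi k).
pose J k := Jk (phi k) (res c r2 v).
pose F k := pderive s (Jk (phi k) (res c r2 u)).
have sF k : smooth (F k) by apply: smooth_pderive; exact: smooth_Jk.
have sJ k : smooth (J k) by exact: smooth_Jk.
have inc k x : cl c r1 x -> `|x - c| <= r2 - rho k.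
  by rewrite /cl /= => /le_trans; apply; have := rhol k; lra.
have FJ k x : cl c r1 x -> F k x = J k x.
  by move=> xr; exact: (Jk_wds wv Om (mphi k) (inc k _ xr)).
have dF k i x : cl c r1 x -> pd i (F k) x = Jk (phi k) (res c r2 (g i)) x.
  by move=> xr; rewrite -(Jk_wds (wg i) Om (mphi k) (inc k _ xr)) pderive_cons.
pose E := (\sum_i \int[leb]_x (`|res c r2 (g i) x| ^+ 2)%:E)%E.
have Ei i : (0 <= \int[leb]_x (`|res c r2 (g i) x| ^+ 2)%:E)%E.
  by apply: integral_ge0 => x _; rewrite lee_fin exprn_ge0.
have Efin : E \is a fin_num.
  rewrite ge0_fin_numE; last exact: sume_ge0.
  apply: lte_sum_pinfty => i _; apply: le_lt_trans (g2 i).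
  by rewrite le_eqVlt; apply/orP; left; apply/eqP; apply: eq_integral => x _; rewrite res_sqr.
pose L := (\int[leb]_x (`|res c r2 v x|)%:E)%E.
have L0 : (0 <= L)%E by apply: integral_ge0 => x _; rewrite lee_fin.
have Lfin : L \is a fin_num.
  by rewrite ge0_fin_numE//; have /integrableP[] := iv.
have [C C0 HC] := local_L2 (n := n) r0 rr1.
have bnd k : (\int[leb]_x (\1_(cl c r) x * J k x ^+ 2)%:E <= (C * (fine E + fine L ^+ 2))%:E)%E.
  have -> : (\int[leb]_x (\1_(cl c r) x * J k x ^+ 2)%:E = \int[leb]_x (\1_(cl c r) x * F k x ^+
    2)%:E)%E.
    apply: eq_integral => x _; rewrite indicE; case: (boolP (x \in cl c r)) => [/set_mem xr|]; last
      by rewrite !mul0r.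
    by rewrite FJ//; apply: cl_sub xr; exact: ltW.
  apply: HC => //.
  - by apply: fine_ge0; exact: sume_ge0.
  - exact: fine_ge0.
  - rewrite fineK// /E.
    apply: (@le_trans _ _ (\sum_i \int[leb]_x (`|Jk (phi k) (res c r2 (g i)) x| ^+ 2)%:E)%E); last
      first.
      by apply: lee_sum => i _; exact: (Jk_contraction (p := 2) isT (mphi k) (ig i)).
    have mJ i : measurable_fun setT (fun x => (`|Jk (phi k) (res c r2 (g i)) x| ^+ 2)%:E).
      by apply/measurable_EFinP; apply: measurable_normX; apply: smooth_measurable; exact:
        smooth_Jk.
    rewrite -ge0_integral_sum//.
    apply: ge0_le_integral => //.
    + by move=> x _; rewrite lee_fin mulr_ge0 ?grad2_ge0// indic_ge0.
    + apply/measurable_EFinP; apply: measurable_funM; first exact: measurable_indic_cl.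
      by apply: smooth_measurable; exact: smooth_grad2.
    + by apply: emeasurable_sum => i _; exact: mJ.
    move=> x _; rewrite sumEFin lee_fin indicE; case: (boolP (x \in cl c r1)) => [/set_mem xr|_];
      last first.
      by rewrite mul0r; apply: sumr_ge0 => i _; rewrite exprn_ge0.
    by rewrite mul1r; apply: ler_sum => i _; rewrite dF// real_normK ?num_real.
  - rewrite fineK//; apply: (@le_trans _ _ (\int[leb]_x (`|J k x| ^+ 1)%:E)%E); last first.
      exact: (Jk_contraction (p := 1) isT (mphi k) iv).
    have mJ : measurable_fun setT (J k) by exact: smooth_measurable.
    apply: ge0_le_integral => //.
    + apply/measurable_EFinP; apply: measurable_funM; first exact: measurable_indic_cl.
      by apply: measurableT_comp => //; exact: smooth_measurable.
    + by apply/measurable_EFinP; apply: measurable_normX.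
    move=> x _; rewrite lee_fin indicE; case: (boolP (x \in cl c r1)) => [/set_mem xr|_]; last by
      rewrite mul0r.
    by rewrite mul1r FJ.
have ae0 : {ae leb, forall x, `|J k x - res c r2 v x| @[k --> \oo] --> 0}.
  apply: ae_cvg0_summable => [k|k x //|k].
    by apply: measurableT_comp => //; apply: measurable_funB => //; exact: smooth_measurable.
  by have [_ _ /(_ ord0)] := hphi k.
apply: le_lt_trans (ltry (C * (fine E + fine L ^+ 2))).
apply: (fatou_ae (f := fun k x => \1_(cl c r) x * J k x ^+ 2)) bnd.
- move=> k; apply: measurable_funM; first exact: measurable_indic_cl.
  by apply: measurable_funX; exact: smooth_measurable.
- have -> : (fun x => \1_(cl c r) x * v x ^+ 2) = (fun x => \1_(cl c r) x * res c r2 v x ^+ 2).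
    apply/funext => x; rewrite indicE; case: (boolP (x \in cl c r)) => [/set_mem xr|]; last by
      rewrite !mul0r.
    by rewrite res_in//; apply: cl_sub xr; exact/ltW/(lt_trans rr1).
  by apply: measurable_funM; [exact: measurable_indic_cl|exact: measurable_funX].
- by move=> k x; rewrite mulr_ge0 ?indic_ge0// sqr_ge0.
- by move=> x; rewrite mulr_ge0 ?indic_ge0// sqr_ge0.
apply: filterS ae0 => x Jx; rewrite indicE; case: (boolP (x \in cl c r)) => [/set_mem xr|_]; last
  first.
  by under eq_fun do rewrite mul0r; rewrite mul0r; exact: cvg_cst.
under eq_fun do rewrite mul1r; rewrite mul1r.
have Jv : J k x @[k --> \oo] --> v x.
  rewrite -(@res_in _ _ c r2 v x); last by apply: cl_sub xr; exact/ltW/(lt_trans rr1).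
  exact: cvg_dist0.
under eq_fun do rewrite expr2; rewrite expr2; exact: cvgM.
Qed.

(** Descending induction on the order. Each step down needs a slightly larger cube, and every radius
    below S is available. *)
Lemma bootstrap Omega c m u (G : seq 'I_n -> X -> R) (S : R) :
  (forall r, r < S -> cl c r `<=` Omega) ->
  (forall s, (size s <= m)%N -> wds Omega s u (G s)) ->
  (forall s r, size s = m -> r < S -> (\int[leb]_x (\1_(cl c r) x * G s x ^+ 2)%:E < +oo)%E) ->
  forall s r, (size s <= m)%N -> r < S -> (\int[leb]_x (\1_(cl c r) x * G s x ^+ 2)%:E < +oo)%E.
Proof.
move=> Om wG Gm.
have main j : forall s r, (size s + j = m)%N -> 0 <= r -> r < S ->
    (\int[leb]_x (\1_(cl c r) x * G s x ^+ 2)%:E < +oo)%E.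
  elim: j => [|j ih] s r; first by rewrite addn0 => sm _; exact: Gm.
  move=> sj r0 rS; pose r2 := (r + S) / 2.
  have r2S : r2 < S by rewrite /r2; lra.
  have rr2 : r < r2 by rewrite /r2; lra.
  apply: (bootstrap_step (u := u) (g := fun i => G (i :: s)) r0 rr2 (Om _ r2S)).
  - by apply: wG; rewrite -sj leq_addr.
  - by move=> i; apply: wG => /=; rewrite -sj -addSnnS leq_addr.
  - by move=> i; apply: ih => //=; [rewrite -sj addSnnS|lra].
move=> s r sm rS; have [r0|r0] := leP 0 r; first by apply: (main (m - size s)%N); rewrite ?subnKC.
rewrite integral0_eq ?ltry// => x _; rewrite indicE.
case: (boolP (x \in cl c r)) => [/set_mem|_]; last by rewrite mul0r.
by move=> /le_lt_trans /(_ r0); rewrite normr_lt0.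
Qed.

Lemma en_full k f (B : R) : smooth f ->
  (forall s, size s = k -> en 0 (pderive s f) <= B) -> en k f <= n%:R ^+ k * B.
Proof.
elim: k f => [|k ih] f sf h; first by rewrite expr0 mul1r; exact: (h [::]).
have -> : n%:R ^+ k.+1 * B = \sum_(i < n) n%:R ^+ k * B.
  by rewrite sumr_const card_ord exprS -mulrA mulr_natl.
rewrite /=; apply: ler_sum => i _; apply: ih; first exact: smooth_pd.
by move=> s sk; rewrite -pderive_rcons; apply: h; rewrite size_rcons sk.
Qed.

Lemma tfMl f g : tf f -> smooth g -> tf (f \* g).
Proof.
move=> tff sg; have -> : f \* g = g \* f by apply/funext => x /=; rewrite mulrC.
exact: tfM.
Qed.

Lemma en0_mul_loc c (r : R) h f (B e : R) : 0 <= B -> tf h -> smooth f ->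
  (forall x, `|h x| <= B * \1_(cl c r) x) ->
  (\int[leb]_x (\1_(cl c r) x * f x ^+ 2)%:E <= e%:E)%E -> en 0 (h \* f) <= B ^+ 2 * e.
Proof.
move=> B0 th sf hB fe; have tg : tf (h \* f) by exact: tfMl.
have cg : cb (fun x => (h \* f) x ^+ 2) by apply: cb_sqr_tf.
rewrite -lee_fin [en _ _]/= -itg_EFin//.
have mF : measurable_fun setT (fun x => (\1_(cl c r) x * f x ^+ 2)%:E).
  apply/measurable_EFinP; apply: measurable_funM; first exact: measurable_indic_cl.
  by apply: measurable_funX; exact: smooth_measurable.
have F0 x : (0 <= (\1_(cl c r) x * f x ^+ 2)%:E)%E.
  by rewrite lee_fin mulr_ge0 ?indic_ge0// sqr_ge0.
apply: (@le_trans _ _ ((B ^+ 2)%:E * e%:E)%E) => //.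
apply: (@le_trans _ _ (\int[leb]_x ((B ^+ 2)%:E * (\1_(cl c r) x * f x ^+ 2)%:E))%E).
  apply: ge0_le_integral => //.
  - by move=> x _; rewrite lee_fin sqr_ge0.
  - by apply/measurable_EFinP; exact: measurable_cb.
  - exact: measurable_funeM.
  move=> x _; rewrite -EFinM lee_fin /= exprMn [leRHS]mulrA ler_wpM2r ?sqr_ge0//.
  rewrite -real_normK ?num_real//; apply: (@le_trans _ _ ((B * \1_(cl c r) x) ^+ 2)).
    by rewrite lerXn2r ?nnegrE ?mulr_ge0 ?indic_ge0.
  rewrite exprMn ler_wpM2l ?sqr_ge0// expr2 ler_piMr ?indic_ge0//; exact: indic_le1.
rewrite ge0_integralZl//; last by rewrite lee_fin sqr_ge0.
by apply: lee_wpmul2l => //; rewrite lee_fin sqr_ge0.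
Qed.

(** A product estimate for f smooth but without bounded support: only its derivatives on the cube
    carrying [h] enter. *)
Lemma en_mul_loc k c (r : R) h (B : R) : 0 <= B -> tf h ->
  (forall s x, (size s <= k)%N -> `|pderive s h x| <= B * \1_(cl c r) x) ->
  exists C, 0 <= C /\ forall f (e : R), smooth f -> 0 <= e ->
  (forall s, (size s <= k)%N ->
     (\int[leb]_x (\1_(cl c r) x * pderive s f x ^+ 2)%:E <= e%:E)%E) ->
  en k (h \* f) <= C * e.
Proof.
move=> B0 th hB.
exists (n%:R ^+ k * (2 ^+ (2 ^ k) * ((2 ^ k)%:R * B ^+ 2))); split.
  by rewrite mulr_ge0// mulr_ge0// mulr_ge0// sqr_ge0.
move=> f e sf e0 fe; have sh : smooth h by case: th.
have tg : tf (h \* f) by exact: tfMl.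
rewrite -mulrA; apply: en_full; first by case: tg.
move=> s sk.
have -> : pderive s (h \* f) = fun x => \sum_(p <- splits s) (pderive p.1 h \* pderive p.2 f) x.
  by apply/funext => x; rewrite pderiveM.
have tfp (p : seq 'I_n * seq 'I_n) : tf (pderive p.1 h \* pderive p.2 f).
  by apply: tfMl; [exact: tf_pderive|exact: smooth_pderive].
apply: (le_trans (en_sum 0 (splits s) tfp)); rewrite size_splits sk -mulrA ler_wpM2l//.
have -> : (2 ^ k)%:R * B ^+ 2 * e = \sum_(p <- splits s) B ^+ 2 * e.
  by rewrite big_const_seq count_predT size_splits sk iter_addr_0 -mulrA mulr_natl.
rewrite big_seq [leRHS]big_seq; apply: ler_sum => p ps.
have /allP/(_ _ ps)/eqP := splits_size s; rewrite sk => pk.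
apply: (en0_mul_loc (c := c) (r := r)) => //.
- exact: tf_pderive.
- exact: smooth_pderive.
- by move=> x; apply: hB; rewrite -pk leq_addr.
- by apply: fe; rewrite -pk leq_addl.
Qed.

(** The mollified u times a cut-off that is 1 near the cube of radius R1. It is Cauchy in all
    energies up to order m because [bootstrap] puts all these derivatives in L^2 around the support
    of the cut-off. One mollifier serves the finitely many components and sequences of
    directions. *)
Lemma approximants (I : finType) Omega c m (u : I -> X -> R) (G : I -> seq 'I_n -> X -> R) (R1 S :
  R) :
  0 <= R1 -> R1 < S -> (forall r, r < S -> cl c r `<=` Omega) ->
  (forall i s, (size s <= m)%N -> wds Omega s (u i) (G i s)) ->
  (forall i s r, size s = m -> r < S -> (\int[leb]_x (\1_(cl c r) x * G i s x ^+ 2)%:E < +oo)%E) ->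
  exists U : nat -> I -> X -> R, [/\ forall k i, tf (U k i),
    forall k i s, (size s <= m)%N ->
      (\int[leb]_x (\1_(cl c R1) x * (pderive s (U k i) x - G i s x) ^+ 2)%:E <=
       (1 / (2 ^ k.+1)%:R)%:E)%E &
    forall e : R, 0 < e -> exists k0, forall k l i j, (k0 <= k)%N -> (k0 <= l)%N -> (j <= m)%N ->
      en j (fun x => U k i x - U l i x) <= e].
Proof.
move=> R10 R1S Om wG Gm.
(* The cut-off is 1 up to R2 and vanishes from R3 on; u is truncated at R4, so up to R3
   mollification commutes with weak derivatives. *)
pose R2 := R1 + (S - R1) / 4; pose R3 := R1 + (S - R1) / 2; pose R4 := R1 + (S - R1) * (3 / 4).
have R12 : R1 < R2 by rewrite /R2; lra.
have R23 : R2 < R3 by rewrite /R2 /R3; lra.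
have R34 : R3 < R4 by rewrite /R3 /R4; lra.
have R4S : R4 < S by rewrite /R4; lra.
have Om4 := Om _ R4S.
have L2 i := bootstrap Om (wG i) (Gm i).
pose w (z : I * m.-bseq 'I_n) := res c R4 (G z.1 z.2).
have zm (z : I * m.-bseq 'I_n) : (size z.2 <= m)%N by exact: size_bseq.
have iw z : leb.-integrable setT (EFin \o w z).
  by have [_ lv _] := wG z.1 z.2 (zm z); exact: integrable_res lv Om4.
have mw z : measurable_fun setT (w z) by apply/measurable_EFinP; have /integrableP[] := iw z.
have aw z : apx 2 (w z).
  apply: (@apx_res _ _ 2 Omega) => //; first exact: iw.
  apply/integrableP; split; first by apply/measurable_EFinP; apply: measurable_normX; exact: mw.
  apply: le_lt_trans (L2 z.1 z.2 R4 (zm z) R4S); rewrite le_eqVlt; apply/orP; left; apply/eqP.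
  by apply: eq_integral => x _; rewrite gee0_abs ?lee_fin ?exprn_ge0// res_sqr.
have [rho [phi hphi]] := mollify_seq (p := 2) isT (rho0 := R4 - R3) ltac:(by rewrite subr_gt0) iw
  aw.
have mphi k : mollk (rho k) (phi k) by have [] := hphi k.
have rhol k : rho k <= R4 - R3 by have [/andP[]] := hphi k.
have tphi k := mollk_tf (mphi k).
have iu i : leb.-integrable setT (EFin \o res c R4 (u i)).
  by have [lv _ _] := wG i [::] (leq0n m); exact: integrable_res lv Om4.
pose J k i := Jk (phi k) (res c R4 (u i)).
have sJ k i : smooth (J k i) by exact: smooth_Jk.
have dJ k i (s : m.-bseq 'I_n) x : cl c R3 x -> pderive s (J k i) x = Jk (phi k) (w (i, s)) x.
  move=> xr; apply: (Jk_wds (wG i s (size_bseq s)) Om4 (mphi k)).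
  by move: xr; rewrite /cl /= => /le_trans; apply; have := rhol k; lra.
have [M M0 hM] := cutoff (R := R) n m.
have [h [[sh dh] _ h1 h0]] := hM c R2 R3 ltac:(by rewrite (le_trans R10 (ltW R12)) R23).
have th : tf h.
  split => //; exists (R3 + `|c|) => x xr; apply: h0; rewrite leNgt; apply/negP => xc.
  move: xr; rewrite ltNge => /negP; apply; exact: (@bounded_cl _ _ c R3 x (ltW xc)).
pose q := (R3 - R2)^-1; have q0 : 0 <= q by rewrite invr_ge0; lra.
pose B := M * (1 + q) ^+ m; have B0 : 0 <= B by rewrite mulr_ge0// exprn_ge0// addr_ge0.
have hB s x : (size s <= m)%N -> `|pderive s h x| <= B * \1_(cl c R3) x.
  move=> sm; rewrite indicE; case: (boolP (x \in cl c R3)) => [_|xr]; last first.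
    rewrite (@pderive_out _ _ c R3) ?normr0 ?mulr0//; first by move=> y /ltW /h0.
    by rewrite ltNge; apply: contra xr => xr; rewrite mem_set.
  rewrite mulr1 (le_trans (dh s x sm))// ler_wpM2l// (@le_trans _ _ ((1 + q) ^+ size s))//.
    by rewrite lerXn2r ?nnegrE ?addr_ge0// lerDr.
  by rewrite ler_weXn2l// lerDl.
pose U k i := h \* J k i.
have tU k i : tf (U k i) by exact: tfMl.
have mJ k z : measurable_fun setT (Jk (phi k) (w z)) by apply: smooth_measurable; exact: smooth_Jk.
exists U; split => //.
  move=> k i s sm; pose b := Bseq sm.
  have [_ _ /(_ (i, b))] := hphi k; apply: le_trans.
  have mG : measurable_fun setT (fun x => \1_(cl c R1) x * (pderive s (U k i) x - G i s x) ^+ 2).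
    have -> : (fun x => \1_(cl c R1) x * (pderive s (U k i) x - G i s x) ^+ 2) =
      (fun x => \1_(cl c R1) x * (pderive s (U k i) x - w (i, b) x) ^+ 2).
      apply/funext => x; rewrite indicE; case: (boolP (x \in cl c R1)) => [/set_mem xr|]; last by
        rewrite !mul0r.
      by rewrite /w res_in//=; apply: cl_sub xr; lra.
    apply: measurable_funM; first exact: measurable_indic_cl.
    apply: measurable_funX; apply: measurable_funB; last exact: mw.
    by apply: smooth_measurable; apply: smooth_pderive; case: (tU k i).
  apply: ge0_le_integral => //.
  - by move=> x _; rewrite lee_fin mulr_ge0 ?indic_ge0// sqr_ge0.
  - exact/measurable_EFinP.
  - by apply/measurable_EFinP; apply: measurable_normX; apply: measurable_funB.
  move=> x _; rewrite lee_fin indicE; case: (boolP (x \in cl c R1)) => [/set_mem xr|_]; last first.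
    by rewrite mul0r exprn_ge0.
  rewrite mul1r real_normK ?num_real// /w res_in/=; last by apply: cl_sub xr; lra.
  rewrite -/(w (i, b)) -dJ; last by apply: cl_sub xr; lra.
  suff -> : pderive s (U k i) x = pderive s (J k i) x by [].
  apply: near_pderiveE; have xR2 : `|x - c| < R2 by apply: le_lt_trans R12.
  by apply: filterS (near_cl_in xR2) => y yR2; rewrite /U /= h1 ?mul1r// ltW.
move=> e e0.
have hj (j : 'I_m.+1) : exists C, 0 <= C /\ forall f (e : R), smooth f -> 0 <= e ->
  (forall s, (size s <= j)%N ->
     (\int[leb]_x (\1_(cl c R3) x * pderive s f x ^+ 2)%:E <= e%:E)%E) ->
  en j (h \* f) <= C * e.
  by apply: en_mul_loc B0 th _ => s x sj; apply: hB; rewrite (leq_trans sj)// -ltnS.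
have {hj}[Cj hCj] := choice hj.
(* 8 = 2^2 * 2: the constant of [ge0_integralD_le] for p = 2, applied to two errors of at most
   2^(-k0). *)
pose C := 8 * \sum_j Cj j.
have C0 : 0 <= C by rewrite mulr_ge0// sumr_ge0// => j _; case: (hCj j).
pose k0 := Num.bound (C / e).
have k0e : C / 2 ^+ k0 <= e.
  rewrite ler_pdivrMr ?exprn_gt0// -ler_pdivrMl// mulrC.
  apply: ltW; apply: (lt_le_trans (archi_boundP _)); first by rewrite divr_ge0// ltW.
  by rewrite -natrX ler_nat ltnW// ltn_expl.
exists k0 => k l i j kk kl jm.
pose f x := J k i x - J l i x.
have sf : smooth f by exact: smoothB.
have -> : (fun x => U k i x - U l i x) = h \* f.
  by apply/funext => x; rewrite /U /f /= mulrBr.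
have jm' : (j < m.+1)%N by [].
have [Cj0 hC] := hCj (Ordinal jm').
have d0 a : (k0 <= a)%N -> 1 / (2 ^ a.+1)%:R <= (2 ^+ k0)^-1 :> R.
  move=> ka; rewrite div1r natrX lef_pV2 ?posrE ?exprn_gt0// ler_weXn2l ?ler1n//.
  exact: leqW.
apply: (@le_trans _ _ (Cj (Ordinal jm') * (8 * (2 ^+ k0)^-1))); last first.
  apply: le_trans k0e; rewrite mulrA ler_wpM2r ?invr_ge0 ?exprn_ge0// mulrC ler_wpM2l//.
  by rewrite (bigD1 (Ordinal jm'))//= lerDl sumr_ge0// => b _; case: (hCj b).
have e8 : 0 <= 8 * (2 ^+ k0)^-1 :> R by rewrite mulr_ge0// invr_ge0 exprn_ge0.
apply: (hC _ _ sf e8).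
move=> s sj; have sm : (size s <= m)%N by exact: leq_trans jm.
pose b := Bseq sm.
apply: (@le_trans _ _ (\int[leb]_x (`|Jk (phi k) (w (i, b)) x - Jk (phi l) (w (i, b)) x| ^+
  2)%:E)%E).
  apply: ge0_le_integral => //.
  - by move=> x _; rewrite lee_fin mulr_ge0 ?indic_ge0// sqr_ge0.
  - apply/measurable_EFinP; apply: measurable_funM; first exact: measurable_indic_cl.
    by apply: measurable_funX; apply: smooth_measurable; exact: smooth_pderive.
  - by apply/measurable_EFinP; apply: measurable_normX; apply: measurable_funB.
  move=> x _; rewrite lee_fin indicE; case: (boolP (x \in cl c R3)) => [/set_mem xr|_]; last first.
    by rewrite mul0r exprn_ge0.
  rewrite mul1r real_normK ?num_real// /f pderiveB//.
  by rewrite -(dJ k i b)// -(dJ l i b).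
have [_ _ /(_ (i, b)) hk] := hphi k; have [_ _ /(_ (i, b)) hl] := hphi l.
have hl' : (\int[leb]_x (`|w (i, b) x - Jk (phi l) (w (i, b)) x| ^+ 2)%:E <= (1 / (2 ^
  l.+1)%:R)%:E)%E.
  by apply: le_trans hl; rewrite le_eqVlt; apply/orP; left; apply/eqP; apply: eq_integral => x _;
    rewrite distrC.
apply: (le_trans (ge0_integralD_le (mJ k (i, b)) (mw (i, b)) (mJ l (i, b)) hk hl')).
rewrite lee_fin; have := d0 _ kk; have := d0 _ kl; lra.
Qed.

End bootstrap.

(** * The Caccioppoli inequality for real-valued families *)

Section trilinear.
Context {R : realType} {n : nat}.
Local Notation X := 'rV[R]_n.
Local Notation leb := (@lebesgue_rV R n).
Implicit Types (a p q f g u v w : X -> R).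

Definition tri a p q : R := \int[leb]_x (p x * a x * q x).

Lemma tri_integrable k1 k2 a (L : R) p q : measurable_fun setT a ->
  cbd k1 k2 (fun x => `|a x|) L -> tf p -> tf q ->
  leb.-integrable setT (EFin \o (fun x => p x * a x * q x)).
Proof.
move=> ma ca tp tq; apply/integrableP; split.
  apply/measurable_EFinP; apply: measurable_funM; first apply: measurable_funM => //.
    by apply: smooth_measurable; case: tp.
  by apply: smooth_measurable; case: tq.
apply: le_lt_trans (ltry (L * (Num.sqrt (en k1 p) * Num.sqrt (en k2 q)))).
apply: le_trans (ca p q tp tq); rewrite le_eqVlt; apply/orP; left; apply/eqP.
by apply: eq_integral => x _; rewrite /= !normrM mulrCA mulrA.
Qed.

Lemma tri_le k1 k2 a (L A B : R) p q : measurable_fun setT a -> 0 <= L ->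
  cbd k1 k2 (fun x => `|a x|) L -> tf p -> tf q -> en k1 p <= A -> en k2 q <= B ->
  `|tri a p q| <= L * (Num.sqrt A * Num.sqrt B).
Proof.
move=> ma L0 ca tp tq pA qB; have ip := tri_integrable ma ca tp tq.
apply: (@le_trans _ _ (L * (Num.sqrt (en k1 p) * Num.sqrt (en k2 q)))); last first.
  by rewrite ler_wpM2l// ler_pM ?sqrtr_ge0// ler_wsqrtr.
rewrite -lee_fin; apply: le_trans (ca p q tp tq).
have fi : (\int[leb]_x (p x * a x * q x)%:E)%E \is a fin_num by exact: integrable_fin_num.
rewrite /tri /Rintegral -abse_EFin fineK//.
apply: (le_trans (le_abse_integral _ measurableT _)); first by have /integrableP[] := ip.
rewrite le_eqVlt; apply/orP; left; apply/eqP.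
by apply: eq_integral => x _; rewrite /= !normrM mulrCA mulrA.
Qed.

End trilinear.

Section commutator.
Context {R : realType} {n : nat}.
Local Notation X := 'rV[R]_n.
Implicit Types (h f g u v w : X -> R) (s : seq 'I_n).

(* The commutator of [pderive s] with multiplication by [h]. *)
Definition comm s h w (x : X) : R :=
  \sum_(p <- splits s | p.1 != [::]) pderive p.1 h x * pderive p.2 w x.

Lemma splits_nil (V : zmodType) s (F : seq 'I_n * seq 'I_n -> V) :
  \sum_(p <- splits s) F p = F ([::], s) + \sum_(p <- splits s | p.1 != [::]) F p.
Proof.
elim: s F => [|i s ih] F; first by rewrite /= !big_cons !big_nil /= addr0.
rewrite /= !big_cat /= !big_map (ih (fun p => F (p.1, i :: p.2))) addrCA; congr (_ + _).
Qed.

Lemma leibniz_comm s h w : smooth h -> smooth w ->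
  pderive s (h \* w) = fun x => h x * pderive s w x + comm s h w x.
Proof. by move=> sh sw; apply/funext => x; rewrite pderiveM// splits_nil. Qed.

Lemma tf_comm s h w : smooth h -> tf w -> tf (comm s h w).
Proof.
move=> sh tw; apply: (@tf_sum _ _ _ _ _ (fun p x => pderive p.1 h x * pderive p.2 w x)) => p _.
by apply: tfM; [exact: smooth_pderive|exact: tf_pderive].
Qed.

(* [ze] is 1 wherever [h] varies. *)
Definition absorbs (ze h : X -> R) := forall x : X,
  (\forall y \near x, ze y = 1) \/ (exists k, \forall y \near x, h y = k).

Lemma comm_cst s h w (x : X) (k : R) : (\forall y \near x, h y = k) -> comm s h w x = 0.
Proof.
move=> hk; apply: big1 => p p0; have -> : pderive p.1 h x = 0; last by rewrite mul0r.
rewrite (near_pderiveE (g := cst k))// pderive_cst.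
by case: p p0 => -[].
Qed.

(** Where [h] is locally constant the commutator vanishes; elsewhere [ze] is 1 near the point and
    changes no derivative there. *)
Lemma comm_absorb s h ze w x : absorbs ze h -> comm s h w x = comm s h (ze \* w) x.
Proof.
move=> /(_ x)[z1|[k hk]]; last by rewrite !(comm_cst _ _ hk).
apply: eq_bigr => p _; congr (_ * _); apply: near_pderiveE.
by apply: filterS z1 => y zy /=; rewrite zy mul1r.
Qed.

Lemma comm_absorbM s t h ze w u x : absorbs ze h ->
  comm s h w x * pderive t u x = comm s h w x * pderive t (ze \* u) x.
Proof.
move=> /(_ x)[z1|[k hk]]; last by rewrite !(comm_cst _ _ hk) !mul0r.
congr (_ * _); apply: near_pderiveE.
by apply: filterS z1 => y zy /=; rewrite zy mul1r.
Qed.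

(** The factors are the constant of [en_sum] for at most 2^m terms, the number of these terms, and
    the constant of [en_mul]. *)
Definition Kc (m : nat) : R := 2 ^+ (2 ^ m) * ((2 ^ m)%:R * (2 * n.+1%:R) ^+ m).

Lemma Kc_ge0 m : 0 <= Kc m.
Proof. by rewrite mulr_ge0// mulr_ge0// exprn_ge0// mulr_ge0. Qed.

Lemma lowen_ge0 (r : R) m w : 0 <= r -> 0 <= lowen r m w.
Proof. by move=> r0; rewrite /lowen mulr_ge0 ?sqr_ge0// wen_ge0. Qed.

Lemma en_comm m k (M r : R) s h w : 0 <= M -> 0 <= r -> dbound m M r h -> tf w ->
  (k + size s = m)%N -> en k (comm s h w) <= Kc m * M ^+ 2 * lowen r m w.
Proof.
move=> M0 r0 dh tw ks; have sh : smooth h by case: dh.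
have tp (p : seq 'I_n * seq 'I_n) : tf (pderive p.1 h \* pderive p.2 w).
  by apply: tfM; [exact: smooth_pderive|exact: tf_pderive].
have -> : comm s h w = fun x => \sum_(p <- [seq p <- splits s | p.1 != [::]])
    (pderive p.1 h \* pderive p.2 w) x by apply/funext => x; rewrite big_filter.
apply: (le_trans (en_sum k _ tp)); rewrite big_filter.
have b1 : 1 <= 2 * n.+1%:R :> R.
  by rewrite -[leLHS]mulr1 ler_pM// ?ler1n.
have L0 := lowen_ge0 m w r0.
have sm : (size s <= m)%N by rewrite -ks leq_addl.
rewrite [leRHS](_ : _ = 2 ^+ (2 ^ m) * ((2 ^ m)%:R * ((2 * n.+1%:R) ^+ m * M ^+ 2 * lowen r m w)));
  last first.
  by rewrite /Kc; ring.
have z0 : 0 <= (2 * n.+1%:R) ^+ m * M ^+ 2 * lowen r m w.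
  by rewrite mulr_ge0// mulr_ge0 ?sqr_ge0// exprn_ge0// mulr_ge0.
have szs : (size [seq p <- splits s | p.1 != [::]] <= 2 ^ m)%N.
  by rewrite size_filter (leq_trans (count_size _ _))// size_splits leq_pexp2l.
apply: ler_pM => //.
- by apply: sumr_ge0 => p _; exact: en_ge0.
- by rewrite ler_weXn2l// ler1n.
apply: (@le_trans _ _ (\sum_(p <- splits s) (2 * n.+1%:R) ^+ m * M ^+ 2 * lowen r m w)); last first.
  rewrite big_const_seq count_predT size_splits iter_addr_0 -[leLHS]mulr_natl ler_wpM2r//.
  by rewrite ler_nat leq_pexp2l.
rewrite big_mkcond big_seq [leRHS]big_seq; apply: ler_sum => p ps.
case: ifPn => // p0; have /allP/(_ _ ps)/eqP pk := splits_size s.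
apply: (@le_trans _ _ ((2 * n.+1%:R) ^+ k * M ^+ 2 * lowen r m w)).
  by apply: en_lower => //; rewrite -addnA pk.
rewrite ler_wpM2r// ler_wpM2r ?sqr_ge0// ler_weXn2l//.
by rewrite -ks leq_addr.
Qed.

Lemma lowen_mul m (M r : R) h w : (0 < m)%N -> 0 <= M -> 0 <= r -> dbound m M r h -> tf w ->
  lowen r m (h \* w) <= m%:R * ((2 * n.+1%:R) ^+ m * M ^+ 2) * lowen r m w.
Proof.
case: m => // k _ M0 r0 [sh dh] tw; rewrite /lowen /= mulrCA ler_wpM2l ?sqr_ge0//.
rewrite {1}/wen -mulrA.
have -> : k.+1%:R * ((2 * n.+1%:R) ^+ k.+1 * M ^+ 2 * wen r k w) =
    \sum_(j < k.+1) (2 * n.+1%:R) ^+ k.+1 * M ^+ 2 * wen r k w.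
  by rewrite sumr_const card_ord mulr_natl.
have b1 : 1 <= 2 * n.+1%:R :> R by rewrite -[leLHS]mulr1 ler_pM// ?ler1n.
have W0 := wen_ge0 k w r0.
apply: ler_sum => j _.
have dj : dbound j M r h by split => // s x sj; apply: dh; rewrite (leq_trans sj)// ltnW.
have H := en_mul M0 r0 dj tw.
apply: (@le_trans _ _ (r ^+ (2 * (k - j)) * ((2 * n.+1%:R) ^+ j * M ^+ 2 * wen r j w))).
  by rewrite ler_wpM2l// exprn_ge0.
rewrite mulrCA; apply: ler_pM.
- by rewrite mulr_ge0 ?sqr_ge0// exprn_ge0// mulr_ge0.
- by rewrite mulr_ge0 ?exprn_ge0// wen_ge0.
- by rewrite ler_wpM2r ?sqr_ge0// ler_weXn2l// ltnW.
have := @wen_scale R n r j (k - j) w r0; rewrite subnKC// -ltnS; exact: ltn_ord.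
Qed.

(** Applied with v = h u and w = h ze u: the leading part keeps v, while the commutator is charged
    to w, so its lower-order energies reduce to those of ze u. *)
Lemma en_mul_top m (M r : R) h v w : (0 < m)%N -> 0 <= M -> 0 <= r -> dbound m M r h ->
  tf v -> tf w -> (forall s x, comm s h v x = comm s h w x) ->
  en m (h \* v) <= n%:R ^+ m * (2 * (M ^+ 2 * en m v + Kc m * M ^+ 2 * lowen r m w)).
Proof.
move=> m0 M0 r0 dh tv tw hvw; have sh : smooth h by case: dh.
have [sv _] := tv; apply: en_full; first exact: smoothM.
move=> s sm; rewrite leibniz_comm//.
have t1 : tf (h \* pderive s v) by apply: tfM => //; exact: tf_pderive.
have tc := tf_comm s sh tw.
rewrite (_ : (fun x => _) = (h \* pderive s v) \+ comm s h w); last by apply/funext => x /=;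
  rewrite hvw.
apply: (le_trans (enD 0 t1 tc)); rewrite ler_wpM2l//; apply: lerD; last by apply: en_comm.
have d0 : dbound 0 M r h.
  by case: dh => _ dh; split => // t x; rewrite leqn0 size_eq0 => /eqP ->; exact: dh.
apply: (le_trans (en_mul M0 r0 d0 (tf_pderive s tv))).
rewrite expr0 mul1r ler_wpM2l ?sqr_ge0//.
rewrite /wen big_ord_recl big_ord0 addr0 subnn muln0 expr0 mul1r.
by have := en_pderive_le 0 s sv; rewrite add0n sm.
Qed.

End commutator.

Lemma amgm (R : realType) (e c x y : R) : 0 < e -> 0 <= c -> 0 <= x -> 0 <= y ->
  c * (Num.sqrt x * Num.sqrt y) <= e * x + c ^+ 2 / (4 * e) * y.
Proof.
move=> e0 c0 x0 y0; rewrite -{2}(sqr_sqrtr x0) -{2}(sqr_sqrtr y0).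
move: (Num.sqrt x) (Num.sqrt y) => s t; rewrite -subr_ge0.
have -> : e * s ^+ 2 + c ^+ 2 / (4 * e) * t ^+ 2 - c * (s * t) = e * (s - c * t / (2 * e)) ^+ 2.
  by field; rewrite gt_eqF.
by rewrite mulr_ge0 ?sqr_ge0// ltW.
Qed.

Section master.
Context {R : realType} {n : nat} (I T : finType) (m : nat) (ci cj : T -> I) (sa sb : T -> seq 'I_n).
Local Notation X := 'rV[R]_n.
Implicit Types (f g u v w : I -> X -> R) (a : T -> X -> R) (h ze : X -> R).

Definition bform a f g : R :=
  \sum_t tri (a t) (pderive (sa t) (f (ci t))) (pderive (sb t) (g (cj t))).

Definition En k f : R := \sum_i en k (f i).

Definition lowE (r : R) f : R := \sum_i lowen r m (f i).

Definition coefs a (L : R) := forall t, [/\ measurable_fun setT (a t),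
  (size (sa t) <= m)%N, (size (sb t) <= m)%N &
  cbd (m - size (sa t)) (m - size (sb t)) (fun x => `|a t x|) L].

Definition garding a (lam de : R) := forall f, (forall i, tf (f i)) ->
  lam * En m f <= bform a f f + de * En 0 f.

Lemma En_ge0 k f : 0 <= En k f.
Proof. by apply: sumr_ge0 => i _; exact: en_ge0. Qed.

Lemma en_En k f i : en k (f i) <= En k f.
Proof. by rewrite /En (bigD1 i)//= lerDl sumr_ge0// => j _; exact: en_ge0. Qed.

Lemma lowE_ge0 (r : R) f : 0 <= r -> 0 <= lowE r f.
Proof. by move=> r0; apply: sumr_ge0 => i _; exact: lowen_ge0. Qed.

Lemma lowen_lowE (r : R) f i : 0 <= r -> lowen r m (f i) <= lowE r f.
Proof. by move=> r0; rewrite /lowE (bigD1 i)//= lerDl sumr_ge0// => j _; exact: lowen_ge0. Qed.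

Lemma En_pderive k s f i : (forall i, tf (f i)) -> (size s <= k)%N ->
  en (k - size s) (pderive s (f i)) <= En k f.
Proof.
move=> tff sk; apply: le_trans (en_En k f i); have [sf _] := tff i.
by apply: (le_trans (en_pderive_le _ _ sf)); rewrite subnK.
Qed.

Definition hmul h f : I -> X -> R := fun i => h \* f i.

Definition Kd (M : R) : R := m%:R * ((2 * n.+1%:R) ^+ m * M ^+ 2).

Lemma Kd_ge0 M : 0 <= Kd M.
Proof. by rewrite mulr_ge0// mulr_ge0 ?sqr_ge0// exprn_ge0// mulr_ge0. Qed.

Lemma lowE_mul (M r : R) h w : (0 < m)%N -> 0 <= M -> 0 <= r -> dbound m M r h ->
  (forall i, tf (w i)) -> lowE r (hmul h w) <= Kd M * lowE r w.
Proof.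
by move=> m0 M0 r0 dh tw; rewrite /lowE mulr_sumr; apply: ler_sum => i _; exact: lowen_mul.
Qed.

Lemma hmulC h ze u : hmul ze (hmul h u) = hmul h (hmul ze u).
Proof. by apply/funext => i; apply/funext => x; rewrite /hmul /= mulrCA. Qed.

Lemma En_mul_top (M r : R) h ze u : (0 < m)%N -> 0 <= M -> 0 <= r -> dbound m M r h ->
  smooth ze -> absorbs ze h -> (forall i, tf (u i)) ->
  En m (hmul h (hmul h u)) <=
  n%:R ^+ m * (2 * (M ^+ 2 * En m (hmul h u) + @Kc R n m * M ^+ 2 * (Kd M * lowE r (hmul ze u)))).
Proof.
move=> m0 M0 r0 dh sz ab tu; have sh : smooth h by case: dh.
have tv i : tf (hmul h u i) by exact: tfM.
have tz i : tf (hmul ze u i) by exact: tfM.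
have tw i : tf (hmul h (hmul ze u) i) by exact: tfM.
apply: (@le_trans _ _ (n%:R ^+ m * (2 * (M ^+ 2 * En m (hmul h u) + @Kc R n m * M ^+ 2 * lowE r
  (hmul h (hmul ze u)))))).
  rewrite /En /lowE !mulr_sumr -big_split !mulr_sumr; apply: ler_sum => i _.
  apply: (en_mul_top m0 M0 r0 dh (tv i) (tw i)).
  move=> s x; rewrite (comm_absorb s (hmul h u i) x ab); congr (comm s h _ x).
  by have := congr1 (fun z => z i) (hmulC h ze u).
rewrite ler_wpM2l ?exprn_ge0// ler_wpM2l// lerD2l ler_wpM2l//; last exact: lowE_mul.
by rewrite mulr_ge0 ?sqr_ge0// Kc_ge0.
Qed.

(** With D(hu) = h Du + q and D(hhu) = h D(hu) + p', the products of D(hu) with h Du cancel. What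
    remains is D(hu) a q - p' a Du, and in the last term p' allows Du to be replaced by D(ze u). *)
Lemma bform_comm a (L M r : R) h ze u : (0 < m)%N -> 0 <= L -> 0 <= M -> 0 <= r ->
  coefs a L -> dbound m M r h -> smooth ze -> absorbs ze h -> (forall i, tf (u i)) ->
  bform a (hmul h u) (hmul h u) - bform a (hmul h (hmul h u)) u <=
  #|T|%:R * (L * (Num.sqrt (En m (hmul h u)) *
      Num.sqrt (@Kc R n m * M ^+ 2 * lowE r (hmul ze u)) +
    Num.sqrt (En m (hmul ze u)) *
      Num.sqrt (@Kc R n m * M ^+ 2 * (Kd M * lowE r (hmul ze u))))).
Proof.
move=> m0 L0 M0 r0 ca dh sz ab tu; set Q := @Kc R n m * M ^+ 2; set W := lowE r (hmul ze u); have
  sh : smooth h by case: dh.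
have Q0 : 0 <= Q by rewrite mulr_ge0 ?sqr_ge0// Kc_ge0.
have tv i : tf (hmul h u i) by exact: tfM.
have tw i : tf (hmul ze u i) by exact: tfM.
have thw i : tf (hmul h (hmul ze u) i) by exact: tfM.
have thv i : tf (hmul h (hmul h u) i) by exact: tfM.
rewrite /bform -sumrB mulr_natl -sumr_const; apply: ler_sum => t _.
have [ma sam sbm cat] := ca t.
pose p := pderive (sa t) (hmul h u (ci t)).
pose q := comm (sb t) h (hmul ze u (cj t)).
pose p' := comm (sa t) h (hmul h (hmul ze u) (ci t)).
pose q' := pderive (sb t) (hmul ze u (cj t)).
have tp : tf p by exact: tf_pderive.
have tq : tf q by exact: tf_comm.
have tp' : tf p' by exact: tf_comm.
have tq' : tf q' by exact: tf_pderive.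
have i1 := tri_integrable ma cat tp (tf_pderive (sb t) (tv (cj t))).
have i2 := tri_integrable ma cat (tf_pderive (sa t) (thv (ci t))) (tf_pderive (sb t) (tu (cj t))).
have i3 := tri_integrable ma cat tp tq.
have i4 := tri_integrable ma cat tp' tq'.
have -> : tri (a t) p (pderive (sb t) (hmul h u (cj t))) -
    tri (a t) (pderive (sa t) (hmul h (hmul h u) (ci t))) (pderive (sb t) (u (cj t))) =
    tri (a t) p q - tri (a t) p' q'.
  rewrite /tri -(RintegralB measurableT i1 i2) -(RintegralB measurableT i3 i4).
  have [su _] := tu (cj t); have [sv _] := tv (ci t).
  apply: eq_Rintegral => x _.
  have e1 : pderive (sb t) (hmul h u (cj t)) x = h x * pderive (sb t) (u (cj t)) x + q x.
    by rewrite /hmul leibniz_comm// /q (comm_absorb _ _ _ ab).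
  have e2 : pderive (sa t) (hmul h (hmul h u) (ci t)) x = h x * p x + p' x.
    rewrite {1}/hmul leibniz_comm// /p' (comm_absorb _ _ _ ab); congr (_ + comm _ _ _ x).
    by have := congr1 (fun z => z (ci t)) (hmulC h ze u).
  have e3 : p' x * pderive (sb t) (u (cj t)) x = p' x * q' x by exact: comm_absorbM.
  rewrite e1 e2; transitivity (p x * a t x * q x - a t x * (p' x * pderive (sb t) (u (cj t)) x));
    first by ring.
  by rewrite e3; ring.
apply: (le_trans (ler_norm _)); apply: (le_trans (ler_normB _ _)); rewrite mulrDr; apply: lerD.
  apply: (tri_le ma L0 cat tp tq); first exact: En_pderive.
  apply: (@le_trans _ _ (Q * lowen r m (hmul ze u (cj t)))).
    by apply: en_comm => //; rewrite subnK.
  by rewrite ler_wpM2l//; exact: lowen_lowE.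
rewrite [X in L * X]mulrC; apply: (tri_le ma L0 cat tp' tq'); last exact: En_pderive.
apply: (@le_trans _ _ (Q * lowen r m (hmul h (hmul ze u) (ci t)))).
  by apply: en_comm => //; rewrite subnK.
rewrite ler_wpM2l//; apply: (le_trans (lowen_lowE _ _ r0)); exact: lowE_mul.
Qed.

Lemma lowE_interp (e : R) : (0 < m)%N -> 0 < e -> exists2 C : R, 0 <= C &
  forall r w, 0 < r -> (forall i, tf (w i)) ->
  lowE r w <= e * En m w + C * r ^+ (2 * m) * En 0 w.
Proof.
move=> m0 e0; have [C C0 hC] := lowen_interp (R := R) (n := n) m0 e0; exists C => // r w r0 tw.
by rewrite /lowE /En !mulr_sumr -big_split/=; apply: ler_sum => i _; exact: hC.
Qed.

(** C depends on ep but is fixed before r, de, K and the cut-offs. This uniformity is what lets the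
    estimate be iterated over shrinking scales. *)
Lemma master (lam L M ep : R) : (0 < m)%N -> 0 < lam -> 0 <= L -> 0 <= M -> 0 < ep ->
  exists2 C : R, 0 <= C & forall a (de r K : R) h ze u, coefs a L -> garding a lam de ->
  0 <= de -> 0 < r -> 0 <= K -> dbound m M r h -> smooth ze -> absorbs ze h ->
  (forall i, tf (u i)) ->
  `|bform a (hmul h (hmul h u)) u| <= K * Num.sqrt (En m (hmul h (hmul h u))) ->
  En m (hmul h u) <= ep * En m (hmul ze u) +
    C * (r ^+ (2 * m) * En 0 (hmul ze u) + de * En 0 (hmul h u) + K ^+ 2).
Proof.
move=> m0 lam0 L0 M0 ep0.
pose N : R := n%:R ^+ m; have N0 : 0 <= N by exact: exprn_ge0.
pose Q := @Kc R n m * M ^+ 2; have Q0 : 0 <= Q by rewrite mulr_ge0 ?sqr_ge0// Kc_ge0.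
pose k1 := N * (2 * M ^+ 2) + 1; have k10 : 0 < k1.
  by rewrite ltr_wpDl// mulr_ge0// mulr_ge0// sqr_ge0.
pose k2 := N * (2 * (Q * Kd M)); have k20 : 0 <= k2.
  by rewrite mulr_ge0// mulr_ge0// mulr_ge0// Kd_ge0.
pose k3 := #|T|%:R * L; have k30 : 0 <= k3 by rewrite mulr_ge0.
(* [e1] is spent twice, in Young's inequality and in the interpolation, and the outcome is divided
   by lam / 2: 2 e1 * 2 / lam = ep. *)
pose e1 := lam * ep / 4; have e10 : 0 < e1 by rewrite divr_gt0// mulr_gt0.
pose k4 := lam / (4 * k1) * k2 + k3 ^+ 2 / lam * Q + k3 ^+ 2 / (4 * e1) * (Q * Kd M).
have k40 : 0 <= k4.
  apply: addr_ge0; first apply: addr_ge0.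
  - by rewrite mulr_ge0// divr_ge0 ?(ltW lam0)// mulr_ge0// ltW.
  - by rewrite mulr_ge0// divr_ge0 ?sqr_ge0// ltW.
  - by rewrite mulr_ge0 ?mulr_ge0 ?Kd_ge0// invr_ge0 mulr_ge0// ltW.
pose e2 := e1 / (k4 + 1); have e20 : 0 < e2 by rewrite divr_gt0// ltr_wpDl.
have [C5 C50 hC5] := lowE_interp m0 e20.
pose C := 2 / lam * (1 + k1 / lam + k4 * C5).
exists C.
  by rewrite mulr_ge0 ?divr_ge0 ?(ltW lam0)// !addr_ge0 ?mulr_ge0 ?invr_ge0 ?(ltW lam0) ?(ltW k10).
move=> a de r K h ze u ca ga de0 r0 K0 dh sz ab tu hK.
have sh : smooth h by case: dh.
have tv i : tf (hmul h u i) by exact: tfM.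
have tw i : tf (hmul ze u i) by exact: tfM.
have rw := ltW r0.
have hP := En_mul_top m0 M0 rw dh sz ab tu.
have hB := bform_comm m0 L0 M0 rw ca dh sz ab tu.
have hG := ga _ tv; have hL := hC5 r _ r0 tw.
move: hP hB hG hL hK (En_ge0 m (hmul h u)) (En_ge0 m (hmul ze u)) (En_ge0 0 (hmul h u))
  (En_ge0 0 (hmul ze u)) (lowE_ge0 (hmul ze u) rw) (En_ge0 m (hmul h (hmul h u))) => /=.
rewrite -/Q -/N; move: (En m (hmul h (hmul h u))) (En m (hmul h u)) (En m (hmul ze u)) (lowE r
  (hmul ze u))
   (En 0 (hmul h u)) (En 0 (hmul ze u)) (bform _ _ _) (bform _ _ _) => P V W Lw Z0 Zw B2 B1.
move=> hP hB hG hL hK V0 W0 Z00 Zw0 Lw0 P0.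
(* Young's inequality, with the weight of P so small that the multiple of V contained in P by
   [En_mul_top] becomes at most lam / 4. *)
have h1 : `|B2| <= k1 / lam * K ^+ 2 + lam / 4 * V + lam / (4 * k1) * k2 * Lw.
  have hh : K * Num.sqrt P <= k1 / lam * K ^+ 2 + lam / (4 * k1) * P.
    have e0 : 0 < lam / (4 * k1) by rewrite divr_gt0// mulr_gt0.
    have := amgm e0 K0 P0 ler01; rewrite sqrtr1 !mulr1.
    suff -> : K ^+ 2 / (4 * (lam / (4 * k1))) = k1 / lam * K ^+ 2 by rewrite addrC.
    by field; rewrite !gt_eqF.
  apply: (le_trans hK); apply: (le_trans hh); rewrite -addrA lerD2l.
  have e0 : 0 <= lam / (4 * k1) by rewrite divr_ge0 ?(ltW lam0)// mulr_ge0// ltW.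
  apply: (le_trans (ler_wpM2l e0 hP)).
  have -> : lam / (4 * k1) * (N * (2 * (M ^+ 2 * V + Q * (Kd M * Lw)))) =
    lam / 4 * ((N * (2 * M ^+ 2)) / k1 * V) + lam / (4 * k1) * k2 * Lw.
    by rewrite /k2; field; rewrite gt_eqF.
  rewrite lerD2r ler_wpM2l ?divr_ge0 ?(ltW lam0)// ler_piMl// ler_pdivrMr// mul1r /k1.
  by rewrite lerDl.
have h2 : B1 - B2 <= lam / 4 * V + k3 ^+ 2 / lam * Q * Lw + (e1 * W + k3 ^+ 2 / (4 * e1) * (Q * Kd
  M) * Lw).
  apply: (le_trans hB); rewrite mulrA -/k3 mulrDr; apply: lerD.
    have e0 : 0 < lam / 4 by rewrite divr_gt0.
    have := amgm e0 k30 V0 (mulr_ge0 Q0 Lw0).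
    suff -> : k3 ^+ 2 / (4 * (lam / 4)) * (Q * Lw) = k3 ^+ 2 / lam * Q * Lw by [].
    by field; rewrite gt_eqF.
  have := amgm e10 k30 W0 (mulr_ge0 Q0 (mulr_ge0 (Kd_ge0 M) Lw0)).
  by rewrite !mulrA.
have h3 : k4 * Lw <= e1 * W + k4 * C5 * r ^+ (2 * m) * Zw.
  apply: (le_trans (ler_wpM2l k40 hL)); rewrite mulrDr; apply: lerD; last by rewrite !mulrA.
  rewrite mulrA ler_wpM2r// /e2 mulrCA ler_piMr ?(ltW e10)// ler_pdivrMr ?mul1r ?lerDl//.
  by rewrite ltr_wpDl.
(* [h1] and [h2] each give back lam / 4 of V, which the lam V of the Gårding inequality absorbs. *)
have h4 : lam / 2 * V <= 2 * e1 * W + (k4 * C5 * r ^+ (2 * m) * Zw + de * Z0 + k1 / lam * K ^+ 2).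
  have k4E : k4 * Lw = lam / (4 * k1) * k2 * Lw + k3 ^+ 2 / lam * Q * Lw +
    k3 ^+ 2 / (4 * e1) * (Q * Kd M) * Lw by rewrite /k4 !mulrDl.
  move: h1 h2 h3 k4E (ler_norm B2) hG; move: (k4 * Lw) (lam / (4 * k1) * k2 * Lw)
    (k3 ^+ 2 / lam * Q * Lw) (k3 ^+ 2 / (4 * e1) * (Q * Kd M) * Lw) => z z1 z2 z3.
  move: (k4 * C5 * r ^+ (2 * m) * Zw) (de * Z0) (k1 / lam * K ^+ 2) => z4 z5 z6.
  by clearbody e1; lra.
have h5 : V <= 2 / lam * (2 * e1 * W + (k4 * C5 * r ^+ (2 * m) * Zw + de * Z0 + k1 / lam * K ^+ 2)).
  by rewrite mulrC -ler_pdivrMr ?divr_gt0// invf_div mulrC.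
apply: (le_trans h5); rewrite mulrDr; apply: lerD.
  by rewrite le_eqVlt; apply/orP; left; apply/eqP; rewrite /e1; field; rewrite gt_eqF.
rewrite /C -[leRHS]mulrA ler_wpM2l ?divr_ge0 ?(ltW lam0)//.
set rr := r ^+ _; have rr0 : 0 <= rr by exact: exprn_ge0.
have q1 : 0 <= k1 / lam by rewrite divr_ge0// ltW.
have q2 : 0 <= k4 * C5 by exact: mulr_ge0.
have q3 : 0 <= rr * Zw by exact: mulr_ge0.
have q4 : 0 <= de * Z0 by exact: mulr_ge0.
have q5 := sqr_ge0 K; move: (k1 / lam) (k4 * C5) q1 q2 => x y q1 q2.
rewrite -[y * rr * Zw]mulrA; move: (rr * Zw) (de * Z0) (K ^+ 2) q3 q4 q5 => z1 z2 z3 q3 q4 q5.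
rewrite !mulrDr !mulrDl !mul1r.
have := mulr_ge0 q1 q3; have := mulr_ge0 q1 q4; have := mulr_ge0 q2 q4; have := mulr_ge0 q2 q5; lra.
Qed.

End master.

(** After k iterations the excess over 2 b is at most (D - 2 b) / 2^k. The size of D leaves no trace
    in the conclusion, so a crude bound on F suffices. *)
Lemma halving (R : realType) (F : nat -> R) (b D : R) :
  (forall i, F i <= F i.+1 / 2 + b) -> (forall i, F i <= D) -> F 0%N <= 2 * b.
Proof.
move=> h hD.
have D0 : 0 <= D - 2 * b \/ D - 2 * b < 0 by case: (leP 0 (D - 2 * b)); [left|right].
have H k : forall i, F i <= (D - 2 * b) / 2 ^+ k + 2 * b.
  elim: k => [|k ih] i; first by rewrite expr0 divr1 subrK.
  apply: (le_trans (h i)); have := ih i.+1; rewrite exprS invfM mulrCA; lra.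
case: D0 => D0; last by have := hD 0%N; lra.
apply/ler_addgt0Pr => e e0; pose k := Num.bound ((D - 2 * b) / e).
apply: (le_trans (H k 0%N)); rewrite [leLHS]addrC lerD2l ler_pdivrMr ?exprn_gt0// -ler_pdivrMl//
  [leLHS]mulrC.
apply: ltW; apply: (lt_le_trans (archi_boundP _)); first by rewrite divr_ge0// ltW.
by rewrite -natrX ler_nat ltnW// ltn_expl.
Qed.

(** * The cut-offs on nested annuli *)

Section cutoffs.
Context {R : realType} {n : nat}.
Local Notation X := 'rV[R]_n.

Lemma dbound_mono K (M M' r : R) (h : X -> R) : 0 <= r -> M <= M' -> dbound K M r h -> dbound K M'
  r h.
Proof.
move=> r0 MM [sh dh]; split => // s x sK; apply: (le_trans (dh s x sK)).
by rewrite ler_wpM2r// exprn_ge0.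
Qed.

Lemma dbound_1B K (M r : R) (h : X -> R) : 0 <= M -> 0 <= r -> dbound K M r h ->
  dbound K (M + 1) r (fun x => 1 - h x).
Proof.
move=> M0 r0 [sh dh]; have s1 : smooth (cst 1 : X -> R) by exact: smooth_cst.
split => [|s x sK]; first exact: smoothB.
rewrite pderiveB// pderive_cst; apply: (le_trans (ler_normB _ _)).
have := dh s x sK; case: s {sK} => [|i s]; first by rewrite expr0 !mulr1 normr1; lra.
rewrite normr0 add0r => /le_trans; apply.
by rewrite ler_wpM2r ?exprn_ge0// lerDl.
Qed.

(** [chi i] is 1 between [A i] and [B i]. These annuli widen with i but stay at distance more than h
    from both ends, and the transition zones of [chi i] lie where [chi i.+1] is 1. *)
Lemma annulus_cutoffs m : exists2 M : R, 0 <= M & forall (c : X) (a0 wd : R), 0 <= a0 -> 0 < wd ->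
  exists (eta : X -> R) (chi : nat -> X -> R),
  [/\ dbound m M (64 / wd) eta, forall i, dbound m M (64 / wd * 2 ^+ i) (chi i),
    absorbs (chi 0%N) eta, forall i, absorbs (chi i.+1) (chi i) &
  [/\ forall x, `|x - c| <= a0 -> eta x = 1, forall x, 0 <= eta x <= 1,
    forall x, a0 + wd <= `|x - c| -> eta x = 0, forall i x, 0 <= chi i x <= 1 &
    forall i x, chi i x != 0 -> a0 < `|x - c| < a0 + wd]].
Proof.
have [M M0 hM] := cutoff (R := R) n m.
have MM0 : 0 <= 2 ^+ m * (M * (M + 1)).
  by apply: mulr_ge0; [exact: exprn_ge0|apply: mulr_ge0 => //; exact: addr_ge0].
exists (M + 2 ^+ m * (M * (M + 1))); first exact: addr_ge0.
(* A transition zone of [chi i] has length h 2^(-i) / 4, whose inverse is 64 / wd * 2^i. *)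
move=> c a0 wd a00 wd0; pose h := wd / 16; have h0 : 0 < h by rewrite divr_gt0.
pose p (i : nat) : R := 2 ^- i.
have p0 i : 0 < p i by rewrite invr_gt0 exprn_gt0.
have pS i : p i.+1 = p i / 2 by rewrite /p exprS invfM mulrC.
have p1 i : p i <= 1 by rewrite invf_le1 ?exprn_gt0// exprn_ege1// ler1n.
have hp0 i : 0 < h * p i by exact: mulr_gt0.
have hp1 i : h * p i <= h by rewrite ler_piMr// ltW.
have hpS i : h * p i.+1 = h * p i / 2 by rewrite pS mulrA.
have wE : wd = 16 * h by rewrite /h; field.
pose A i := a0 + h + h * p i; pose A' i := a0 + h + h * p i * (3 / 4).
pose B i := a0 + wd - h - h * p i; pose B' i := a0 + wd - h - h * p i * (3 / 4).
have rE i : (h * p i / 4)^-1 = 64 / wd * 2 ^+ i.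
  rewrite /h /p; field; rewrite ?gt_eqF// ?exprn_gt0//.
have [eta [deta eta01 eta1 eta0]] := hM c (a0 + 3 * h) (a0 + 3 * h + h * p 0%N / 4)
  ltac:(have := hp0 0%N => ?; apply/andP; split; lra).
have hA i := hM c (A' i) (A i) ltac:(have := hp0 i; rewrite /A' /A => ?; apply/andP; split; lra).
have hB i := hM c (B i) (B' i) ltac:(have := hp0 i; have := hp1 i; rewrite /B' /B => ? ?;
  apply/andP; split; lra).
have [al hal] := choice hA; have [be hbe] := choice hB.
have eA i : (A i - A' i)^-1 = 64 / wd * 2 ^+ i by rewrite -rE /A /A'; congr (_^-1); field.
have eB i : (B' i - B i)^-1 = 64 / wd * 2 ^+ i by rewrite -rE /B /B'; congr (_^-1); field.
have r0 i : 0 <= 64 / wd * 2 ^+ i by rewrite mulr_ge0 ?exprn_ge0// divr_ge0// ltW.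
exists eta, (fun i => be i \* (fun x => 1 - al i x)).
have chi1 i x : A i < `|x - c| < B i -> \forall y \near x, (be i \* (fun x => 1 - al i x)) y = 1.
  move=> /andP[xA xB]; have [_ _ _ al0] := hal i; have [_ _ be1 _] := hbe i.
  apply: filterS2 (near_cl_out xA) (near_cl_in xB) => y yA yB /=.
  by rewrite al0 ?(ltW yA)// be1 ?(ltW yB)// subr0 mulr1.
split.
- move: deta; rewrite addrAC subrr add0r rE expr0 mulr1 => deta.
  by apply: dbound_mono deta; [rewrite divr_ge0// ltW|rewrite lerDl].
- move=> i; apply: (dbound_mono (M := 2 ^+ m * (M * (M + 1)))) => //; first by rewrite lerDr.
  have [dal _ _ _] := hal i; have [dbe _ _ _] := hbe i; move: dal dbe; rewrite eA eB => dal dbe.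
  by apply: dboundM => //; [exact: addr_ge0|exact: dbound_1B].
(* [eta] varies between a0 + 3 h and a0 + 13 h / 4, well inside the region from a0 + 2 h to a0 + 14
   h where [chi 0] is 1. *)
- move=> x; have [x3|x3] := ltP (`|x - c|) (a0 + 3 * h).
    by right; exists 1; apply: filterS (near_cl_in x3) => y y3; rewrite eta1// ltW.
  have := hp1 0%N; have p01 : p 0%N = 1 by rewrite /p expr0 invr1.
  have [x14|x14] := ltP (`|x - c|) (a0 + 14 * h) => _.
    by left; apply: chi1; rewrite /A /B wE p01 mulr1; apply/andP; split; lra.
  right; exists 0; have x5 : a0 + 5 * h < `|x - c| by lra.
  apply: filterS (near_cl_out x5) => y y5; rewrite eta0//.
  by move: y5; rewrite p01 mulr1; lra.
- move=> i x; have [_ _ al1 _] := hal i; have [_ _ _ be0] := hbe i.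
  have [xA|xA] := leP (`|x - c|) (A i.+1).
    have xA' : `|x - c| < A' i.
      by apply: le_lt_trans xA _; rewrite /A /A' hpS; have := hp0 i; lra.
    right; exists 0; apply: filterS (near_cl_in xA') => y yA /=.
    by rewrite al1 ?subrr ?mulr0// ltW.
  have [xB|xB] := leP (B i.+1) (`|x - c|).
    have xB' : B' i < `|x - c|.
      by apply: lt_le_trans xB; rewrite /B /B' hpS; have := hp0 i; lra.
    right; exists 0; apply: filterS (near_cl_out xB') => y yB /=.
    by rewrite be0 ?mul0r// ltW.
  by left; apply: chi1; rewrite xA xB.
split => //.
- by move=> x xa; apply: eta1; lra.
- by move=> x xa; apply: eta0; have := hp1 0%N; lra.
- move=> i x /=; have [_ /(_ x)/andP[a1 a2] _ _] := hal i; have [_ /(_ x)/andP[b1 b2] _ _] := hbe i.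
  by rewrite mulr_ge0// ?subr_ge0//= mulr_ile1// ?subr_ge0// lerBlDr lerDl.
- move=> i x /=; have [_ _ al1 _] := hal i; have [_ _ _ be0] := hbe i => nz.
  have := hp0 i; have := hp1 i => q1 q0.
  apply/andP; split; rewrite ltNge; apply: contra nz => xa.
    by rewrite al1 ?subrr ?mulr0//; rewrite /A'; lra.
  by rewrite be0 ?mul0r//; rewrite /B'; lra.
Qed.

End cutoffs.

Section iteration.
Context {R : realType} {n : nat} (I T : finType) (m : nat) (ci cj : T -> I) (sa sb : T -> seq 'I_n).
Local Notation X := 'rV[R]_n.
Implicit Types (u : I -> X -> R) (a : T -> X -> R) (h : X -> R).
Local Notation bform := (bform ci cj sa sb).
Local Notation coefs := (coefs m sa sb).
Local Notation garding := (garding m ci cj sa sb).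

Lemma wen_geometric (r0 : R) k i (w : X -> R) : 0 <= r0 -> wen (r0 * 2 ^+ i) k w <= (4 ^+ k) ^+ i *
  wen r0 k w.
Proof.
move=> r00; rewrite /wen mulr_sumr; apply: ler_sum => j _; rewrite mulrA ler_wpM2r ?en_ge0//.
rewrite exprMn mulrC ler_wpM2r ?exprn_ge0//.
have -> : (4 : R) = 2 ^+ 2 by rewrite expr2; lra.
by rewrite -!exprM ler_weXn2l ?ler1n//; lia.
Qed.

Lemma pow4 i k : (2 ^+ i) ^+ (2 * k) = (4 ^+ k) ^+ i :> R.
Proof.
have -> : (4 : R) = 2 ^+ 2 by rewrite expr2; lra.
by rewrite -!exprM mulnCA (mulnC i).
Qed.

Lemma caccioppoli_tf (lam L : R) : (0 < m)%N -> 0 < lam -> 0 <= L ->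
  exists2 C : R, 0 <= C & forall a (de K : R) (c : X) (a0 wd : R) u (N1 N2 : R),
  coefs a L -> garding a lam de -> 0 <= de -> 0 <= K -> 0 <= a0 -> 0 < wd ->
  (forall i, tf (u i)) ->
  (forall phi, (forall i, tf (phi i)) -> (forall i x, a0 + wd <= `|x - c| -> phi i x = 0) ->
    `|bform a phi u| <= K * Num.sqrt (En m phi)) ->
  (forall h, smooth h -> (forall x, 0 <= h x <= 1) ->
    (forall x, h x != 0 -> a0 < `|x - c| < a0 + wd) -> En 0 (hmul h u) <= N1) ->
  (forall h, smooth h -> (forall x, 0 <= h x <= 1) ->
    (forall x, h x != 0 -> `|x - c| < a0 + wd) -> En 0 (hmul h u) <= N2) ->
  exists eta, [/\ smooth eta, forall x, 0 <= eta x <= 1, forall x, `|x - c| <= a0 -> eta x = 1,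
    forall x, a0 + wd <= `|x - c| -> eta x = 0 &
    En m (hmul eta u) <= C * (wd^-1 ^+ (2 * m) * N1 + de * N2 + K ^+ 2)].
Proof.
move=> m0 lam0 L0; have [M M0 hM] := annulus_cutoffs (R := R) (n := n) m.
pose q : R := 4 ^+ m; have q1 : 1 <= q by rewrite exprn_ege1// ler1n.
have q0 : 0 < q by exact: lt_le_trans q1.
(* q = 4^m is the growth of r^(2m) when the scale is halved; the fraction 1/(2q) becomes the factor
   1/2 once energies are divided by q^i. *)
have ep0 : 0 < (2 * q)^-1 by rewrite invr_gt0 mulr_gt0.
have [C1 C10 hC1] := master ci cj sa sb m0 lam0 L0 M0 ep0.
have [C2 C20 hC2] := master ci cj sa sb m0 lam0 L0 M0 ltr01.
exists ((2 * C1 + C2) * 64 ^+ (2 * m)).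
  by rewrite mulr_ge0 ?exprn_ge0// addr_ge0// mulr_ge0.
move=> a de K c a0 wd u N1 N2 ca ga de0 K0 a00 wd0 tu hK hN1 hN2.
have [eta [chi [deta dchi ab0 abS [eta1 eta01 eta0 chi01 chi0]]]] := hM c a0 wd a00 wd0.
have seta : smooth eta by case: deta.
have schi i : smooth (chi i) by case: (dchi i).
pose r0 := 64 / wd; have r00 : 0 < r0 by rewrite divr_gt0.
have ri0 i : 0 < r0 * 2 ^+ i by rewrite mulr_gt0// exprn_gt0.
have nz0 i x : a0 + wd <= `|x - c| -> chi i x = 0.
  move=> xa; apply/eqP/negP => /negP /chi0 /andP[_]; rewrite ltNge => /negP; exact.
have n1 i : En 0 (hmul (chi i) u) <= N1 by exact: (hN1 _ (schi i) (chi01 i) (chi0 i)).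
have n2 i : En 0 (hmul (chi i) u) <= N2.
  by apply: (hN2 _ (schi i) (chi01 i)) => x /chi0 /andP[].
have n3 : En 0 (hmul eta u) <= N2.
  by apply: (hN2 _ seta eta01) => x; rewrite ltNge => nz; apply/negP => /eta0 e0; rewrite e0 eqxx
    in nz.
have N10 : 0 <= N1 by apply: le_trans (n1 0%N); exact: En_ge0.
have N20 : 0 <= N2 by apply: le_trans n3; exact: En_ge0.
pose b := r0 ^+ (2 * m) * N1 + de * N2 + K ^+ 2.
have b0 : 0 <= b by rewrite !addr_ge0 ?sqr_ge0 ?mulr_ge0// exprn_ge0// ltW.
have test h : smooth h -> (forall x, a0 + wd <= `|x - c| -> h x = 0) ->
    `|bform a (hmul h (hmul h u)) u| <= K * Num.sqrt (En m (hmul h (hmul h u))).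
  move=> sh h0; apply: hK; first by move=> i; do 2 apply: tfM => //.
  by move=> i x xa; rewrite /hmul /= h0// mul0r.
pose F i := En m (hmul (chi i) u) / q ^+ i.
have qi i : 0 < q ^+ i by exact: exprn_gt0.
have step i : F i <= F i.+1 / 2 + C1 * b.
  have H := hC1 a de _ K _ _ u ca ga de0 (ri0 i) K0 (dchi i) (schi i.+1) (abS i) tu
    (test _ (schi i) (nz0 i)).
  rewrite /F ler_pdivrMr//; apply: (le_trans H); rewrite [leRHS]mulrDl; apply: lerD.
    rewrite le_eqVlt; apply/orP; left; apply/eqP.
    by rewrite [q ^+ i.+1]exprS; field; rewrite !gt_eqF.
  rewrite -[leRHS]mulrA ler_wpM2l// /b.
  have rr : (r0 * 2 ^+ i) ^+ (2 * m) = r0 ^+ (2 * m) * q ^+ i.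
    by rewrite exprMn pow4.
  have qi1 : 1 <= q ^+ i by rewrite exprn_ege1.
  rewrite rr [leRHS](_ : _ = r0 ^+ (2 * m) * q ^+ i * N1 + de * N2 * q ^+ i + K ^+ 2 * q ^+ i);
    last by ring.
  apply: lerD; first apply: lerD.
  - by rewrite ler_wpM2l// mulr_ge0 ?exprn_ge0// ltW.
  - apply: (@le_trans _ _ (de * N2)); first by rewrite ler_wpM2l.
    by rewrite ler_peMr// mulr_ge0.
  - by rewrite ler_peMr// sqr_ge0.
(* For a fixed test family the order m energy of [chi i * u] grows at most like q^i, which is what
   the division compensates. *)
have [D hD] : exists D, forall i, F i <= D.
  exists ((2 * n.+1%:R) ^+ m * M ^+ 2 * \sum_i wen r0 m (u i)) => i.
  rewrite /F ler_pdivrMr// [leRHS](_ : _ =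
    \sum_j (2 * n.+1%:R) ^+ m * M ^+ 2 * (q ^+ i * wen r0 m (u j))); last first.
    by rewrite mulr_sumr mulr_suml; apply: eq_bigr => j _; rewrite [X in _ = _ * X]mulrC [RHS]mulrA.
  apply: ler_sum => j _; apply: (le_trans (en_mul M0 (ltW (ri0 i)) (dchi i) (tu j))).
  rewrite ler_wpM2l//; last exact: wen_geometric (ltW r00).
  by rewrite mulr_ge0 ?sqr_ge0// exprn_ge0// mulr_ge0.
have E0 : En m (hmul (chi 0%N) u) <= 2 * (C1 * b).
  by have := halving step hD; rewrite /F expr0 divr1.
have EH := hC2 a de _ K _ _ u ca ga de0 r00 K0 deta (schi 0%N) ab0 tu (test _ seta eta0).
exists eta; split => //; apply: (le_trans EH); rewrite mul1r.
apply: (@le_trans _ _ ((2 * C1 + C2) * b)).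
  rewrite [leRHS](_ : _ = 2 * (C1 * b) + C2 * b); last by ring.
  apply: lerD => //; rewrite ler_wpM2l// /b; apply: lerD => //.
  by apply: lerD; [rewrite ler_wpM2l// exprn_ge0// ltW|rewrite ler_wpM2l].
rewrite -[leRHS]mulrA ler_wpM2l ?addr_ge0 ?mulr_ge0// /b /r0.
have k1 : 1 <= 64 ^+ (2 * m) :> R by rewrite exprn_ege1// ler1n.
rewrite exprMn [leRHS](_ : _ = 64 ^+ (2 * m) * wd^-1 ^+ (2 * m) * N1 +
  64 ^+ (2 * m) * (de * N2) + 64 ^+ (2 * m) * K ^+ 2); last by ring.
apply: lerD; last by rewrite ler_peMl ?sqr_ge0.
by apply: lerD => //; rewrite ler_peMl// mulr_ge0.
Qed.

End iteration.

(** * Passage from test functions to weak solutions *)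

Section weak.
Context {R : realType} {n : nat}.
Local Notation X := 'rV[R]_n.
Local Notation leb := (@lebesgue_rV R n).
Implicit Types (a p v g : X -> R).

Lemma cvg_sqr_dist0 (z : nat -> R) (b : R) : (z k - b) ^+ 2 @[k --> \oo] --> 0 -> z k @[k --> \oo]
  --> b.
Proof.
move=> /cvgrPdist_lt h; apply/cvgrPdist_lt => e e0.
have e20 : 0 < e ^+ 2 by exact: exprn_gt0.
apply: filterS (h _ e20) => k; rewrite sub0r normrN ger0_norm ?sqr_ge0// distrC => zk.
by rewrite -(ltr_pXn2r (n := 2)) ?nnegrE ?(ltW e0)// real_normK ?num_real.
Qed.

Lemma ae_cvg_L2 c (R1 : R) (V : nat -> X -> R) g : (forall k, tf (V k)) ->
  measurable_fun setT (res c R1 g) ->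
  (forall k, \int[leb]_x (\1_(cl c R1) x * (V k x - g x) ^+ 2)%:E <= (1 / (2 ^ k.+1)%:R)%:E)%E ->
  {ae leb, forall x, cl c R1 x -> V k x @[k --> \oo] --> g x}.
Proof.
move=> tV mg hV.
have E k x : \1_(cl c R1) x * (V k x - g x) ^+ 2 = \1_(cl c R1) x * (V k x - res c R1 g x) ^+ 2.
  by rewrite indicE; case: (boolP (x \in cl c R1)) => [/set_mem xr|_]; rewrite ?mul0r// res_in.
have := @ae_cvg0_summable R _ _ leb (fun k x => \1_(cl c R1) x * (V k x - g x) ^+ 2).
move=> /(_ _ _ hV) H; apply: filterS (H _ _).
- move=> x Hx xr; apply: cvg_sqr_dist0; move: Hx.
  by under eq_fun do rewrite indicE mem_set// mul1r.
- move=> k; under eq_fun do rewrite E.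
  apply: measurable_funM; first exact: measurable_indic_cl.
  apply: measurable_funX; apply: measurable_funB => //.
  by apply: smooth_measurable; case: (tV k).
- by move=> k x; rewrite mulr_ge0 ?indic_ge0// sqr_ge0.
Qed.

(** [cbd] is stated for test functions, and g is only an almost everywhere limit of them. Fatou
    provides both the integrability of p a (v - g) and its bound. *)
Lemma tri_weak k1 k2 a (L A e : R) p v (V : nat -> X -> R) g c (R1 : R) :
  measurable_fun setT a -> 0 <= L -> cbd k1 k2 (fun x => `|a x|) L -> tf p -> tf v ->
  (forall l, tf (V l)) -> (forall x, R1 < `|x - c| -> p x = 0) ->
  measurable_fun setT (res c R1 g) ->
  {ae leb, forall x, cl c R1 x -> V k x @[k --> \oo] --> g x} ->
  en k1 p <= A -> (forall l, en k2 (fun x => v x - V l x) <= e) ->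
  leb.-integrable setT (EFin \o (fun x => p x * a x * g x)) /\
  `|tri a p v - tri a p g| <= L * (Num.sqrt A * Num.sqrt e).
Proof.
move=> ma L0 ca tp tv tV p0 mg cV pA ve; have [sp _] := tp; have [sv _] := tv.
have mp : measurable_fun setT p by exact: smooth_measurable.
have mv : measurable_fun setT v by exact: smooth_measurable.
have mV l : measurable_fun setT (V l) by apply: smooth_measurable; case: (tV l).
have pr x : p x * g x = p x * res c R1 g x.
  have [xr|xr] := leP (`|x - c|) R1; first by rewrite res_in.
  by rewrite p0// !mul0r.
pose D x := p x * a x * (v x - g x).
have mD : measurable_fun setT D.
  have -> : D = fun x => p x * a x * (v x - res c R1 g x).
    by apply/funext => x; rewrite /D [p x * _]mulrC -!mulrA !mulrBr pr.
  by apply: measurable_funM; [exact: measurable_funM|exact: measurable_funB].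
have bD : (\int[leb]_x (`|D x|)%:E <= (L * (Num.sqrt A * Num.sqrt e))%:E)%E.
  apply: (fatou_ae (f := fun l x => `|p x * a x * (v x - V l x)|)) => //.
  - move=> l; apply: measurableT_comp => //.
    by apply: measurable_funM; [exact: measurable_funM|exact: measurable_funB].
  - exact: measurableT_comp.
  - apply: filterS cV => x cV; have [xr|xr] := leP (`|x - c|) R1; last first.
      rewrite /D p0//; under eq_fun do rewrite !mul0r normr0.
      by rewrite !mul0r normr0; exact: cvg_cst.
    apply: cvg_norm; apply: cvgM; first exact: cvg_cst.
    by apply: cvgB; [exact: cvg_cst|exact: cV].
  - move=> l; have tvV : tf (fun x => v x - V l x) by exact: tfB.
    apply: (@le_trans _ _ (L * (Num.sqrt (en k1 p) * Num.sqrt (en k2 (fun x => v x - V l x))))%:E).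
      apply: le_trans (ca _ _ tp tvV); rewrite le_eqVlt; apply/orP; left; apply/eqP.
      by apply: eq_integral => x _; rewrite !normrM mulrCA mulrA.
    by rewrite lee_fin ler_wpM2l// ler_pM ?sqrtr_ge0//; apply: ler_wsqrtr.
have iD : leb.-integrable setT (EFin \o D).
  apply/integrableP; split; first exact/measurable_EFinP.
  exact: le_lt_trans bD (ltry _).
have i1 := tri_integrable ma ca tp tv.
have i2 : leb.-integrable setT (EFin \o (fun x => p x * a x * g x)).
  rewrite (_ : EFin \o _ = ((EFin \o (fun x => p x * a x * v x)%R) \- (EFin \o D))%E).
    exact: integrableB.
  by apply/funext => x /=; rewrite -EFinB; congr EFin; rewrite /D; ring.
split => //; have -> : tri a p v - tri a p g = \int[leb]_x D x.
  rewrite /tri -(RintegralB measurableT i1 i2); apply: eq_Rintegral => x _.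
  by rewrite /D mulrBr.
rewrite -lee_fin; apply: le_trans bD.
have fi : (\int[leb]_x (D x)%:E)%E \is a fin_num by exact: integrable_fin_num.
rewrite /Rintegral -abse_EFin fineK//.
by apply: (le_trans (le_abse_integral _ measurableT _)); first by have /integrableP[] := iD.
Qed.

Lemma en0_cut (P : set X) (h V : X -> R) g c (R1 : R) : measurable P -> tf V -> smooth h ->
  (forall x, 0 <= h x <= 1) -> (forall x, h x != 0 -> P x /\ cl c R1 x) ->
  measurable_fun setT (res c R1 g) ->
  ((en 0 (h \* V))%:E <= 2%:E * (\int[leb]_x (\1_(P `&` cl c R1) x * g x ^+ 2)%:E +
     \int[leb]_x (\1_(cl c R1) x * (V x - g x) ^+ 2)%:E))%E.
Proof.
move=> mP tV sh h01 hP mg; have [sV _] := tV.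
have tg : tf (h \* V) by exact: tfM.
have cg : cb (fun x => (h \* V) x ^+ 2) by exact: cb_sqr_tf.
have E1 x : \1_(P `&` cl c R1) x * g x ^+ 2 = \1_(P `&` cl c R1) x * res c R1 g x ^+ 2.
  by rewrite indicE; case: (boolP (x \in P `&` cl c R1)) => [/set_mem[_ xr]|_]; rewrite ?mul0r//
    res_in.
have E2 x : \1_(cl c R1) x * (V x - g x) ^+ 2 = \1_(cl c R1) x * (V x - res c R1 g x) ^+ 2.
  by rewrite indicE; case: (boolP (x \in cl c R1)) => [/set_mem xr|_]; rewrite ?mul0r// res_in.
have m1 : measurable_fun setT (fun x => (\1_(P `&` cl c R1) x * g x ^+ 2)%:E).
  under eq_fun do rewrite E1.
  apply/measurable_EFinP; apply: measurable_funM; last exact: measurable_funX.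
  by apply: measurable_indic; apply: measurableI => //; exact: measurable_cl.
have m2 : measurable_fun setT (fun x => (\1_(cl c R1) x * (V x - g x) ^+ 2)%:E).
  under eq_fun do rewrite E2.
  apply/measurable_EFinP; apply: measurable_funM; first exact: measurable_indic_cl.
  by apply: measurable_funX; apply: measurable_funB => //; exact: smooth_measurable.
have p1 x : (0 <= (\1_(P `&` cl c R1) x * g x ^+ 2)%:E)%E.
  by rewrite lee_fin mulr_ge0 ?indic_ge0// sqr_ge0.
have p2 x : (0 <= (\1_(cl c R1) x * (V x - g x) ^+ 2)%:E)%E.
  by rewrite lee_fin mulr_ge0 ?indic_ge0// sqr_ge0.
rewrite -ge0_integralD// -ge0_integralZl//; last 2 first.
- exact: emeasurable_funD.
- by move=> x _; rewrite adde_ge0.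
rewrite [en _ _]/= -itg_EFin//; apply: ge0_le_integral => //.
- by move=> x _; rewrite lee_fin sqr_ge0.
- by apply/measurable_EFinP; exact: measurable_cb.
- by apply: measurable_funeM; exact: emeasurable_funD.
move=> x _; rewrite -EFinD -EFinM lee_fin.
have [hx|/hP[Px xr]] := eqVneq (h x) 0.
  rewrite /= hx mul0r expr0n/= mulr_ge0// addr_ge0//; first by have := p1 x; rewrite lee_fin.
  by have := p2 x; rewrite lee_fin.
rewrite !indicE !mem_set// !mul1r /= exprMn.
have h2 : h x ^+ 2 <= 1 by have /andP[a b] := h01 x; rewrite expr_le1.
apply: (@le_trans _ _ (V x ^+ 2)); first by rewrite ler_piMl ?sqr_ge0.
by have := sqr_ge0 (g x - (V x - g x)); rewrite !sqrrB; lra.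
Qed.

Lemma indic_en c (a0 : R) (h V : X -> R) s : tf V -> smooth h ->
  (forall x, `|x - c| <= a0 -> h x = 1) ->
  (\int[leb]_x (\1_[set x | (`|x - c| < a0)%R] x * pderive s V x ^+ 2)%:E <=
   (en (size s) (h \* V))%:E)%E.
Proof.
move=> tV sh h1; have tg : tf (h \* V) by exact: tfM.
have [sg _] := tg; have [sV _] := tV.
have cg : cb (fun x => pderive s (h \* V) x ^+ 2) by apply: cb_sqr_tf; exact: tf_pderive.
apply: (@le_trans _ _ ((en 0 (pderive s (h \* V)))%:E)); last first.
  by rewrite lee_fin; exact: (en_pderive_le 0).
rewrite [en _ _]/= -itg_EFin//.
have mI : measurable [set x : X | (`|x - c| < a0)%R].
  apply: open_measurable_rV; rewrite openE => x xa.
  by apply: filterS (near_cl_in xa) => y.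
apply: ge0_le_integral => //.
- by move=> x _; rewrite lee_fin mulr_ge0 ?indic_ge0// sqr_ge0.
- apply/measurable_EFinP; apply: measurable_funM; first exact: measurable_indic.
  by apply: measurable_funX; apply: smooth_measurable; exact: smooth_pderive.
- by apply/measurable_EFinP; exact: measurable_cb.
move=> x _; rewrite lee_fin indicE; case: (boolP (x \in _)) => [/set_mem xr|_]; last by rewrite
  mul0r sqr_ge0.
rewrite mul1r le_eqVlt; apply/orP; left; apply/eqP; congr (_ ^+ 2).
apply: near_pderiveE; apply: filterS (near_cl_in xr) => y ya /=.
by rewrite h1 ?mul1r// ltW.
Qed.

End weak.

Section weak_caccioppoli.
Context {R : realType} {n : nat} (I T : finType) (m : nat) (ci cj : T -> I) (sa sb : T -> seq 'I_n).
Local Notation X := 'rV[R]_n.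
Local Notation leb := (@lebesgue_rV R n).
Local Notation coefs := (coefs m sa sb).
Local Notation garding := (garding m ci cj sa sb).

Lemma En0_cut (P : set X) (h : X -> R) (V g : I -> X -> R) c (R1 N q : R) : measurable P ->
  (forall i, tf (V i)) -> smooth h -> (forall x, 0 <= h x <= 1) ->
  (forall x, h x != 0 -> P x /\ cl c R1 x) ->
  (forall i, measurable_fun setT (res c R1 (g i))) ->
  (\sum_i \int[leb]_x (\1_(P `&` cl c R1) x * g i x ^+ 2)%:E <= N%:E)%E ->
  (forall i, \int[leb]_x (\1_(cl c R1) x * (V i x - g i x) ^+ 2)%:E <= q%:E)%E ->
  En 0 (hmul h V) <= 2 * (N + #|I|%:R * q).
Proof.
move=> mP tV sh h01 hP mg hN hq; rewrite -lee_fin /En -sumEFin.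
apply: (@le_trans _ _ (\sum_i (2%:E * (\int[leb]_x (\1_(P `&` cl c R1) x * g i x ^+ 2)%:E +
     \int[leb]_x (\1_(cl c R1) x * (V i x - g i x) ^+ 2)%:E)))%E).
  by apply: lee_sum => i _; exact: en0_cut.
have i1 i : (0 <= \int[leb]_x (\1_(P `&` cl c R1) x * g i x ^+ 2)%:E)%E.
  by apply: integral_ge0 => x _; rewrite lee_fin mulr_ge0 ?indic_ge0// sqr_ge0.
have i2 i : (0 <= \int[leb]_x (\1_(cl c R1) x * (V i x - g i x) ^+ 2)%:E)%E.
  by apply: integral_ge0 => x _; rewrite lee_fin mulr_ge0 ?indic_ge0// sqr_ge0.
rewrite -ge0_sume_distrr; last by move=> i _; exact: adde_ge0.
rewrite EFinM; apply: lee_wpmul2l; first by rewrite lee_fin.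
rewrite big_split EFinD; apply: leeD => //.
apply: (@le_trans _ _ (\sum_(i in I) q%:E)%E); first by apply: lee_sum => i _; exact: hq.
by rewrite sumEFin lee_fin sumr_const mulr_natl.
Qed.

Lemma en_le_lowen (r : R) j w : (j < m)%N -> 0 <= r ->
  r ^+ (2 * (m - j)) * en j w <= @lowen R n r m w.
Proof.
case: m => // k jk r0; rewrite /lowen /wen /= mulr_sumr (bigD1 (Ordinal jk))//=.
have -> : (2 * (k.+1 - j) = 2 + 2 * (k - j))%N by rewrite subSn// mulnS.
rewrite exprD -mulrA lerDl.
by apply: sumr_ge0 => i _; rewrite mulr_ge0 ?sqr_ge0// mulr_ge0 ?exprn_ge0// en_ge0.
Qed.

Lemma pow2_small (e : R) : 0 < e -> exists k0, forall k, (k0 <= k)%N -> 1 / (2 ^ k.+1)%:R <= e.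
Proof.
move=> e0; exists (Num.bound e^-1) => k kk.
rewrite div1r -[leRHS]invrK lef_pV2 ?posrE ?invr_gt0// ?ltr0n ?expn_gt0//.
apply: ltW; apply: (lt_le_trans (archi_boundP _)); first by rewrite invr_ge0 ltW.
rewrite ler_nat; apply: (leq_trans kk); apply: (leq_trans (leqnSn k)).
by rewrite ltnW// ltn_expl.
Qed.

(** The approximants solve the equation up to an error that [tri_weak] bounds by a small multiple of
    the square root of the test function's energy, so the error only increases K. The estimates hold
    for all late approximants and pass to the limit on the open cube, where the cut-off is 1. *)
Lemma caccioppoli_weak (lam L : R) : (0 < m)%N -> 0 < lam -> 0 <= L ->
  exists2 C : R, 0 <= C & forall (a : T -> X -> R) (de K : R) (Omega : set X) (c : X) (a0 S : R)
    (u : I -> X -> R) (G : I -> seq 'I_n -> X -> R) (N1 N2 : R),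
  coefs a L -> garding a lam de -> 0 <= de -> 0 <= K -> 0 <= a0 -> a0 < S -> 0 <= N1 -> 0 <= N2 ->
  (forall r, r < S -> cl c r `<=` Omega) ->
  (forall i s, (size s <= m)%N -> wds Omega s (u i) (G i s)) ->
  (forall i s r, size s = m -> r < S -> (\int[leb]_x (\1_(cl c r) x * G i s x ^+ 2)%:E < +oo)%E) ->
  (forall R1 phi, R1 < S -> (forall i, tf (phi i)) ->
    (forall i x, R1 <= `|x - c| -> phi i x = 0) ->
    (forall t, leb.-integrable setT (EFin \o (fun x =>
       pderive (sa t) (phi (ci t)) x * a t x * G (cj t) (sb t) x))) ->
    `|\sum_t tri (a t) (pderive (sa t) (phi (ci t))) (G (cj t) (sb t))| <= K * Num.sqrt (En m phi))
      ->
  (forall R1, R1 < S -> (\sum_i \int[leb]_x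
    (\1_([set x | (a0 < `|x - c|)%R] `&` cl c R1) x * G i [::] x ^+ 2)%:E <= N1%:E)%E) ->
  (forall R1, R1 < S -> (\sum_i \int[leb]_x
    (\1_(setT `&` cl c R1) x * G i [::] x ^+ 2)%:E <= N2%:E)%E) ->
  let r := ((S - a0) / 2)^-1 in let B := r ^+ (2 * m) * N1 + de * N2 + K ^+ 2 in
  (forall i s, size s = m ->
    (\int[leb]_x (\1_[set x | (`|x - c| < a0)%R] x * G i s x ^+ 2)%:E <= (C * B)%:E)%E) /\
  (forall i s, (size s < m)%N ->
    ((r ^+ (2 * (m - size s)))%:E *
      \int[leb]_x (\1_[set x | (`|x - c| < a0)%R] x * G i s x ^+ 2)%:E <=
     (C * (B + r ^+ (2 * m) * N2))%:E)%E).
Proof.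
move=> m0 lam0 L0; have [C0 C00 hC0] := @caccioppoli_tf R n I T m ci cj sa sb lam L m0 lam0 L0.
have [C5 C50 hC5] := lowen_interp (R := R) (n := n) m0 ltr01.
exists (2 * (C0 + C5)); first by rewrite mulr_ge0// addr_ge0.
move=> a de K Omega c a0 S u G N1 N2 ca ga de0 K0 a00 aS N10 N20 Om wG Gm eqG hN1 hN2 r B.
pose wd := (S - a0) / 2; have wd0 : 0 < wd by rewrite divr_gt0// subr_gt0.
pose R1 := a0 + wd; have R1S : R1 < S by rewrite /R1 /wd; lra.
have R10 : 0 <= R1 by rewrite addr_ge0// ltW.
have r0 : 0 < r by rewrite invr_gt0.
have [U [tU hU cU]] := approximants R10 R1S Om wG Gm.
have mG i s : (size s <= m)%N -> measurable_fun setT (res c R1 (G i s)).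
  move=> sm; have [_ lv _] := wG i s sm.
  by apply/measurable_EFinP; have /integrableP[] := integrable_res lv (Om _ R1S).
have cvU i s : (size s <= m)%N ->
    {ae leb, forall x, cl c R1 x -> pderive s (U k i) x @[k --> \oo] --> G i s x}.
  by move=> sm; apply: ae_cvg_L2; [move=> k; exact: tf_pderive|exact: mG|move=> k; exact: hU].
have key (e : R) : 0 < e -> exists k2, forall k, (k2 <= k)%N -> exists eta,
    [/\ smooth eta, forall x, `|x - c| <= a0 -> eta x = 1,
      En m (hmul eta (U k)) <= C0 * (2 * B + e) & En 0 (hmul eta (U k)) <= 2 * N2 + e].
  move=> e0; pose rm := r ^+ (2 * m); have rm0 : 0 <= rm by rewrite exprn_ge0// ltW.
  pose TL := #|T|%:R * L; have TL0 : 0 <= TL by rewrite mulr_ge0.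
  (* W collects the coefficients with which the accuracy e' enters the two bounds of [key], so that
     e' = e / W keeps both errors below e. *)
  pose W := 2 * #|I|%:R * (rm + de + 1) + 2 * TL ^+ 2 + 1.
  have rd0 : 0 <= rm + de by rewrite addr_ge0.
  have I0 : 0 <= #|I|%:R :> R by [].
  have W0 : 0 < W.
    by rewrite ltr_wpDl// addr_ge0 ?mulr_ge0 ?sqr_ge0// addr_ge0.
  pose e' := e / W; have e'0 : 0 < e' by rewrite divr_gt0.
  have eE : e = W * e' by rewrite /e'; field; rewrite gt_eqF.
  have [k0 hk0] := cU _ e'0; have [k1 hk1] := pow2_small e'0.
  exists (maxn k0 k1) => k; rewrite geq_max => /andP[kk0 kk1].
  pose q := 1 / (2 ^ k.+1)%:R : R; have qe : q <= e' by exact: hk1.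
  (* Testing with an approximant costs one trilinear error of size L sqrt(e') for each of the [#|T|]
     terms. *)
  pose K' := K + TL * Num.sqrt e'.
  have K'0 : 0 <= K' by rewrite addr_ge0// mulr_ge0// sqrtr_ge0.
  have hUk i : (\int[leb]_x (\1_(cl c R1) x * (U k i x - G i [::] x) ^+ 2)%:E <= q%:E)%E.
    exact: (hU k i [::]).
  have mP : measurable [set x : X | (a0 < `|x - c|)%R].
    apply: open_measurable_rV; rewrite openE => x xa.
    by apply: filterS (near_cl_out xa) => y.
  have test phi : (forall i, tf (phi i)) -> (forall i x, a0 + wd <= `|x - c| -> phi i x = 0) ->
      `|bform ci cj sa sb a phi (U k)| <= K' * Num.sqrt (En m phi).
    move=> tphi phi0.
    have H t : leb.-integrable setT (EFin \o (fun x =>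
         pderive (sa t) (phi (ci t)) x * a t x * G (cj t) (sb t) x)) /\
       `|tri (a t) (pderive (sa t) (phi (ci t))) (pderive (sb t) (U k (cj t))) -
         tri (a t) (pderive (sa t) (phi (ci t))) (G (cj t) (sb t))| <=
       L * (Num.sqrt (En m phi) * Num.sqrt e').
      have [ma sam sbm cat] := ca t.
      apply: (tri_weak (V := fun l => pderive (sb t) (U (l + k0)%N (cj t))) (R1 := R1) (c := c) ma
        L0 cat).
      - exact: tf_pderive.
      - exact: tf_pderive.
      - by move=> l; exact: tf_pderive.
      - by apply: pderive_out => x /ltW; exact: phi0.
      - exact: mG.
      - apply: filterS (cvU (cj t) (sb t) sbm) => x /[apply].
        by rewrite -(cvg_shiftn k0).
      - exact: En_pderive.
      - move=> l; have [s1 _] := tU k (cj t); have [s2 _] := tU (l + k0)%N (cj t).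
        rewrite -pderiveB//; apply: (@le_trans _ _ (en m (fun x => U k (cj t) x - U (l + k0)%N (cj
          t) x))).
          by rewrite -{2}(subnK sbm); apply: en_pderive_le; exact: smoothB.
        by apply: hk0 => //; exact: leq_addl.
    have eqp := eqG _ _ R1S tphi phi0 (fun t => (H t).1).
    set b := bform _ _ _ _ _ _ _; set b' := \sum_t _ in eqp.
    rewrite -(subrK b' b) addrC (le_trans (ler_normD _ _))// /K' mulrDl lerD//.
    rewrite /b /b' /bform -sumrB (le_trans (ler_norm_sum _ _ _))//.
    have -> : TL * Num.sqrt e' * Num.sqrt (En m phi) =
        \sum_(t in T) L * (Num.sqrt (En m phi) * Num.sqrt e').
      by rewrite sumr_const -mulr_natl /TL; ring.
    by apply: ler_sum => t _; case: (H t).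
  have [eta [seta eta01 eta1 eta0 hE]] := hC0 a de K' c a0 wd (U k)
    (2 * (N1 + #|I|%:R * q)) (2 * (N2 + #|I|%:R * q)) ca ga de0 K'0 a00 wd0 (tU k) test
    ltac:(move=> h sh h01 hP; apply: (En0_cut mP (tU k) sh h01 _ (fun i => mG i [::] isT) (hN1 _
      R1S) hUk);
      by move=> x /hP/andP[x1 x2]; split => //; rewrite /cl /= ltW)
    ltac:(move=> h sh h01 hP; apply: (En0_cut measurableT (tU k) sh h01 _ (fun i => mG i [::] isT)
      (hN2 _ R1S) hUk);
      by move=> x /hP x1; split => //; rewrite /cl /= ltW).
  have qI : #|I|%:R * q <= #|I|%:R * e' by rewrite ler_wpM2l.
  have e'w := ltW e'0.
  have z1 : 0 <= TL ^+ 2 * e' by rewrite mulr_ge0 ?sqr_ge0.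
  have z2 : 0 <= #|I|%:R * e' by rewrite mulr_ge0.
  have z3 : 0 <= #|I|%:R * e' * (rm + de) by rewrite mulr_ge0.
  exists eta; split => //.
    apply: (le_trans hE); rewrite ler_wpM2l//.
    have KK : K' ^+ 2 <= 2 * K ^+ 2 + 2 * (TL ^+ 2 * e').
      have := sqr_ge0 (K - TL * Num.sqrt e'); rewrite /K' sqrrB sqrrD exprMn sqr_sqrtr//; lra.
    apply: (@le_trans _ _ (rm * (2 * (N1 + #|I|%:R * e')) + de * (2 * (N2 + #|I|%:R * e')) +
        (2 * K ^+ 2 + 2 * (TL ^+ 2 * e')))).
      apply: lerD => //; apply: lerD.
        by rewrite -/r -/rm ler_wpM2l// ler_wpM2l// lerD2l.
      by rewrite ler_wpM2l// ler_wpM2l// lerD2l.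
    rewrite eE /W /B -/rm -subr_ge0.
    rewrite [leRHS](_ : _ = 2 * (#|I|%:R * e') + e'); last by ring.
    by rewrite addr_ge0// mulr_ge0.
  apply: (@le_trans _ _ (2 * (N2 + #|I|%:R * q))).
    apply: (En0_cut measurableT (tU k) seta eta01 _ (fun i => mG i [::] isT) (hN2 _ R1S) hUk) => x
      xn.
    split => //; rewrite /cl /= leNgt; apply: contra xn => /ltW xr; rewrite eta0//.
  rewrite mulrDr lerD2l eE /W -subr_ge0.
  apply: (@le_trans _ _ (2 * (#|I|%:R * e' * (rm + de)) + 2 * (TL ^+ 2 * e') + e' + 2 * (#|I|%:R *
    e' - #|I|%:R * q))).
    have qI' : 0 <= #|I|%:R * e' - #|I|%:R * q by rewrite subr_ge0.
    move: z1 z3 e'w qI'; lra.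
  by rewrite le_eqVlt; apply/orP; left; apply/eqP; ring.
(* Fatou along the tail beginning at k2, for each e, removes the error in the limit. *)
have bndE i s (Z : R) : (size s <= m)%N -> (forall e : R, 0 < e -> exists k2, forall k, (k2 <= k)%N
  ->
   (\int[leb]_x (\1_[set x | (`|x - c| < a0)%R] x * pderive s (U k i) x ^+ 2)%:E <= (Z + e)%:E)%E)
     ->
   (\int[leb]_x (\1_[set x | (`|x - c| < a0)%R] x * G i s x ^+ 2)%:E <= Z%:E)%E.
  move=> sm hZ; apply/lee_addgt0Pr => e e0; rewrite -EFinD; have [k2 hk2] := hZ _ e0.
  have mI : measurable [set x : X | (`|x - c| < a0)%R].
    apply: open_measurable_rV; rewrite openE => x xa.
    by apply: filterS (near_cl_in xa) => y.
  have inR x : `|x - c| < a0 -> cl c R1 x.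
    by rewrite /cl /= => xa; rewrite ltW// (lt_trans xa)// /R1 ltrDl.
  apply: (fatou_ae (f := fun l x => \1_[set x | (`|x - c| < a0)%R] x * pderive s (U (l + k2)%N i) x
    ^+ 2)).
  - move=> l; apply: measurable_funM; first exact: measurable_indic.
    by apply: measurable_funX; apply: smooth_measurable; apply: smooth_pderive; case: (tU (l +
      k2)%N i).
  - have -> : (fun x => \1_[set x | (`|x - c| < a0)%R] x * G i s x ^+ 2) =
        (fun x => \1_[set x | (`|x - c| < a0)%R] x * res c R1 (G i s) x ^+ 2).
      apply/funext => x; rewrite indicE; case: (boolP (x \in _)) => [/set_mem/inR xr|_]; rewrite
        ?mul0r//.
      by rewrite res_in.
    by apply: measurable_funM; [exact: measurable_indic|apply: measurable_funX; exact: mG].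
  - by move=> l x; rewrite mulr_ge0 ?indic_ge0// sqr_ge0.
  - by move=> x; rewrite mulr_ge0 ?indic_ge0// sqr_ge0.
  - apply: filterS (cvU i s sm) => x xc; rewrite indicE; case: (boolP (x \in _)) => [/set_mem/inR
    xr|_]; last first.
      by under eq_fun do rewrite mul0r; rewrite mul0r; exact: cvg_cst.
    under eq_fun do rewrite mul1r; rewrite mul1r.
    have xG : pderive s (U (l + k2)%N i) x @[l --> \oo] --> G i s x.
      by have := xc xr; rewrite -(cvg_shiftn k2).
    by under eq_fun do rewrite expr2; rewrite expr2; exact: cvgM.
  - by move=> l; apply: hk2; exact: leq_addl.
have rm0 : 0 <= r ^+ (2 * m) by rewrite exprn_ge0// ltW.
have B0 : 0 <= B by rewrite addr_ge0 ?sqr_ge0// addr_ge0// mulr_ge0.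
split=> i s sm.
  apply: bndE => [|e e0]; first by rewrite sm.
  have C10 : 0 < C0 + 1 by rewrite ltr_wpDl.
  have e20 : 0 < e / (C0 + 1) by rewrite divr_gt0.
  have [k2 hk2] := key _ e20; exists k2 => k /hk2[eta [seta eta1 eE _]].
  apply: (le_trans (indic_en s (tU k i) seta eta1)); rewrite lee_fin sm.
  apply: (le_trans (en_En m (hmul eta (U k)) i)); apply: (le_trans eE).
  rewrite mulrDr; apply: lerD.
    rewrite mulrCA -[leRHS]mulrA ler_wpM2l// ler_wpM2r// lerDl//.
  by rewrite mulrCA ler_piMr ?(ltW e0)// ler_pdivrMr// mul1r lerDl.
pose rs := r ^+ (2 * (m - size s)); have rs0 : 0 < rs by exact: exprn_gt0.
pose Z := 2 * (C0 + C5) * (B + r ^+ (2 * m) * N2).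
suff H : (\int[leb]_x (\1_[set x | (`|x - c| < a0)%R] x * G i s x ^+ 2)%:E <= (rs^-1 * Z)%:E)%E.
  apply: (le_trans (lee_wpmul2l _ H)); first by rewrite lee_fin ltW.
  by rewrite -EFinM lee_fin mulVKf ?gt_eqF.
apply: bndE => [|e e0]; first exact: ltnW.
pose D := C0 + C5 * r ^+ (2 * m) + 1.
have D0 : 0 < D by rewrite ltr_wpDl// addr_ge0// mulr_ge0.
have e20 : 0 < e * rs / D by rewrite divr_gt0// mulr_gt0.
have [k2 hk2] := key _ e20; exists k2 => k /hk2[eta [seta eta1 eE e0E]].
apply: (le_trans (indic_en s (tU k i) seta eta1)); rewrite lee_fin.
have te : tf (eta \* U k i) by exact: tfM.
have lw : rs * en (size s) (eta \* U k i) <= C0 * (2 * B + e * rs / D) + C5 * r ^+ (2 * m) * (2 *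
  N2 + e * rs / D).
  apply: (le_trans (en_le_lowen _ sm (ltW r0))); apply: (le_trans (hC5 _ _ r0 te)).
  rewrite mul1r; apply: lerD; first exact: le_trans (en_En m (hmul eta (U k)) i) eE.
  rewrite ler_wpM2l ?mulr_ge0//; exact: le_trans (en_En 0 (hmul eta (U k)) i) e0E.
rewrite -(ler_pM2l rs0); apply: (le_trans lw).
have -> : rs * (rs^-1 * Z + e) = Z + rs * e by rewrite [LHS]mulrDr mulVKf ?gt_eqF.
have d1 : (C0 + C5 * r ^+ (2 * m)) * (e * rs / D) <= rs * e.
  rewrite [leLHS](_ : _ = (C0 + C5 * r ^+ (2 * m)) / D * (rs * e)); last by ring.
  by rewrite ler_piMl ?mulr_ge0 ?(ltW rs0) ?(ltW e0)// ler_pdivrMr// mul1r lerDl.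
have z1 : 0 <= C5 * B by exact: mulr_ge0.
have z2 : 0 <= C0 * (r ^+ (2 * m) * N2) by rewrite !mulr_ge0.
rewrite [leLHS](_ : _ = (C0 + C5 * r ^+ (2 * m)) * (e * rs / D) + (2 * (C0 * B) + 2 * (C5 * (r ^+
  (2 * m) * N2)))); last by ring.
rewrite [leRHS]addrC; apply: lerD => //; rewrite /Z -subr_ge0.
rewrite [leRHS](_ : _ = 2 * (C5 * B) + 2 * (C0 * (r ^+ (2 * m) * N2))); last by ring.
by rewrite addr_ge0// mulr_ge0.
Qed.

End weak_caccioppoli.

(** * From complex to real-valued functions *)

Section multi_index_lists.
Context {n : nat}.
Implicit Types (s : seq 'I_n) (a : 'I_n -> nat).

(** Estimates use sequences, whose derivatives compose by concatenation, and the statement uses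
    multi-indices. [sq] is the sequence built into [mderive]; with [cnt] it identifies the two up to
    permutation. *)
Definition sq a : seq 'I_n := flatten [seq nseq (a i) i | i <- enum 'I_n].

Definition cnt s (i : 'I_n) : nat := count_mem i s.

Lemma cnt_sq a : cnt (sq a) = a.
Proof.
apply/funext => j; rewrite /cnt /sq count_flatten -map_comp sumnE big_map big_enum/=.
rewrite (bigD1 j)//= count_nseq/= eqxx mul1n big1 ?addn0// => i /negPf ij.
by rewrite count_nseq/= ij.
Qed.

Lemma perm_sq s : perm_eq (sq (cnt s)) s.
Proof. by apply/allP => j _ /=; rewrite -/(cnt (sq (cnt s)) j) cnt_sq. Qed.

Lemma size_sq a : size (sq a) = mi_order a.
Proof.
rewrite /sq /mi_order size_flatten /shape -map_comp sumnE big_map big_enum/=.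
by apply: eq_bigr => i _; rewrite size_nseq.
Qed.

Lemma mi_order_cnt s : mi_order (cnt s) = size s.
Proof. by rewrite -size_sq; exact: perm_size (perm_sq s). Qed.

Lemma multi_index_cnt m s : (size s <= m)%N -> exists a : multi_index n m, multi_index_fun a = cnt
  s.
Proof.
move=> sm; have ci i : (cnt s i < m.+1)%N by rewrite ltnS (leq_trans (count_size _ _)).
pose f : {ffun 'I_n -> 'I_m.+1} := [ffun i => Ordinal (ci i)].
have fs : (\sum_i f i <= m)%N.
  rewrite (eq_bigr (cnt s)) => [|i _]; last by rewrite ffunE.
  by have := mi_order_cnt s; rewrite /mi_order => ->.
by exists (exist _ f fs); apply/funext => i; rewrite /multi_index_fun /= ffunE.
Qed.

Lemma mi_order_le m (a : multi_index n m) : (mi_order a <= m)%N.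
Proof. by case: a. Qed.

End multi_index_lists.

Section complex_derivatives.
Context {R : realType} {n : nat}.
Local Notation X := 'rV[R]_n.
Local Notation leb := (@lebesgue_rV R n).
Implicit Types (w v : X -> R[i]) (s : seq 'I_n) (Omega : set X).

Definition part (b : bool) (z : R[i]) : R := if b then complex.Im z else complex.Re z.

Definition partf b w : X -> R := fun x => part b (w x).

Lemma cmderive_part (a : 'I_n -> nat) w b : partf b (cmderive a w) = pderive (sq a) (partf b w).
Proof. by apply/funext => x; case: b. Qed.

Lemma loc_integrable_part Omega w : loc_integrable Omega w <-> forall b, linted Omega (partf b w).
Proof.
split=> [h b K cK KO|h K cK KO]; first by have [h1 h2] := h K cK KO; case: b.
by split; [exact: (h false K cK KO)|exact: (h true K cK KO)].
Qed.

Lemma part_cintegral b (D : set X) w : part b (cintegral D w) = \int[leb]_(x in D) part b (w x).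
Proof. by case: b. Qed.

Lemma part_realM b (z : R[i]) (r : R) : part b (z * r%:C%C) = part b z * r.
Proof. by case: z => x y; case: b; rewrite /= ?mulr0 ?subr0 ?add0r// addrC. Qed.

Lemma part_signM b k (z : R[i]) : part b ((-1) ^+ k * z) = (-1) ^+ k * part b z.
Proof.
have -> : (-1) ^+ k = ((-1) ^+ k)%:C%C :> R[i] by rewrite rmorphXn rmorphN1.
by rewrite mulrC part_realM mulrC.
Qed.

Lemma part_inj (z z' : R[i]) : (forall b, part b z = part b z') -> z = z'.
Proof. by case: z z' => x y [x' y'] h; have /= -> := h true; have /= -> := h false. Qed.

(** Test functions are real, so the complex identity is the pair formed by its real and imaginary
    parts. *)
Lemma is_wderive_part Omega a w v :
  is_wderive Omega a w v <-> forall b, wds Omega (sq a) (partf b w) (partf b v).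
Proof.
split=> [[/loc_integrable_part lw /loc_integrable_part lv h] b|h].
  split=> // f tf; have /(congr1 (part b)) := h f tf.
  rewrite part_signM !part_cintegral size_sq => {}h; apply: etrans (etrans h _).
    by apply: eq_Rintegral => x _; rewrite part_realM.
  by congr (_ * _); apply: eq_Rintegral => x _; rewrite part_realM.
split.
- by apply/loc_integrable_part => b; have [] := h b.
- by apply/loc_integrable_part => b; have [] := h b.
move=> f tf; apply: part_inj => b; have [_ _ {}h] := h b.
rewrite part_signM !part_cintegral -size_sq; apply: etrans (etrans (h f tf) _).
  by apply: eq_Rintegral => x _; rewrite part_realM.
by congr (_ * _); apply: eq_Rintegral => x _; rewrite part_realM.
Qed.

Lemma wds_perm Omega s t (u v : X -> R) : perm_eq s t -> wds Omega s u v -> wds Omega t u v.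
Proof.
move=> st [lu lv h]; split => // f tf; rewrite -(perm_size st) -h//.
apply: eq_Rintegral => x _; congr (_ * _).
by rewrite (pderive_perm _ st)//; case: tf.
Qed.

Lemma exh_setT c : exh [set: X] c (fun k => k%:R).
Proof.
split => [k|//|x _]; first by rewrite ltr_nat.
by exists (Num.bound `|x - c|); apply/ltW/archi_boundP.
Qed.

Lemma cubeP (c : X) (l : R) x : 0 < l -> cube c l x <-> `|x - c| < l / 2.
Proof.
move=> l0; split => [h|h i].
  by apply: rV_norm_lt; [rewrite divr_gt0|move=> i; have := h i; rewrite !mxE].
by apply: le_lt_trans h; have := rV_norm_coord (x - c) i; rewrite !mxE.
Qed.

Lemma exh_cube (c : X) (l : R) : 0 < l ->
  exh (cube c l) c (fun k => l / 2 * (1 - k.+2%:R^-1)).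
Proof.
move=> l0; have l2 : 0 < l / 2 by rewrite divr_gt0.
split => [k|k x|x /cubeP-/(_ l0) xl].
- by rewrite ltr_pM2l// ltrD2l ltrN2 ltf_pV2 ?posrE// ltr_nat.
- rewrite /cl /= => xk; apply/cubeP => //; apply: le_lt_trans xk _.
  by rewrite gtr_pMr// gtrDl oppr_lt0 invr_gt0.
pose e := 1 - `|x - c| / (l / 2).
have e0 : 0 < e by rewrite subr_gt0 ltr_pdivrMr// mul1r.
exists (Num.bound e^-1); rewrite /cl /= mulrC -ler_pdivrMr// lerBrDr -lerBrDl -/e.
rewrite -[leRHS]invrK lef_pV2 ?posrE ?invr_gt0//.
apply: ltW; apply: (lt_le_trans (archi_boundP _)); first by rewrite invr_ge0 ltW.
by rewrite ler_nat; lia.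
Qed.

Lemma open_cube (c : X) (l : R) : 0 < l -> measurable (cube c l).
Proof.
move=> l0; apply: open_measurable_rV; rewrite openE => x /cubeP-/(_ l0) xl.
by apply: filterS (near_cl_in xl) => y; move=> /cubeP; exact.
Qed.

Lemma exh_cover Omega c q : exh Omega c q -> Omega = \bigcup_k cl c (q k).
Proof.
move=> [_ qO Oq]; apply/seteqP; split => [x /Oq[k xk]|x [k _ xk]]; first by exists k.
exact: qO xk.
Qed.

Lemma exh_measurable Omega c q : exh Omega c q -> measurable Omega.
Proof.
move=> /exh_cover ->; apply: bigcup_measurable => k _; exact: measurable_cl.
Qed.

Lemma linted_measurable Omega c q (v : X -> R) : exh Omega c q -> linted Omega v ->
  measurable_fun Omega v.
Proof.
move=> ex lv; rewrite {1}(exh_cover ex); apply/measurable_fun_bigcup => k.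
  exact: measurable_cl.
have [_ qO _] := ex; apply/measurable_EFinP.
by have /integrableP[] := lv _ (@compact_cl R n c (q k)) (qO k).
Qed.

Lemma wderiveP Omega a w : (exists v, is_wderive Omega a w v) ->
  is_wderive Omega a w (wderive Omega a w).
Proof. by move=> h; exact: (@xgetPex _ _ [set v | is_wderive Omega a w v]). Qed.

(** [wderive] is a representative picked by choice; this identifies it whenever some weak derivative
    is known explicitly. *)
Lemma wderive_ae Omega c q a w v : exh Omega c q -> is_wderive Omega a w v ->
  {ae leb, forall x, Omega x -> wderive Omega a w x = v x}.
Proof.
move=> ex wv; have /is_wderive_part w1 := wderiveP (ex_intro _ v wv).
move: wv => /is_wderive_part w2.
have h b := wds_unique ex (w1 b) (w2 b).
apply: filterS2 (h false) (h true) => x h0 h1 Ox; apply: part_inj => -[].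
  exact: h1. exact: h0.
Qed.

Lemma test_fun_tf Omega f : test_fun Omega f -> tf f /\ forall s x, ~ Omega x -> pderive s f x = 0.
Proof.
move=> [sf cf sO]; split.
  split => //; have /compact_bounded[M [_ hM]] := cf.
  exists (M + 1) => x xM; apply/eqP/negP => /negP fx.
  have : supp f x by apply: subset_closure.
  by move=> /(hM (M + 1) (ltr_pwDr ltr01 (lexx _))) /=; rewrite leNgt xM.
move=> s x Ox; have nx : (~` supp f) x by move=> /sO.
have : open (~` supp f) by apply: closed_openC; exact: closed_closure.
rewrite openE => /(_ _ nx) nf; rewrite (near_pderiveE (g := fun=> 0)); first by rewrite
  pderive_cst0.
apply: filterS nf => y ny; apply/eqP/negP => /negP fy; apply: ny; exact: subset_closure.
Qed.

Lemma Rintegral_out Omega (g : X -> R) : (forall x, ~ Omega x -> g x = 0) ->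
  \int[leb]_(x in Omega) g x = \int[leb]_x g x.
Proof.
move=> g0; rewrite Rintegral_mkcond; apply: eq_Rintegral => x _.
rewrite patchE; case: (boolP (x \in Omega)) => // xO.
by rewrite g0// => xi; rewrite mem_set in xO.
Qed.

Lemma wds_tf Omega s (f : X -> R) : tf f -> wds Omega s f (pderive s f).
Proof.
move=> tff; have [sf _] := tff.
have lt (g : X -> R) : tf g -> linted Omega g.
  move=> tg K cK KO; apply: integrableS (cb_integrable (tf_cb tg)) => //.
  exact: compact_measurable_rV.
split; [exact: lt|exact/lt/tf_pderive|move=> g tg].
have [tfg g0] := test_fun_tf tg.
rewrite [LHS]Rintegral_out; last by move=> x Ox; rewrite (g0 s)// mulr0.
rewrite [X in _ = _ * X]Rintegral_out; last by move=> x Ox; rewrite [g x](g0 [::])// mulr0.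
have := itg_pderive (rev s) sf tfg; rewrite revK size_rev !itgE => h.
(* Integration by parts reverses the sequence of directions; symmetry of derivatives restores its
   order. *)
rewrite (pderive_perm sf (s := s) (t := rev s)); last by rewrite perm_sym perm_rev.
by rewrite h mulrA -exprD addnn -muln2 exprM sqrr_sign mul1r.
Qed.

Lemma is_wderive_tf Omega a w : (forall b, tf (partf b w)) -> is_wderive Omega a w (cmderive a w).
Proof. by move=> tw; apply/is_wderive_part => b; rewrite cmderive_part; exact: wds_tf. Qed.

End complex_derivatives.

Section cbd_extra.
Context {R : realType} {n : nat}.
Local Notation X := 'rV[R]_n.
Local Notation leb := (@lebesgue_rV R n).

Lemma cbd_mono k1 k2 (a a' : X -> R) (M : R) : measurable_fun setT a -> measurable_fun setT a' ->
  (forall x, 0 <= a x <= a' x) -> cbd k1 k2 a' M -> cbd k1 k2 a M.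
Proof.
move=> ma ma' aa ca f g tff tg; apply: le_trans (ca f g tff tg).
have mf := measurable_cb (tf_cb tff); have mg := measurable_cb (tf_cb tg).
have mfg : measurable_fun setT (fun x => `|f x| * `|g x|).
  by apply: measurable_funM; exact: measurableT_comp.
have a0 x : 0 <= a x by have /andP[] := aa x.
have a'0 x : 0 <= a' x by have /andP[h1 h2] := aa x; exact: le_trans h2.
apply: ge0_le_integral => //.
- by move=> x _; rewrite lee_fin mulr_ge0// mulr_ge0.
- by apply/measurable_EFinP; exact: measurable_funM.
- by apply/measurable_EFinP; exact: measurable_funM.
by move=> x _; rewrite lee_fin ler_wpM2r ?mulr_ge0//; have /andP[] := aa x.
Qed.

Lemma cbd_ae0 k1 k2 (a : X -> R) (M : R) : measurable_fun setT a -> (forall x, 0 <= a x) -> 0 <= M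
  ->
  {ae leb, forall x, a x = 0} -> cbd k1 k2 a M.
Proof.
move=> ma a0 M0 aeq f g tff tg.
have mf := measurable_cb (tf_cb tff); have mg := measurable_cb (tf_cb tg).
have mfg : measurable_fun setT (fun x => `|f x| * `|g x|).
  by apply: measurable_funM; exact: measurableT_comp.
apply: (@le_trans _ _ (\int[leb]_x 0)%E); last first.
  by rewrite integral0 lee_fin mulr_ge0// mulr_ge0 ?sqrtr_ge0.
apply: ae_ge0_le_integral => //.
- by move=> x _; rewrite lee_fin mulr_ge0// mulr_ge0.
- by apply/measurable_EFinP; exact: measurable_funM.
- by apply: filterS aeq => x -> _; rewrite mul0r.
Qed.

Lemma Rintegral_sumr (I : Type) (s : seq I) (F : I -> X -> R) :
  (forall i, leb.-integrable setT (EFin \o F i)) ->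
  leb.-integrable setT (EFin \o (fun x => \sum_(i <- s) F i x)) /\
  \int[leb]_x (\sum_(i <- s) F i x) = \sum_(i <- s) \int[leb]_x F i x.
Proof.
move=> iF; elim: s => [|i s [ih1 ih2]].
  split; first by under eq_fun do rewrite /= big_nil; exact: integrable0.
  rewrite big_nil -[RHS](@itg0 R n) itgE; apply: eq_Rintegral => x _; exact: big_nil.
have e : (fun x => \sum_(j <- i :: s) F j x) = (fun x => F i x + \sum_(j <- s) F j x).
  by apply/funext => x; rewrite big_cons.
split; last by rewrite e big_cons -ih2 RintegralD.
rewrite e (_ : EFin \o _ = (EFin \o F i) \+ (EFin \o (fun x => \sum_(j <- s) F j x)%R))%E//.
exact: integrableD.
Qed.

End cbd_extra.

Section complex_parts.
Context {R : realType}.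

Lemma normcE (z : R[i]) : Normc.normc z = Num.sqrt (complex.Re z ^+ 2 + complex.Im z ^+ 2).
Proof. by case: z. Qed.

Lemma sqr_normcE (z : R[i]) : Normc.normc z ^+ 2 = \sum_(b : bool) part b z ^+ 2.
Proof. by rewrite normcE sqr_sqrtr ?addr_ge0 ?sqr_ge0// big_bool/= addrC. Qed.

Lemma part_le_normc b (z : R[i]) : `|part b z| <= Normc.normc z.
Proof.
rewrite -sqrtr_sqr normcE ler_wsqrtr//; case: b => /=.
  by rewrite lerDr sqr_ge0.
by rewrite lerDl sqr_ge0.
Qed.

Lemma normc_ge0 (z : R[i]) : 0 <= Normc.normc z.
Proof. by rewrite normcE sqrtr_ge0. Qed.

Lemma partD b (z z' : R[i]) : part b (z + z') = part b z + part b z'.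
Proof. by case: z z' => x y [x' y']; case: b. Qed.

Lemma part_sum b (I : Type) (s : seq I) (P : pred I) (F : I -> R[i]) :
  part b (\sum_(i <- s | P i) F i) = \sum_(i <- s | P i) part b (F i).
Proof. by apply: big_morph; [exact: partD|case: b]. Qed.

(* Matrix entry [(p, q)] of the real 2 x 2 block of multiplication by [z]. *)
Definition block (p q : bool) (z : R[i]) : R :=
  if p == q then complex.Re z else if q then - complex.Im z else complex.Im z.

Lemma block_le p q (z : R[i]) : `|block p q z| <= Normc.normc z.
Proof.
rewrite /block; case: p q => -[]/=; rewrite ?normrN.
- exact: (part_le_normc false).
- exact: (part_le_normc true).
- exact: (part_le_normc true).
- exact: (part_le_normc false).
Qed.

Lemma Re_block (z a w : R[i]) :
  complex.Re (conjc z * a * w) = \sum_(e : bool * bool) part e.1 z * block e.1 e.2 a * part e.2 w.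
Proof.
rewrite -(pair_bigA _ (fun p q => part p z * block p q a * part q w)) !big_bool /block/=.
by case: z a w => z0 z1 [a0 a1] [w0 w1] /=; ring.
Qed.

Lemma Re_conjM (z w : R[i]) : complex.Re (z * conjc w) = complex.Re (conjc z * w).
Proof. by case: z w => z0 z1 [w0 w1] /=; ring. Qed.

End complex_parts.

(** * The form, its coefficients and (WG) in real terms *)

Section terms.
Context {R : realType} {d m N : nat}.
Local Notation X := 'rV[R]_d.
Local Notation leb := (@lebesgue_rV R d).
Local Notation MI := (multi_index d m).

(** The last component selects an entry of the real 2 x 2 block, so the real part of the complex
    form becomes a [bform] over families indexed by component and by real or imaginary part. *)
Definition term : Type := 'I_N * 'I_N * MI * MI * (bool * bool).

Definition tci (t : term) : 'I_N * bool := (t.1.1.1.1, t.2.1).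
Definition tcj (t : term) : 'I_N * bool := (t.1.1.1.2, t.2.2).
Definition tsa (t : term) : seq 'I_d := sq t.1.1.2.
Definition tsb (t : term) : seq 'I_d := sq t.1.2.

Variable A : coefficients R d m N.

Definition tco (t : term) (x : X) : R :=
  block t.2.1 t.2.2 (A t.1.1.1.1 t.1.1.1.2 t.1.1.2 t.1.2 x).

Lemma measurable_normc_coef j k a b : measurable_coefficients A ->
  measurable_fun setT (fun x => Normc.normc (A j k a b x)).
Proof.
move=> mA; have [m1 m2] := mA j k a b; under eq_fun do rewrite normcE.
apply: (measurableT_comp (continuous_measurable_fun (@sqrt_continuous R))) => //.
by apply: measurable_funD; apply: measurable_funX.
Qed.

Lemma measurable_tco t : measurable_coefficients A -> measurable_fun setT (tco t).
Proof.
move=> mA; have [m1 m2] := mA t.1.1.1.1 t.1.1.1.2 t.1.1.2 t.1.2; rewrite /tco /block.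
case: (_ == _) => //; case: t.2.2 => //; exact: measurableT_comp.
Qed.

Lemma tsa_le t : (size (tsa t) <= m)%N.
Proof. by rewrite size_sq mi_order_le. Qed.

Lemma tsb_le t : (size (tsb t) <= m)%N.
Proof. by rewrite size_sq mi_order_le. Qed.

Lemma sum_term (V : nmodType) (F : term -> V) :
  \sum_t F t = \sum_j \sum_k \sum_a \sum_b \sum_e F (j, k, a, b, e).
Proof. by rewrite !pair_bigA; apply: eq_bigr => -[[[[j k] a] b] e]. Qed.

End terms.

Section coefficient_bounds.
Context {R : realType}.

Lemma cbd_lebesgue_unif n m : exists2 C : R, 0 <= C & forall k1 k2, (k1 <= m)%N -> (k2 <= m)%N ->
  (2 * k1 < n)%N -> (2 * k2 < n)%N -> forall (a : 'rV[R]_n -> R) M, measurable_fun setT a ->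
  (forall x, 0 <= a x) -> 0 <= M ->
  ('N[lebesgue_rV n]_(if (k1 + k2 == 0)%N then +oo else (n%:R / (k1 + k2)%:R)%:E)[EFin \o a] <=
    M%:E)%E ->
  cbd k1 k2 a (C * M).
Proof.
have h (z : 'I_m.+1 * 'I_m.+1) : exists C : R, 0 <= C /\
    ((2 * z.1 < n)%N -> (2 * z.2 < n)%N -> forall (a : 'rV[R]_n -> R) M, measurable_fun setT a ->
  (forall x, 0 <= a x) -> 0 <= M ->
  ('N[lebesgue_rV n]_(if (z.1 + z.2 == 0)%N then +oo else (n%:R / (z.1 + z.2)%:R)%:E)[EFin \o a] <=
    M%:E)%E ->
  cbd z.1 z.2 a (C * M)).
  case: (boolP (2 * z.1 < n)%N) => z1; last by exists 0; split => // h; rewrite h in z1.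
  case: (boolP (2 * z.2 < n)%N) => z2; last by exists 0; split => // _ h; rewrite h in z2.
  by have [C C0 hC] := cbd_lebesgue (R := R) z1 z2; exists C; split.
have {h}[C hC] := choice h; exists (\sum_z C z).
  by apply: sumr_ge0 => z _; case: (hC z).
move=> k1 k2 k1m k2m n1 n2 a M ma a0 M0 aM; pose z : 'I_m.+1 * 'I_m.+1 := (inord k1, inord k2).
have z1 : z.1 = k1 :> nat by rewrite inordK.
have z2 : z.2 = k2 :> nat by rewrite inordK.
have [C0] := hC z; rewrite z1 z2 => H; apply: cbd_le (H n1 n2 a M ma a0 M0 aM).
by rewrite ler_wpM2r// (bigD1 z)//= lerDl sumr_ge0// => y _; case: (hC y).
Qed.

Lemma double_sub_lt (m p q : nat) : (p <= m)%N -> (2 * m < 2 * p + q)%N -> (2 * (m - p) < q)%N.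
Proof. lia. Qed.

(** [above_half a] says that 2 (m - |a|) is less than the dimension, the exact range of the Sobolev
    inequality. Dimension d + 1 makes slices R^d available for the second bound, and the absolute
    value supplies a nonnegative constant whatever the sign of Lambda. *)
Lemma coefs_bound d m N : exists2 C : R, 0 <= C & forall (A : coefficients R d.+1 m N) (Lambda : R),
  measurable_coefficients A -> bound1 A Lambda \/ bound2 A Lambda ->
  coefs m tsa tsb (tco A) (C * `|Lambda|).
Proof.
have [C1 C10 h1] := cbd_lebesgue_unif d.+1 m; have [C2 C20 h2] := cbd_lebesgue_unif d m.
exists (C1 + C2); first exact: addr_ge0.
move=> A Lambda mA bA t; split; [exact: measurable_tco|exact: tsa_le|exact: tsb_le|].
set j := t.1.1.1.1 in bA *; set k := t.1.1.1.2.
set a : multi_index d.+1 m := t.1.1.2; set b : multi_index d.+1 m := t.1.2.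
pose f x := Normc.normc (A j k a b x).
have mf : measurable_fun setT f by exact: measurable_normc_coef.
have f0 x : 0 <= f x by exact: normc_ge0.
have ma := mi_order_le a; have mb := mi_order_le b.
have L0 : 0 <= `|Lambda| by [].
have kE : (m - mi_order a + (m - mi_order b) = 2 * m - mi_order a - mi_order b)%N by lia.
have ae0 : {ae lebesgue_rV d.+1, forall x, A j k a b x = 0} ->
    cbd (m - mi_order a) (m - mi_order b) f ((C1 + C2) * `|Lambda|).
  move=> A0; apply: cbd_ae0 => //; first by rewrite mulr_ge0// addr_ge0.
  by apply: filterS A0 => x Ax; rewrite /f Ax normcE/= expr0n/= addr0 sqrtr0.
rewrite /tsa /tsb !size_sq -/a -/b.
apply: (@cbd_mono _ _ _ _ _ f) => //.
- by apply: measurableT_comp => //; exact: measurable_tco.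
- by move=> x; rewrite normr_ge0/=; exact: block_le.
case: bA => bA; have [b1 b2] := bA j k a b.
  case: (boolP (above_half a && above_half b)) => [ab|/b2]; last exact: ae0.
  have /andP[] := ab; rewrite /above_half => aa bb.
  have := b1 ab; rewrite /coef_exp -kE => fL.
  apply: (@cbd_le _ _ _ _ _ (C1 * `|Lambda|)); first by rewrite ler_wpM2r// lerDl.
  apply: h1 => //; do ?[exact: leq_subr | exact: double_sub_lt].
  by apply: le_trans fL _; rewrite lee_fin ler_norm.
case: (boolP (above_half_pred a && above_half_pred b)) => [ab|/b2]; last exact: ae0.
have /andP[] := ab; rewrite /above_half_pred/= => aa bb.
have /ess_supP := b1 ab; rewrite /coef_exp -kE/= => fL.
apply: (@cbd_le _ _ _ _ _ (C2 * `|Lambda|)); first by rewrite ler_wpM2r// lerDr.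
apply: cbd_slice => //; first exact: mulr_ge0.
apply: filterS fL => s fL; apply: h2 => //; do ?[exact: leq_subr | exact: double_sub_lt].
  by apply: (measurableT_comp mf); exact: (measurableT_comp (@measurable_snoc R d)
    (measurable_pair2 s)).
by apply: le_trans fL _; rewrite lee_fin ler_norm.
Qed.

End coefficient_bounds.

Section garding.
Context {R : realType} {d m N : nat}.
Local Notation X := 'rV[R]_d.
Local Notation leb := (@lebesgue_rV R d).
Local Notation MI := (multi_index d m).
Local Notation V := 'rV[R[i]]_N.
Implicit Types (f : 'I_N * bool -> X -> R).

Definition cfun f (x : X) : V := \row_j Complex (f (j, false) x) (f (j, true) x).

Lemma partf_cfun f j b : partf b (coordf (cfun f) j) = f (j, b).
Proof. by apply/funext => x; rewrite /partf /coordf mxE; case: b. Qed.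

Lemma sum_comp (W : nmodType) (F : 'I_N * bool -> W) : \sum_c F c = \sum_j \sum_(b : bool) F (j, b).
Proof. by rewrite pair_bigA; apply: eq_bigr => -[]. Qed.

Lemma sqnorm_part (z : V) : sqnorm z = \sum_(c : 'I_N * bool) part c.2 (z ord0 c.1) ^+ 2.
Proof.
rewrite sum_comp /sqnorm.
by apply: eq_bigr => j _; rewrite sqr_normcE.
Qed.

Lemma tf_family_bound (I : finType) (f : I -> X -> R) : (forall i, tf (f i)) ->
  exists r : R, forall i x, r < `|x| -> f i x = 0.
Proof.
move=> tff; have h i : exists r, forall x, r < `|x| -> f i x = 0 by case: (tff i).
have {h}[r hr] := choice h; exists (\sum_i `|r i|) => i x xr; apply: hr.
apply: le_lt_trans xr; rewrite (bigD1 i)//= (le_trans (ler_norm _))// lerDl.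
exact: sumr_ge0.
Qed.

Lemma cfun_compact f : (forall c, tf (f c)) -> compact (supp (cfun f)).
Proof.
move=> tff; have [r hr] := tf_family_bound tff.
apply: (@subclosed_compact _ _ (cl 0 r)); [exact: closed_closure|exact: compact_cl|].
have /closure_id -> := @closed_cl R d 0 r; apply: closureS => x /= fx.
rewrite /cl /= subr0 leNgt; apply/negP => xr; move/eqP: fx; apply.
by apply/rowP => j; rewrite !mxE !hr.
Qed.

(** Each of the d^m sequences of length m is a permutation of the sequence of a multi-index, hence
    has one of the energies on the right. *)
Lemma En_mi f : (forall c, tf (f c)) ->
  En m f <= d%:R ^+ m * \sum_(a : MI | mi_order a == m) \sum_c en 0 (pderive (sq a) (f c)).
Proof.
move=> tff; rewrite exchange_big/= mulr_sumr; apply: ler_sum => c _.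
have [sf _] := tff c; apply: en_full => // s sm.
have [a as_] : exists a : MI, multi_index_fun a = cnt s by apply: multi_index_cnt; rewrite sm.
have am : mi_order a == m by rewrite as_ mi_order_cnt sm.
have -> : pderive s (f c) = pderive (sq a) (f c).
  by apply: pderive_perm => //; rewrite perm_sym as_; exact: perm_sq.
rewrite (bigD1 a)//= lerDl; apply: sumr_ge0 => i _; exact: (en_ge0 0).
Qed.

(** [weak_Garding] counts each multi-index once and [En] with multiplicity, whence the loss of d^m
    in the constant. *)
Lemma garding_real (A : coefficients R d m N) (lambda delta L : R) : (0 < d)%N -> 0 < lambda ->
  coefs m tsa tsb (tco A) L -> weak_Garding A lambda delta ->
  garding m tci tcj tsa tsb (tco A) (lambda / d%:R ^+ m) delta.
Proof.
move=> d0 lam0 cA wG f tff.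
have tD s c : tf (pderive s (f c)) by exact: tf_pderive.
have cD s c : cb (fun x => pderive s (f c) x ^+ 2) by apply: cb_sqr_tf.
have sm j : smooth (@complex.Re R \o coordf (cfun f) j) /\ smooth (@complex.Im R \o coordf (cfun f)
  j).
  have := partf_cfun f j false; have := partf_cfun f j true; rewrite /partf => e1 e0.
  split; first by rewrite (_ : _ \o _ = f (j, false))//; case: (tff (j, false)).
  by rewrite (_ : _ \o _ = f (j, true))//; case: (tff (j, true)).
have := wG (cfun f) sm (cfun_compact tff).
have dE a j b x : part b (cmderive a (coordf (cfun f) j) x) = pderive (sq a) (f (j, b)) x.
  by rewrite -/(partf b _ x) cmderive_part partf_cfun.
have -> : \int[leb]_x (\sum_(a : MI | mi_order a == m)
    \sum_j Normc.normc (cmderive a (coordf (cfun f) j) x) ^+ 2) =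
  \sum_(a : MI | mi_order a == m) \sum_c en 0 (pderive (sq a) (f c)).
  transitivity (itg (fun x => \sum_(a : MI | mi_order a == m) \sum_c pderive (sq a) (f c) x ^+ 2)).
    rewrite itgE; apply: eq_Rintegral => x _; apply: eq_bigr => a _.
    rewrite [RHS]sum_comp.
    by apply: eq_bigr => j _; rewrite sqr_normcE; apply: eq_bigr => b _; rewrite dE.
  rewrite itg_sum => [|a _]; last by apply: cb_sum => c _; exact: cD.
  by apply: eq_bigr => a _; rewrite itg_sum.
have -> : \int[leb]_x sqnorm (cfun f x) = En 0 f.
  transitivity (itg (fun x => \sum_c f c x ^+ 2)).
    rewrite itgE; apply: eq_Rintegral => x _; rewrite sqnorm_part; apply: eq_bigr => -[j b] _.
    by rewrite -(partf_cfun f j b).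
  by rewrite itg_sum// => c _; exact: (cD [::]).
have -> : complex.Re (\sum_j \sum_k \sum_(a : MI) \sum_(b : MI)
    cintegral setT (fun x => conjc (cmderive a (coordf (cfun f) j) x) *
       A j k a b x * cmderive b (coordf (cfun f) k) x)) = bform tci tcj tsa tsb (tco A) f f.
  rewrite /bform [RHS]sum_term.
  rewrite -/(part false _) part_sum; apply: eq_bigr => j _.
  rewrite part_sum; apply: eq_bigr => k _; rewrite part_sum; apply: eq_bigr => a _.
  rewrite part_sum; apply: eq_bigr => b _.
  pose F (e : bool * bool) x := pderive (sq (a : MI)) (f (j, e.1)) x * block e.1 e.2 (A j k a b x) *
    pderive (sq (b : MI)) (f (k, e.2)) x.
  have iF e : leb.-integrable setT (EFin \o F e).
    have [ma _ _ ca] := cA (j, k, a, b, e).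
    exact: (tri_integrable ma ca (tD (sq (a : MI)) (j, e.1)) (tD (sq (b : MI)) (k, e.2))).
  have [_ <-] := Rintegral_sumr (index_enum _) iF.
  rewrite part_cintegral; apply: eq_Rintegral => x _.
  by apply: etrans (Re_block _ _ _) _; apply: eq_bigr => e _; rewrite !dE.
set Z := \sum_(a | _) _ => H.
have EZ : lambda / d%:R ^+ m * En m f <= lambda * Z.
  rewrite -mulrA ler_wpM2l ?(ltW lam0)// mulrC ler_pdivrMr ?exprn_gt0 ?ltr0n// mulrC.
  exact: En_mi.
by lra.
Qed.

End garding.

Lemma powR_sum_le (R : realType) (I : finType) (x : I -> R) (p : R) : 0 < p ->
  (forall i, 0 <= x i) -> (\sum_i x i) `^ p <= #|I|%:R `^ p * \sum_i x i `^ p.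
Proof.
move=> p0 x0; case: (pickP (fun _ : I => true)) => [i0 _|I0]; last first.
  rewrite !big_pred0// mulr0 powR0 ?gt_eqF//.
have [i hi] : exists i, forall j, x j <= x i.
  by exists [arg max_(i > i0) x i]%O; case: arg_maxP => // i _ hi j; exact: hi.
apply: (@le_trans _ _ ((#|I|%:R * x i) `^ p)).
  rewrite ge0_ler_powR ?nnegrE ?(ltW p0)// ?sumr_ge0 ?mulr_ge0//.
  by rewrite mulr_natl -sumr_const; apply: ler_sum.
rewrite powRM// ler_wpM2l ?powR_ge0// (bigD1 i)//= lerDl.
by apply: sumr_ge0 => j _; exact: powR_ge0.
Qed.

(** * The norms of Y and of its dual on test functions *)

Section sobolev_norm.
Context {R : realType}.

(** Dimensions 1 and 2 only admit j = 0, for which both sides are the L^2 norm. *)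
Lemma lpn_en n j : (2 * j < n)%N -> exists2 C : R, 0 <= C & forall f : 'rV[R]_n -> R, tf f ->
  lpn (2 * n%:R / (n%:R - 2 * j%:R)) f <= C * Num.sqrt (en j f).
Proof.
case: n => // -[|[|k]] jn; last exact: (sobolev (R := R) jn).
all: have -> : j = 0%N by lia.
all: exists 1 => // f tff; rewrite mul1r mulr0 subr0 mulfK// /lpn powR12_sqrt;
  last by apply: itg_ge0 => x; exact: powR_ge0.
all: rewrite le_eqVlt; apply/orP; left; apply/eqP; congr (Num.sqrt (itg _)).
all: by apply/funext => x; rewrite powR_mulrn// real_normK// num_real.
Qed.

Context {d m N : nat}.
Local Notation X := 'rV[R]_d.
Local Notation leb := (@lebesgue_rV R d).
Local Notation MI := (multi_index d m).
Local Notation V := 'rV[R[i]]_N.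
Local Notation I := ('I_N * bool)%type.
Implicit Types (f : 'I_N * bool -> X -> R) (u : X -> V).

Lemma YexpE (a : MI) : (0 < d)%N -> above_half a ->
  (Yexp a : R) = 2 * d%:R / (d%:R - 2 * (m - mi_order a)%:R) /\ 1 <= (Yexp a : R).
Proof.
rewrite /above_half => d0 aa; have am := mi_order_le a.
have d0' : 0 < d%:R :> R by rewrite ltr0n.
have dj : 0 < d%:R - 2 * (m - mi_order a)%:R :> R.
  by rewrite subr_gt0 -natrM ltr_nat; lia.
have E : (Yexp a : R) = 2 * d%:R / (d%:R - 2 * (m - mi_order a)%:R).
  by rewrite /Yexp natrB//; move: dj; rewrite natrB// => dj; field; rewrite !gt_eqF//=; lra.
split => //; rewrite E ler_pdivlMr// mul1r.
have := ler0n R (m - mi_order a); move: dj d0'; lra.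
Qed.

Lemma sqnorm_le (z : V) : Num.sqrt (sqnorm z) <= \sum_(c : I) `|part c.2 (z ord0 c.1)|.
Proof.
have s0 : 0 <= \sum_(c : I) `|part c.2 (z ord0 c.1)| by exact: sumr_ge0.
rewrite -[leRHS]ger0_norm// -sqrtr_sqr ler_wsqrtr// sqnorm_part expr2 mulr_sumr.
apply: ler_sum => c _; rewrite -real_normK ?num_real// expr2 ler_wpM2r//.
by rewrite (bigD1 c)//= lerDl sumr_ge0.
Qed.

Lemma measurable_sqnorm (D : set X) (v : X -> V) :
  (forall j b, measurable_fun D (partf b (coordf v j))) ->
  measurable_fun D (fun x => sqnorm (v x)).
Proof.
move=> mv; under eq_fun do rewrite sqnorm_part.
by apply: measurable_sum => c; apply: measurable_funX; exact: (mv c.1 c.2).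
Qed.

(** Sobolev on the whole space bounds each term of the Y norm by the energy of order m. This is how
    a bound on T in the dual of Y becomes the constant K of the real estimates. *)
Lemma Ynorm_tf : (0 < d)%N -> exists2 C : R, 0 <= C & forall Omega c q f, exh Omega c q ->
  (forall i, tf (f i)) -> (Ynorm Omega m (cfun f) <= (C * Num.sqrt (En m f))%:E)%E.
Proof.
move=> d0; pose k : R := #|{: I}|%:R.
have h (a : MI) : exists C : R, 0 <= C /\ (above_half a -> forall g : X -> R, tf g ->
    lpn ((Yexp a : R)) g <= C * Num.sqrt (en (m - mi_order a) g)).
  case: (boolP (above_half a)) => [aa|]; last by exists 0.
  have jn : (2 * (m - mi_order a) < d)%N by move: aa (mi_order_le a); rewrite /above_half; lia.
  have [C C0 hC] := @lpn_en d _ jn; exists C; split; first exact: C0.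
  by move=> _ g tg; have [E _] := YexpE d0 aa; rewrite E; exact: hC.
have {h}[Ca hCa] := choice h.
have Ca0 a : 0 <= Ca a by case: (hCa a).
have k0 : 0 <= k by [].
(* k^p comes from [powR_sum_le] and a further k from summing over the components; the latter is at
   most (k + 1)^p because p >= 1. *)
exists (\sum_a k * (k + 1) * Ca a).
  by apply: sumr_ge0 => a _; rewrite mulr_ge0// mulr_ge0// addr_ge0.
move=> Omega c q f ex tff; have mO := exh_measurable ex.
have s0 : 0 <= Num.sqrt (En m f) by exact: sqrtr_ge0.
rewrite /Ynorm mulr_suml -sumEFin big_mkcond; apply: lee_sum => a0 _; pose a : MI := a0.
case: ifP => aa; last by rewrite lee_fin mulr_ge0// mulr_ge0// mulr_ge0// addr_ge0.
have [_ p1] := YexpE d0 aa; have p0 : 0 < (Yexp a : R) by exact: lt_le_trans p1.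
have [_ /(_ aa) hC] := hCa a.
pose p := (Yexp a : R); pose D (i : I) := pderive (sq a) (f i).
have tD i : tf (D i) by exact: tf_pderive.
pose Z := Ca a * Num.sqrt (En m f); have Z0 : 0 <= Z by exact: mulr_ge0.
have DZ i : lpn p (D i) <= Z.
  apply: (le_trans (hC _ (tD i))); rewrite ler_wpM2l// ler_wsqrtr//.
  by have := En_pderive (s := sq a) i tff; rewrite size_sq; apply; exact: mi_order_le.
rewrite -/a -/p unlock.
pose g : X -> \bar R := (fun x => (Num.sqrt (sqnorm (vwderive Omega a (cfun f) x)))%:E) \_ Omega.
rewrite -/g.
have mw j b : measurable_fun Omega (partf b (wderive Omega a (coordf (cfun f) j))).
  apply: (linted_measurable ex); have [_ lv _] : is_wderive Omega a (coordf (cfun f) j)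
      (wderive Omega a (coordf (cfun f) j)).
    apply: wderiveP; exists (cmderive a (coordf (cfun f) j)); apply: is_wderive_tf => b'.
    by rewrite partf_cfun.
  by move/loc_integrable_part : lv; apply.
have mg : measurable_fun setT g.
  apply/(measurable_restrictT _ mO); apply/measurable_EFinP.
  apply: (measurableT_comp (continuous_measurable_fun (@sqrt_continuous R))).
  apply: measurable_sqnorm => j b; have := mw j b; apply: eq_measurable_fun => x _.
  by rewrite /partf /coordf /vwderive mxE.
have mp (h : X -> R) : measurable_fun setT h -> measurable_fun setT (fun x => (h x `^ p)%:E).
  by move=> mh; apply/measurable_EFinP; exact: (measurableT_comp (measurable_powR _)).
have H1 : (\int[leb]_x `|g x| `^ p <= \int[leb]_x ((\sum_i `|D i x|) `^ p)%:E)%E.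
  apply: ae_ge0_le_integral => //.
  - by move=> x _; exact: poweR_ge0.
  - by apply: (measurableT_comp (measurable_poweR p)); exact: measurableT_comp.
  - by move=> x _; rewrite lee_fin powR_ge0.
  - apply: mp; apply: measurable_sum => i; apply: measurableT_comp => //.
    by apply: smooth_measurable; case: (tD i).
  have aew : {ae leb, forall x, forall j, Omega x ->
      wderive Omega a (coordf (cfun f) j) x = cmderive a (coordf (cfun f) j) x}.
    have hj (j : 'I_N) : {ae leb, forall x, Omega x ->
        wderive Omega a (coordf (cfun f) j) x = cmderive a (coordf (cfun f) j) x}.
      by apply: (wderive_ae ex); apply: is_wderive_tf => b'; rewrite partf_cfun.
    by apply: filter_forall => j; exact: hj.
  apply: filterS aew => x hx _; rewrite /g patchE; case: ifPn => [/set_mem Ox|_]; last first.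
    by rewrite -[point]/(0%:E) abse0 poweR_EFin powR0 ?gt_eqF// lee_fin powR_ge0.
  rewrite gee0_abs; last by rewrite lee_fin sqrtr_ge0.
  rewrite poweR_EFin lee_fin.
  apply: ge0_ler_powR; rewrite ?nnegrE ?sqrtr_ge0 ?sumr_ge0 ?(ltW p0)//.
  apply: (le_trans (sqnorm_le _)); apply: ler_sum => -[j b] _ /=.
  rewrite mxE hx// -/(partf b _ x) cmderive_part partf_cfun.
  exact: lexx.
have mDi i : measurable_fun setT (fun x => (`|D i x| `^ p)%:E).
  by apply: (mp (fun x => `|D i x|)); apply: measurableT_comp => //; apply: smooth_measurable;
    case: (tD i).
have H2 : (\int[leb]_x ((\sum_i `|D i x|) `^ p)%:E <= ((k * (k + 1) * Z) `^ p)%:E)%E.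
  apply: (@le_trans _ _ (\int[leb]_x ((k `^ p)%:E * (\sum_i (`|D i x| `^ p)%:E)))%E).
    apply: ge0_le_integral => //.
    - by move=> x _; rewrite lee_fin powR_ge0.
    - apply: mp; apply: measurable_sum => i; apply: measurableT_comp => //.
      by apply: smooth_measurable; case: (tD i).
    - apply: measurable_funeM; apply: emeasurable_sum => i _; exact: mDi.
    move=> x _; rewrite sumEFin -EFinM lee_fin; exact: powR_sum_le.
  rewrite ge0_integralZl//.
  all: try solve [by apply: emeasurable_sum => i _; exact: mDi
    | by move=> x _; apply: sume_ge0 => i _; rewrite lee_fin powR_ge0 | by rewrite lee_fin
      powR_ge0].
  rewrite ge0_integral_sum//.
  apply: (@le_trans _ _ ((k `^ p)%:E * \sum_(i : I) (Z `^ p)%:E)%E).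
    apply: lee_wpmul2l; first by rewrite lee_fin powR_ge0.
    apply: lee_sum => i _; rewrite itg_EFin; last by apply: cb_abspow => //; exact: tf_cb.
    by rewrite -lpn_pow// lee_fin ge0_ler_powR ?nnegrE ?lpn_ge0 ?(ltW p0).
  rewrite sumEFin -EFinM lee_fin sumr_const -mulr_natl -/k.
  have k1 : 0 <= k + 1 by exact: addr_ge0.
  rewrite (@powRM _ (k * (k + 1)) Z) ?mulr_ge0// (@powRM _ k (k + 1))//.
  rewrite -mulrA ler_wpM2l ?powR_ge0// ler_wpM2r ?powR_ge0//.
  apply: (@le_trans _ _ (k + 1)); first by rewrite lerDl.
  by rewrite -[leLHS]powRr1// ler_powR// lerDr.
have W0 : 0 <= k * (k + 1) * Z by rewrite mulr_ge0// mulr_ge0// addr_ge0.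
have -> : k * (k + 1) * Ca a * Num.sqrt (En m f) = k * (k + 1) * Z by rewrite /Z mulrA.
apply: (@le_trans _ _ (((k * (k + 1) * Z) `^ p)%:E `^ p^-1)%E).
  apply: gt0_ler_poweR => //.
  - by rewrite invr_ge0 ltW.
  - by rewrite in_itv/= leey andbT integral_ge0// => x _; exact: poweR_ge0.
  - by rewrite in_itv/= leey andbT lee_fin powR_ge0.
  exact: le_trans H1 H2.
by rewrite poweR_EFin -powRrM divff ?gt_eqF// powRr1.
Qed.

Lemma is_wderive_cfun Omega (a : 'I_d -> nat) f j : (forall i, tf (f i)) ->
  is_wderive Omega a (coordf (cfun f) j) (cmderive a (coordf (cfun f) j)).
Proof. by move=> tff; apply: is_wderive_tf => b; rewrite partf_cfun. Qed.

Lemma Yspace0_tf Omega f : (0 < d)%N -> (forall i, tf (f i)) ->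
  (forall i x, ~ Omega x -> f i x = 0) -> Yspace0 Omega m (cfun f).
Proof.
move=> d0 tff f0; split; first split.
- by move=> j a; exists (cmderive a (coordf (cfun f) j)); exact: is_wderive_cfun.
- have [C _ hC] := Ynorm_tf d0.
  exact: le_lt_trans (hC _ _ _ f (exh_setT 0) tff) (ltry _).
by apply: aeW => x Ox; apply/rowP => j; rewrite !mxE !f0.
Qed.

(** For y > 0 each admissible constant is at least |T psi| / y, hence so is the infimum. For y = 0
    division fails, but a single admissible constant already forces T psi to vanish. *)
Lemma Ydual_norm_le Omega (T : (X -> V) -> R[i]) psi (y : R) : Ydual Omega m T ->
  Yspace0 Omega m psi -> 0 <= y -> (Ynorm Omega m psi <= y%:E)%E ->
  0 <= Ydual_norm Omega m T /\ Normc.normc (T psi) <= y * Ydual_norm Omega m T.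
Proof.
move=> [_ [K0 bK0]] Ypsi y0 Yy; rewrite /Ydual_norm.
set B := [set K | _]; have B0 : B !=set0 by exists K0.
have lB : lbound B 0 by move=> K [].
have i0 : 0 <= inf B by exact: lb_le_inf.
split => //; have bK K : B K -> Normc.normc (T psi) <= y * K.
  move=> [K00 /(_ _ Ypsi) h]; rewrite -lee_fin; apply: (le_trans h).
  by rewrite EFinM; apply: lee_wpmul2r; rewrite ?lee_fin.
move: y0; rewrite le_eqVlt => /orP[/eqP y0|y0].
  by have := bK _ bK0; rewrite -y0 !mul0r.
rewrite mulrC -ler_pdivrMr//; apply: lb_le_inf => // K /bK.
by rewrite ler_pdivrMr// mulrC.
Qed.

(** Passing through [cnt] gives permuted sequences the same representative, and at [sq a] it is the
    derivative that occurs in [Lpairing]. *)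
Definition wpart Omega u (i : I) (s : seq 'I_d) : X -> R :=
  partf i.2 (wderive Omega (cnt s) (coordf u i.1)).

Lemma wpart_sq Omega u i (a : MI) : wpart Omega u i (sq a) = partf i.2 (wderive Omega a (coordf u
  i.1)).
Proof. by rewrite /wpart cnt_sq. Qed.

Lemma wds_wpart Omega u i s : Yspace Omega m u -> (size s <= m)%N ->
  wds Omega s (partf i.2 (coordf u i.1)) (wpart Omega u i s).
Proof.
move=> [hu _] /multi_index_cnt[a aE].
have := wderiveP (hu i.1 a); rewrite aE => /is_wderive_part/(_ i.2).
apply: wds_perm; exact: perm_sq.
Qed.

Lemma linted_wpart Omega u i s : Yspace Omega m u -> (size s <= m)%N ->
  linted Omega (wpart Omega u i s).
Proof. by move=> Yu sm; have [] := wds_wpart i Yu sm. Qed.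

(** [Lpairing] conjugates the factor with u whereas (WG) conjugates that with the test function; the
    real parts agree, and the real part of the equation is all that the energy estimate tests. *)
Lemma Re_Lpairing (A : coefficients R d m N) Omega c q u f : exh Omega c q ->
  measurable_coefficients A -> Yspace Omega m u -> (forall i, tf (f i)) ->
  (forall i x, ~ Omega x -> f i x = 0) -> (forall i s x, ~ Omega x -> pderive s (f i) x = 0) ->
  (forall t : term, leb.-integrable setT (EFin \o (fun x =>
     pderive (tsa t) (f (tci t)) x * tco A t x * wpart Omega u (tcj t) (tsb t) x))) ->
  complex.Re (Lpairing A Omega u (cfun f)) =
  \sum_(t : term) tri (tco A t) (pderive (tsa t) (f (tci t))) (wpart Omega u (tcj t) (tsb t)).
Proof.
move=> ex mA Yu tff f0 Df0 it; have mO := exh_measurable ex.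
rewrite [RHS]sum_term /Lpairing -/(part false _) part_sum; apply: eq_bigr => j _.
rewrite part_sum; apply: eq_bigr => k _; rewrite part_sum; apply: eq_bigr => a0 _.
rewrite part_sum; apply: eq_bigr => b0 _; pose a : MI := a0; pose b : MI := b0.
pose F (e : bool * bool) x := pderive (sq a) (f (j, e.1)) x * block e.1 e.2 (A j k a b x) *
  partf e.2 (wderive Omega b (coordf u k)) x.
have iF e : leb.-integrable setT (EFin \o F e).
  have := it (j, k, a, b, e); rewrite /tsa /tsb /tci /tcj /= wpart_sq; exact.
have [iS SE] := Rintegral_sumr (index_enum _) iF.
have -> : \sum_e tri (tco A (j, k, a0, b0, e)) (pderive (tsa (j, k, a0, b0, e)) (f (tci (j, k, a0,
  b0, e))))
    (wpart Omega u (tcj (j, k, a0, b0, e)) (tsb (j, k, a0, b0, e))) = \int[leb]_x (\sum_e F e x).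
  rewrite SE; apply: eq_bigr => e _; rewrite /tri /tsb /= wpart_sq.
  by apply: eq_Rintegral => x _.
rewrite part_cintegral -(@Rintegral_out _ _ Omega); last first.
  by move=> x Ox; apply: big1 => e _; rewrite /F Df0// !mul0r.
pose w (e : bool) := partf e (wderive Omega a (coordf (cfun f) j)).
pose v (e : bool) := partf e (wderive Omega b (coordf u k)).
have mw e : measurable_fun Omega (w e).
  apply: (linted_measurable ex).
  have [_ lv _] := wderiveP (ex_intro _ _ (is_wderive_cfun Omega a j tff)).
  by move/loc_integrable_part : lv; apply.
have mv e : measurable_fun Omega (v e).
  apply: (linted_measurable ex); have [hu _] := Yu; have [_ lv _] := wderiveP (hu k b).
  by move/loc_integrable_part : lv; apply.
have E x : part false (wderive Omega a (coordf (cfun f) j) x *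
    conjc (A j k a b x * wderive Omega b (coordf u k) x)) =
    \sum_(e : bool * bool) w e.1 x * block e.1 e.2 (A j k a b x) * v e.2 x.
  by apply: etrans (Re_conjM _ _) _; rewrite mulrA; exact: Re_block.
transitivity (\int[leb]_(x in Omega) \sum_(e : bool * bool) w e.1 x * block e.1 e.2 (A j k a b x) *
  v e.2 x).
  by apply: eq_Rintegral => x _; exact: E.
rewrite /Rintegral; congr fine; apply: ae_eq_integral => //.
- apply/measurable_EFinP; apply: measurable_sum => e; apply: measurable_funM; last exact: mv.
  apply: measurable_funM; first exact: mw.
  by have := measurable_tco (j, k, a, b, e) mA; exact: measurable_funTS.
- by apply: measurable_funTS; have /integrableP[] := iS.
apply: filterS (wderive_ae ex (is_wderive_cfun Omega a j tff)) => x hx Ox.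
congr EFin; apply: eq_bigr => e _; rewrite /F /w /partf hx//.
by rewrite -/(partf e.1 _ x) cmderive_part partf_cfun.
Qed.

End sobolev_norm.

Section cube_volume.
Context {R : realType} {d : nat}.
Local Notation X := 'rV[R]_d.

Lemma cubeE (c : X) (l : R) : 0 < l -> cube c l = [set x | (`|x - c| < l / 2)%R].
Proof. by move=> l0; apply/seteqP; split => x; move=> /cubeP; exact. Qed.

Lemma volume_cube (c : X) (l : R) : 0 < l -> volume (cube c l) = l ^+ d.
Proof.
move=> l0; rewrite /volume.
pose A (i : 'I_d) : set R := `](c ord0 i - l / 2), (c ord0 i + l / 2)[%classic.
have -> : cube c l = [set x | forall i, A i (x ord0 i)].
  by apply/seteqP; split => x /= h i; have := h i; rewrite /A /= in_itv/= ltr_distl.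
rewrite lebesgue_rV_box => [|i]; last exact: measurable_itv.
have e (i : 'I_d) : lebesgue_measure (A i) = l%:E.
  rewrite /A lebesgue_measure_itv/= lte_fin ifT; last by lra.
  by rewrite -EFinB; congr EFin; lra.
by rewrite (eq_bigr (fun=> l%:E)) => [|i _]; [rewrite prodEFin prodr_const card_ord|exact: e].
Qed.

Lemma volume_root (c : X) (l : R) k : 0 < l -> (0 < d)%N ->
  volume (cube c l) `^ (k%:R / d%:R) = l ^+ k.
Proof.
move=> l0 d0; rewrite volume_cube// -powR_mulrn ?(ltW l0)// -powRrM mulrCA divff ?mulr1.
  by rewrite powR_mulrn// ltW.
by rewrite pnatr_eq0 -lt0n.
Qed.

End cube_volume.

(** * Assembly of the estimates on cubes *)

Section final.
Context {R : realType} {d m N : nat}.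
Local Notation X := 'rV[R]_d.
Local Notation leb := (@lebesgue_rV R d).
Local Notation MI := (multi_index d m).
Local Notation V := 'rV[R[i]]_N.
Local Notation I := ('I_N * bool)%type.
Implicit Types (u : X -> V) (Omega P D : set X).

Lemma measurable_indicM P Omega (v : X -> R) : measurable P -> P `<=` Omega ->
  measurable Omega -> measurable_fun Omega v ->
  measurable_fun setT (fun x => \1_P x * v x ^+ 2).
Proof.
move=> mP PO mO mv; rewrite (_ : (fun x => _) = (fun x => \1_P x * (v \_ P) x ^+ 2)).
  apply: measurable_funM; first exact: measurable_indic.
  apply: measurable_funX; apply/(measurable_restrictT _ mP).
  exact: measurable_funS mv.
apply/funext => x; rewrite indicE patchE; case: ifPn => // _.
by rewrite !mul0r.
Qed.

Lemma sqgrad_integral Omega c q u k P (b : R) : exh Omega c q -> Yspace Omega m u ->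
  (k <= m)%N -> measurable P -> P `<=` Omega ->
  0 <= b -> (forall i s, size s = k -> (\int[leb]_x (\1_P x * wpart Omega u i s x ^+ 2)%:E <=
    b%:E)%E) ->
  (\int[leb]_(x in P) (sqgrad Omega k u x)%:E <= (#|{: multi_index d k}|%:R * #|{: I}|%:R *
    b)%:E)%E.
Proof.
move=> ex Yu km mP PO b0 hb; have mO := exh_measurable ex.
have am (a : multi_index d k) : mi_order a == k -> size (sq a) = k by move=> /eqP; rewrite size_sq.
have mw (a : multi_index d k) i : mi_order a == k -> measurable_fun Omega (wpart Omega u i (sq a)).
  by move=> /am ak; apply: (linted_measurable ex); apply: (linted_wpart i Yu); rewrite ak.
have mf (a : multi_index d k) i : mi_order a == k ->
    measurable_fun setT (fun x => (\1_P x * wpart Omega u i (sq a) x ^+ 2)%:E).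
  by move=> ak; apply/measurable_EFinP; apply: (measurable_indicM mP PO mO); exact: mw.
have g0 (v : X -> R) x : (0 <= (\1_P x * v x ^+ 2)%:E)%E.
  by rewrite lee_fin mulr_ge0 ?indic_ge0// sqr_ge0.
rewrite integral_mkcond.
have -> : (\int[leb]_x (((fun x => (sqgrad Omega k u x)%:E) \_ P) x) = \int[leb]_x
    (\sum_(a : multi_index d k | mi_order a == k) \sum_(i : I) (\1_P x * wpart Omega u i (sq a) x
      ^+ 2)%:E))%E.
  apply: eq_integral => x _; rewrite patchE indicE.
  rewrite (eq_bigr (fun a : multi_index d k => ((x \in P)%:R * sqnorm (vwderive Omega a u x))%:E));
    last first.
    move=> a _; rewrite sumEFin -mulr_sumr sqnorm_part; congr ((_ * _)%:E).
    by apply: eq_bigr => i _; rewrite wpart_sq mxE.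
  by rewrite sumEFin -mulr_sumr; case: ifP => _; rewrite ?mul1r ?mul0r.
under eq_integral do rewrite big_mkcond.
rewrite ge0_integral_sum//=; last 2 first.
- by move=> a; case: (boolP (mi_order a == k)) => // ak; apply: emeasurable_sum => i; exact: mf.
- by move=> a x _; case: (mi_order a == k) => //; apply: sume_ge0.
apply: (@le_trans _ _ (\sum_(a : multi_index d k) (#|{: I}|%:R * b)%:E)%E).
  apply: lee_sum => a _; case: (boolP (mi_order a == k)) => ak; last first.
    by rewrite integral0 lee_fin mulr_ge0.
  rewrite ge0_integral_sum//; last by move=> i; exact: mf.
  apply: (@le_trans _ _ (\sum_(i : I) b%:E)%E).
    by apply: lee_sum => i _; apply: hb; exact: am.
  by rewrite sumEFin sumr_const mulr_natl.
by rewrite sumEFin lee_fin sumr_const -[leLHS]mulr_natl mulrA.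
Qed.

(** At order m the exponent [Yexp] is 2, so the corresponding term of the finite Y norm is an L^2
    norm. *)
Lemma Yspace_top Omega c q u i s : (0 < d)%N -> exh Omega c q -> Yspace Omega m u -> size s = m ->
  (\int[leb]_x (\1_Omega x * wpart Omega u i s x ^+ 2)%:E < +oo)%E.
Proof.
move=> d0 ex Yu sm; have mO := exh_measurable ex.
have [a aE] : exists a : MI, multi_index_fun a = cnt s by apply: multi_index_cnt; rewrite sm.
have am : mi_order a = m by rewrite aE mi_order_cnt sm.
have aa : above_half a by rewrite /above_half am -[X in (X < _)%N]addn0 ltn_add2l.
have [Y2 _] := YexpE (R := R) d0 aa.
have {}Y2 : Yexp a = 2 :> R.
  by rewrite Y2 am subnn mulr0 subr0 mulfK// pnatr_eq0 -lt0n.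
have [hu] := Yu; rewrite /Ynorm (bigD1 a)//= => Yoo.
have {}Yoo : ('N[leb]_((Yexp a)%:E)
    [(fun x => (Num.sqrt (sqnorm (vwderive Omega a u x)))%:E) \_ Omega] < +oo)%E.
  apply: le_lt_trans Yoo; rewrite leeDl// sume_ge0// => b _; exact: Lnorm_ge0.
have mw j b : measurable_fun Omega (partf b (wderive Omega a (coordf u j))).
  apply: (linted_measurable ex); have [_ lv _] := wderiveP (hu j a).
  by move/loc_integrable_part : lv; apply.
pose g : X -> \bar R := (fun x => (Num.sqrt (sqnorm (vwderive Omega a u x)))%:E) \_ Omega.
have mg : measurable_fun setT g.
  apply/(measurable_restrictT _ mO); apply/measurable_EFinP.
  apply: (measurableT_comp (continuous_measurable_fun (@sqrt_continuous R))).
  apply: measurable_sqnorm => j b; have := mw j b; apply: eq_measurable_fun => x _.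
  by rewrite /partf /coordf /vwderive mxE.
have goo : (\int[leb]_x `|g x| `^ 2 < +oo)%E.
  move: Yoo; rewrite -/g Y2 unlock; apply: contraLR; rewrite -!leNgt !leye_eq => /eqP ->.
  by rewrite poweRyr// invr_eq0 pnatr_eq0.
apply: le_lt_trans goo; apply: ge0_le_integral => //.
- by move=> x _; rewrite lee_fin mulr_ge0 ?indic_ge0// sqr_ge0.
- apply/measurable_EFinP; apply: (measurable_indicM mO _ mO) => //.
  by rewrite /wpart -aE; exact: mw.
- by apply: (measurableT_comp (measurable_poweR 2)); exact: measurableT_comp.
move=> x _; rewrite /g indicE patchE; case: ifPn => [/set_mem Ox|_]; last by rewrite mul0r
  poweR_ge0.
rewrite mul1r gee0_abs; last by rewrite lee_fin sqrtr_ge0.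
rewrite poweR_EFin lee_fin powR_mulrn ?sqrtr_ge0// sqr_sqrtr; last first.
  by rewrite sqnorm_part; apply: sumr_ge0 => e _; exact: sqr_ge0.
rewrite sqnorm_part (bigD1 i)//= mxE /wpart -aE /partf lerDl.
by apply: sumr_ge0 => e _; exact: sqr_ge0.
Qed.

Lemma linted_u Omega u i : Yspace Omega m u -> linted Omega (partf i.2 (coordf u i.1)).
Proof. by move=> Yu; have [] := wds_wpart i (s := [::]) Yu (leq0n m). Qed.

Lemma wds_nil Omega (v : X -> R) : linted Omega v -> wds Omega [::] v v.
Proof. by move=> lv; split => // f _; rewrite expr0 mul1r. Qed.

(** [wpart] at the empty sequence is a weak derivative of order 0, hence equal to u almost
    everywhere by uniqueness. *)
Lemma zero_order Omega c q u P D : exh Omega c q -> Yspace Omega m u -> measurable P ->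
  P `<=` D -> measurable D -> D `<=` Omega ->
  (\sum_(i : I) \int[leb]_x (\1_P x * wpart Omega u i [::] x ^+ 2)%:E <=
   \int[leb]_(x in D) (sqnorm (u x))%:E)%E.
Proof.
move=> ex Yu mP PD mD DO; have mO := exh_measurable ex.
have PO := subset_trans PD DO.
have lu i := linted_u i Yu; have mu i := linted_measurable ex (lu i).
have mw i : measurable_fun Omega (wpart Omega u i [::]).
  exact: (linted_measurable ex (linted_wpart (s := [::]) i Yu (leq0n m))).
have m1 i := measurable_indicM mP PO mO (mu i).
have g0 (v : X -> R) x : (0 <= (\1_P x * v x ^+ 2)%:E)%E.
  by rewrite lee_fin mulr_ge0 ?indic_ge0// sqr_ge0.
apply: (@le_trans _ _ (\sum_(i : I) \int[leb]_x (\1_P x * partf i.2 (coordf u i.1) x ^+ 2)%:E)%E).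
  apply: lee_sum => i _; apply: ae_ge0_le_integral => //.
  - by apply/measurable_EFinP; exact: (measurable_indicM mP PO mO).
  - exact/measurable_EFinP.
  have := wds_unique ex (wds_wpart i (s := [::]) Yu (leq0n m)) (wds_nil (lu i)).
  apply: filterS => x hx _; rewrite lee_fin indicE; case: (boolP (x \in P)) => [/set_mem/PO Ox|_];
    last by rewrite !mul0r.
  by rewrite hx.
rewrite -ge0_integral_sum//; last by move=> i; apply/measurable_EFinP; exact: m1.
rewrite [leRHS]integral_mkcond; apply: ge0_le_integral => //.
- by move=> x _; apply: sume_ge0.
- by apply: emeasurable_sum => i; apply/measurable_EFinP; exact: m1.
- apply/(measurable_restrictT _ mD); apply/measurable_EFinP; apply: measurable_sqnorm => j b.
  by apply: measurable_funS (mu (j, b)).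
move=> x _; rewrite sumEFin patchE indicE; case: (boolP (x \in P)) => [/set_mem/PD Dx|_].
  by rewrite mem_set// lee_fin sqnorm_part; apply: ler_sum => e _; rewrite mul1r.
under eq_bigr do rewrite mul0r; rewrite big1//; case: ifP => // _.
by rewrite lee_fin sqnorm_part sumr_ge0// => e _; exact: sqr_ge0.
Qed.

(** Ensures that the integral of |u|^2 over the larger cube can be infinite only because of the
    annulus, in which case the first inequality is trivial. *)
Lemma zero_order_finite Omega c q u (a0 S : R) : (0 < d)%N -> (0 < m)%N -> exh Omega c q ->
  Yspace Omega m u -> 0 <= a0 -> a0 < S -> (forall r, r < S -> cl c r `<=` Omega) ->
  (\int[leb]_(x in [set x | (`|x - c| < a0)%R]) (sqnorm (u x))%:E < +oo)%E.
Proof.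
move=> d0 m0 ex Yu a00 aS Om; have mO := exh_measurable ex.
have lu i := linted_u i Yu; have mu i := linted_measurable ex (lu i).
pose G (i : I) (s : seq 'I_d) := if s is [::] then partf i.2 (coordf u i.1) else wpart Omega u i s.
have wG i s : (size s <= m)%N -> wds Omega s (partf i.2 (coordf u i.1)) (G i s).
  by case: s => [_|j s sm]; [exact: (wds_nil (lu i))|exact: (wds_wpart i Yu sm)].
have Gm i s r : size s = m -> r < S -> (\int[leb]_x (\1_(cl c r) x * G i s x ^+ 2)%:E < +oo)%E.
  move=> sm rS; have GE : G i s = wpart Omega u i s by move: sm m0; case: s => //= <-.
  rewrite GE; apply: le_lt_trans (Yspace_top i d0 ex Yu sm).
  have mw : measurable_fun Omega (wpart Omega u i s).
    by apply: (linted_measurable ex); apply: (linted_wpart i Yu); rewrite sm.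
  apply: ge0_le_integral => //.
  - by move=> x _; rewrite lee_fin mulr_ge0 ?indic_ge0// sqr_ge0.
  - by apply/measurable_EFinP; apply: (measurable_indicM (measurable_cl c r) (Om _ rS) mO).
  - by apply/measurable_EFinP; apply: (measurable_indicM mO _ mO).
  move=> x _; rewrite lee_fin ler_wpM2r ?sqr_ge0// !indicE.
  by case: (boolP (x \in cl c r)) => // /set_mem/(Om _ rS) Ox; rewrite mem_set.
have L2 i := bootstrap Om (wG i) (Gm i) (leq0n m : (size [::] <= m)%N) aS.
have m1 i := measurable_indicM (measurable_cl c a0) (Om _ aS) mO (mu i).
apply: (@le_lt_trans _ _ (\sum_(i : I) \int[leb]_x (\1_(cl c a0) x * partf i.2 (coordf u i.1) x ^+
  2)%:E)%E); last first.
  by apply: lte_sum_pinfty => i _; exact: L2.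
have mP : measurable [set x : X | (`|x - c| < a0)%R].
  apply: open_measurable_rV; rewrite openE => x xa.
  by apply: filterS (near_cl_in xa) => y.
have PO : [set x : X | (`|x - c| < a0)%R] `<=` Omega.
  by move=> x /= xa; apply: (Om _ aS); rewrite /cl /= ltW.
rewrite -ge0_integral_sum//; last 2 first.
- by move=> i; apply/measurable_EFinP; exact: m1.
- by move=> i x _; rewrite lee_fin mulr_ge0 ?indic_ge0// sqr_ge0.
rewrite [leLHS]integral_mkcond; apply: ge0_le_integral => //.
- by move=> x _; rewrite patchE; case: ifP => // _; rewrite lee_fin sqnorm_part sumr_ge0// => e _;
  exact: sqr_ge0.
- apply/(measurable_restrictT _ mP); apply/measurable_EFinP; apply: measurable_sqnorm => j b.
  by apply: measurable_funS (mu (j, b)).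
- by apply: emeasurable_sum => i; apply/measurable_EFinP; exact: m1.
move=> x _; rewrite sumEFin patchE; case: ifPn => [/set_mem xa|_].
  rewrite lee_fin sqnorm_part; apply: ler_sum => e _.
  by rewrite indicE mem_set ?mul1r// /cl /= ltW.
by rewrite lee_fin sumr_ge0// => e _; rewrite mulr_ge0 ?indic_ge0// sqr_ge0.
Qed.

Lemma caccioppoli_complex (lambda L : R) : (0 < d)%N -> (0 < m)%N -> 0 < lambda -> 0 <= L ->
  exists2 C : R, 0 <= C & forall (A : coefficients R d m N) (delta : R) Omega (c : X) q (a0 S : R) u
    (T : (X -> V) -> R[i]) (N1 N2 : R),
  measurable_coefficients A -> 0 <= delta -> weak_Garding A lambda delta ->
  coefs m tsa tsb (tco A) L -> 0 <= a0 -> a0 < S -> exh Omega c q ->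
  (forall r, r < S -> cl c r `<=` Omega) -> Yspace Omega m u -> Ydual Omega m T ->
  (forall phi, Yspace0 Omega m phi -> Lpairing A Omega u phi = T phi) ->
  (\int[leb]_(x in Omega `\` [set x | (`|x - c| < a0)%R]) (sqnorm (u x))%:E <= N1%:E)%E ->
  (\int[leb]_(x in Omega) (sqnorm (u x))%:E <= N2%:E)%E ->
  let r := ((S - a0) / 2)^-1 in
  let B := r ^+ (2 * m) * N1 + delta * N2 + Ydual_norm Omega m T ^+ 2 in
  (\int[leb]_(x in [set x | (`|x - c| < a0)%R]) (sqgrad Omega m u x)%:E <= (C * B)%:E)%E /\
  (forall j, (j < m)%N ->
    \int[leb]_(x in [set x | (`|x - c| < a0)%R]) (sqgrad Omega j u x)%:E <=
    ((r ^+ (2 * (m - j)))^-1 * (C * (B + r ^+ (2 * m) * N2)))%:E)%E.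
Proof.
move=> d0 m0 lam0 L0; have lam'0 : 0 < lambda / d%:R ^+ m :> R by rewrite divr_gt0// exprn_gt0//
  ltr0n.
have [C C0 hC] := @caccioppoli_weak R d I (term (d := d) (m := m) (N := N)) m tci tcj tsa tsb _ L
  m0 lam'0 L0.
have [CY CY0 hCY] := @Ynorm_tf R d m N d0.
(* Bounds, for all orders up to m at once, the number of real terms in [sqgrad]. *)
pose M : R := (\sum_(j < m.+1) #|{: multi_index d j}|)%:R * #|{: I}|%:R.
have M0 : 0 <= M by rewrite mulr_ge0.
have Mj j : (j <= m)%N -> #|{: multi_index d j}|%:R * #|{: I}|%:R <= M.
  move=> jm; rewrite /M ler_wpM2r// ler_nat.
  have jm' : (j < m.+1)%N by [].
  by rewrite (bigD1 (Ordinal jm'))//= leq_addr.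
(* The real estimate is applied with K equal to [CY] times the norm of T, and K enters squared. *)
exists (M * C * (1 + CY ^+ 2)); first by rewrite mulr_ge0 ?mulr_ge0// addr_ge0// sqr_ge0.
move=> A delta Omega c q a0 S u T N1 N2 mA de0 wG cA a00 aS ex Om Yu YT eqL hN1 hN2 r B.
have mO := exh_measurable ex.
pose P := [set x : X | (`|x - c| < a0)%R].
have mP : measurable P.
  apply: open_measurable_rV; rewrite openE => x xa.
  by apply: filterS (near_cl_in xa) => y.
have PO : P `<=` Omega by move=> x /= xa; apply: (Om _ aS); rewrite /cl /= ltW.
have s0 (z : V) : (0 <= (sqnorm z)%:E)%E by rewrite lee_fin sqnorm_part sumr_ge0// => e _; exact:
  sqr_ge0.
have N10 : 0 <= N1 by rewrite -lee_fin; apply: le_trans hN1; apply: integral_ge0.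
have N20 : 0 <= N2 by rewrite -lee_fin; apply: le_trans hN2; apply: integral_ge0.
have Gm i s r1 : size s = m -> r1 < S -> (\int[leb]_x (\1_(cl c r1) x * wpart Omega u i s x ^+
  2)%:E < +oo)%E.
  move=> sm rS; apply: le_lt_trans (Yspace_top i d0 ex Yu sm).
  have mw : measurable_fun Omega (wpart Omega u i s).
    by apply: (linted_measurable ex); apply: (linted_wpart i Yu); rewrite sm.
  apply: ge0_le_integral => //.
  - by move=> x _; rewrite lee_fin mulr_ge0 ?indic_ge0// sqr_ge0.
  - by apply/measurable_EFinP; apply: (measurable_indicM (measurable_cl c r1) (Om _ rS) mO).
  - by apply/measurable_EFinP; apply: (measurable_indicM mO _ mO).
  move=> x _; rewrite lee_fin ler_wpM2r ?sqr_ge0// !indicE.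
  by case: (boolP (x \in cl c r1)) => // /set_mem/(Om _ rS) Ox; rewrite mem_set.
pose nT := Ydual_norm Omega m T.
have tf0 : forall i : I, tf (fun _ : X => 0 : R) by move=> _; exact: tf0.
have nT0 : 0 <= nT.
  have Y0 : Yspace0 Omega m (cfun (fun _ : I => fun _ : X => 0 : R)) by exact: Yspace0_tf.
  by have [] := Ydual_norm_le YT Y0 (mulr_ge0 CY0 (sqrtr_ge0 _)) (hCY _ _ _ _ ex tf0).
have eqG R1 (phi : I -> X -> R) : R1 < S -> (forall i, tf (phi i)) ->
    (forall i x, R1 <= `|x - c| -> phi i x = 0) ->
    (forall t : term, leb.-integrable setT (EFin \o (fun x =>
       pderive (tsa t) (phi (tci t)) x * tco A t x * wpart Omega u (tcj t) (tsb t) x))) ->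
    `|\sum_(t : term) tri (tco A t) (pderive (tsa t) (phi (tci t))) (wpart Omega u (tcj t) (tsb
      t))| <=
    CY * nT * Num.sqrt (En m phi).
  move=> R1S tphi phi0 it.
  have out i s x : ~ Omega x -> pderive s (phi i) x = 0.
    move=> Ox; apply: (@pderive_out _ _ c R1) => [y /ltW|]; first exact: phi0.
    by rewrite ltNge; apply/negP => xr; apply: Ox; exact: (Om _ R1S).
  have Yphi : Yspace0 Omega m (cfun phi) by apply: Yspace0_tf => // i x; exact: (out i [::]).
  rewrite -(Re_Lpairing ex mA Yu tphi (fun i => out i [::]) out it) (eqL _ Yphi).
  apply: (le_trans (part_le_normc false _)).
  have [|_ h] := Ydual_norm_le YT Yphi _ (hCY _ _ _ phi ex tphi).
    by rewrite mulr_ge0// sqrtr_ge0.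
  by apply: (le_trans h); rewrite mulrAC.
have K0 : 0 <= CY * nT by exact: mulr_ge0.
have gA := garding_real d0 lam0 cA wG.
have [H1 H2] := hC (tco A) delta (CY * nT) Omega c a0 S _ (wpart Omega u) N1 N2 cA gA de0 K0 a00 aS
  N10 N20 Om
  (fun i s sm => wds_wpart i Yu sm) Gm eqG
  ltac:(move=> R1 R1S; apply: le_trans hN1;
    apply: (zero_order (P := [set x | (a0 < `|x - c|)%R] `&` cl c R1) ex Yu);
    [apply: measurableI; [|exact: measurable_cl];
       apply: open_measurable_rV; rewrite openE => x xa; by apply: filterS (near_cl_out xa) => y
    |by move=> x [/= xa xR]; split; [exact: (Om _ R1S)|rewrite /= => h; move: xa; rewrite ltNge
      (ltW h)]
    |exact: measurableD
    |by move=> x []])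
  ltac:(move=> R1 R1S; apply: le_trans hN2;
    apply: (zero_order (P := setT `&` cl c R1) ex Yu) => //;
    [by apply: measurableI => //; exact: measurable_cl|by move=> x [_]; exact: (Om _ R1S)]).
pose B' := r ^+ (2 * m) * N1 + delta * N2 + (CY * nT) ^+ 2.
have r0 : 0 < r by rewrite invr_gt0 divr_gt0// subr_gt0.
have rm0 k : 0 <= r ^+ k by rewrite exprn_ge0// ltW.
have BB : B' <= (1 + CY ^+ 2) * B.
  rewrite /B' /B exprMn -subr_ge0.
  rewrite [leRHS](_ : _ = CY ^+ 2 * (r ^+ (2 * m) * N1 + delta * N2) + nT ^+ 2); last by rewrite
    /nT; ring.
  by rewrite addr_ge0 ?sqr_ge0// mulr_ge0 ?sqr_ge0// addr_ge0// mulr_ge0.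
have MCE z : M * C * (1 + CY ^+ 2) * z = M * (C * ((1 + CY ^+ 2) * z)) by rewrite !mulrA.
have B0 : 0 <= B' by rewrite addr_ge0 ?sqr_ge0// addr_ge0// mulr_ge0.
split.
  have b0 : 0 <= C * B' by exact: mulr_ge0.
  have := sqgrad_integral (P := P) ex Yu (leqnn m) mP PO b0 H1; move=> /le_trans; apply.
  rewrite lee_fin; apply: (@le_trans _ _ (M * (C * B'))); first by rewrite ler_wpM2r// Mj.
  rewrite MCE ler_wpM2l// ler_wpM2l//; exact: BB.
move=> j jm; set rj := r ^+ (2 * (m - j)); have rj0 : 0 < rj by exact: exprn_gt0.
have z0 : 0 <= r ^+ (2 * m) * N2 by exact: mulr_ge0.
have b0 : 0 <= rj^-1 * (C * (B' + r ^+ (2 * m) * N2)).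
  by rewrite mulr_ge0 ?invr_ge0 ?(ltW rj0)// mulr_ge0// addr_ge0.
have := sqgrad_integral (P := P) ex Yu (ltnW jm) mP PO b0; move=> /(_ _)/le_trans; apply.
  move=> i s sj; have := H2 i s; rewrite sj => /(_ jm) H.
  have := lee_wpmul2l (x := (rj^-1)%:E) _ H; rewrite lee_fin invr_ge0 => /(_ (ltW rj0)).
  by rewrite muleA -EFinM mulVf ?gt_eqF// mul1e -EFinM.
rewrite lee_fin; apply: (@le_trans _ _ (M * (rj^-1 * (C * (B' + r ^+ (2 * m) * N2))))).
  by rewrite ler_wpM2r// Mj// ltnW.
rewrite mulrCA ler_wpM2l ?invr_ge0 ?(ltW rj0)// MCE ler_wpM2l// ler_wpM2l//.
rewrite [leRHS]mulrDr; apply: lerD => //.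
by rewrite ler_peMl// lerDl sqr_ge0.
Qed.

End final.

(** The estimate carries the scale th l / 4 and the claim the scale l. The mismatch is (th /
    4)^(2(m-j)) <= 1, and this factor lowers the power of 1/th from 2m to 2j. *)
Lemma scaled_bound (R : realType) (m j : nat) (l th C n1 n2 dn t : R) (x : \bar R) : (j <= m)%N ->
  0 < l -> 0 < th <= 1 -> 0 <= C -> 0 <= n1 -> n1 <= n2 -> 0 <= dn -> 0 <= t ->
  let r := (th * l / 4)^-1 in
  (x <= ((r ^+ (2 * (m - j)))^-1 * (C * (r ^+ (2 * m) * n1 + dn + t + r ^+ (2 * m) * n2)))%:E)%E ->
  ((l ^+ (2 * m - 2 * j))^-1%:E * x <=
    (2 * 4 ^+ (2 * m) * C / (th ^+ (2 * j) * l ^+ (2 * m)) * n2 + C * dn + C * t)%:E)%E.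
Proof.
move=> jm l0 /andP[th0 th1] C0 n10 n12 dn0 t0 r xb.
pose k := (2 * (m - j))%N; have kE : (2 * m - 2 * j = k)%N by rewrite /k mulnBr.
have mE : (2 * m = k + 2 * j)%N by rewrite /k; lia.
have lk0 : 0 < l ^+ k by exact: exprn_gt0.
apply: (le_trans (lee_wpmul2l _ xb)); first by rewrite kE lee_fin invr_ge0 ltW.
rewrite -EFinM lee_fin kE -/k.
have rE : r = 4 / (th * l) by rewrite /r invf_div.
have th0' := gt_eqF th0; have l0' := gt_eqF l0.
pose ka := (th / 4) ^+ k.
have ka0 : 0 <= ka by rewrite exprn_ge0// divr_ge0// ltW.
have ka1 : ka <= 1 by rewrite exprn_ile1 ?divr_ge0 ?(ltW th0)// ler_pdivrMr//; lra.
have E1 : (l ^+ k)^-1 * (r ^+ k)^-1 = ka.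
  by rewrite -invfM -exprMn rE /ka -exprVn; congr (_ ^+ _); field; rewrite th0' l0'.
have E2 : ka * r ^+ (2 * m) = 4 ^+ (2 * j) / (th ^+ (2 * j) * l ^+ (2 * m)).
  rewrite rE /ka mE !expr_div_n !exprMn !exprD.
  field; rewrite ?expf_eq0 ?th0' ?l0' ?pnatr_eq0 ?andbF//.
have p4 : 4 ^+ (2 * j) <= 4 ^+ (2 * m) :> R by rewrite ler_weXn2l ?ler1n// leq_mul2l jm orbT.
rewrite mulrA E1.
have D0 : 0 <= (th ^+ (2 * j) * l ^+ (2 * m))^-1.
  by rewrite invr_ge0 mulr_ge0// exprn_ge0// ltW.
have n20 := le_trans n10 n12.
have q0 : 0 <= ka * r ^+ (2 * m).
  by rewrite E2 mulr_ge0// exprn_ge0.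
have qE : ka * r ^+ (2 * m) <= 4 ^+ (2 * m) / (th ^+ (2 * j) * l ^+ (2 * m)).
  by rewrite E2 ler_wpM2r.
rewrite [leLHS](_ : _ = C * (ka * r ^+ (2 * m) * n1 + ka * r ^+ (2 * m) * n2) + ka * (C * dn) + ka
  * (C * t)); last by ring.
apply: lerD; last by rewrite ler_piMl// mulr_ge0.
apply: lerD; last by rewrite ler_piMl// mulr_ge0.
rewrite [leRHS](_ : _ = C * (4 ^+ (2 * m) / (th ^+ (2 * j) * l ^+ (2 * m)) * n2 +
  4 ^+ (2 * m) / (th ^+ (2 * j) * l ^+ (2 * m)) * n2)); last by ring.
rewrite ler_wpM2l//; apply: lerD; last by rewrite ler_wpM2r.
by apply: ler_pM.
Qed.

Theorem corollary51 (R : realType) (d m N : nat) (lambda Lambda : R) :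
  (2 <= d)%N -> (1 <= m)%N -> (1 <= N)%N -> 0 < lambda ->
  exists2 C : R, 0 < C &
  forall (A : coefficients R d m N) (delta : R) (c : 'rV[R]_d) (l theta : R)
    (u : 'rV[R]_d -> 'rV[R[i]]_N) (T : ('rV[R]_d -> 'rV[R[i]]_N) -> R[i]),
  measurable_coefficients A ->
  0 <= delta ->
  weak_Garding A lambda delta ->
  bound1 A Lambda \/ bound2 A Lambda ->
  0 < l -> 1 < theta <= 2 ->
  let leb := @lebesgue_rV R d in
  let Q := cube c l in
  let thetaQ := cube c (theta * l) in
  Yspace thetaQ m u ->
  Ydual thetaQ m T ->
  (forall phi, Yspace0 thetaQ m phi -> Lpairing A thetaQ u phi = T phi) ->
  (\int[leb]_(x in Q) (sqgrad thetaQ m u x)%:E <=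
     (C / ((theta - 1) * volume Q `^ d%:R^-1) ^+ (2 * m))%:E *
       \int[leb]_(x in thetaQ `\` Q) (sqnorm (u x))%:E
     + (C * delta)%:E * \int[leb]_(x in thetaQ) (sqnorm (u x))%:E
     + (C * Ydual_norm thetaQ m T ^+ 2)%:E)%E /\
  (forall j : nat, (1 <= j <= m - 1)%N ->
   (((volume Q `^ ((2 * m - 2 * j)%:R / d%:R))^-1)%:E *
      \int[leb]_(x in Q) (sqgrad thetaQ j u x)%:E <=
     (C / ((theta - 1) ^+ (2 * j) * volume Q `^ ((2 * m)%:R / d%:R)))%:E *
       \int[leb]_(x in thetaQ) (sqnorm (u x))%:E
     + (C * delta)%:E * \int[leb]_(x in thetaQ) (sqnorm (u x))%:E
     + (C * Ydual_norm thetaQ m T ^+ 2)%:E)%E).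
Proof.
move=> d2 m1 N1 lam0; case: d d2 => [//|d] d2.
have [Cc Cc0 hCc] := @coefs_bound R d m N.
have [C0 C00 hC0] := @caccioppoli_complex R d.+1 m N lambda (Cc * `|Lambda|) isT m1 lam0
  (mulr_ge0 Cc0 (normr_ge0 _)).
(* 4^(2m) comes from the width (theta - 1) l / 4 of the annulus used for the cut-offs, 2 from the
   two zero-order terms in the second inequality, and 1 makes C positive. *)
pose C := 2 * 4 ^+ (2 * m) * C0 + 1.
have k4 : 1 <= 4 ^+ (2 * m) :> R by rewrite exprn_ege1// ler1n.
have CC0 : 2 * 4 ^+ (2 * m) * C0 <= C by rewrite /C lerDl.
have C0C : C0 <= C.
  apply: le_trans CC0; rewrite ler_peMl//.
  by apply: (le_trans k4); rewrite ler_peMl ?ler1n// (le_trans ler01 k4).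
have C1 : 0 < C by rewrite ltr_wpDl// mulr_ge0// mulr_ge0// exprn_ge0.
exists C => // A delta c l theta u T mA de0 wG bA l0 /andP[th1 th2] leb Q thQ Yu YT eqL.
have cA := hCc A Lambda mA bA.
pose th := theta - 1; have th0 : 0 < th <= 1 by apply/andP; split; rewrite /th; lra.
have [th0' _] := andP th0.
have tl0 : 0 < theta * l by rewrite mulr_gt0// (lt_trans _ th1).
have QE : Q = [set x | (`|x - c| < l / 2)%R] by exact: cubeE.
have a00 : 0 <= l / 2 by rewrite divr_ge0// ltW.
have aS : l / 2 < theta * l / 2 by rewrite ltr_pM2r// ltr_pMl.
have Om r : r < theta * l / 2 -> cl c r `<=` thQ.
  by move=> rS x /= xr; apply/cubeP => //; exact: le_lt_trans rS.
have ex : exh thQ c _ := exh_cube c tl0.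
have rE : ((theta * l / 2 - l / 2) / 2)^-1 = (th * l / 4)^-1.
  by congr (_^-1); rewrite /th; field.
have vd k : volume Q `^ (k%:R / d.+1%:R) = l ^+ k by exact: volume_root.
have v1 : volume Q `^ d.+1%:R^-1 = l by have := vd 1%N; rewrite div1r expr1.
have mthQ : measurable thQ := exh_measurable ex.
have mQ : measurable Q by exact: open_cube.
have QthQ : Q `<=` thQ by move=> x; rewrite QE /= => xa; apply: (Om _ aS); rewrite /cl /= ltW.
have s0 (z : 'rV[R[i]]_N) : (0 <= (sqnorm z)%:E)%E.
  by rewrite lee_fin sqnorm_part sumr_ge0// => e _; exact: sqr_ge0.
have mu : measurable_fun thQ (fun x => (sqnorm (u x))%:E).
  apply/measurable_EFinP; apply: measurable_sqnorm => j b.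
  exact: (linted_measurable ex (linted_u (j, b) Yu)).
have I2E : (\int[leb]_(x in thQ) (sqnorm (u x))%:E = \int[leb]_(x in thQ `\` Q) (sqnorm (u x))%:E +
    \int[leb]_(x in Q) (sqnorm (u x))%:E)%E.
  have thE : thQ = (thQ `\` Q) `|` Q by rewrite setUC setDUK.
  rewrite {1}thE ge0_integral_setU//.
  - exact: measurableD.
  - by rewrite -thE.
  - by apply/disj_setPS => x [[_ nQ] /nQ].
have I1 : (0 <= \int[leb]_(x in thQ `\` Q) (sqnorm (u x))%:E)%E by apply: integral_ge0.
have I2 : (0 <= \int[leb]_(x in thQ) (sqnorm (u x))%:E)%E by apply: integral_ge0.
have IQ : (\int[leb]_(x in Q) (sqnorm (u x))%:E < +oo)%E.
  by rewrite QE; exact: (zero_order_finite _ _ ex Yu a00 aS Om).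
have nT2 : 0 <= Ydual_norm thQ m T ^+ 2 by exact: sqr_ge0.
have key (n1 n2 : R) : (\int[leb]_(x in thQ `\` Q) (sqnorm (u x))%:E = n1%:E)%E ->
    (\int[leb]_(x in thQ) (sqnorm (u x))%:E = n2%:E)%E ->
  let r := (th * l / 4)^-1 in
  let B := r ^+ (2 * m) * n1 + delta * n2 + Ydual_norm thQ m T ^+ 2 in
  (\int[leb]_(x in Q) (sqgrad thQ m u x)%:E <= (C0 * B)%:E)%E /\
  (forall j, (j < m)%N -> \int[leb]_(x in Q) (sqgrad thQ j u x)%:E <=
    ((r ^+ (2 * (m - j)))^-1 * (C0 * (B + r ^+ (2 * m) * n2)))%:E)%E.
  move=> e1 e2 r B; have := hC0 A delta thQ c _ _ _ u T n1 n2 mA de0 wG cA a00 aS ex Om Yu YT eqL.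
  by rewrite -QE rE e1 e2 !lexx => /(_ isT isT).
split.
  rewrite v1; have D0 : 0 < C / (th * l) ^+ (2 * m) by rewrite divr_gt0// exprn_gt0// mulr_gt0.
  (* If u is not square integrable on the annulus, the right-hand side is infinite, the coefficient
     of that integral being positive. *)
  have [I1oo|I1oo] := ltP (\int[leb]_(x in thQ `\` Q) (sqnorm (u x))%:E)%E +oo%E; last first.
    have -> : (\int[leb]_(x in thQ `\` Q) (sqnorm (u x))%:E = +oo)%E by apply/eqP; rewrite -leye_eq.
    rewrite gt0_muley ?lte_fin// -addeA addye ?leey// gt_eqF//.
    apply: (@lt_le_trans _ _ 0%E) => //; rewrite adde_ge0 ?mule_ge0 ?lee_fin//.
      by rewrite mulr_ge0// ltW.
    by rewrite mulr_ge0// ltW.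
  have f1 : (\int[leb]_(x in thQ `\` Q) (sqnorm (u x))%:E)%E \is a fin_num by rewrite ge0_fin_numE.
  (* The integral over [Q] is finite by [IQ], so finiteness on the annulus gives finiteness on the
     whole of [thQ]; this covers the term with delta. *)
  have f2 : (\int[leb]_(x in thQ) (sqnorm (u x))%:E)%E \is a fin_num.
    by rewrite ge0_fin_numE// I2E lte_add_pinfty.
  have [K1 _] := key _ _ (esym (fineK f1)) (esym (fineK f2)).
  move: K1; rewrite -(fineK f1) -(fineK f2).
  move: (fine_ge0 I1) (fine_ge0 I2); move: (fine _) (fine _) => n1 n2 n10 n20 K1.
  apply: (le_trans K1); rewrite -!EFinM -!EFinD lee_fin.
  have rm : (th * l / 4)^-1 ^+ (2 * m) = 4 ^+ (2 * m) / (th * l) ^+ (2 * m).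
    by rewrite invf_div expr_div_n.
  rewrite rm !mulrDr; apply: lerD; last by rewrite ler_wpM2r.
  apply: lerD; last by rewrite -[leRHS]mulrA ler_wpM2r// mulr_ge0.
  rewrite mulrA ler_wpM2r// mulrA ler_wpM2r ?invr_ge0 ?exprn_ge0 ?mulr_ge0 ?(ltW th0') ?(ltW l0)//.
  apply: le_trans CC0; rewrite mulrC ler_wpM2r// ler_peMl ?ler1n//.
move=> j /andP[j1 jm]; rewrite !vd.
have jm' : (j < m)%N by rewrite (leq_ltn_trans jm)// ltn_subrL m1.
have D0 : 0 < th ^+ (2 * j) * l ^+ (2 * m) by rewrite mulr_gt0// exprn_gt0.
(* In the second inequality the integral over the whole larger cube has a positive coefficient, so
   the infinite case is again trivial. *)
have [I2oo|I2oo] := ltP (\int[leb]_(x in thQ) (sqnorm (u x))%:E)%E +oo%E; last first.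
  have -> : (\int[leb]_(x in thQ) (sqnorm (u x))%:E = +oo)%E by apply/eqP; rewrite -leye_eq.
  rewrite gt0_muley ?lte_fin ?divr_gt0// -addeA addye ?leey// gt_eqF//.
  apply: (@lt_le_trans _ _ 0%E) => //; rewrite adde_ge0 ?mule_ge0 ?lee_fin//.
    by rewrite mulr_ge0// ltW.
  by rewrite mulr_ge0// ltW.
have I12 : (\int[leb]_(x in thQ `\` Q) (sqnorm (u x))%:E <= \int[leb]_(x in thQ) (sqnorm (u
  x))%:E)%E.
  by rewrite I2E leeDl// integral_ge0.
have f1 : (\int[leb]_(x in thQ `\` Q) (sqnorm (u x))%:E)%E \is a fin_num.
  by rewrite ge0_fin_numE//; exact: le_lt_trans I2oo.
have f2 : (\int[leb]_(x in thQ) (sqnorm (u x))%:E)%E \is a fin_num by rewrite ge0_fin_numE.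
have [_ /(_ _ jm') K2] := key _ _ (esym (fineK f1)) (esym (fineK f2)).
move: K2 I12; rewrite -(fineK f1) -(fineK f2) lee_fin.
move: (fine_ge0 I1) (fine_ge0 I2); move: (fine _) (fine _) => n2 n1 n10 n20 K2 n12.
have := scaled_bound (ltnW jm') l0 th0 C00 n10 n12 (mulr_ge0 de0 n20) nT2 K2.
move/le_trans; apply.
rewrite -!EFinM -!EFinD lee_fin; apply: lerD; last by rewrite ler_wpM2r.
apply: lerD; last by rewrite -[leRHS]mulrA ler_wpM2r// mulr_ge0.
by rewrite ler_wpM2r// ler_wpM2r// invr_ge0 ltW.
Qed.
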